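(* Let $\mathcal{G}$ be a metric graph in the class $\mathbf{G}$ which is noncompact, has finitely many edges, and contains at least one pendant or at least one signpost. Then for every $p>6$ there exists $\mu_{p,\mathcal{G}}>0$, depending on $p$ and $\mathcal{G}$, such that for every $\mu\in(0,\mu_{p,\mathcal{G}}]$ problem \[ \begin{cases} u''+u^{p-1}=\lambda u & \text{on every edge of }\mathcal{G},\\ u\in H^1(\mathcal{G}),\ u>0 & \text{on }\mathcal{G},\\ \sum_{e\succ \mathrm{v}}\frac{du}{dx_e}(\mathrm{v})=0 & \text{for every vertex }\mathrm{v}, \end{cases} \] admits a solution $(u,\lambda)$ with $u\in H^1_\mu(\mathcal{G})$, $E(u,\mathcal{G})>0$ and $\lambda>0$.
   Context: A metric graph $\mathcal{G}=(\mathbb{V},\mathbb{E})$ belongs to the class $\mathbf{G}$ if it is connected, has at most countably many edges, every vertex has finite degree (number of incident edges), and $e_0:=\inf_{e\in\mathbb{E}}|e|>0$, where $|e|$ is the length of $e$ (edges may be bounded intervals or half-lines). $\mathcal{G}$ is noncompact if it has at least one half-line or infinitely many edges. $H^1(\mathcal{G})$ is the space of continuous functions on $\mathcal{G}$ whose restriction to each edge is in $H^1$ of that edge, with $\int_{\mathcal G}(|u'|^2+|u|^2)<\infty$. $H^1_\mu(\mathcal{G})=\{v\in H^1(\mathcal{G}):\|v\|_{L^2(\mathcal{G})}^2=\mu\}$. $E(u,\mathcal{G})=\frac12\|u'\|_{L^2(\mathcal G)}^2-\frac1p\|u\|_{L^p(\mathcal G)}^p$. In the vertex condition, $e\succ\mathrm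 v$ means the edge $e$ is incident at $\mathrm v$ and $\frac{du}{dx_e}(\mathrm v)$ is the derivative of $u$ at $\mathrm v$ along $e$ parametrized so that $\mathrm v$ corresponds to $0$ (Kirchhoff condition). A pendant is a bounded edge one of whose vertices has degree $1$. A signpost is the union of a bounded edge and a loop glued together at a common vertex. *)

(* Defs.v *)
From Stdlib Require Import Reals List Arith Relations Bool.
From Coquelicot Require Import Coquelicot.
Open Scope R_scope.

(** * Metric graphs with finitely many edges.
    Vertices are the naturals [v < nV], edges the naturals [e < nE].
    A bounded edge of length [l] is identified with [0,l], with [src e]
    at 0 and [tgt e] at [l] (a loop has [src e = tgt e]).  A half-line is
    identified with [0, +oo) with [src e] at 0 ([tgt e] is irrelevant). *)
Inductive edge_kind := Bounded (l : R) | HalfLine.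

Record MGraph := {
  nV : nat;
  nE : nat;
  kind : nat -> edge_kind;
  src : nat -> nat;
  tgt : nat -> nat }.

Definition is_bounded (G : MGraph) (e : nat) : bool :=
  match kind G e with Bounded _ => true | HalfLine => false end.

Definition wf_graph (G : MGraph) : Prop :=
  forall e, (e < nE G)%nat ->
    (src G e < nV G)%nat /\
    match kind G e with
    | Bounded l => 0 < l /\ (tgt G e < nV G)%nat
    | HalfLine => True
    end.

Definition adjacent (G : MGraph) (v w : nat) : Prop :=
  exists e, (e < nE G)%nat /\ is_bounded G e = true /\
    ((src G e = v /\ tgt G e = w) \/ (src G e = w /\ tgt G e = v)).

Definition connected_graph (G : MGraph) : Prop :=
  forall v w, (v < nV G)%nat -> (w < nV G)%nat ->
    clos_refl_trans nat (adjacent G) v w.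

(** With finitely many edges: noncompact <-> at least one half-line. *)
Definition noncompact (G : MGraph) : Prop :=
  exists e, (e < nE G)%nat /\ kind G e = HalfLine.

(** degree (a loop counts twice) *)
Definition degree (G : MGraph) (v : nat) : nat :=
  length (filter (fun e => Nat.eqb (src G e) v) (seq 0 (nE G))) +
  length (filter (fun e => andb (is_bounded G e) (Nat.eqb (tgt G e) v))
                 (seq 0 (nE G))).

Definition has_pendant (G : MGraph) : Prop :=
  exists e, (e < nE G)%nat /\ is_bounded G e = true /\
    (degree G (src G e) = 1%nat \/ degree G (tgt G e) = 1%nat).

Definition has_signpost (G : MGraph) : Prop :=
  exists e1 e2, (e1 < nE G)%nat /\ (e2 < nE G)%nat /\ e1 <> e2 /\
    is_bounded G e1 = true /\ is_bounded G e2 = true /\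
    src G e2 = tgt G e2 /\
    (src G e1 = src G e2 \/ tgt G e1 = src G e2).

(** * Functions on the graph: [u e] is the restriction to edge [e]. *)
Definition in_edge (k : edge_kind) (x : R) : Prop :=
  match k with Bounded l => 0 <= x <= l | HalfLine => 0 <= x end.

Definition in_edge_int (k : edge_kind) (x : R) : Prop :=
  match k with Bounded l => 0 < x < l | HalfLine => 0 < x end.

Definition edge_integral (k : edge_kind) (f : R -> R) (I : R) : Prop :=
  match k with
  | Bounded l => is_RInt_gen f (at_right 0) (at_left l) I
  | HalfLine => is_RInt_gen f (at_right 0) (Rbar_locally p_infty) I
  end.

Definition graph_sum (G : MGraph) (f : nat -> R) : R :=
  fold_right Rplus 0 (map f (seq 0 (nE G))).

Definition graph_integral (G : MGraph) (f : nat -> R -> R) (I : R) : Prop :=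
  exists Ie : nat -> R,
    (forall e, (e < nE G)%nat -> edge_integral (kind G e) (f e) (Ie e)) /\
    I = graph_sum G Ie.

Definition rpow_abs (x p : R) : R :=
  if Req_EM_T x 0 then 0 else Rpower (Rabs x) p.

(** H^1(G): continuous on G (continuous on each closed edge, with
    matching values at vertices), derivable inside each edge (the
    solutions considered are smooth inside edges, so the weak derivative
    is the classical one), and int_G (|u'|^2 + |u|^2) < +oo. *)
Definition in_H1 (G : MGraph) (u : nat -> R -> R) : Prop :=
  (exists phi : nat -> R,
    forall e, (e < nE G)%nat ->
      u e 0 = phi (src G e) /\
      (forall l, kind G e = Bounded l -> u e l = phi (tgt G e))) /\
  (forall e, (e < nE G)%nat ->
     (forall x, in_edge (kind G e) x ->
        filterlim (u e) (within (in_edge (kind G e)) (locally x))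
                  (locally (u e x))) /\
     (forall x, in_edge_int (kind G e) x -> ex_derive (u e) x)) /\
  exists I, graph_integral G
              (fun e x => (Derive (u e) x) ^ 2 + (u e x) ^ 2) I.

Definition graph_mass (G : MGraph) (u : nat -> R -> R) (mu : R) : Prop :=
  graph_integral G (fun e x => (u e x) ^ 2) mu.

Definition graph_energy (G : MGraph) (p : R) (u : nat -> R -> R) (En : R)
  : Prop :=
  exists K P,
    graph_integral G (fun e x => (Derive (u e) x) ^ 2) K /\
    graph_integral G (fun e x => rpow_abs (u e x) p) P /\
    En = K / 2 - P / p.

(** Kirchhoff condition: outgoing derivatives at the endpoints of each
    edge (vertex at 0 in the outgoing parametrisation) sum to 0 at each
    vertex. *)
Definition kirchhoff (G : MGraph) (u : nat -> R -> R) : Prop :=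
  exists ds dt : nat -> R,
    (forall e, (e < nE G)%nat ->
       filterlim (fun h => (u e h - u e 0) / h) (at_right 0)
                 (locally (ds e)) /\
       (forall l, kind G e = Bounded l ->
          filterlim (fun h => (u e (l - h) - u e l) / h) (at_right 0)
                    (locally (dt e)))) /\
    (forall v, (v < nV G)%nat ->
       graph_sum G (fun e =>
         (if Nat.eqb (src G e) v then ds e else 0) +
         (if andb (is_bounded G e) (Nat.eqb (tgt G e) v) then dt e else 0)) = 0).

Definition NLS_solution (G : MGraph) (p lam : R) (u : nat -> R -> R)
  : Prop :=
  in_H1 G u /\
  (forall e, (e < nE G)%nat -> forall x, in_edge (kind G e) x -> 0 < u e x) /\
  (forall e, (e < nE G)%nat -> forall x, in_edge_int (kind G e) x ->
     ex_derive (u e) x /\ ex_derive (Derive (u e)) x /\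
     Derive (Derive (u e)) x + Rpower (u e x) (p - 1) = lam * u e x) /\
  kirchhoff G u.

(* Main.v *)
(** Write [lam = k ^ 2] and [u = k ^ (2 / (p - 2)) w (k x)], so that [w'' = w - w ^ (p - 1)] on a
    graph whose edges become long as [k -> +oo].  The solution carries one peak, close to the half
    soliton: at the free end of the pendant, or in the middle of the loop, where [w] is symmetric.
    Everywhere else [w] is small.

    Cut the edge of the peak at a fixed rescaled distance [rho] of the peak.  The unknowns are the
    height of the peak, the core of the peak (an initial value problem on [[0, rho]]), the values at
    the vertices (the Kirchhoff conditions) and the functions on the bounded edges and on the tail of
    the peak (boundary value problems with a small nonlinearity); on half-lines the solution is
    explicit.  At the cut the values agree by construction, and the slopes agree up to sign when the
    conserved energies agree; the energy of the tail, read off at its far end, is exponentially small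
    in [k].  So the height of the peak solves [a ^ p / p - a ^ 2 / 2 = O (exp (- c k))], and for
    large [k] the whole system is one contraction in a weighted sup norm.

    Hence the solution depends continuously on [k].  Its mass is [k ^ ((6 - p) / (p - 2))] times a
    quantity bounded above and below, which tends to [0] since [p > 6], so that the intermediate
    value theorem provides every small mass.  The energy is, up to small terms, the energy of a
    zero-energy profile, [(p - 6) / (2 (p + 2))] times its rescaled mass. *)

Require Import Defs.
From Stdlib Require Import Reals Lra Lia Psatz List Arith Bool Relations ClassicalEpsilon.
From Coquelicot Require Import Coquelicot.
Open Scope R_scope.

(** The obstacle is that the core amplifies errors: a change in the height of the peak may grow by
    the factor [core_gain p rho] before it reaches the cut. It decays only afterwards, by [decay k]
    on the way to the vertex, and returns to the height through the tail energy. Since [rho] is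
    fixed before [k], the gain of this loop is of order [core_gain p rho * decay k] and tends to
    zero; the weights of the norm are designed to display exactly this. Matching energies turns the
    condition at the cut into a scalar equation for the height whose zero [peak p] is simple, so one
    Newton step with a frozen slope contracts it; the sign lost in passing from slopes to energies
    is recovered afterwards from estimates at the cut. The ratio 3/4 of the contraction is 1/2 for
    this Newton step plus 1/4 for the tail energy. The contraction holds on a set that does not
    depend on [k], while the iteration stays in a smaller set that does; the larger set allows fixed
    points of neighbouring parameters to be compared, so that continuity in [k] needs no
    differentiation with respect to [k]. *)

Lemma pow_lt_eps (q D eps : R) : 0 <= q < 1 -> 0 <= D -> 0 < eps ->
  exists N, forall n, (N <= n)%nat -> q ^ n * D < eps.
Proof.
  intros Hq HD He.
  destruct (pow_lt_1_zero q) with (y := eps / (D + 1)) as [N HN].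
  - rewrite Rabs_pos_eq; lra.
  - apply Rdiv_lt_0_compat; lra.
  - exists N. intros n Hn. specialize (HN n Hn).
    assert (0 <= q ^ n) by (apply pow_le; lra).
    rewrite Rabs_pos_eq in HN by assumption.
    apply Rmult_lt_compat_r with (r := D + 1) in HN; [|lra].
    replace (eps / (D + 1) * (D + 1)) with eps in HN by (field; lra). nra.
Qed.

(** * Fixed points of weighted contractions *)

Section Banach.
Variables (T : Type) (om : T -> R) (C P : (T -> R) -> Prop)
  (Phi : (T -> R) -> T -> R).
Hypothesis om_pos : forall t, 0 <= om t.
Hypothesis contr : forall F G d, 0 <= d -> C F -> C G ->
  (forall t, Rabs (F t - G t) <= d * om t) ->
  forall t, Rabs (Phi F t - Phi G t) <= 3/4 * d * om t.

(** [C] is where [Phi] contracts, [P] a smaller set, preserved by [Phi] and closed under weighted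
    uniform limits. The limit is taken pointwise in [R], so no complete space has to be built; the
    weighted bound [D] on the first step stands for the finiteness of the norm. *)
Lemma weighted_banach (F0 : T -> R) (D : R) :
  (forall F, P F -> C F) -> (forall F, P F -> P (Phi F)) -> P F0 ->
  (forall t, Rabs (Phi F0 t - F0 t) <= D * om t) ->
  (forall (Fn : nat -> T -> R) F, (forall n, P (Fn n)) ->
     (forall eps, 0 < eps -> exists N, forall n, (N <= n)%nat ->
        forall t, Rabs (Fn n t - F t) <= eps * om t) -> P F) ->
  exists F, P F /\ forall t, Phi F t = F t.
Proof.
  intros PC PP P0 HD0 Pcl.
  set (D' := Rmax D 0).
  assert (HD' : 0 <= D') by apply Rmax_r.
  assert (HD : forall t, Rabs (Phi F0 t - F0 t) <= D' * om t).
  { intros t. eapply Rle_trans; [apply HD0|].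
    apply Rmult_le_compat_r; [apply om_pos|apply Rmax_l]. }
  set (S := fun n => Nat.iter n Phi F0).
  assert (PS : forall n, P (S n)) by (induction n; [exact P0|apply PP; exact IHn]).
  assert (step : forall n t, Rabs (S (1 + n)%nat t - S n t) <= (3/4) ^ n * D' * om t).
  { induction n; intros t.
    - rewrite pow_O, Rmult_1_l. apply HD.
    - replace ((3/4) ^ (Datatypes.S n) * D' * om t) with (3/4 * ((3/4)^n * D') * om t)
        by (simpl; ring).
      apply (contr (S (1 + n)%nat) (S n)); auto.
      apply Rmult_le_pos; [apply pow_le; lra|exact HD']. }
  assert (cau : forall n m t, Rabs (S (m + n)%nat t - S n t) <= 4 * (3/4) ^ n * D' * om t).
  (* The partial geometric sum [1 - (3/4) ^ m] is kept so that the induction on [m] closes; the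
     factor 4 is [1 / (1 - 3/4)]. *)
  { assert (A : forall n m t, Rabs (S (m + n)%nat t - S n t)
      <= 4 * (1 - (3/4) ^ m) * (3/4) ^ n * D' * om t).
    { intros n; induction m; intros t.
      - simpl. rewrite Rminus_diag, Rabs_R0. lra.
      - replace (S (Datatypes.S m + n)%nat t - S n t) with
          ((S (1 + (m + n))%nat t - S (m + n)%nat t) + (S (m + n)%nat t - S n t))
          by (simpl; ring).
        eapply Rle_trans; [apply Rabs_triang|].
        specialize (IHm t). pose proof (step (m + n)%nat t) as E.
        rewrite pow_add in E. simpl ((3/4) ^ (Datatypes.S m)).
        eapply Rle_trans; [apply Rplus_le_compat; [exact E|exact IHm]|].
        right. field. }
    intros n m t. eapply Rle_trans; [apply A|].
    assert (0 <= (3/4) ^ m) by (apply pow_le; lra).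
    assert (0 <= (3/4) ^ n) by (apply pow_le; lra).
    assert (0 <= (3/4) ^ n * D' * om t).
    { apply Rmult_le_pos; [apply Rmult_le_pos|]; auto. }
    nra. }
  assert (lim : forall t, {l : R | Un_cv (fun n => S n t) l}).
  { intros t. apply Rcomplete.R_complete. intros eps He.
    destruct (pow_lt_eps (3/4) (8 * D' * om t) eps) as [N HN]; [lra| |exact He|].
    { apply Rmult_le_pos; [lra|apply om_pos]. }
    exists N. intros n m Hn Hm. unfold Rdist.
    pose proof (cau N (n - N)%nat t) as A1. pose proof (cau N (m - N)%nat t) as A2.
    replace (n - N + N)%nat with n in A1 by lia.
    replace (m - N + N)%nat with m in A2 by lia.
    specialize (HN N (le_n _)).
    replace (S n t - S m t) with ((S n t - S N t) + - (S m t - S N t)) by ring.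
    eapply Rle_lt_trans; [apply Rabs_triang|]. rewrite Rabs_Ropp.
    eapply Rle_lt_trans; [apply Rplus_le_compat; eassumption|]. lra. }
  set (F := fun t => proj1_sig (lim t)).
  assert (conv : forall n t, Rabs (S n t - F t) <= 4 * (3/4) ^ n * D' * om t).
  { intros n t. unfold F. destruct (lim t) as [l Hl]. simpl.
    apply Rle_plus_epsilon. intros eps He. destruct (Hl eps He) as [N HN].
    specialize (HN (N + n)%nat ltac:(lia)). unfold Rdist in HN.
    specialize (cau n N t).
    replace (S n t - l) with (- (S (N + n)%nat t - S n t) + (S (N + n)%nat t - l)) by ring.
    eapply Rle_trans; [apply Rabs_triang|]. rewrite Rabs_Ropp. lra. }
  assert (PF : P F).
  { apply (Pcl S); [exact PS|]. intros eps He.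
    destruct (pow_lt_eps (3/4) (4 * D') eps) as [N HN]; [lra|lra|exact He|].
    exists N. intros n Hn t. eapply Rle_trans; [apply conv|].
    apply Rmult_le_compat_r; [apply om_pos|]. specialize (HN n Hn). lra. }
  exists F. split; [exact PF|]. intros t.
  apply Rminus_diag_uniq. apply Rabs_eq_0. apply Rle_antisym; [|apply Rabs_pos].
  apply Rle_plus_epsilon. intros eps He.
  destruct (pow_lt_eps (3/4) (8 * D' * om t) eps) as [N HN]; [lra| |exact He|].
  { apply Rmult_le_pos; [lra|apply om_pos]. }
  specialize (HN N (le_n _)).
  assert (0 <= (3/4) ^ N) by (apply pow_le; lra).
  pose proof (contr F (S N) (4 * (3/4) ^ N * D')) as A.
  replace (Phi F t - F t) with ((Phi F t - S (1 + N)%nat t) + (S (1 + N)%nat t - F t)) by ring.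
  eapply Rle_trans; [apply Rabs_triang|].
  pose proof (conv (1 + N)%nat t) as B. simpl ((3/4)^(1 + N)) in B.
  assert (A' : Rabs (Phi F t - S (1 + N)%nat t) <= 3/4 * (4 * (3/4) ^ N * D') * om t).
  { apply A; auto.
    - apply Rmult_le_pos; [lra|exact HD'].
    - intros s. rewrite Rabs_minus_sym. apply conv. }
  assert (0 <= (3/4) ^ N * D' * om t).
  { apply Rmult_le_pos; [apply Rmult_le_pos|]; auto. }
  simpl in *. nra.
Qed.

(** A bound [d] on the distance improves to [3/4 * d + e], so iterating from the a priori bound [D]
    leads to the stationary value [4 * e]. [G] is only an approximate fixed point: later it is the
    fixed point belonging to a neighbouring parameter. *)
Lemma contraction_stability (F G : T -> R) (D e : R) :
  C F -> C G -> (forall t, Phi F t = F t) -> 0 <= e ->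
  (forall t, Rabs (Phi G t - G t) <= e * om t) ->
  (forall t, Rabs (F t - G t) <= D * om t) ->
  forall t, Rabs (F t - G t) <= 4 * e * om t.
Proof.
  intros CF CG fix_F He HG HD0.
  set (D' := Rmax D 0).
  assert (HD' : 0 <= D') by apply Rmax_r.
  assert (HD : forall t, Rabs (F t - G t) <= D' * om t).
  { intros t. eapply Rle_trans; [apply HD0|].
    apply Rmult_le_compat_r; [apply om_pos|apply Rmax_l]. }
  assert (A : forall n t, Rabs (F t - G t) <= ((3/4) ^ n * D' + 4 * e) * om t).
  { induction n; intros t.
    - eapply Rle_trans; [apply HD|]. pose proof (om_pos t). simpl. nra.
    - replace (F t - G t) with ((Phi F t - Phi G t) + (Phi G t - G t))
        by (rewrite fix_F; ring).
      eapply Rle_trans; [apply Rabs_triang|].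
      eapply Rle_trans; [apply Rplus_le_compat; [|apply HG]|].
      + apply (contr F G ((3/4) ^ n * D' + 4 * e)); auto.
        assert (0 <= (3/4) ^ n) by (apply pow_le; lra). nra.
      + rewrite <- tech_pow_Rmult. right. field. }
  intros t. apply Rle_plus_epsilon. intros eps Heps.
  destruct (pow_lt_eps (3/4) (D' * om t) eps) as [N HN]; [lra| |exact Heps|].
  { apply Rmult_le_pos; auto. }
  specialize (HN N (le_n _)). specialize (A N t). lra.
Qed.

End Banach.

(** * Powers of nonnegative numbers *)

(* [Rpower 0 r] is [1]; this variant has the right value at [0]. *)
Definition pw (r x : R) : R := if Rle_dec x 0 then 0 else Rpower x r.

Lemma pw_pos (r x : R) : 0 < x -> pw r x = Rpower x r.
Proof. intros H. unfold pw. destruct (Rle_dec x 0); [lra|reflexivity]. Qed.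

Lemma pw_nonpos (r x : R) : x <= 0 -> pw r x = 0.
Proof. intros H. unfold pw. destruct (Rle_dec x 0); [reflexivity|lra]. Qed.

Lemma Rpower_gt_0 (x r : R) : 0 < Rpower x r.
Proof. apply exp_pos. Qed.

Lemma pw_ge_0 (r x : R) : 0 <= pw r x.
Proof. unfold pw. destruct (Rle_dec x 0); [lra|left; apply Rpower_gt_0]. Qed.

Lemma pw_S (r x : R) : 0 <= x -> pw (1 + r) x = x * pw r x.
Proof.
  intros H. unfold pw. destruct (Rle_dec x 0).
  - replace x with 0 by lra. ring.
  - rewrite Rpower_plus, Rpower_1 by lra. reflexivity.
Qed.

Lemma pw_incr (r x y : R) : 0 <= r -> x <= y -> pw r x <= pw r y.
Proof.
  intros Hr H. unfold pw. destruct (Rle_dec x 0), (Rle_dec y 0); try lra.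
  - left; apply Rpower_gt_0.
  - apply Rle_Rpower_l; lra.
Qed.

Lemma pw_mult (r x y : R) : 0 <= x -> 0 <= y -> pw r (x * y) = pw r x * pw r y.
Proof.
  intros Hx Hy. unfold pw.
  destruct (Rle_dec x 0), (Rle_dec y 0), (Rle_dec (x * y) 0); try nra.
  rewrite Rpower_mult_distr; lra.
Qed.

Lemma is_derive_pw (r x : R) : 0 < x -> is_derive (pw r) x (r * pw (r - 1) x).
Proof.
  intros Hx. apply is_derive_ext_loc with (fun x => Rpower x r).
  - exists (mkposreal x Hx). intros y Hy. symmetry. apply pw_pos.
    change (Rabs (y - x) < x) in Hy. apply Rabs_def2 in Hy. lra.
  - rewrite pw_pos by assumption. apply is_derive_Reals.
    apply derivable_pt_lim_power. exact Hx.
Qed.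

(** [pw r] vanishes on the negatives and its derivative increases on the positives, so an upper
    bound of the arguments controls the slope. The mean value theorem is applied on the positive
    side only; a nonpositive [x] is compared directly through [pw r y = y * pw (r - 1) y]. *)
Lemma pw_lipschitz_le (r M x y : R) : 1 <= r -> x <= y <= M ->
  Rabs (pw r x - pw r y) <= r * pw (r - 1) M * (y - x).
Proof.
  intros Hr H.
  assert (HM := pw_ge_0 (r - 1) M).
  rewrite Rabs_minus_sym, Rabs_pos_eq by (pose proof (pw_incr r x y); lra).
  destruct (Rle_dec x 0) as [Hx|Hx].
  - rewrite (pw_nonpos r x) by assumption. rewrite Rminus_0_r.
    destruct (Rle_dec y 0) as [Hy|Hy].
    + rewrite pw_nonpos by assumption. apply Rmult_le_pos; [apply Rmult_le_pos|]; lra.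
    + replace (pw r y) with (y * pw (r - 1) y)
        by (rewrite <- pw_S by lra; f_equal; ring).
      assert (pw (r - 1) y <= pw (r - 1) M) by (apply pw_incr; lra).
      assert (0 <= pw (r - 1) y) by apply pw_ge_0.
      apply Rle_trans with (pw (r - 1) M * y); [nra|].
      assert (0 <= (r - 1) * (pw (r-1) M * y)) by (repeat apply Rmult_le_pos; lra).
      assert (0 <= r * pw (r-1) M * - x) by (repeat apply Rmult_le_pos; lra).
      lra.
  - destruct (MVT_gen (pw r) x y (fun z => r * pw (r - 1) z)) as [c [Hc ->]].
    + intros z Hz. rewrite Rmin_left in Hz by lra. apply is_derive_pw. lra.
    + intros z Hz. rewrite Rmin_left in Hz by lra.
      apply derivable_continuous_pt. exists (r * pw (r - 1) z).
      apply is_derive_Reals. apply is_derive_pw. lra.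
    + rewrite Rmin_left, Rmax_right in Hc by lra.
      apply Rmult_le_compat_r; [lra|]. apply Rmult_le_compat_l; [lra|].
      apply pw_incr; lra.
Qed.

Lemma pw_lipschitz (r M x y : R) : 1 <= r -> x <= M -> y <= M ->
  Rabs (pw r x - pw r y) <= r * pw (r - 1) M * Rabs (x - y).
Proof.
  intros Hr Hx Hy. destruct (Rle_dec x y).
  - rewrite (Rabs_minus_sym x y), (Rabs_pos_eq (y - x)) by lra.
    apply pw_lipschitz_le; lra.
  - rewrite Rabs_minus_sym, (Rabs_pos_eq (x - y)) by lra.
    apply pw_lipschitz_le; lra.
Qed.

Lemma lipschitz_continuous (f : R -> R) (x L e : R) : 0 < e ->
  (forall y, Rabs (y - x) < e -> Rabs (f y - f x) <= L * Rabs (y - x)) ->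
  continuous f x.
Proof.
  intros He H. apply filterlim_locally. intros eps.
  assert (HL : 0 < Rmax L 0 + 1) by (pose proof (Rmax_r L 0); lra).
  assert (Hd : 0 < Rmin e (eps / (Rmax L 0 + 1))).
  { apply Rmin_pos; [exact He|]. apply Rdiv_lt_0_compat; [apply cond_pos|lra]. }
  exists (mkposreal _ Hd). intros y Hy.
  change (Rabs (y - x) < Rmin e (eps / (Rmax L 0 + 1))) in Hy.
  change (Rabs (f y - f x) < eps).
  assert (H1 : Rabs (y - x) < e) by (eapply Rlt_le_trans; [exact Hy|apply Rmin_l]).
  assert (H2 : Rabs (y - x) < eps / (Rmax L 0 + 1))
    by (eapply Rlt_le_trans; [exact Hy|apply Rmin_r]).
  eapply Rle_lt_trans; [apply H; exact H1|].
  pose proof (Rabs_pos (y - x)). pose proof (Rmax_l L 0).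
  apply Rmult_lt_compat_r with (r := Rmax L 0 + 1) in H2; [|lra].
  replace (eps / (Rmax L 0 + 1) * (Rmax L 0 + 1)) with (pos eps) in H2 by (field; lra).
  nra.
Qed.

Lemma continuous_pw (r x : R) : 1 <= r -> continuous (pw r) x.
Proof.
  intros Hr. apply lipschitz_continuous with (L := r * pw (r - 1) (x + 1)) (e := 1); [lra|].
  intros y Hy. apply Rabs_def2 in Hy. apply pw_lipschitz; lra.
Qed.

Lemma pw_small (r eps : R) : 0 < r -> 0 < eps ->
  exists d, 0 < d /\ forall x, x <= d -> pw r x <= eps.
Proof.
  intros Hr He. exists (Rpower eps (/ r)). split; [apply Rpower_gt_0|].
  intros x Hx. eapply Rle_trans; [apply pw_incr with (y := Rpower eps (/ r)); lra|].
  rewrite pw_pos by apply Rpower_gt_0. rewrite Rpower_mult, Rinv_l, Rpower_1; lra.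
Qed.

(** * Twice continuously differentiable functions *)

(** The derivatives are explicit functions on the whole line, so that a differential equation is an
    identity for the third component and no one-sided derivatives occur at the ends of edges. *)
Definition C2 (f f1 f2 : R -> R) : Prop :=
  forall x, is_derive f x (f1 x) /\ is_derive f1 x (f2 x) /\ continuous f2 x.

Lemma is_derive_continuous (f : R -> R) (x l : R) : is_derive f x l -> continuous f x.
Proof. intros H. apply (ex_derive_continuous (V := R_NormedModule) f x). exists l. exact H. Qed.

Lemma is_derive_glue (f g : R -> R) (r x lf lg : R) : f r = g r ->
  (x <= r -> is_derive f x lf) -> (r <= x -> is_derive g x lg) -> (x = r -> lf = lg) ->
  is_derive (fun x => if Rle_dec x r then f x else g x) x (if Rle_dec x r then lf else lg).
Proof.
  intros Er Hf Hg El. destruct (total_order_T x r) as [[H|H]|H].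
  - destruct (Rle_dec x r); [|lra].
    apply is_derive_ext_loc with f; [|apply Hf; lra].
    assert (Hd : 0 < r - x) by lra. exists (mkposreal _ Hd). intros y Hy.
    change (Rabs (y - x) < r - x) in Hy. apply Rabs_def2 in Hy.
    destruct (Rle_dec y r); [reflexivity|lra].
  - subst x. destruct (Rle_dec r r) as [_|]; [|lra].
    specialize (Hf (Rle_refl _)). specialize (Hg (Rle_refl _)).
    rewrite <- (El eq_refl) in Hg.
    apply is_derive_Reals. apply is_derive_Reals in Hf. apply is_derive_Reals in Hg.
    intros eps He. destruct (Hf eps He) as [d1 H1]. destruct (Hg eps He) as [d2 H2].
    assert (Hd : 0 < Rmin d1 d2) by (apply Rmin_pos; apply cond_pos).
    exists (mkposreal _ Hd). simpl. intros h Hh Hhd.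
    destruct (Rle_dec r r); [|lra].
    destruct (Rle_dec (r + h) r).
    + apply H1; auto. eapply Rlt_le_trans; [exact Hhd|apply Rmin_l].
    + rewrite Er. apply H2; auto. eapply Rlt_le_trans; [exact Hhd|apply Rmin_r].
  - destruct (Rle_dec x r); [lra|].
    apply is_derive_ext_loc with g; [|apply Hg; lra].
    assert (Hd : 0 < x - r) by lra. exists (mkposreal _ Hd). intros y Hy.
    change (Rabs (y - x) < x - r) in Hy. apply Rabs_def2 in Hy.
    destruct (Rle_dec y r); [lra|reflexivity].
Qed.

Lemma continuous_glue (f g : R -> R) (r x : R) : f r = g r ->
  continuous f x -> continuous g x ->
  continuous (fun x => if Rle_dec x r then f x else g x) x.
Proof.
  intros Er Hf Hg. apply filterlim_locally. intros eps.
  pose proof (proj1 (filterlim_locally _ _) Hf eps) as [d1 H1].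
  pose proof (proj1 (filterlim_locally _ _) Hg eps) as [d2 H2].
  destruct (total_order_T x r) as [[H|H]|H].
  - assert (Hd : 0 < Rmin d1 (r - x)) by (apply Rmin_pos; [apply cond_pos|lra]).
    exists (mkposreal _ Hd). intros y Hy.
    change (Rabs (y - x) < Rmin d1 (r - x)) in Hy.
    assert (A : Rabs (y - x) < r - x) by (eapply Rlt_le_trans; [exact Hy|apply Rmin_r]).
    apply Rabs_def2 in A.
    destruct (Rle_dec y r); [|lra]. destruct (Rle_dec x r); [|lra].
    apply H1. eapply Rlt_le_trans; [exact Hy|apply Rmin_l].
  - subst x. assert (Hd : 0 < Rmin d1 d2) by (apply Rmin_pos; apply cond_pos).
    exists (mkposreal _ Hd). intros y Hy.
    change (Rabs (y - r) < Rmin d1 d2) in Hy.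
    destruct (Rle_dec r r); [|lra]. destruct (Rle_dec y r).
    + apply H1. eapply Rlt_le_trans; [exact Hy|apply Rmin_l].
    + rewrite Er. apply H2. eapply Rlt_le_trans; [exact Hy|apply Rmin_r].
  - assert (Hd : 0 < Rmin d2 (x - r)) by (apply Rmin_pos; [apply cond_pos|lra]).
    exists (mkposreal _ Hd). intros y Hy.
    change (Rabs (y - x) < Rmin d2 (x - r)) in Hy.
    assert (A : Rabs (y - x) < x - r) by (eapply Rlt_le_trans; [exact Hy|apply Rmin_r]).
    apply Rabs_def2 in A.
    destruct (Rle_dec y r); [lra|]. destruct (Rle_dec x r); [lra|].
    apply H2. eapply Rlt_le_trans; [exact Hy|apply Rmin_l].
Qed.

Lemma C2_glue (f f1 f2 g g1 g2 : R -> R) (r : R) :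
  C2 f f1 f2 -> C2 g g1 g2 -> f r = g r -> f1 r = g1 r -> f2 r = g2 r ->
  C2 (fun x => if Rle_dec x r then f x else g x)
     (fun x => if Rle_dec x r then f1 x else g1 x)
     (fun x => if Rle_dec x r then f2 x else g2 x).
Proof.
  intros Hf Hg E0 E1 E2 x. destruct (Hf x) as (a & b & c). destruct (Hg x) as (a' & b' & c').
  split; [|split].
  - apply (is_derive_glue f g r x); auto. intros ->; assumption.
  - apply (is_derive_glue f1 g1 r x); auto. intros ->; assumption.
  - apply (continuous_glue f2 g2 r x); assumption.
Qed.

Lemma C2_comp_lin (f f1 f2 : R -> R) (c u v : R) : C2 f f1 f2 ->
  C2 (fun x => c * f (u * x + v)) (fun x => c * u * f1 (u * x + v))
     (fun x => c * u ^ 2 * f2 (u * x + v)).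
Proof.
  intros H x. destruct (H (u * x + v)) as (a & b & d).
  assert (E : is_derive (fun x => u * x + v) x u) by (auto_derive; [trivial|ring]).
  split; [|split].
  - replace (c * u * f1 (u * x + v)) with (scal c (u * f1 (u * x + v)))
      by (unfold scal; simpl; unfold mult; simpl; ring).
    apply (is_derive_scal (fun x => f (u * x + v)) x c).
    exact (is_derive_comp f (fun x => u * x + v) x _ _ a E).
  - replace (c * u ^ 2 * f2 (u * x + v)) with (scal (c * u) (u * f2 (u * x + v)))
      by (unfold scal; simpl; unfold mult; simpl; ring).
    apply (is_derive_scal (fun x => f1 (u * x + v)) x (c * u)).
    exact (is_derive_comp f1 (fun x => u * x + v) x _ _ b E).
  - apply (continuous_scal_r (c * u ^ 2) (fun x => f2 (u * x + v))).
    apply (continuous_comp (fun x => u * x + v) f2); [|exact d].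
    exact (is_derive_continuous _ _ _ E).
Qed.

(** * Integrals of continuous functions *)

(* Integrals have type [R] only up to conversion, which [ring] and [field] do not see. *)
Ltac real_eq := apply Rminus_diag_uniq.

Definition cont (f : R -> R) : Prop := forall x, continuous f x.

Lemma cont_const (c : R) : cont (fun _ => c).
Proof. intros x. apply continuous_const. Qed.

Lemma cont_id : cont (fun x => x).
Proof. intros x. apply continuous_id. Qed.

Lemma cont_plus (f g : R -> R) : cont f -> cont g -> cont (fun x => f x + g x).
Proof. intros Hf Hg x. apply (continuous_plus f g x); auto. Qed.

Lemma cont_minus (f g : R -> R) : cont f -> cont g -> cont (fun x => f x - g x).
Proof. intros Hf Hg x. apply (continuous_minus f g x); auto. Qed.

Lemma cont_mult (f g : R -> R) : cont f -> cont g -> cont (fun x => f x * g x).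
Proof. intros Hf Hg x. apply (continuous_mult f g x); auto. Qed.

Lemma cont_comp (f g : R -> R) : cont f -> cont g -> cont (fun x => f (g x)).
Proof. intros Hf Hg x. apply (continuous_comp g f x); auto. Qed.

Lemma cont_pow (f : R -> R) (n : nat) : cont f -> cont (fun x => f x ^ n).
Proof.
  intros Hf. induction n; simpl.
  - apply cont_const.
  - apply cont_mult; assumption.
Qed.

Lemma cont_pw (r : R) (f : R -> R) : 1 <= r -> cont f -> cont (fun x => pw r (f x)).
Proof. intros Hr Hf. apply (cont_comp (pw r)); [|exact Hf]. intros x. apply continuous_pw, Hr. Qed.

Lemma cont_derive (f f' : R -> R) : (forall x, is_derive f x (f' x)) -> cont f.
Proof. intros H x. exact (is_derive_continuous _ _ _ (H x)). Qed.

Lemma cont_abs (f : R -> R) : cont f -> cont (fun x => Rabs (f x)).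
Proof. intros H. apply (cont_comp Rabs); [|exact H]. intros x. apply continuous_Rabs. Qed.

Lemma cont_ex_RInt (f : R -> R) (a b : R) : cont f -> ex_RInt f a b.
Proof. intros H. apply (ex_RInt_continuous (V := R_CompleteNormedModule)). intros; apply H. Qed.

Lemma is_derive_RInt_cont (f : R -> R) (a x : R) : cont f ->
  is_derive (fun t => RInt f a t) x (f x).
Proof.
  intros H. apply (is_derive_RInt f (fun t => RInt f a t) a x); [|apply H].
  apply filter_forall. intros y. apply (RInt_correct (V := R_CompleteNormedModule)).
  apply cont_ex_RInt, H.
Qed.

Lemma RInt_primitive (F f : R -> R) (a b : R) : a <= b -> cont f ->
  (forall x, a <= x <= b -> is_derive F x (f x)) -> RInt f a b = F b - F a.
Proof.
  intros Hab Hf HF. apply is_RInt_unique. apply (is_RInt_derive F f).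
  - intros x Hx. rewrite Rmin_left, Rmax_right in Hx by lra. apply HF. lra.
  - intros x _. apply Hf.
Qed.

Lemma RInt_le_cont (f g : R -> R) (a b : R) : a <= b -> cont f -> cont g ->
  (forall x, a <= x <= b -> f x <= g x) -> RInt f a b <= RInt g a b.
Proof.
  intros Hab Hf Hg H. apply RInt_le; [exact Hab|apply cont_ex_RInt, Hf|apply cont_ex_RInt, Hg|].
  intros x Hx. apply H. lra.
Qed.

Lemma RInt_plus_cont (f g : R -> R) (a b : R) : cont f -> cont g ->
  RInt (fun x => f x + g x) a b = RInt f a b + RInt g a b.
Proof.
  intros Hf Hg. apply (RInt_plus (V := R_CompleteNormedModule) f g); apply cont_ex_RInt; assumption.
Qed.

Lemma RInt_minus_cont (f g : R -> R) (a b : R) : cont f -> cont g ->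
  RInt (fun x => f x - g x) a b = RInt f a b - RInt g a b.
Proof.
  intros Hf Hg. apply (RInt_minus (V := R_CompleteNormedModule) f g); apply cont_ex_RInt; assumption.
Qed.

Lemma RInt_scal_cont (f : R -> R) (c a b : R) : cont f ->
  RInt (fun x => c * f x) a b = c * RInt f a b.
Proof.
  intros Hf. apply (RInt_scal (V := R_CompleteNormedModule) f a b c); apply cont_ex_RInt; assumption.
Qed.

Lemma RInt_const_R (c a b : R) : RInt (fun _ => c) a b = c * (b - a).
Proof. rewrite RInt_const. unfold scal; simpl; unfold mult; simpl. ring. Qed.

Lemma RInt_Chasles_cont (f : R -> R) (a b c : R) : cont f ->
  RInt f a b + RInt f b c = RInt f a c.
Proof.
  intros Hf. apply (RInt_Chasles (V := R_CompleteNormedModule) f); apply cont_ex_RInt, Hf.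
Qed.

Lemma RInt_abs_le_cont (f g : R -> R) (a b : R) : a <= b -> cont f -> cont g ->
  (forall x, a <= x <= b -> Rabs (f x) <= g x) -> Rabs (RInt f a b) <= RInt g a b.
Proof.
  intros Hab Hf Hg H.
  eapply Rle_trans; [apply abs_RInt_le; [exact Hab|apply cont_ex_RInt, Hf]|].
  apply RInt_le_cont; auto. apply cont_abs, Hf.
Qed.

Lemma RInt_ge_0_cont (f : R -> R) (a b : R) : a <= b -> cont f ->
  (forall x, a <= x <= b -> 0 <= f x) -> 0 <= RInt f a b.
Proof.
  intros Hab Hf H. replace 0 with (0 * (b - a)) by ring. rewrite <- RInt_const_R.
  apply RInt_le_cont; auto. apply cont_const.
Qed.

Lemma RInt_ext_le (f g : R -> R) (a b : R) : a <= b ->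
  (forall x, a <= x <= b -> f x = g x) -> RInt f a b = RInt g a b.
Proof.
  intros Hab H. apply RInt_ext. intros x Hx. rewrite Rmin_left, Rmax_right in Hx by lra.
  apply H; lra.
Qed.

Lemma RInt_close (f g : R -> R) (a b e : R) : a <= b -> cont f -> cont g ->
  (forall x, a <= x <= b -> Rabs (f x - g x) <= e) ->
  Rabs (RInt f a b - RInt g a b) <= e * (b - a).
Proof.
  intros Hab Hf Hg H. rewrite <- RInt_minus_cont by assumption.
  rewrite <- RInt_const_R. apply RInt_abs_le_cont; auto.
  - apply cont_minus; assumption.
  - apply cont_const.
Qed.

Lemma RInt_comp_lin_cont (f : R -> R) (u v a b : R) : cont f ->
  u * RInt (fun x => f (u * x + v)) a b = RInt f (u * a + v) (u * b + v).
Proof.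
  intros Hf. rewrite <- RInt_scal_cont.
  - symmetry. symmetry. apply is_RInt_unique.
    apply (is_RInt_comp_lin f u v a b).
    apply (RInt_correct (V := R_CompleteNormedModule)). apply cont_ex_RInt, Hf.
  - apply (cont_comp f); [exact Hf|]. apply cont_plus; [|apply cont_const].
    apply cont_mult; [apply cont_const|apply cont_id].
Qed.

Lemma RInt_exp_le (b T : R) : 0 < b -> 0 <= T ->
  RInt (fun t => exp (- (b * t))) 0 T <= / b.
Proof.
  intros Hb HT.
  rewrite (RInt_primitive (fun t => - (exp (- (b * t)) / b))); [|exact HT| |].
  - rewrite Rmult_0_r, Ropp_0, exp_0. pose proof (exp_pos (- (b * T))).
    assert (0 < exp (- (b * T)) / b) by (apply Rdiv_lt_0_compat; lra).
    unfold Rdiv in *. lra.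
  - apply cont_derive with (fun t => - b * exp (- (b * t))). intros x. auto_derive; [trivial|ring].
  - intros x _. auto_derive; [trivial|field; lra].
Qed.

Lemma cont_exp_lin (b : R) : cont (fun t => exp (- (b * t))).
Proof. apply cont_derive with (fun t => - b * exp (- (b * t))). intros x. auto_derive; [trivial|ring]. Qed.

(** * Integrals along edges *)

(** The integral is improper at both ends, but for a function continuous on the line the primitive
    [RInt f 0] is continuous, so both limits are its values. *)
Lemma bounded_edge_integral (f : R -> R) (l : R) : cont f -> 0 < l ->
  edge_integral (Bounded l) f (RInt f 0 l).
Proof.
  intros Hf Hl. simpl.
  assert (A : is_RInt_gen f (at_right 0) (at_left l) (RInt f 0 l)).
  { intros Q HQ.
    assert (D : filterlim (fun ab : R * R => RInt f (fst ab) (snd ab))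
              (filter_prod (at_right 0) (at_left l)) (locally (RInt f 0 l))).
    { apply filterlim_ext with (fun ab : R * R => RInt f 0 (snd ab) - RInt f 0 (fst ab)).
      { intros [a b]. simpl. rewrite <- (RInt_Chasles_cont f 0 a b) by assumption. ring. }
      replace (RInt f 0 l) with (RInt f 0 l - RInt f 0 0)
        by (rewrite RInt_point; unfold zero; simpl; ring).
      apply (filterlim_comp_2 (G := locally (RInt f 0 l)) (H := locally (- RInt f 0 0))
               (fun ab : R * R => RInt f 0 (snd ab)) (fun ab : R * R => - RInt f 0 (fst ab)) Rplus).
      - apply (filterlim_comp _ _ _ snd (fun b => RInt f 0 b) _ (at_left l)); [apply filterlim_snd|].
        apply (filterlim_filter_le_1 _ (F := locally l)).
        { intros S HS. unfold at_left, within. revert HS. apply filter_imp. intros; assumption. }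
        exact (is_derive_continuous _ _ _ (is_derive_RInt_cont f 0 l Hf)).
      - apply (filterlim_comp _ _ _ fst (fun a => - RInt f 0 a) _ (at_right 0)); [apply filterlim_fst|].
        apply (filterlim_filter_le_1 _ (F := locally 0)).
        { intros S HS. unfold at_right, within. revert HS. apply filter_imp. intros; assumption. }
        apply (continuous_opp (fun t => RInt f 0 t) 0).
        exact (is_derive_continuous _ _ _ (is_derive_RInt_cont f 0 0 Hf)).
      - apply (filterlim_plus (RInt f 0 l) (- RInt f 0 0)). }
    specialize (D Q HQ). unfold filtermapi. unfold filtermap in D.
    revert D. apply filter_imp. intros [a b] HD. exists (RInt f a b). split; [|exact HD].
    apply (RInt_correct (V := R_CompleteNormedModule)). apply cont_ex_RInt, Hf. }
  exact A.
Qed.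

(** With the lower end fixed at 0, convergence concerns a single primitive; for continuous [f] this
    implies the improper integral of [edge_integral HalfLine]. *)
Definition half_integral (f : R -> R) (I : R) : Prop :=
  filterlim (fun T => RInt f 0 T) (Rbar_locally p_infty) (locally I).

Lemma half_edge_integral (f : R -> R) (I : R) : cont f -> half_integral f I ->
  edge_integral HalfLine f I.
Proof.
  intros Hf HI. simpl. intros Q HQ.
  assert (D : filterlim (fun ab : R * R => RInt f (fst ab) (snd ab))
            (filter_prod (at_right 0) (Rbar_locally p_infty)) (locally I)).
  { apply filterlim_ext with (fun ab : R * R => RInt f 0 (snd ab) - RInt f 0 (fst ab)).
    { intros [a b]. simpl. rewrite <- (RInt_Chasles_cont f 0 a b) by assumption. ring. }
    replace I with (I - RInt f 0 0) by (rewrite RInt_point; unfold zero; simpl; ring).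
    apply (filterlim_comp_2 (G := locally I) (H := locally (- RInt f 0 0))
             (fun ab : R * R => RInt f 0 (snd ab)) (fun ab : R * R => - RInt f 0 (fst ab)) Rplus).
    - apply (filterlim_comp _ _ _ snd (fun b => RInt f 0 b) _ (Rbar_locally p_infty)); [apply filterlim_snd|exact HI].
    - apply (filterlim_comp _ _ _ fst (fun a => - RInt f 0 a) _ (at_right 0)); [apply filterlim_fst|].
      apply (filterlim_filter_le_1 _ (F := locally 0)).
      { intros S HS. unfold at_right, within. revert HS. apply filter_imp. intros; assumption. }
      apply (continuous_opp (fun t => RInt f 0 t) 0).
      exact (is_derive_continuous _ _ _ (is_derive_RInt_cont f 0 0 Hf)).
    - apply (filterlim_plus I (- RInt f 0 0)). }
  specialize (D Q HQ). unfold filtermapi. unfold filtermap in D.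
  revert D. apply filter_imp. intros [a b] HD. exists (RInt f a b). split; [|exact HD].
  apply (RInt_correct (V := R_CompleteNormedModule)). apply cont_ex_RInt, Hf.
Qed.

Lemma half_integral_spec (f : R -> R) (I : R) :
  half_integral f I <->
  forall eps, 0 < eps -> exists M, 0 <= M /\ forall T, M < T -> Rabs (RInt f 0 T - I) < eps.
Proof.
  unfold half_integral. split.
  - intros H eps He.
    destruct (proj1 (filterlim_locally _ _) H (mkposreal eps He)) as [M HM].
    exists (Rmax M 0). split; [apply Rmax_r|]. intros T HT. apply (HM T).
    eapply Rle_lt_trans; [apply Rmax_l|exact HT].
  - intros H. apply filterlim_locally. intros eps.
    destruct (H eps (cond_pos eps)) as (M & _ & HM). exists M. exact HM.
Qed.

(** The primitive is increasing and bounded by [c / b], so it converges to its supremum. *)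
Lemma half_integral_exists (f : R -> R) (c b : R) : cont f -> 0 < b ->
  (forall t, 0 <= t -> 0 <= f t <= c * exp (- (b * t))) ->
  exists I, half_integral f I /\ 0 <= I <= c / b.
Proof.
  intros Hf Hb H.
  assert (Hc : 0 <= c).
  { specialize (H 0 (Rle_refl _)). rewrite Rmult_0_r, Ropp_0, exp_0 in H. lra. }
  assert (ub : forall T, 0 <= T -> RInt f 0 T <= c / b).
  { intros T HT. eapply Rle_trans; [apply RInt_le_cont with (g := fun t => c * exp (- (b * t)))|].
    - exact HT.
    - exact Hf.
    - apply cont_mult; [apply cont_const|apply cont_exp_lin].
    - intros x Hx. apply H. lra.
    - rewrite RInt_scal_cont by apply cont_exp_lin. unfold Rdiv.
      apply Rmult_le_compat_l; [exact Hc|]. apply RInt_exp_le; assumption. }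
  assert (mono : forall S T, 0 <= S <= T -> RInt f 0 S <= RInt f 0 T).
  { intros S T HST. rewrite <- (RInt_Chasles_cont f 0 S T) by assumption.
    assert (0 <= RInt f S T); [|lra].
    apply RInt_ge_0_cont; [lra|exact Hf|]. intros x Hx. apply H. lra. }
  destruct (completeness (fun y => exists T, 0 <= T /\ y = RInt f 0 T)) as [I [UI LI]].
  - exists (c / b). intros y (T & HT & ->). apply ub, HT.
  - exists (RInt f 0 0), 0. split; [lra|reflexivity].
  - exists I. split.
    + apply half_integral_spec. intros eps He.
      destruct (Classical_Prop.classic (exists T, 0 <= T /\ I - eps < RInt f 0 T)) as [(M & HM & HI)|N].
      * exists M. split; [exact HM|]. intros T HT.
        assert (RInt f 0 T <= I) by (apply UI; exists T; split; [lra|reflexivity]).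
        pose proof (mono M T). apply Rabs_def1; lra.
      * exfalso. assert (I <= I - eps); [|lra]. apply LI. intros y (T & HT & ->).
        apply Rnot_lt_le. intros A. apply N. exists T. split; assumption.
    + split.
      * apply UI. exists 0. split; [lra|]. rewrite RInt_point. reflexivity.
      * apply LI. intros y (T & HT & ->). apply ub, HT.
Qed.

Lemma half_integral_le (f g : R -> R) (I J c : R) :
  half_integral f I -> half_integral g J ->
  (forall T, 0 <= T -> Rabs (RInt f 0 T - RInt g 0 T) <= c) -> Rabs (I - J) <= c.
Proof.
  intros HI HJ H. apply Rle_plus_epsilon. intros eps He.
  destruct (proj1 (half_integral_spec f I) HI (eps / 2)) as (M & HM & H1); [lra|].
  destruct (proj1 (half_integral_spec g J) HJ (eps / 2)) as (N & HN & H2); [lra|].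
  specialize (H1 (M + N + 1)). specialize (H2 (M + N + 1)). specialize (H (M + N + 1)).
  specialize (H1 ltac:(lra)). specialize (H2 ltac:(lra)). specialize (H ltac:(lra)).
  replace (I - J) with (- (RInt f 0 (M + N + 1) - I) + (RInt f 0 (M + N + 1) - RInt g 0 (M + N + 1))
     + (RInt g 0 (M + N + 1) - J)) by ring.
  eapply Rle_trans; [apply Rabs_triang|]. eapply Rle_trans; [apply Rplus_le_compat_r, Rabs_triang|].
  rewrite Rabs_Ropp. lra.
Qed.

Lemma half_integral_close (f g : R -> R) (I J c b : R) : cont f -> cont g -> 0 < b -> 0 <= c ->
  half_integral f I -> half_integral g J ->
  (forall t, 0 <= t -> Rabs (f t - g t) <= c * exp (- (b * t))) -> Rabs (I - J) <= c / b.
Proof.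
  intros Hf Hg Hb Hc HI HJ H. apply (half_integral_le f g); auto. intros T HT.
  rewrite <- RInt_minus_cont by assumption.
  eapply Rle_trans; [apply RInt_abs_le_cont with (g := fun t => c * exp (- (b * t)))|].
  - exact HT.
  - apply cont_minus; assumption.
  - apply cont_mult; [apply cont_const|apply cont_exp_lin].
  - intros x Hx. apply H. lra.
  - rewrite RInt_scal_cont by apply cont_exp_lin. unfold Rdiv.
    apply Rmult_le_compat_l; [exact Hc|]. apply RInt_exp_le; assumption.
Qed.

Lemma half_integral_scale (f g : R -> R) (c k I : R) : cont f -> 0 < k ->
  (forall t, g t = c * f (k * t)) -> half_integral f I -> half_integral g (c / k * I).
Proof.
  intros Hf Hk Hg HI. apply half_integral_spec. intros eps He.
  assert (Hc : 0 < Rabs (c / k) + 1) by (pose proof (Rabs_pos (c / k)); lra).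
  destruct (proj1 (half_integral_spec f I) HI (eps / (Rabs (c / k) + 1))) as (M & HM & H1).
  { apply Rdiv_lt_0_compat; lra. }
  exists (M / k). split.
  { apply Rmult_le_pos; [exact HM|]. left; apply Rinv_0_lt_compat, Hk. }
  intros T HT.
  assert (HT' : M < k * T + 0).
  { apply Rmult_lt_compat_r with (r := k) in HT; [|exact Hk].
    unfold Rdiv in HT. rewrite Rmult_assoc, Rinv_l in HT; lra. }
  specialize (H1 _ HT').
  assert (E : RInt g 0 T = c / k * RInt f 0 (k * T + 0)).
  { replace 0 with (k * 0 + 0) at 2 by ring.
    rewrite <- RInt_comp_lin_cont by assumption.
    replace (c / k * (k * RInt (fun x => f (k * x + 0)) 0 T)) with
      (c * RInt (fun x => f (k * x + 0)) 0 T) by (field; lra).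
    rewrite <- RInt_scal_cont.
    - apply RInt_ext. intros x _. rewrite Rplus_0_r. apply Hg.
    - apply (cont_comp f); [exact Hf|]. apply cont_plus; [|apply cont_const].
      apply cont_mult; [apply cont_const|apply cont_id]. }
  rewrite E, <- Rmult_minus_distr_l, Rabs_mult.
  apply Rmult_lt_compat_r with (r := Rabs (c / k) + 1) in H1; [|exact Hc].
  unfold Rdiv in H1 at 2. rewrite Rmult_assoc, Rinv_l in H1 by lra.
  pose proof (Rabs_pos (RInt f 0 (k * T + 0) - I)). nra.
Qed.

(** * The explicit decaying solutions of w'' = w - w^(p-1) *)

Definition sol_base (p s t : R) : R :=
  cosh ((p - 2) / 2 * t) + s * sinh ((p - 2) / 2 * t).

Definition sol_dbase (p s t : R) : R :=
  sinh ((p - 2) / 2 * t) + s * cosh ((p - 2) / 2 * t).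

(* With [s ^ 2 = 1 - 2 / p * x ^ (p - 2)] this is the zero-energy solution with
   value [x] and derivative [- s * x] at [0]: [w ^ (- (p - 2) / 2)] solves a linear equation. *)
Definition sol (p x s t : R) : R := x * exp (- (2 / (p - 2)) * ln (sol_base p s t)).

Definition sol1 (p x s t : R) : R := - (sol p x s t * (sol_dbase p s t / sol_base p s t)).

Definition slope (p x : R) : R := sqrt (1 - 2 / p * pw (p - 2) x).

Lemma cosh_ge_abs_sinh (t : R) : Rabs (sinh t) < cosh t.
Proof.
  unfold sinh, cosh. pose proof (exp_pos t). pose proof (exp_pos (- t)).
  apply Rabs_def1; lra.
Qed.

Lemma cosh2_sinh2 (t : R) : cosh t ^ 2 = 1 + sinh t ^ 2.
Proof.
  unfold sinh, cosh. assert (E : exp t * exp (- t) = 1).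
  { rewrite <- exp_plus, Rplus_opp_r. apply exp_0. }
  replace (((exp t + exp (- t)) / 2) ^ 2) with
    (((exp t - exp (- t)) / 2) ^ 2 + exp t * exp (- t)) by field.
  rewrite E. ring.
Qed.

Lemma sinh_ge_0 (t : R) : 0 <= t -> 0 <= sinh t.
Proof.
  intros H. unfold sinh. assert (exp (- t) <= exp t); [|lra].
  destruct (Rle_lt_or_eq_dec 0 t H) as [L|<-].
  - left. apply exp_increasing. lra.
  - rewrite Ropp_0. lra.
Qed.

Lemma sol_base_pos (p s t : R) : -1 <= s <= 1 -> 0 < sol_base p s t.
Proof.
  intros Hs. unfold sol_base. set (u := (p - 2) / 2 * t).
  pose proof (cosh_ge_abs_sinh u) as A.
  assert (Rabs (s * sinh u) <= Rabs (sinh u)).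
  { rewrite Rabs_mult. pose proof (Rabs_pos (sinh u)).
    assert (Rabs s <= 1) by (apply Rabs_le; lra). nra. }
  pose proof (Rle_abs (- (s * sinh u))) as D. rewrite Rabs_Ropp in D. lra.
Qed.

Lemma is_derive_sol_base (p s t : R) :
  is_derive (sol_base p s) t ((p - 2) / 2 * sol_dbase p s t).
Proof. unfold sol_base, sol_dbase. auto_derive; [trivial|]. ring. Qed.

Lemma is_derive_sol_dbase (p s t : R) :
  is_derive (sol_dbase p s) t ((p - 2) / 2 * sol_base p s t).
Proof. unfold sol_base, sol_dbase. auto_derive; [trivial|]. ring. Qed.

Lemma sol_base_dbase (p s t : R) :
  sol_base p s t ^ 2 - sol_dbase p s t ^ 2 = 1 - s ^ 2.
Proof.
  unfold sol_base, sol_dbase. set (u := (p - 2) / 2 * t).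
  pose proof (cosh2_sinh2 u). nra.
Qed.

Lemma is_derive_sol (p x s t : R) : 2 < p -> -1 <= s <= 1 ->
  is_derive (sol p x s) t (sol1 p x s t).
Proof.
  intros Hp Hs. pose proof (sol_base_pos p s t Hs) as Hb.
  unfold sol1, sol.
  evar_last.
  - apply (is_derive_scal (fun t => exp (- (2 / (p - 2)) * ln (sol_base p s t))) t x).
    apply (is_derive_comp exp (fun t => - (2 / (p - 2)) * ln (sol_base p s t))).
    + apply is_derive_Reals, derivable_pt_lim_exp.
    + apply (is_derive_scal (fun t => ln (sol_base p s t)) t (- (2 / (p - 2)))).
      apply (is_derive_comp ln (sol_base p s)).
      * apply is_derive_Reals, derivable_pt_lim_ln, Hb.
      * apply is_derive_sol_base.
  - unfold scal; simpl; unfold mult; simpl. field. split; lra.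
Qed.

Lemma pw_sol (p x s t : R) : 2 < p -> 0 <= x -> -1 <= s <= 1 ->
  pw (p - 2) (sol p x s t) = pw (p - 2) x / sol_base p s t ^ 2.
Proof.
  intros Hp Hx Hs. pose proof (sol_base_pos p s t Hs) as Hb.
  unfold sol. rewrite pw_mult; [|exact Hx|left; apply exp_pos].
  unfold Rdiv. f_equal. rewrite pw_pos by apply exp_pos. unfold Rpower. rewrite ln_exp.
  replace ((p - 2) * (- (2 * / (p - 2)) * ln (sol_base p s t)))
    with (- (ln (sol_base p s t) + ln (sol_base p s t))) by (field; lra).
  rewrite exp_Ropp, exp_plus, exp_ln by assumption. f_equal. ring.
Qed.

Lemma sol_ge_0 (p x s t : R) : 0 <= x -> 0 <= sol p x s t.
Proof. intros Hx. unfold sol. apply Rmult_le_pos; [exact Hx|left; apply exp_pos]. Qed.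

Lemma sol_gt_0 (p x s t : R) : 0 < x -> 0 < sol p x s t.
Proof. intros Hx. unfold sol. apply Rmult_lt_0_compat; [exact Hx|apply exp_pos]. Qed.

Lemma pw_p1 (p x : R) : 0 <= x -> pw (p - 1) x = x * pw (p - 2) x.
Proof. intros H. rewrite <- pw_S by assumption. f_equal. ring. Qed.

Lemma pw_p0 (p x : R) : 0 <= x -> pw p x = x ^ 2 * pw (p - 2) x.
Proof.
  intros H. replace (x ^ 2 * pw (p - 2) x) with (x * (x * pw (p - 2) x)) by ring.
  rewrite <- pw_p1, <- pw_S by assumption. f_equal. ring.
Qed.

Lemma sol_C2 (p x s : R) : 6 < p -> 0 <= x -> 0 <= s <= 1 ->
  s ^ 2 = 1 - 2 / p * pw (p - 2) x ->
  C2 (sol p x s) (sol1 p x s) (fun t => sol p x s t - pw (p - 1) (sol p x s t)).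
Proof.
  intros Hp Hx Hs Es.
  assert (D0 : forall t, is_derive (sol p x s) t (sol1 p x s t)).
  { intros t. apply is_derive_sol; lra. }
  intros t. split; [apply D0|split].
  - pose proof (sol_base_pos p s t ltac:(lra)) as Hb.
    assert (Eb := sol_base_dbase p s t).
    unfold sol1.
    apply (is_derive_ext (fun t => - (sol p x s t * (sol_dbase p s t * / sol_base p s t))));
      [reflexivity|].
    evar_last.
    + apply (is_derive_opp (fun t => sol p x s t * (sol_dbase p s t * / sol_base p s t))).
      apply (is_derive_mult (sol p x s) (fun t => sol_dbase p s t * / sol_base p s t)).
      * apply D0.
      * apply (is_derive_mult (sol_dbase p s) (fun t => / sol_base p s t)).
        -- apply is_derive_sol_dbase.
        -- apply is_derive_inv; [apply is_derive_sol_base|lra].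
        -- intros; apply Rmult_comm.
      * intros; apply Rmult_comm.
    + rewrite pw_p1 by (apply sol_ge_0; assumption).
      rewrite pw_sol by lra.
      (* By the choice of [s], the power of [x] is a multiple of [sol_base ^ 2 - sol_dbase ^ 2], so
         the nonlinear term becomes rational in [sol_base] and [sol_dbase]. *)
      assert (Ex : pw (p - 2) x = p / 2 * (sol_base p s t ^ 2 - sol_dbase p s t ^ 2)).
      { rewrite Eb, Es. field. lra. }
      rewrite Ex. unfold sol1, plus, opp; simpl. unfold mult; simpl. unfold plus; simpl.
      field. lra.
  - apply cont_minus.
    + exact (cont_derive _ _ D0).
    + apply cont_pw; [lra|]. exact (cont_derive _ _ D0).
Qed.

Lemma sol_energy (p x s t : R) : 6 < p -> 0 <= x -> 0 <= s <= 1 ->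
  s ^ 2 = 1 - 2 / p * pw (p - 2) x ->
  sol1 p x s t ^ 2 = sol p x s t ^ 2 - 2 / p * pw p (sol p x s t).
Proof.
  intros Hp Hx Hs Es.
  pose proof (sol_base_pos p s t ltac:(lra)) as Hb.
  assert (Eb := sol_base_dbase p s t).
  rewrite pw_p0 by (apply sol_ge_0; assumption). rewrite pw_sol by lra.
  assert (Ex : pw (p - 2) x = p / 2 * (sol_base p s t ^ 2 - sol_dbase p s t ^ 2)).
  { rewrite Eb, Es. field. lra. }
  rewrite Ex. unfold sol1. field. lra.
Qed.

Lemma sol_at_0 (p x s : R) : sol p x s 0 = x.
Proof.
  unfold sol, sol_base. rewrite Rmult_0_r, cosh_0, sinh_0, Rmult_0_r, Rplus_0_r, ln_1, Rmult_0_r, exp_0.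
  ring.
Qed.

Lemma sol1_at_0 (p x s : R) : sol1 p x s 0 = - (x * s).
Proof.
  unfold sol1. rewrite sol_at_0. unfold sol_dbase, sol_base.
  rewrite Rmult_0_r, cosh_0, sinh_0. field.
Qed.

Lemma exp_le (x y : R) : x <= y -> exp x <= exp y.
Proof.
  intros H. destruct (Rle_lt_or_eq_dec x y H) as [L| ->]; [|lra].
  left. apply exp_increasing, L.
Qed.

(** [sol_base] is at least [exp ((p - 2) / 2 * t) / 2]. The power [- 2 / (p - 2)] turns this into
    [exp (- t)] times a power of 2 whose exponent [2 / (p - 2)] is at most 1. *)
Lemma sol_decay_factor (p s t : R) : 6 < p -> 0 <= s <= 1 -> 0 <= t ->
  exp (- (2 / (p - 2)) * ln (sol_base p s t)) <= 2 * exp (- t).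
Proof.
  intros Hp Hs Ht. pose proof (sol_base_pos p s t ltac:(lra)) as Hb.
  assert (Hu : 0 <= (p - 2) / 2 * t) by (apply Rmult_le_pos; lra).
  assert (L : exp ((p - 2) / 2 * t) / 2 <= sol_base p s t).
  { unfold sol_base. pose proof (sinh_ge_0 _ Hu). unfold cosh.
    pose proof (exp_pos (- ((p - 2) / 2 * t))). nra. }
  assert (LL : (p - 2) / 2 * t - ln 2 <= ln (sol_base p s t)).
  { rewrite <- (ln_exp ((p - 2) / 2 * t)).
    unfold Rminus. rewrite <- ln_Rinv, <- ln_mult by (try apply exp_pos; lra).
    apply ln_le; [|exact L]. apply Rmult_lt_0_compat; [apply exp_pos|lra]. }
  rewrite <- (exp_ln 2) at 3 by lra. rewrite <- exp_plus. apply exp_le.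
  assert (H2 : 0 <= ln 2) by (rewrite <- ln_1; apply ln_le; lra).
  assert (Hq : 0 < 2 / (p - 2) <= 1).
  { split; [apply Rdiv_lt_0_compat; lra|]. apply Rmult_le_reg_r with (p - 2); [lra|].
    unfold Rdiv. rewrite Rmult_assoc, Rinv_l; lra. }
  apply Rmult_le_compat_l with (r := 2 / (p - 2)) in LL; [|lra].
  replace (2 / (p - 2) * ((p - 2) / 2 * t - ln 2)) with (t - 2 / (p - 2) * ln 2) in LL
    by (field; lra).
  nra.
Qed.

Lemma sol_decay (p x s t : R) : 6 < p -> 0 <= x -> 0 <= s <= 1 -> 0 <= t ->
  sol p x s t <= 2 * x * exp (- t).
Proof.
  intros Hp Hx Hs Ht. unfold sol. pose proof (sol_decay_factor p s t Hp Hs Ht). nra.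
Qed.

Lemma sol_dbase_ratio (p s t : R) : 0 <= s <= 1 ->
  Rabs (sol_dbase p s t / sol_base p s t) <= 1.
Proof.
  intros Hs. pose proof (sol_base_pos p s t ltac:(lra)) as Hb.
  pose proof (sol_base_dbase p s t) as E.
  unfold Rdiv. rewrite Rabs_mult, Rabs_inv, (Rabs_pos_eq (sol_base p s t)) by lra.
  apply Rmult_le_reg_r with (sol_base p s t); [exact Hb|].
  rewrite Rmult_assoc, Rinv_l, Rmult_1_r, Rmult_1_l by lra.
  apply Rsqr_incr_0_var; [|lra]. rewrite <- Rsqr_abs. unfold Rsqr. nra.
Qed.

(** The value and the slope parameter vary independently. In [s] the exponential factor has
    logarithmic derivative [- 2 / (p - 2) * sinh / sol_base], bounded by 1, so the decay [exp (- t)]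
    survives differentiation. *)
Lemma sol_lipschitz (p x y s r t : R) : 6 < p -> 0 <= y -> 0 <= s <= 1 -> 0 <= r <= 1 -> 0 <= t ->
  Rabs (sol p x s t - sol p y r t) <= 2 * (Rabs (x - y) + y * Rabs (s - r)) * exp (- t).
Proof.
  intros Hp Hy Hs Hr Ht.
  set (rho := fun s => exp (- (2 / (p - 2)) * ln (sol_base p s t))).
  assert (Hu : 0 <= (p - 2) / 2 * t) by (apply Rmult_le_pos; lra).
  assert (Hrho : Rabs (rho s - rho r) <= 2 * exp (- t) * Rabs (s - r)).
  { set (drho := fun s => rho s * (- (2 / (p - 2)) * (sinh ((p - 2) / 2 * t) / sol_base p s t))).
    assert (D : forall z, 0 <= z <= 1 -> is_derive rho z (drho z)).
    { intros z Hz. pose proof (sol_base_pos p z t ltac:(lra)) as Hb.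
      unfold drho, rho, sol_base. unfold sol_base in Hb.
      auto_derive; [exact Hb|]. field. split; lra. }
    destruct (MVT_gen rho r s drho) as [c [Hc E]].
    - intros z Hz. apply D. unfold Rmin, Rmax in Hz. destruct (Rle_dec r s); lra.
    - intros z Hz. apply derivable_continuous_pt. exists (drho z). apply is_derive_Reals, D.
      unfold Rmin, Rmax in Hz. destruct (Rle_dec r s); lra.
    - rewrite E, Rabs_mult. apply Rmult_le_compat_r; [apply Rabs_pos|].
      assert (Hc' : 0 <= c <= 1) by (unfold Rmin, Rmax in Hc; destruct (Rle_dec r s); lra).
      unfold drho. rewrite Rabs_mult, (Rabs_pos_eq (rho c)) by (left; apply exp_pos).
      rewrite <- (Rmult_1_r (2 * exp (- t))).
      apply Rmult_le_compat; [left; apply exp_pos|apply Rabs_pos|apply sol_decay_factor; assumption|].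
      pose proof (sol_base_pos p c t ltac:(lra)) as Hb.
      assert (Hq : 0 < 2 / (p - 2) <= 1).
      { split; [apply Rdiv_lt_0_compat; lra|]. apply Rmult_le_reg_r with (p - 2); [lra|].
        unfold Rdiv. rewrite Rmult_assoc, Rinv_l; lra. }
      assert (Hsc : 0 <= sinh ((p - 2) / 2 * t) / sol_base p c t <= 1).
      { pose proof (sinh_ge_0 _ Hu). split.
        - apply Rmult_le_pos; [assumption|left; apply Rinv_0_lt_compat, Hb].
        - apply Rmult_le_reg_r with (sol_base p c t); [exact Hb|].
          unfold Rdiv. rewrite Rmult_assoc, Rinv_l, Rmult_1_r, Rmult_1_l by lra.
          unfold sol_base. pose proof (cosh_ge_abs_sinh ((p - 2) / 2 * t)) as G.
          rewrite Rabs_pos_eq in G by assumption. nra. }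
      rewrite Rabs_mult, Rabs_Ropp, !Rabs_pos_eq by lra. nra. }
  unfold sol. fold (rho s). fold (rho r).
  replace (x * rho s - y * rho r) with ((x - y) * rho s + y * (rho s - rho r)) by ring.
  eapply Rle_trans; [apply Rabs_triang|]. rewrite !Rabs_mult, (Rabs_pos_eq y Hy).
  rewrite (Rabs_pos_eq (rho s)) by (left; apply exp_pos).
  pose proof (sol_decay_factor p s t Hp Hs Ht) as F. fold (rho s) in F.
  pose proof (Rabs_pos (x - y)). pose proof (exp_pos (- t)). nra.
Qed.

(** * The half soliton *)

(** The positive root of [a ^ p / p = a ^ 2 / 2], that is, the height at which a zero-energy
    solution has zero slope; it makes the parameter [s] of [sol] vanish. *)
Definition peak (p : R) : R := Rpower (p / 2) (/ (p - 2)).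

Definition soliton (p t : R) : R := sol p (peak p) 0 t.

Definition soliton1 (p t : R) : R := sol1 p (peak p) 0 t.

Lemma pw_peak (p : R) : 6 < p -> pw (p - 2) (peak p) = p / 2.
Proof.
  intros Hp. rewrite pw_pos by apply Rpower_gt_0. unfold peak.
  rewrite Rpower_mult, Rinv_l, Rpower_1; lra.
Qed.

Lemma peak_gt_1 (p : R) : 6 < p -> 1 < peak p.
Proof.
  intros Hp. unfold peak. rewrite <- (Rpower_O (p / 2)) by lra.
  apply Rpower_lt; [lra|]. apply Rinv_0_lt_compat. lra.
Qed.

Lemma peak_slope (p : R) : 6 < p -> 0 ^ 2 = 1 - 2 / p * pw (p - 2) (peak p).
Proof. intros Hp. rewrite pw_peak by assumption. field. lra. Qed.

Lemma soliton_C2 (p : R) : 6 < p ->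
  C2 (soliton p) (soliton1 p) (fun t => soliton p t - pw (p - 1) (soliton p t)).
Proof.
  intros Hp. pose proof (peak_gt_1 p Hp).
  apply sol_C2; [assumption|lra|lra|apply peak_slope; assumption].
Qed.

Lemma soliton_pos (p t : R) : 0 < soliton p t.
Proof. apply sol_gt_0, Rpower_gt_0. Qed.

Lemma soliton_0 (p : R) : soliton p 0 = peak p.
Proof. apply sol_at_0. Qed.

Lemma soliton1_0 (p : R) : soliton1 p 0 = 0.
Proof. unfold soliton1. rewrite sol1_at_0. ring. Qed.

Lemma soliton1_le_0 (p t : R) : 6 < p -> 0 <= t -> soliton1 p t <= 0.
Proof.
  intros Hp Ht. unfold soliton1, sol1.
  pose proof (sol_base_pos p 0 t ltac:(lra)) as Hb.
  assert (0 <= sol p (peak p) 0 t * (sol_dbase p 0 t / sol_base p 0 t)); [|lra].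
  apply Rmult_le_pos; [left; apply soliton_pos|].
  apply Rmult_le_pos; [|left; apply Rinv_0_lt_compat, Hb].
  unfold sol_dbase. rewrite Rmult_0_l, Rplus_0_r. apply sinh_ge_0. apply Rmult_le_pos; lra.
Qed.

Lemma soliton_decr (p a b : R) : 6 < p -> 0 <= a <= b -> soliton p b <= soliton p a.
Proof.
  intros Hp Hab.
  destruct (MVT_gen (soliton p) a b (soliton1 p)) as [c [Hc E]].
  - intros z _. apply soliton_C2, Hp.
  - intros z _. apply derivable_continuous_pt. exists (soliton1 p z).
    apply is_derive_Reals. apply soliton_C2, Hp.
  - rewrite Rmin_left, Rmax_right in Hc by lra.
    pose proof (soliton1_le_0 p c Hp ltac:(lra)). nra.
Qed.

Lemma soliton_small (p eps R0 : R) : 6 < p -> 0 < eps ->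
  exists R, R0 <= R /\ 0 <= R /\ soliton p R <= eps.
Proof.
  intros Hp He. pose proof (peak_gt_1 p Hp) as Ha.
  set (T := Rmax (Rmax R0 0) (2 * peak p / eps)).
  assert (T1 : Rmax R0 0 <= T) by apply Rmax_l.
  assert (T2 : 2 * peak p / eps <= T) by apply Rmax_r.
  pose proof (Rmax_l R0 0). pose proof (Rmax_r R0 0).
  exists T. split; [lra|split; [lra|]].
  unfold soliton. eapply Rle_trans; [apply sol_decay; lra|].
  rewrite exp_Ropp. pose proof (exp_ineq1_le T).
  apply Rmult_le_reg_r with (exp T); [apply exp_pos|].
  rewrite Rmult_assoc, Rinv_l by (pose proof (exp_pos T); lra). rewrite Rmult_1_r.
  apply Rmult_le_compat_r with (r := eps) in T2; [|lra].
  unfold Rdiv in T2. rewrite Rmult_assoc, Rinv_l in T2 by lra. nra.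
Qed.

(** * Outgoing slope along a half-line *)

(** The outgoing derivative [- x * slope p x] of the decaying solution with its linear part [- x]
    removed. Only this remainder, of order [x ^ (p - 1)], stays on the right-hand side of the
    Kirchhoff condition. *)
Definition half_flow (p x : R) : R := x - x * slope p x.

Lemma slope_bounds (p x : R) : 6 < p -> pw (p - 2) x <= 1 ->
  0 <= slope p x <= 1 /\ slope p x ^ 2 = 1 - 2 / p * pw (p - 2) x /\ 1/2 <= slope p x.
Proof.
  intros Hp Hx. pose proof (pw_ge_0 (p - 2) x).
  assert (0 < 2 / p <= 1/3).
  { split; [apply Rdiv_lt_0_compat; lra|]. apply Rmult_le_reg_r with p; [lra|].
    unfold Rdiv. rewrite Rmult_assoc, Rinv_l; lra. }
  assert (E : slope p x ^ 2 = 1 - 2 / p * pw (p - 2) x).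
  { unfold slope. rewrite <- Rsqr_pow2, Rsqr_sqrt; nra. }
  assert (0 <= slope p x) by apply sqrt_pos.
  repeat split; nra.
Qed.

(** The squares of the slopes differ by [2 / p] times the difference of the powers, and the sum of
    the slopes is at least 1: this is what the lower bound 1/2 in [slope_bounds] is for. *)
Lemma slope_lipschitz (p x y : R) : 6 < p -> pw (p - 2) x <= 1 -> pw (p - 2) y <= 1 ->
  Rabs (slope p x - slope p y) <= Rabs (pw (p - 2) x - pw (p - 2) y).
Proof.
  intros Hp Hx Hy.
  destruct (slope_bounds p x Hp Hx) as (a1 & a2 & a3).
  destruct (slope_bounds p y Hp Hy) as (b1 & b2 & b3).
  assert (0 < 2 / p <= 1/3).
  { split; [apply Rdiv_lt_0_compat; lra|]. apply Rmult_le_reg_r with p; [lra|].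
    unfold Rdiv. rewrite Rmult_assoc, Rinv_l; lra. }
  assert (E : (slope p x + slope p y) * Rabs (slope p x - slope p y)
     = 2 / p * Rabs (pw (p - 2) x - pw (p - 2) y)).
  { rewrite <- (Rabs_pos_eq (slope p x + slope p y)) at 1 by lra.
    rewrite <- (Rabs_pos_eq (2 / p)) by lra. rewrite <- !Rabs_mult.
    rewrite <- (Rabs_Ropp (2 / p * _)). f_equal. nra. }
  pose proof (Rabs_pos (slope p x - slope p y)).
  pose proof (Rabs_pos (pw (p - 2) x - pw (p - 2) y)). nra.
Qed.

Lemma half_flow_bounds (p x : R) : 6 < p -> 0 <= x -> pw (p - 2) x <= 1 ->
  0 <= half_flow p x.
Proof.
  intros Hp Hx0 Hx. destruct (slope_bounds p x Hp Hx) as (a & _). unfold half_flow. nra.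
Qed.

Lemma half_flow_lipschitz (p M x y : R) : 6 < p -> 0 <= x <= M -> 0 <= y <= M ->
  pw (p - 2) M <= 1 ->
  Rabs (half_flow p x - half_flow p y) <= 2 * (p - 1) * pw (p - 2) M * Rabs (x - y).
Proof.
  intros Hp Hx Hy HM.
  assert (Px : pw (p - 2) x <= pw (p - 2) M) by (apply pw_incr; lra).
  assert (Py : pw (p - 2) y <= pw (p - 2) M) by (apply pw_incr; lra).
  destruct (slope_bounds p x Hp ltac:(lra)) as (a1 & a2 & a3).
  destruct (slope_bounds p y Hp ltac:(lra)) as (b1 & b2 & b3).
  assert (S := slope_lipschitz p x y Hp ltac:(lra) ltac:(lra)).
  assert (L := pw_lipschitz (p - 2) M x y ltac:(lra) ltac:(lra) ltac:(lra)).
  replace (half_flow p x - half_flow p y)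
    with ((x - y) * (1 - slope p x) - y * (slope p x - slope p y)) by (unfold half_flow; ring).
  assert (1 - slope p x <= pw (p - 2) M).
  { assert (2 / p <= 1).
    { apply Rmult_le_reg_r with p; [lra|]. unfold Rdiv. rewrite Rmult_assoc, Rinv_l; lra. }
    pose proof (pw_ge_0 (p - 2) x). nra. }
  eapply Rle_trans; [apply (Rabs_triang _ (- _))|]. rewrite Rabs_Ropp, !Rabs_mult.
  rewrite (Rabs_pos_eq (1 - slope p x)), (Rabs_pos_eq y) by lra.
  pose proof (Rabs_pos (x - y)).
  assert (y * Rabs (slope p x - slope p y) <= (p - 2) * pw (p - 2) M * Rabs (x - y)).
  { replace (pw (p - 2) M) with (M * pw (p - 2 - 1) M)
      by (rewrite <- pw_S by lra; f_equal; ring).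
    pose proof (Rabs_pos (slope p x - slope p y)).
    assert (0 <= pw (p - 2 - 1) M) by apply pw_ge_0.
    assert (0 <= (p - 2) * pw (p - 2 - 1) M * Rabs (x - y)) by (repeat apply Rmult_le_pos; lra).
    apply Rle_trans with (M * ((p - 2) * pw (p - 2 - 1) M * Rabs (x - y))); [|right; ring].
    apply Rmult_le_compat; lra. }
  assert (0 <= pw (p - 2) M) by apply pw_ge_0.
  assert (0 <= pw (p - 2) M * Rabs (x - y)) by (apply Rmult_le_pos; lra). nra.
Qed.

(** * The linear boundary value problem on an edge *)

Lemma sinh_gt_0 (t : R) : 0 < t -> 0 < sinh t.
Proof. intros H. unfold sinh. assert (exp (- t) < exp t) by (apply exp_increasing; lra). lra. Qed.

Lemma sinh_plus (a b : R) : sinh (a + b) = sinh a * cosh b + cosh a * sinh b.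
Proof.
  unfold sinh, cosh. rewrite Ropp_plus_distr, !exp_plus. field.
Qed.

Lemma cosh_ge_1 (t : R) : 1 <= cosh t.
Proof.
  pose proof (cosh_ge_abs_sinh t). pose proof (Rabs_pos (sinh t)). pose proof (cosh2_sinh2 t).
  pose proof (pow2_ge_0 (sinh t)). nra.
Qed.

(** Edges are parametrised by [[0, 1]] and the rescaled length [l] enters through the equation
    [v'' = l ^ 2 * (v - g)], so that the unknown functions live on a domain independent of [k].
    [hat0] and [hat1] are the homogeneous solutions with value 1 at one end and 0 at the other. *)
Definition hat0 (l t : R) : R := sinh (l * (1 - t)) / sinh l.
Definition hat1 (l t : R) : R := sinh (l * t) / sinh l.

Lemma hat0_ge_0 (l t : R) : 0 < l -> 0 <= t <= 1 -> 0 <= hat0 l t.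
Proof.
  intros Hl Ht. pose proof (sinh_gt_0 l Hl). apply Rmult_le_pos.
  - apply sinh_ge_0. apply Rmult_le_pos; lra.
  - left. apply Rinv_0_lt_compat. assumption.
Qed.

Lemma hat1_ge_0 (l t : R) : 0 < l -> 0 <= t <= 1 -> 0 <= hat1 l t.
Proof.
  intros Hl Ht. pose proof (sinh_gt_0 l Hl). apply Rmult_le_pos.
  - apply sinh_ge_0. apply Rmult_le_pos; lra.
  - left. apply Rinv_0_lt_compat. assumption.
Qed.

Lemma hat0_gt_0 (l t : R) : 0 < l -> t < 1 -> 0 < hat0 l t.
Proof.
  intros Hl Ht. apply Rdiv_lt_0_compat; [|apply sinh_gt_0, Hl].
  apply sinh_gt_0. apply Rmult_lt_0_compat; lra.
Qed.

Lemma hat1_gt_0 (l t : R) : 0 < l -> 0 < t -> 0 < hat1 l t.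
Proof.
  intros Hl Ht. apply Rdiv_lt_0_compat; [|apply sinh_gt_0, Hl].
  apply sinh_gt_0. apply Rmult_lt_0_compat; lra.
Qed.

(** By the addition formula, [sinh l] is the sum of the two numerators, each multiplied by a
    hyperbolic cosine, which is at least 1. *)
Lemma hat_sum_le_1 (l t : R) : 0 < l -> 0 <= t <= 1 -> hat0 l t + hat1 l t <= 1.
Proof.
  intros Hl Ht. pose proof (sinh_gt_0 l Hl). unfold hat0, hat1.
  apply Rmult_le_reg_r with (sinh l); [assumption|].
  rewrite Rmult_plus_distr_r. unfold Rdiv.
  rewrite !Rmult_assoc, Rinv_l, !Rmult_1_r, Rmult_1_l by lra.
  replace (sinh l) with (sinh (l * (1 - t) + l * t)) by (f_equal; ring).
  rewrite sinh_plus.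
  assert (0 <= sinh (l * (1 - t))) by (apply sinh_ge_0, Rmult_le_pos; lra).
  assert (0 <= sinh (l * t)) by (apply sinh_ge_0, Rmult_le_pos; lra).
  pose proof (cosh_ge_1 (l * t)). pose proof (cosh_ge_1 (l * (1 - t))). nra.
Qed.

Lemma hat0_le_exp (l t : R) : 0 < l -> 0 <= t -> hat0 l t <= exp (- (l * t)).
Proof.
  intros Hl Ht. pose proof (sinh_gt_0 l Hl). unfold hat0.
  apply Rmult_le_reg_r with (sinh l); [assumption|].
  unfold Rdiv. rewrite !Rmult_assoc, Rinv_l, !Rmult_1_r by lra.
  unfold sinh.
  replace (exp (- (l * t)) * ((exp l - exp (- l)) / 2))
    with ((exp (- (l * t)) * exp l - exp (- (l * t)) * exp (- l)) / 2) by field.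
  rewrite <- !exp_plus.
  replace (- (l * t) + l) with (l * (1 - t)) by ring.
  assert (exp (- (l * t) + - l) <= exp (- (l * (1 - t)))); [|lra].
  apply exp_le. assert (0 <= l * t) by (apply Rmult_le_pos; lra). lra.
Qed.

Lemma cont_hat0_num (l : R) : cont (fun s => sinh (l * (1 - s))).
Proof.
  apply cont_derive with (fun s => - l * cosh (l * (1 - s))). intros x. auto_derive; [trivial|unfold Rminus; ring].
Qed.

Lemma cont_hat1_num (l : R) : cont (fun s => sinh (l * s)).
Proof.
  apply cont_derive with (fun s => l * cosh (l * s)). intros x. auto_derive; [trivial|ring].
Qed.

(* Variation of constants: [green l g] solves v'' = l^2 (v - g), v(0) = v(1) = 0. *)
Definition green (l : R) (g : R -> R) (t : R) : R :=
  l / sinh l * (sinh (l * (1 - t)) * RInt (fun s => sinh (l * s) * g s) 0 t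
    + sinh (l * t) * (RInt (fun s => sinh (l * (1 - s)) * g s) 0 1
                      - RInt (fun s => sinh (l * (1 - s)) * g s) 0 t)).

Definition green1 (l : R) (g : R -> R) (t : R) : R :=
  l ^ 2 / sinh l * (- cosh (l * (1 - t)) * RInt (fun s => sinh (l * s) * g s) 0 t
    + cosh (l * t) * (RInt (fun s => sinh (l * (1 - s)) * g s) 0 1
                      - RInt (fun s => sinh (l * (1 - s)) * g s) 0 t)).

Lemma green_C2 (l : R) (g : R -> R) : 0 < l -> cont g ->
  C2 (green l g) (green1 l g) (fun t => l ^ 2 * (green l g t - g t)).
Proof.
  intros Hl Hg.
  assert (Hs := sinh_gt_0 l Hl).
  set (P := fun t => RInt (fun s => sinh (l * s) * g s) 0 t).
  set (Q := fun t => RInt (fun s => sinh (l * (1 - s)) * g s) 0 t).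
  assert (dP : forall t, is_derive P t (sinh (l * t) * g t)).
  { intros t. apply (is_derive_RInt_cont (fun s => sinh (l * s) * g s)).
    apply cont_mult; [apply cont_hat1_num|exact Hg]. }
  assert (dQ : forall t, is_derive Q t (sinh (l * (1 - t)) * g t)).
  { intros t. apply (is_derive_RInt_cont (fun s => sinh (l * (1 - s)) * g s)).
    apply cont_mult; [apply cont_hat0_num|exact Hg]. }
  assert (A : forall t, is_derive (green l g) t (green1 l g t)).
  { intros t.
    apply is_derive_ext with (fun t => l / sinh l * (sinh (l * (1 - t)) * P t
       + sinh (l * t) * (Q 1 - Q t))); [reflexivity|].
    unfold green1. fold (P t). fold (Q 1). fold (Q t).
    specialize (dP t). specialize (dQ t). auto_derive.
    - split; [exists (sinh (l * t) * g t); exact dP|].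
      split; [exists (sinh (l * (1 - t)) * g t); exact dQ|trivial].
    - replace (Derive (fun x => P x) t) with (sinh (l * t) * g t)
        by (symmetry; apply is_derive_unique; exact dP).
      replace (Derive (fun x => Q x) t) with (sinh (l * (1 - t)) * g t)
        by (symmetry; apply is_derive_unique; exact dQ).
      unfold Rminus. field. lra. }
  intros t. split; [apply A|split].
  - apply is_derive_ext with (fun t => l ^ 2 / sinh l * (- cosh (l * (1 - t)) * P t
       + cosh (l * t) * (Q 1 - Q t))); [reflexivity|].
    unfold green. fold (P t). fold (Q 1). fold (Q t).
    specialize (dP t). specialize (dQ t). auto_derive.
    + split; [exists (sinh (l * t) * g t); exact dP|].
      split; [exists (sinh (l * (1 - t)) * g t); exact dQ|trivial].
    + replace (Derive (fun x => P x) t) with (sinh (l * t) * g t)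
        by (symmetry; apply is_derive_unique; exact dP).
      replace (Derive (fun x => Q x) t) with (sinh (l * (1 - t)) * g t)
        by (symmetry; apply is_derive_unique; exact dQ).
      (* The Wronskian of the two homogeneous solutions: it collects the boundary terms of the
         differentiated integrals into [l ^ 2 * g t]. *)
      assert (Es : cosh (l * (1 - t)) * sinh (l * t) + cosh (l * t) * sinh (l * (1 - t)) = sinh l).
      { replace (sinh l) with (sinh (l * (1 - t) + l * t)) by (f_equal; ring).
        rewrite sinh_plus. ring. }
      replace (l ^ 2 * (l / sinh l * (sinh (l * (1 - t)) * P t + sinh (l * t) * (Q 1 - Q t)) - g t))
        with (l ^ 2 * (l / sinh l * (sinh (l * (1 - t)) * P t + sinh (l * t) * (Q 1 - Q t))
          - (cosh (l * (1 - t)) * sinh (l * t) + cosh (l * t) * sinh (l * (1 - t))) / sinh l * g t))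
        by (rewrite Es; field; lra).
      unfold Rminus. field. lra.
  - apply cont_mult; [apply cont_const|]. apply cont_minus; [|exact Hg].
    exact (cont_derive _ _ A).
Qed.

Definition edge_sol (l x y : R) (g : R -> R) (t : R) : R :=
  x * hat0 l t + y * hat1 l t + green l g t.

Definition edge_sol1 (l x y : R) (g : R -> R) (t : R) : R :=
  l / sinh l * (y * cosh (l * t) - x * cosh (l * (1 - t))) + green1 l g t.

Lemma edge_sol_C2 (l x y : R) (g : R -> R) : 0 < l -> cont g ->
  C2 (edge_sol l x y g) (edge_sol1 l x y g) (fun t => l ^ 2 * (edge_sol l x y g t - g t)).
Proof.
  intros Hl Hg t. assert (Hs := sinh_gt_0 l Hl).
  destruct (green_C2 l g Hl Hg t) as (a & b & c).
  assert (H0 : is_derive (fun t => x * hat0 l t + y * hat1 l t) t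
     (l / sinh l * (y * cosh (l * t) - x * cosh (l * (1 - t))))).
  { unfold hat0, hat1. auto_derive; [trivial|]. unfold Rminus. field. lra. }
  assert (H1 : is_derive (fun t => l / sinh l * (y * cosh (l * t) - x * cosh (l * (1 - t)))) t
     (l ^ 2 * (x * hat0 l t + y * hat1 l t))).
  { unfold hat0, hat1. auto_derive; [trivial|]. unfold Rminus. field. lra. }
  split; [|split].
  - exact (is_derive_plus (fun t => x * hat0 l t + y * hat1 l t) (green l g) t _ _ H0 a).
  - replace (l ^ 2 * (edge_sol l x y g t - g t))
      with (l ^ 2 * (x * hat0 l t + y * hat1 l t) + l ^ 2 * (green l g t - g t))
      by (unfold edge_sol; ring).
    exact (is_derive_plus _ (green1 l g) t _ _ H1 b).
  - apply cont_mult; [apply cont_const|]. apply cont_minus; [|exact Hg].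
    apply cont_plus; [|exact (cont_derive _ _ (fun s => proj1 (green_C2 l g Hl Hg s)))].
    apply cont_derive with (fun t => l / sinh l * (y * cosh (l * t) - x * cosh (l * (1 - t)))).
    intros s. unfold hat0, hat1. auto_derive; [trivial|]. unfold Rminus. field. lra.
Qed.

Lemma edge_sol_at_0 (l x y : R) (g : R -> R) : 0 < l -> edge_sol l x y g 0 = x.
Proof.
  intros Hl. assert (Hs := sinh_gt_0 l Hl). unfold edge_sol, hat0, hat1, green.
  rewrite Rmult_0_r, Rminus_0_r, Rmult_1_r, sinh_0, RInt_point. unfold zero; simpl. field. lra.
Qed.

Lemma edge_sol_at_1 (l x y : R) (g : R -> R) : 0 < l -> edge_sol l x y g 1 = y.
Proof.
  intros Hl. assert (Hs := sinh_gt_0 l Hl). unfold edge_sol, hat0, hat1, green.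
  rewrite !Rminus_diag, Rmult_0_r, Rmult_1_r, sinh_0. field. lra.
Qed.

(** For [c = l] and [c = - l] the quantity [(z1 - c * z) * exp (c * t)] is constant. The boundary
    values force [z1 1] to be zero, hence both constants vanish. *)
Lemma edge_unique_homogeneous (l : R) (z z1 : R -> R) : 0 < l ->
  C2 z z1 (fun t => l ^ 2 * z t) -> z 0 = 0 -> z 1 = 0 -> forall t, z t = 0 /\ z1 t = 0.
Proof.
  intros Hl Hz Z0 Z1.
  assert (K : forall c, c ^ 2 = l ^ 2 -> forall t,
    (z1 t - c * z t) * exp (c * t) = z1 0 - c * z 0).
  { intros c Hc t. set (f := fun t => (z1 t - c * z t) * exp (c * t)).
    assert (D : forall t, is_derive f t 0).
    { intros s. destruct (Hz s) as (a & b & _). unfold f. auto_derive.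
      - split; [exists (l ^ 2 * z s); exact b|]. split; [exists (z1 s); exact a|trivial].
      - replace (Derive (fun x => z1 x) s) with (l ^ 2 * z s)
          by (symmetry; apply is_derive_unique; exact b).
        replace (Derive (fun x => z x) s) with (z1 s)
          by (symmetry; apply is_derive_unique; exact a).
        rewrite <- Hc. ring. }
    destruct (MVT_gen f 0 t (fun _ => 0)) as [q [_ E]].
    - intros; apply D.
    - intros s _. apply derivable_continuous_pt. exists 0. apply is_derive_Reals, D.
    - unfold f in E. rewrite Rmult_0_r, exp_0 in E. lra. }
  pose proof (K l eq_refl) as Kp. pose proof (K (- l) ltac:(ring)) as Km.
  assert (E1 := Kp 1). assert (E2 := Km 1). rewrite Z0, Z1 in E1, E2.
  rewrite !Rmult_0_r, !Rminus_0_r, !Rmult_1_r in E1, E2.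
  assert (exp (- l) < exp l) by (apply exp_increasing; lra).
  assert (N : z1 1 = 0) by nra.
  assert (N0 : z1 0 = 0) by (rewrite <- E1, N; ring).
  intros t. specialize (Kp t). specialize (Km t). rewrite Z0, N0 in Kp, Km.
  assert (exp (l * t) <> 0) by (pose proof (exp_pos (l * t)); lra).
  assert (exp (- l * t) <> 0) by (pose proof (exp_pos (- l * t)); lra).
  assert (A : z1 t - l * z t = 0).
  { apply Rmult_eq_reg_r with (exp (l * t)); [|assumption]. lra. }
  assert (B : z1 t - - l * z t = 0).
  { apply Rmult_eq_reg_r with (exp (- l * t)); [|assumption]. lra. }
  split; nra.
Qed.

Lemma C2_minus (f f1 f2 g g1 g2 : R -> R) : C2 f f1 f2 -> C2 g g1 g2 ->
  C2 (fun t => f t - g t) (fun t => f1 t - g1 t) (fun t => f2 t - g2 t).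
Proof.
  intros Hf Hg t. destruct (Hf t) as (a & b & c). destruct (Hg t) as (a' & b' & c').
  split; [|split].
  - exact (is_derive_minus f g t _ _ a a').
  - exact (is_derive_minus f1 g1 t _ _ b b').
  - exact (continuous_minus f2 g2 t c c').
Qed.

Lemma C2_ext (f f1 f2 g2 : R -> R) : C2 f f1 f2 -> (forall t, f2 t = g2 t) -> C2 f f1 g2.
Proof.
  intros H E t. destruct (H t) as (a & b & c). split; [exact a|split].
  - rewrite <- E. exact b.
  - apply continuous_ext with f2; assumption.
Qed.

(** Replaces the computation of integrals: once a function is recognised as a solution, its own
    boundary data give the values of [green] and of the flows. *)
Lemma edge_sol_unique (l : R) (w w1 g : R -> R) : 0 < l -> cont g ->
  C2 w w1 (fun t => l ^ 2 * (w t - g t)) ->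
  forall t, w t = edge_sol l (w 0) (w 1) g t /\ w1 t = edge_sol1 l (w 0) (w 1) g t.
Proof.
  intros Hl Hg Hw t.
  destruct (edge_unique_homogeneous l (fun t => w t - edge_sol l (w 0) (w 1) g t)
     (fun t => w1 t - edge_sol1 l (w 0) (w 1) g t) Hl) with (t := t) as [A B].
  - eapply C2_ext; [apply (C2_minus _ _ _ _ _ _ Hw (edge_sol_C2 l (w 0) (w 1) g Hl Hg))|].
    intros s. simpl. ring.
  - rewrite edge_sol_at_0 by assumption. ring.
  - rewrite edge_sol_at_1 by assumption. ring.
  - simpl in A, B. lra.
Qed.

(** * Boundary flows *)

(** Outgoing slopes at the two ends, in rescaled arc length: hence the division by [l] and the sign
    at the end 1. *)
Definition green_flow0 (l : R) (g : R -> R) : R := green1 l g 0 / l.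
Definition green_flow1 (l : R) (g : R -> R) : R := - green1 l g 1 / l.

Lemma green_flow0_eq (l : R) (g : R -> R) : 0 < l ->
  green_flow0 l g = l / sinh l * RInt (fun s => sinh (l * (1 - s)) * g s) 0 1.
Proof.
  intros Hl. assert (Hs := sinh_gt_0 l Hl). unfold green_flow0, green1.
  rewrite Rmult_0_r, Rminus_0_r, Rmult_1_r, cosh_0, !RInt_point. unfold zero; simpl. field. lra.
Qed.

Lemma green_flow1_eq (l : R) (g : R -> R) : 0 < l ->
  green_flow1 l g = l / sinh l * RInt (fun s => sinh (l * s) * g s) 0 1.
Proof.
  intros Hl. assert (Hs := sinh_gt_0 l Hl). unfold green_flow1, green1.
  rewrite !Rminus_diag, Rmult_0_r, cosh_0. field. lra.
Qed.

(** The slope splits into what arrives from the other end and from the source, minus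
    [cosh l / sinh l] times the value at this very end. The first part enters the right-hand side of
    the Kirchhoff condition, the second its coefficient. *)
Lemma edge_sol1_at_0 (l x y : R) (g : R -> R) : 0 < l ->
  edge_sol1 l x y g 0 = l * (y / sinh l + green_flow0 l g - cosh l / sinh l * x).
Proof.
  intros Hl. assert (Hs := sinh_gt_0 l Hl). unfold edge_sol1, green_flow0.
  rewrite Rmult_0_r, Rminus_0_r, Rmult_1_r, cosh_0. field. lra.
Qed.

Lemma edge_sol1_at_1 (l x y : R) (g : R -> R) : 0 < l ->
  edge_sol1 l x y g 1 = - (l * (x / sinh l + green_flow1 l g - cosh l / sinh l * y)).
Proof.
  intros Hl. assert (Hs := sinh_gt_0 l Hl). unfold edge_sol1, green_flow1.
  rewrite Rminus_diag, Rmult_0_r, Rmult_1_r, cosh_0. field. lra.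
Qed.

(** Maximum principle: the kernels of [green] and of the two flows are nonnegative, so absolute
    values pass under the integrals. *)
Lemma green_monotone (l t : R) (g h : R -> R) : 0 < l -> 0 <= t <= 1 -> cont g -> cont h ->
  (forall s, 0 <= s <= 1 -> Rabs (g s) <= h s) ->
  Rabs (green l g t) <= green l h t /\ Rabs (green_flow0 l g) <= green_flow0 l h /\
  Rabs (green_flow1 l g) <= green_flow1 l h.
Proof.
  intros Hl Ht Hg Hh H. assert (Hs := sinh_gt_0 l Hl).
  assert (Hc : 0 < l / sinh l) by (apply Rdiv_lt_0_compat; lra).
  assert (A : forall a b, 0 <= a <= b -> b <= 1 ->
     Rabs (RInt (fun s => sinh (l * s) * g s) a b) <= RInt (fun s => sinh (l * s) * h s) a b).
  { intros a b Hab Hb. apply RInt_abs_le_cont; [lra| | |].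
    - apply cont_mult; [apply cont_hat1_num|assumption].
    - apply cont_mult; [apply cont_hat1_num|assumption].
    - intros s Hs'. assert (0 <= sinh (l * s)) by (apply sinh_ge_0, Rmult_le_pos; lra).
      rewrite Rabs_mult, Rabs_pos_eq by assumption.
      apply Rmult_le_compat_l; [assumption|]. apply H; lra. }
  assert (B : forall a b, 0 <= a <= b -> b <= 1 ->
     Rabs (RInt (fun s => sinh (l * (1 - s)) * g s) a b)
       <= RInt (fun s => sinh (l * (1 - s)) * h s) a b).
  { intros a b Hab Hb. apply RInt_abs_le_cont; [lra| | |].
    - apply cont_mult; [apply cont_hat0_num|assumption].
    - apply cont_mult; [apply cont_hat0_num|assumption].
    - intros s Hs'. assert (0 <= sinh (l * (1 - s))) by (apply sinh_ge_0, Rmult_le_pos; lra).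
      rewrite Rabs_mult, Rabs_pos_eq by assumption.
      apply Rmult_le_compat_l; [assumption|]. apply H; lra. }
  assert (E : forall f, cont f -> RInt (fun s => sinh (l * (1 - s)) * f s) 0 1
                      - RInt (fun s => sinh (l * (1 - s)) * f s) 0 t =
            RInt (fun s => sinh (l * (1 - s)) * f s) t 1).
  { intros f Hf. rewrite <- (RInt_Chasles_cont _ 0 t 1); [ring|].
    apply cont_mult; [apply cont_hat0_num|assumption]. }
  split; [|rewrite !green_flow0_eq, !green_flow1_eq by assumption; split].
  - unfold green. rewrite !E by assumption.
    rewrite Rabs_mult, Rabs_pos_eq by lra. apply Rmult_le_compat_l; [lra|].
    eapply Rle_trans; [apply Rabs_triang|].
    assert (0 <= sinh (l * (1 - t))) by (apply sinh_ge_0, Rmult_le_pos; lra).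
    assert (0 <= sinh (l * t)) by (apply sinh_ge_0, Rmult_le_pos; lra).
    rewrite !Rabs_mult, (Rabs_pos_eq (sinh (l * (1 - t)))), (Rabs_pos_eq (sinh (l * t))) by assumption.
    apply Rplus_le_compat; (apply Rmult_le_compat_l; [assumption|]); [apply A|apply B]; lra.
  - rewrite Rabs_mult, Rabs_pos_eq by lra. apply Rmult_le_compat_l; [lra|]. apply B; lra.
  - rewrite Rabs_mult, Rabs_pos_eq by lra. apply Rmult_le_compat_l; [lra|]. apply A; lra.
Qed.

Lemma green_scal (l c t : R) (g : R -> R) : 0 < l -> cont g ->
  green l (fun s => c * g s) t = c * green l g t /\
  green_flow0 l (fun s => c * g s) = c * green_flow0 l g /\
  green_flow1 l (fun s => c * g s) = c * green_flow1 l g.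
Proof.
  intros Hl Hg.
  assert (A : forall a b, RInt (fun s => sinh (l * s) * (c * g s)) a b
     = c * RInt (fun s => sinh (l * s) * g s) a b).
  { intros a b. rewrite <- RInt_scal_cont by (apply cont_mult; [apply cont_hat1_num|assumption]).
    apply RInt_ext. intros; simpl; ring. }
  assert (B : forall a b, RInt (fun s => sinh (l * (1 - s)) * (c * g s)) a b
     = c * RInt (fun s => sinh (l * (1 - s)) * g s) a b).
  { intros a b. rewrite <- RInt_scal_cont by (apply cont_mult; [apply cont_hat0_num|assumption]).
    apply RInt_ext. intros; simpl; ring. }
  rewrite !green_flow0_eq, !green_flow1_eq by assumption.
  unfold green. rewrite !A, !B. repeat split; ring.
Qed.

Lemma green_minus (l t : R) (g h : R -> R) : 0 < l -> cont g -> cont h ->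
  green l (fun s => g s - h s) t = green l g t - green l h t /\
  green_flow0 l (fun s => g s - h s) = green_flow0 l g - green_flow0 l h /\
  green_flow1 l (fun s => g s - h s) = green_flow1 l g - green_flow1 l h.
Proof.
  intros Hl Hg Hh.
  assert (A : forall a b, RInt (fun s => sinh (l * s) * (g s - h s)) a b
     = RInt (fun s => sinh (l * s) * g s) a b - RInt (fun s => sinh (l * s) * h s) a b).
  { intros a b. rewrite <- RInt_minus_cont by (apply cont_mult; [apply cont_hat1_num|assumption]).
    apply RInt_ext. intros; simpl; ring. }
  assert (B : forall a b, RInt (fun s => sinh (l * (1 - s)) * (g s - h s)) a b
     = RInt (fun s => sinh (l * (1 - s)) * g s) a b - RInt (fun s => sinh (l * (1 - s)) * h s) a b).
  { intros a b. rewrite <- RInt_minus_cont by (apply cont_mult; [apply cont_hat0_num|assumption]).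
    apply RInt_ext. intros; simpl; ring. }
  rewrite !green_flow0_eq, !green_flow1_eq by assumption.
  unfold green. rewrite !A, !B. repeat split; ring.
Qed.

Lemma exp_lin_C2 (c l : R) :
  C2 (fun t => exp (- (c * l * t))) (fun t => - (c * l) * exp (- (c * l * t)))
     (fun t => c ^ 2 * l ^ 2 * exp (- (c * l * t))).
Proof.
  intros t. split; [|split].
  - auto_derive; [trivial|ring].
  - auto_derive; [trivial|ring].
  - apply cont_mult; [apply cont_const|apply cont_exp_lin].
Qed.

Lemma C2_scal (c : R) (f f1 f2 : R -> R) : C2 f f1 f2 ->
  C2 (fun t => c * f t) (fun t => c * f1 t) (fun t => c * f2 t).
Proof.
  intros H t. destruct (H t) as (a & b & d). split; [|split].
  - exact (is_derive_scal f t c _ a).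
  - exact (is_derive_scal f1 t c _ b).
  - exact (continuous_scal_r c f2 t d).
Qed.

(* [exp (- c l t) / (1 - c ^ 2)] solves the equation with [g = exp (- c l t)]. *)
Lemma green_exp (l c t : R) : 0 < l -> 0 <= c < 1 ->
  green l (fun s => exp (- (c * l * s))) t
    = (exp (- (c * l * t)) - hat0 l t - hat1 l t * exp (- (c * l))) / (1 - c ^ 2) /\
  green_flow0 l (fun s => exp (- (c * l * s)))
    = (cosh l / sinh l - c - exp (- (c * l)) / sinh l) / (1 - c ^ 2) /\
  green_flow1 l (fun s => exp (- (c * l * s)))
    = (exp (- (c * l)) * (cosh l / sinh l + c) - / sinh l) / (1 - c ^ 2).
Proof.
  intros Hl Hc. assert (Hs := sinh_gt_0 l Hl). assert (Hc2 : 1 - c ^ 2 <> 0) by nra.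
  set (Z := fun s => exp (- (c * l * s))).
  assert (CZ : cont Z) by apply cont_exp_lin.
  assert (U := edge_sol_unique l (fun t => / (1 - c ^ 2) * Z t)
     (fun t => / (1 - c ^ 2) * (- (c * l) * Z t)) Z Hl CZ).
  assert (HU : C2 (fun t => / (1 - c ^ 2) * Z t) (fun t => / (1 - c ^ 2) * (- (c * l) * Z t))
     (fun t => l ^ 2 * (/ (1 - c ^ 2) * Z t - Z t))).
  { eapply C2_ext; [apply C2_scal, exp_lin_C2|]. intros s. simpl. unfold Z. field; nra. }
  specialize (U HU).
  assert (Z0 : Z 0 = 1) by (unfold Z; rewrite Rmult_0_r, Ropp_0; apply exp_0).
  assert (Z1 : Z 1 = exp (- (c * l))) by (unfold Z; f_equal; ring).
  split; [|split].
  - destruct (U t) as [E _]. unfold edge_sol in E. cbv beta in E.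
    rewrite Z0, Z1 in E. fold (Z t).
    apply Rplus_eq_reg_l with (/ (1 - c ^ 2) * 1 * hat0 l t + / (1 - c ^ 2) * exp (- (c * l)) * hat1 l t).
    rewrite <- E. field; nra.
  - destruct (U 0) as [_ E]. rewrite edge_sol1_at_0 in E by assumption. rewrite Z0, Z1 in E.
    apply Rmult_eq_reg_l with l; [|lra].
    apply Rplus_eq_reg_l with (l * (/ (1 - c ^ 2) * exp (- (c * l)) / sinh l
       - cosh l / sinh l * (/ (1 - c ^ 2) * 1))).
    replace (l * (/ (1 - c ^ 2) * exp (- (c * l)) / sinh l - cosh l / sinh l * (/ (1 - c ^ 2) * 1)) +
      l * green_flow0 l Z) with (l *
      (/ (1 - c ^ 2) * exp (- (c * l)) / sinh l + green_flow0 l Z -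
       cosh l / sinh l * (/ (1 - c ^ 2) * 1))) by ring.
    rewrite <- E. field; split; [lra|nra].
  - destruct (U 1) as [_ E]. rewrite edge_sol1_at_1 in E by assumption. rewrite Z0, Z1 in E.
    apply Rmult_eq_reg_l with l; [|lra].
    apply Rplus_eq_reg_l with (l * (/ (1 - c ^ 2) * 1 / sinh l
       - cosh l / sinh l * (/ (1 - c ^ 2) * exp (- (c * l))))).
    replace (l * (/ (1 - c ^ 2) * 1 / sinh l - cosh l / sinh l * (/ (1 - c ^ 2) * exp (- (c * l)))) +
      l * green_flow1 l Z) with (- - (l *
      (/ (1 - c ^ 2) * 1 / sinh l + green_flow1 l Z -
       cosh l / sinh l * (/ (1 - c ^ 2) * exp (- (c * l)))))) by ring.
    rewrite <- E. field; split; [lra|nra].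
Qed.

Lemma green_le_const (l t M : R) (g : R -> R) : 0 < l -> 0 <= t <= 1 -> cont g ->
  (forall s, 0 <= s <= 1 -> Rabs (g s) <= M) ->
  Rabs (green l g t) <= M * (1 - hat0 l t - hat1 l t) /\
  Rabs (green_flow0 l g) <= M /\ Rabs (green_flow1 l g) <= M.
Proof.
  intros Hl Ht Hg H. assert (Hs := sinh_gt_0 l Hl).
  assert (HM : 0 <= M) by (pose proof (Rabs_pos (g 0)); specialize (H 0); lra).
  set (Z := fun s => exp (- (0 * l * s))).
  assert (Z1 : forall s, Z s = 1).
  { intros s. unfold Z. rewrite !Rmult_0_l, Ropp_0. apply exp_0. }
  assert (CZ : cont Z) by apply cont_exp_lin.
  destruct (green_monotone l t g (fun s => M * Z s) Hl Ht Hg) as (A & B & C).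
  - apply cont_mult; [apply cont_const|assumption].
  - intros s Hs'. rewrite Z1, Rmult_1_r. apply H, Hs'.
  - destruct (green_scal l M t Z Hl CZ) as (a & b & c). rewrite a in A. rewrite b in B. rewrite c in C.
    destruct (green_exp l 0 t Hl ltac:(lra)) as (a' & b' & c').
    fold Z in a', b', c'. rewrite a' in A. rewrite b' in B. rewrite c' in C.
    rewrite !Rmult_0_l, !Ropp_0, exp_0 in A. rewrite !Rmult_0_l, !Ropp_0, exp_0 in B, C.
    (* The left-hand side is [tanh (l / 2)]. *)
    assert (K : cosh l / sinh l - / sinh l <= 1).
    { apply Rmult_le_reg_r with (sinh l); [assumption|].
      rewrite Rmult_minus_distr_r. unfold Rdiv. rewrite Rmult_assoc, Rinv_l, Rmult_1_r, Rmult_1_l by lra.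
      assert (1 + l <= exp l) by apply exp_ineq1_le.
      assert (exp (- l) <= 1) by (rewrite <- exp_0; apply exp_le; lra).
      unfold cosh, sinh. lra. }
    repeat split.
    + eapply Rle_trans; [exact A|]. right. field.
    + eapply Rle_trans; [exact B|]. rewrite <- (Rmult_1_r M) at 2.
      apply Rmult_le_compat_l; [exact HM|]. replace (1 - 0 ^ 2) with 1 by ring. unfold Rdiv in *. lra.
    + eapply Rle_trans; [exact C|]. rewrite <- (Rmult_1_r M) at 2.
      apply Rmult_le_compat_l; [exact HM|]. replace (1 - 0 ^ 2) with 1 by ring. unfold Rdiv in *. lra.
Qed.

(** A source decaying at half the natural rate yields a solution decaying at the same rate, with the
    factor [1 / (1 - (1/2) ^ 2) = 4/3]. At the full rate resonance would cost a factor of the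
    length, hence the exponent 1/2 in the weights. *)
Lemma green_le_exp (l t M : R) (g : R -> R) : 0 < l -> cosh l / sinh l <= 2 -> 0 <= t <= 1 -> cont g ->
  (forall s, 0 <= s <= 1 -> Rabs (g s) <= M * exp (- (1/2 * l * s))) ->
  Rabs (green l g t) <= 4/3 * M * exp (- (1/2 * l * t)) /\
  Rabs (green_flow1 l g) <= 4 * M * exp (- (1/2 * l)).
Proof.
  intros Hl Hcoth Ht Hg H. assert (Hs := sinh_gt_0 l Hl).
  assert (HM : 0 <= M).
  { pose proof (Rabs_pos (g 0)). specialize (H 0). rewrite Rmult_0_r, Ropp_0, exp_0 in H. lra. }
  set (Z := fun s => exp (- (1/2 * l * s))).
  assert (CZ : cont Z) by apply cont_exp_lin.
  destruct (green_monotone l t g (fun s => M * Z s) Hl Ht Hg) as (A & _ & C).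
  - apply cont_mult; [apply cont_const|assumption].
  - exact H.
  - destruct (green_scal l M t Z Hl CZ) as (a & b & c). rewrite a in A. rewrite c in C.
    destruct (green_exp l (1/2) t Hl ltac:(lra)) as (a' & b' & c').
    fold Z in a', c'. rewrite a' in A. rewrite c' in C. fold (Z t).
    pose proof (hat0_ge_0 l t Hl Ht). pose proof (hat1_ge_0 l t Hl Ht).
    pose proof (exp_pos (- (1/2 * l))) as Ep.
    assert (0 < / sinh l) by (apply Rinv_0_lt_compat; assumption).
    split.
    + eapply Rle_trans; [exact A|]. change (exp (- (1/2 * l * t))) with (Z t).
      assert (0 <= hat1 l t * exp (- (1/2 * l))) by (apply Rmult_le_pos; lra). nra.
    + eapply Rle_trans; [exact C|].
      assert (exp (- (1/2 * l)) * (cosh l / sinh l + 1/2) <= exp (- (1/2 * l)) * (5/2))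
        by (apply Rmult_le_compat_l; lra).
      assert (0 <= M * exp (- (1/2 * l))) by (apply Rmult_le_pos; lra).
      assert (M * ((exp (- (1 / 2 * l)) * (cosh l / sinh l + 1 / 2) - / sinh l) / (1 - (1 / 2) ^ 2))
        <= M * (exp (- (1/2 * l)) * (5/2) * (4/3))).
      { apply Rmult_le_compat_l; [exact HM|]. lra. }
      lra.
Qed.

Lemma green_ge_0 (l t : R) (g : R -> R) : 0 < l -> 0 <= t <= 1 -> cont g ->
  (forall s, 0 <= s <= 1 -> 0 <= g s) ->
  0 <= green l g t /\ 0 <= green_flow0 l g /\ 0 <= green_flow1 l g.
Proof.
  intros Hl Ht Hg H.
  destruct (green_monotone l t g g Hl Ht Hg Hg) as (A & B & C).
  { intros s Hs. rewrite Rabs_pos_eq; [lra|]. apply H, Hs. }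
  pose proof (Rabs_pos (green l g t)). pose proof (Rabs_pos (green_flow0 l g)).
  pose proof (Rabs_pos (green_flow1 l g)). lra.
Qed.

(* The solution for the length [m] solves the equation of length [l] with another right-hand side. *)
Lemma edge_sol_change_length (l m x y M N : R) (g : R -> R) : 0 < l -> 0 < m -> cont g ->
  (forall s, 0 <= s <= 1 -> Rabs (g s) <= M) -> Rabs x <= N -> Rabs y <= N ->
  forall t, 0 <= t <= 1 ->
  Rabs (edge_sol l x y g t - edge_sol m x y g t) <= Rabs (m ^ 2 / l ^ 2 - 1) * (2 * M + 2 * N) /\
  Rabs (edge_sol1 l x y g 0 - edge_sol1 m x y g 0) <= l * Rabs (m ^ 2 / l ^ 2 - 1) * (2 * M + 2 * N) /\
  Rabs (edge_sol1 l x y g 1 - edge_sol1 m x y g 1) <= l * Rabs (m ^ 2 / l ^ 2 - 1) * (2 * M + 2 * N).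
Proof.
  intros Hl Hm Hg HM HN1 HN2 t Ht.
  set (c := m ^ 2 / l ^ 2 - 1).
  set (h := fun s => c * (edge_sol m x y g s - g s)).
  assert (Cm : cont (edge_sol m x y g)).
  { exact (cont_derive _ _ (fun s => proj1 (edge_sol_C2 m x y g Hm Hg s))). }
  assert (Ch : cont h) by (apply cont_mult; [apply cont_const|apply cont_minus; assumption]).
  assert (Bh : forall s, 0 <= s <= 1 -> Rabs (h s) <= Rabs c * (2 * M + 2 * N)).
  { intros s Hs. unfold h. rewrite Rabs_mult. apply Rmult_le_compat_l; [apply Rabs_pos|].
    destruct (green_le_const m s M g Hm Hs Hg HM) as (a & _).
    pose proof (hat0_ge_0 m s Hm Hs). pose proof (hat1_ge_0 m s Hm Hs).
    pose proof (hat_sum_le_1 m s Hm Hs). specialize (HM s Hs).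
    pose proof (Rabs_pos (g s)). pose proof (Rabs_pos x).
    replace (edge_sol m x y g s - g s) with (x * hat0 m s + (y * hat1 m s + (green m g s + - g s)))
      by (unfold edge_sol; ring).
    eapply Rle_trans; [apply Rabs_triang|].
    eapply Rle_trans; [apply Rplus_le_compat_l, Rabs_triang|].
    eapply Rle_trans; [apply Rplus_le_compat_l, Rplus_le_compat_l, Rabs_triang|].
    rewrite !Rabs_mult, Rabs_Ropp, (Rabs_pos_eq (hat0 m s)), (Rabs_pos_eq (hat1 m s)) by assumption.
    assert (Rabs x * hat0 m s <= N * 1) by (apply Rmult_le_compat; lra || apply Rabs_pos).
    assert (Rabs y * hat1 m s <= N * 1) by (apply Rmult_le_compat; lra || apply Rabs_pos).
    nra. }
  assert (D : C2 (fun s => edge_sol l x y g s - edge_sol m x y g s)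
                 (fun s => edge_sol1 l x y g s - edge_sol1 m x y g s)
                 (fun s => l ^ 2 * ((edge_sol l x y g s - edge_sol m x y g s) - h s))).
  { eapply C2_ext; [apply (C2_minus _ _ _ _ _ _ (edge_sol_C2 l x y g Hl Hg) (edge_sol_C2 m x y g Hm Hg))|].
    intros s. simpl. unfold h, c. field. lra. }
  pose proof (edge_sol_unique l _ _ h Hl Ch D) as U. cbv beta in U.
  rewrite !edge_sol_at_0, !edge_sol_at_1 in U by assumption. rewrite !Rminus_diag in U.
  destruct (green_le_const l t _ h Hl Ht Ch Bh) as (a & b & d).
  pose proof (hat0_ge_0 l t Hl Ht). pose proof (hat1_ge_0 l t Hl Ht).
  assert (0 <= Rabs c * (2 * M + 2 * N)).
  { specialize (Bh 0 ltac:(lra)). pose proof (Rabs_pos (h 0)). lra. }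
  split; [|split].
  - destruct (U t) as [E _]. rewrite E. unfold edge_sol. rewrite !Rmult_0_l, !Rplus_0_l.
    eapply Rle_trans; [exact a|]. nra.
  - destruct (U 0) as [_ E]. rewrite E, edge_sol1_at_0 by assumption.
    replace (l * (0 / sinh l + green_flow0 l h - cosh l / sinh l * 0)) with (l * green_flow0 l h)
      by (unfold Rdiv; ring).
    rewrite Rabs_mult, Rabs_pos_eq by lra. rewrite Rmult_assoc. apply Rmult_le_compat_l; lra.
  - destruct (U 1) as [_ E]. rewrite E, edge_sol1_at_1 by assumption.
    replace (- (l * (0 / sinh l + green_flow1 l h - cosh l / sinh l * 0))) with (- (l * green_flow1 l h))
      by (unfold Rdiv; ring).
    rewrite Rabs_Ropp, Rabs_mult, Rabs_pos_eq by lra. rewrite Rmult_assoc. apply Rmult_le_compat_l; lra.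
Qed.

(** * Pointwise continuity: epsilon form and algebraic rules *)

Lemma continuous_eps (f : R -> R) (x eps : R) : 0 < eps -> continuous f x ->
  locally x (fun y => Rabs (f y - f x) < eps).
Proof.
  intros He H. exact (proj1 (filterlim_locally _ _) H (mkposreal eps He)).
Qed.

Lemma eps_continuous (f : R -> R) (x : R) :
  (forall eps, 0 < eps -> locally x (fun y => Rabs (f y - f x) < eps)) -> continuous f x.
Proof. intros H. apply filterlim_locally. intros eps. apply H, cond_pos. Qed.

Lemma continuous_mult_R (f g : R -> R) (x : R) :
  continuous f x -> continuous g x -> continuous (fun y => f y * g y) x.
Proof. intros. apply (continuous_mult f g x); assumption. Qed.

Lemma continuous_plus_R (f g : R -> R) (x : R) :
  continuous f x -> continuous g x -> continuous (fun y => f y + g y) x.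
Proof. intros. apply (continuous_plus f g x); assumption. Qed.

Lemma continuous_minus_R (f g : R -> R) (x : R) :
  continuous f x -> continuous g x -> continuous (fun y => f y - g y) x.
Proof. intros. apply (continuous_minus f g x); assumption. Qed.

Lemma continuous_inv_R (f : R -> R) (x : R) :
  continuous f x -> f x <> 0 -> continuous (fun y => / f y) x.
Proof.
  intros Hf Hx. apply (continuous_comp f Rinv x); [exact Hf|].
  apply (is_derive_continuous _ _ (- / (f x) ^ 2)). auto_derive; [exact Hx|field; exact Hx].
Qed.

Lemma continuous_div_R (f g : R -> R) (x : R) :
  continuous f x -> continuous g x -> g x <> 0 -> continuous (fun y => f y / g y) x.
Proof. intros Hf Hg Hx. apply continuous_mult_R; [exact Hf|]. apply continuous_inv_R; assumption. Qed.

Lemma continuous_const_R (c x : R) : continuous (fun _ => c) x.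
Proof. apply continuous_const. Qed.

Lemma cont_sinh : cont sinh.
Proof. apply cont_derive with cosh. intros x. apply is_derive_Reals, derivable_pt_lim_sinh. Qed.

Lemma cont_cosh : cont cosh.
Proof. apply cont_derive with sinh. intros x. apply is_derive_Reals, derivable_pt_lim_cosh. Qed.

Lemma continuous_Rmax_const (c : R) (f : R -> R) (x : R) :
  continuous f x -> continuous (fun y => Rmax c (f y)) x.
Proof.
  intros H. apply (continuous_comp f (Rmax c)); [exact H|].
  apply lipschitz_continuous with (L := 1) (e := 1); [lra|]. intros y _.
  unfold Rmax. destruct (Rle_dec c y), (Rle_dec c (f x)); rewrite Rmult_1_l;
    unfold Rabs; repeat destruct Rcase_abs; lra.
Qed.

Lemma locally_forall_lt (n : nat) (x : R) (P : nat -> R -> Prop) :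
  (forall i, (i < n)%nat -> locally x (P i)) ->
  locally x (fun y => forall i, (i < n)%nat -> P i y).
Proof.
  induction n; intros H.
  - apply filter_forall. intros y i Hi. lia.
  - assert (A := IHn (fun i Hi => H i (Nat.lt_lt_succ_r _ _ Hi))).
    assert (B := H n (Nat.lt_succ_diag_r n)).
    generalize (filter_and _ _ A B). apply filter_imp. intros y [Y1 Y2] i Hi.
    destruct (Nat.eq_dec i n) as [-> |N]; [exact Y2|]. apply Y1. lia.
Qed.

(** * Dependence of edge solutions on the length *)

Lemma length_ratio_limit (m eps : R) : 0 < m -> 0 < eps ->
  locally m (fun l => 0 < l /\ Rabs (m ^ 2 / l ^ 2 - 1) < eps /\ l < m + 1).
Proof.
  intros Hm He.
  assert (A : continuous (fun l => m ^ 2 / l ^ 2) m).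
  { apply continuous_div_R; [apply continuous_const_R| |nra].
    apply (cont_pow (fun l => l) 2 cont_id). }
  apply continuous_eps with (eps := eps) in A; [|exact He].
  assert (B : locally m (fun l => 0 < l)) by (exists (mkposreal m Hm); intros y Hy;
    change (Rabs (y - m) < m) in Hy; apply Rabs_def2 in Hy; lra).
  assert (B' : locally m (fun l => l < m + 1)) by (exists (mkposreal 1 Rlt_0_1); intros y Hy;
    change (Rabs (y - m) < 1) in Hy; apply Rabs_def2 in Hy; lra).
  generalize (filter_and _ _ A (filter_and _ _ B B')). apply filter_imp. intros l (a & b & c).
  replace (m ^ 2 / m ^ 2) with 1 in a by (field; lra). auto.
Qed.

Lemma edge_sol_length_continuous (m x y M eps : R) (g : R -> R) : 0 < m -> 0 < eps -> cont g ->
  (forall s, 0 <= s <= 1 -> Rabs (g s) <= M) ->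
  locally m (fun l => forall t, 0 <= t <= 1 ->
    Rabs (edge_sol l x y g t - edge_sol m x y g t) < eps).
Proof.
  intros Hm He Hg HM. set (N := Rmax (Rabs x) (Rabs y)).
  assert (Nx : Rabs x <= N) by apply Rmax_l. assert (Ny : Rabs y <= N) by apply Rmax_r.
  assert (HM0 : 0 <= M) by (pose proof (Rabs_pos (g 0)); specialize (HM 0); lra).
  pose proof (Rabs_pos x).
  generalize (length_ratio_limit m (eps / (2 * M + 2 * N + 1)) Hm ltac:(apply Rdiv_lt_0_compat; lra)).
  apply filter_imp. intros l (Hl & Hr & _) t Ht.
  destruct (edge_sol_change_length l m x y M N g Hl Hm Hg HM Nx Ny t Ht) as (a & _ & _).
  eapply Rle_lt_trans; [exact a|].
  apply Rmult_lt_compat_r with (r := 2 * M + 2 * N + 1) in Hr; [|lra].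
  unfold Rdiv in Hr at 2. rewrite Rmult_assoc, Rinv_l in Hr by lra.
  pose proof (Rabs_pos (m ^ 2 / l ^ 2 - 1)). lra.
Qed.

Lemma edge_sol1_length_continuous (m x y M : R) (g : R -> R) : 0 < m -> cont g ->
  (forall s, 0 <= s <= 1 -> Rabs (g s) <= M) ->
  continuous (fun l => edge_sol1 l x y g 0) m /\ continuous (fun l => edge_sol1 l x y g 1) m.
Proof.
  intros Hm Hg HM. set (N := Rmax (Rabs x) (Rabs y)).
  assert (Nx : Rabs x <= N) by apply Rmax_l. assert (Ny : Rabs y <= N) by apply Rmax_r.
  assert (HM0 : 0 <= M) by (pose proof (Rabs_pos (g 0)); specialize (HM 0); lra).
  pose proof (Rabs_pos x).
  assert (K : forall eps, 0 < eps -> locally m (fun l =>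
     Rabs (edge_sol1 l x y g 0 - edge_sol1 m x y g 0) < eps /\
     Rabs (edge_sol1 l x y g 1 - edge_sol1 m x y g 1) < eps)).
  { intros eps He.
    assert (Hd : 0 < (m + 1) * (2 * M + 2 * N + 1)) by (apply Rmult_lt_0_compat; lra).
    generalize (length_ratio_limit m (eps / ((m + 1) * (2 * M + 2 * N + 1))) Hm
      ltac:(apply Rdiv_lt_0_compat; lra)).
    apply filter_imp. intros l (Hl & Hr & Hl1).
    destruct (edge_sol_change_length l m x y M N g Hl Hm Hg HM Nx Ny 0 ltac:(lra)) as (_ & a & b).
    assert (B : l * Rabs (m ^ 2 / l ^ 2 - 1) * (2 * M + 2 * N) < eps).
    { apply Rmult_lt_compat_r with (r := (m + 1) * (2 * M + 2 * N + 1)) in Hr; [|lra].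
      unfold Rdiv in Hr at 2. rewrite Rmult_assoc, Rinv_l, Rmult_1_r in Hr by lra.
      pose proof (Rabs_pos (m ^ 2 / l ^ 2 - 1)).
      eapply Rle_lt_trans; [|exact Hr].
      replace (l * Rabs (m ^ 2 / l ^ 2 - 1) * (2 * M + 2 * N))
        with (Rabs (m ^ 2 / l ^ 2 - 1) * (l * (2 * M + 2 * N))) by ring.
      apply Rmult_le_compat_l; [assumption|]. apply Rmult_le_compat; lra. }
    lra. }
  split; apply eps_continuous; intros eps He; generalize (K eps He); apply filter_imp; tauto.
Qed.

(** * Finite sums over edges *)

(** Convertible to [graph_sum G] for [n = nE G], but suited to induction on [n]. *)
Definition gsum (n : nat) (f : nat -> R) : R := fold_right Rplus 0 (map f (seq 0 n)).

Lemma gsum_S (n : nat) (f : nat -> R) : gsum (S n) f = gsum n f + f n.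
Proof.
  unfold gsum. rewrite seq_S, map_app. simpl. generalize (map f (seq 0 n)). intros l.
  induction l; simpl; [ring|]. rewrite IHl. ring.
Qed.

Lemma gsum_ext (n : nat) (f g : nat -> R) : (forall i, (i < n)%nat -> f i = g i) ->
  gsum n f = gsum n g.
Proof.
  induction n; intros H; [reflexivity|]. rewrite !gsum_S, IHn, H by (intros; auto with arith). reflexivity.
Qed.

Lemma gsum_plus (n : nat) (f g : nat -> R) : gsum n (fun i => f i + g i) = gsum n f + gsum n g.
Proof. induction n; [unfold gsum; simpl; ring|]. rewrite !gsum_S, IHn. ring. Qed.

Lemma gsum_minus (n : nat) (f g : nat -> R) : gsum n (fun i => f i - g i) = gsum n f - gsum n g.
Proof. induction n; [unfold gsum; simpl; ring|]. rewrite !gsum_S, IHn. ring. Qed.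

Lemma gsum_scal (n : nat) (c : R) (f : nat -> R) : gsum n (fun i => c * f i) = c * gsum n f.
Proof. induction n; [unfold gsum; simpl; ring|]. rewrite !gsum_S, IHn. ring. Qed.

Lemma gsum_le (n : nat) (f g : nat -> R) : (forall i, (i < n)%nat -> f i <= g i) ->
  gsum n f <= gsum n g.
Proof.
  induction n; intros H; [unfold gsum; simpl; lra|]. rewrite !gsum_S.
  apply Rplus_le_compat; [apply IHn; intros; apply H; lia|apply H; lia].
Qed.

Lemma gsum_abs_le (n : nat) (f g : nat -> R) : (forall i, (i < n)%nat -> Rabs (f i) <= g i) ->
  Rabs (gsum n f) <= gsum n g.
Proof.
  induction n; intros H; [unfold gsum; simpl; rewrite Rabs_R0; lra|]. rewrite !gsum_S.
  eapply Rle_trans; [apply Rabs_triang|].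
  apply Rplus_le_compat; [apply IHn; intros; apply H; lia|apply H; lia].
Qed.

Lemma gsum_const (n : nat) (c : R) : gsum n (fun _ => c) = INR n * c.
Proof. induction n; [unfold gsum; simpl; ring|]. rewrite gsum_S, IHn, S_INR. ring. Qed.

Lemma gsum_ge_0 (n : nat) (f : nat -> R) : (forall i, (i < n)%nat -> 0 <= f i) -> 0 <= gsum n f.
Proof.
  intros H. replace 0 with (gsum n (fun _ => 0)) by (rewrite gsum_const; ring).
  apply gsum_le, H.
Qed.

Lemma gsum_0 (n : nat) (f : nat -> R) : (forall i, (i < n)%nat -> f i = 0) -> gsum n f = 0.
Proof.
  intros H. rewrite (gsum_ext n f (fun _ => 0)) by assumption. rewrite gsum_const. ring.
Qed.

Lemma gsum_ge_term (n j : nat) (f : nat -> R) : (j < n)%nat ->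
  (forall i, (i < n)%nat -> 0 <= f i) -> f j <= gsum n f.
Proof.
  induction n; intros Hj H; [lia|]. rewrite gsum_S.
  destruct (Nat.eq_dec j n) as [-> |N].
  - assert (0 <= gsum n f) by (apply gsum_ge_0; intros; apply H; lia). lra.
  - assert (f j <= gsum n f) by (apply IHn; [lia|intros; apply H; lia]).
    specialize (H n ltac:(lia)). lra.
Qed.

Lemma gsum_single (n j : nat) (f : nat -> R) : (j < n)%nat ->
  (forall i, (i < n)%nat -> i <> j -> f i = 0) -> gsum n f = f j.
Proof.
  induction n; intros Hj H; [lia|]. rewrite gsum_S.
  destruct (Nat.eq_dec j n) as [-> |N].
  - rewrite gsum_0; [ring|]. intros i Hi. apply H; lia.
  - rewrite IHn by (try lia; intros; apply H; lia). rewrite (H n) by lia. ring.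
Qed.

Lemma gsum_remove (n j : nat) (f : nat -> R) : (j < n)%nat ->
  gsum n f = f j + gsum n (fun i => if Nat.eqb i j then 0 else f i).
Proof.
  intros Hj.
  rewrite (gsum_ext n f (fun i => (if Nat.eqb i j then f i else 0) + (if Nat.eqb i j then 0 else f i)))
    by (intros i _; destruct (Nat.eqb i j); ring).
  rewrite gsum_plus. f_equal.
  rewrite (gsum_single n j) by (try assumption; intros i _ N;
     apply Nat.eqb_neq in N; rewrite N; reflexivity).
  rewrite Nat.eqb_refl. reflexivity.
Qed.

Lemma gsum_continuous (n : nat) (f : nat -> R -> R) (x : R) :
  (forall i, (i < n)%nat -> continuous (f i) x) -> continuous (fun y => gsum n (fun i => f i y)) x.
Proof.
  induction n; intros H.
  - apply continuous_const_R.
  - apply continuous_ext with (fun y => gsum n (fun i => f i y) + f n y).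
    + intros y. rewrite gsum_S. reflexivity.
    + apply continuous_plus_R; [apply IHn; intros; apply H; lia|apply H; lia].
Qed.

(** * Long edges *)

Lemma exp_neg_le_1 (x : R) : 0 <= x -> exp (- x) <= 1.
Proof. intros H. apply Rle_trans with (exp 0); [apply exp_le; lra|rewrite exp_0; lra]. Qed.

(** [exp (l / 2)] is at least 101, so [sinh l] exceeds [16 * exp (l / 2)] with a wide margin; this
    is the only role of the threshold 200. *)
Lemma long_edge (l : R) : 200 <= l ->
  / sinh l <= 1/16 * exp (- (1/2 * l)) /\ / sinh l <= 1/16 /\ 1 <= cosh l / sinh l <= 2.
Proof.
  intros Hl. assert (Hs := sinh_gt_0 l ltac:(lra)).
  assert (E : exp l = exp (1/2 * l) * exp (1/2 * l)) by (rewrite <- exp_plus; f_equal; lra).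
  assert (E1 : 1 + 1/2 * l <= exp (1/2 * l)) by apply exp_ineq1_le.
  assert (E2 : 0 < exp (- l) <= 1).
  { split; [apply exp_pos|]. apply exp_neg_le_1. lra. }
  assert (S : 16 * exp (1/2 * l) <= sinh l).
  { unfold sinh. rewrite E. assert (100 * exp (1/2 * l) <= exp (1/2 * l) * exp (1/2 * l)) by (apply Rmult_le_compat_r; lra). lra. }
  assert (A : / sinh l <= 1/16 * exp (- (1/2 * l))).
  { rewrite exp_Ropp. replace (1/16 * / exp (1/2 * l)) with (/ (16 * exp (1/2 * l))) by (field; lra).
    apply Rinv_le_contravar; lra. }
  split; [exact A|split; [|split]].
  - assert (exp (- (1/2 * l)) <= 1) by (apply exp_neg_le_1; lra). lra.
  - apply Rmult_le_reg_r with (sinh l); [exact Hs|].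
    unfold Rdiv. rewrite Rmult_assoc, Rinv_l by lra. unfold cosh, sinh. lra.
  - apply Rmult_le_reg_r with (sinh l); [exact Hs|].
    unfold Rdiv. rewrite Rmult_assoc, Rinv_l by lra. unfold cosh, sinh in *. lra.
Qed.

(** * The core of the peak *)

(** A retraction of the line onto [[0, 1]]. Unknowns on an edge are functions on all of [R], so that
    continuity and integrability need no restriction to an interval. *)
Definition clamp (t : R) : R := Rmax 0 (Rmin t 1).

Lemma clamp_bounds (t : R) : 0 <= clamp t <= 1.
Proof.
  unfold clamp. split; [apply Rmax_l|]. apply Rmax_lub; [lra|apply Rmin_r].
Qed.

Lemma clamp_id (t : R) : 0 <= t <= 1 -> clamp t = t.
Proof. intros H. unfold clamp. rewrite Rmin_left, Rmax_right; lra. Qed.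

Lemma cont_clamp : cont clamp.
Proof.
  intros x. apply lipschitz_continuous with (L := 1) (e := 1); [lra|]. intros y _.
  unfold clamp, Rmax, Rmin. destruct (Rle_dec y 1), (Rle_dec x 1);
  repeat (match goal with |- context [Rle_dec 0 ?z] => destruct (Rle_dec 0 z) end);
  unfold Rabs; repeat destruct Rcase_abs; lra.
Qed.

(** An even retraction of the line onto [[0, r]], with the role for the core that [clamp] has for
    the edges. *)
Definition fold_abs (r t : R) : R := Rmin (Rabs t) r.

Lemma fold_abs_bounds (r t : R) : 0 <= r -> 0 <= fold_abs r t <= r.
Proof.
  intros Hr. unfold fold_abs. split; [|apply Rmin_r]. apply Rmin_glb; [apply Rabs_pos|exact Hr].
Qed.

Lemma fold_abs_id (r t : R) : Rabs t <= r -> fold_abs r t = Rabs t.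
Proof. intros H. unfold fold_abs. apply Rmin_left, H. Qed.

Lemma fold_abs_id_pos (r t : R) : 0 <= t <= r -> fold_abs r t = t.
Proof. intros H. rewrite fold_abs_id; rewrite Rabs_pos_eq; lra. Qed.

Lemma cont_fold_abs (r : R) : cont (fold_abs r).
Proof.
  intros x. apply lipschitz_continuous with (L := 1) (e := 1); [lra|]. intros y _.
  unfold fold_abs, Rmin. destruct (Rle_dec (Rabs y) r), (Rle_dec (Rabs x) r);
  unfold Rabs in *; repeat destruct Rcase_abs; lra.
Qed.

(* The double primitive of [g], that is [RInt (fun s => (t - s) * g s) 0 t]. *)
Definition primitive2 (g : R -> R) (t : R) : R := t * RInt g 0 t - RInt (fun s => s * g s) 0 t.

Lemma primitive2_C2 (g : R -> R) : cont g -> C2 (primitive2 g) (fun t => RInt g 0 t) g.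
Proof.
  intros Hg t. split; [|split; [|apply Hg]].
  - unfold primitive2.
    assert (A := is_derive_RInt_cont g 0 t Hg).
    assert (B := is_derive_RInt_cont (fun s => s * g s) 0 t (cont_mult _ _ cont_id Hg)).
    set (I := fun t => RInt g 0 t) in *. set (J := fun t => RInt (fun s => s * g s) 0 t) in *.
    apply is_derive_ext with (fun t => t * I t - J t); [reflexivity|].
    change (RInt g 0 t) with (I t).
    auto_derive.
    + split; [exists (g t); exact A|split; [exists (t * g t); exact B|trivial]].
    + replace (Derive (fun x => I x) t) with (g t) by (symmetry; apply is_derive_unique; exact A).
      replace (Derive (fun x => J x) t) with (t * g t) by (symmetry; apply is_derive_unique; exact B).
      ring.
  - apply is_derive_RInt_cont, Hg.
Qed.

Lemma primitive2_eq (g : R -> R) (t : R) : cont g ->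
  primitive2 g t = RInt (fun s => (t - s) * g s) 0 t.
Proof.
  intros Hg. unfold primitive2. rewrite <- RInt_scal_cont by assumption.
  rewrite <- RInt_minus_cont.
  - apply RInt_ext. intros; simpl; ring.
  - apply cont_mult; [apply cont_const|assumption].
  - apply cont_mult; [apply cont_id|assumption].
Qed.

Lemma primitive2_minus (g h : R -> R) (t : R) : cont g -> cont h ->
  primitive2 g t - primitive2 h t = primitive2 (fun s => g s - h s) t.
Proof.
  intros Hg Hh. rewrite !primitive2_eq by (try apply cont_minus; assumption).
  assert (C : cont (fun s => t - s)) by (apply cont_minus; [apply cont_const|apply cont_id]).
  rewrite <- RInt_minus_cont by (apply cont_mult; assumption).
  apply RInt_ext. intros; simpl; ring.
Qed.

(** In the norm weighted by [exp (K * t)] double integration gains [1 / K ^ 2], so a large rate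
    makes the Volterra equation of the core a contraction on an interval of any length. *)
Lemma primitive2_le_exp (g : R -> R) (K M t : R) : cont g -> 0 < K -> 0 <= M -> 0 <= t ->
  (forall s, 0 <= s <= t -> Rabs (g s) <= M * exp (K * s)) ->
  Rabs (primitive2 g t) <= M * exp (K * t) / K ^ 2.
Proof.
  intros Hg HK HM Ht H. rewrite primitive2_eq by assumption.
  assert (C : cont (fun s => t - s)) by (apply cont_minus; [apply cont_const|apply cont_id]).
  assert (CE : cont (fun s => exp (K * s))).
  { apply cont_derive with (fun s => K * exp (K * s)). intros x. auto_derive; [trivial|ring]. }
  set (h := fun s => M * ((t - s) * exp (K * s))).
  assert (Ch : cont h) by (apply cont_mult; [apply cont_const|apply cont_mult; assumption]).
  eapply Rle_trans; [apply RInt_abs_le_cont with (g := h)|].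
  - exact Ht.
  - apply cont_mult; assumption.
  - exact Ch.
  - intros s Hs. unfold h. rewrite Rabs_mult, Rabs_pos_eq by lra.
    specialize (H s Hs). replace (M * ((t - s) * exp (K * s))) with ((t - s) * (M * exp (K * s))) by ring.
    apply Rmult_le_compat_l; lra.
  - rewrite (RInt_primitive (fun s => M * ((t - s) * exp (K * s) / K + exp (K * s) / K ^ 2))).
    + rewrite Rmult_0_r, exp_0, Rminus_diag, Rmult_0_l.
      assert (0 <= M * (t / K)) by (apply Rmult_le_pos; [lra|]; apply Rmult_le_pos;
        [lra|left; apply Rinv_0_lt_compat, HK]).
      assert (0 <= M * / K ^ 2).
      { apply Rmult_le_pos; [lra|]. left; apply Rinv_0_lt_compat. apply pow_lt, HK. }
      unfold Rdiv in *. lra.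
    + exact Ht.
    + exact Ch.
    + intros s _. unfold h. auto_derive; [trivial|]. field. lra.
Qed.

Lemma primitive2_taylor (f f1 f2 : R -> R) (t : R) : C2 f f1 f2 -> 0 <= t ->
  f t = f 0 + t * f1 0 + primitive2 f2 t.
Proof.
  intros H Ht.
  assert (C : cont f2) by (intros s; apply H).
  rewrite primitive2_eq by assumption.
  rewrite (RInt_primitive (fun s => (t - s) * f1 s + f s)).
  - ring.
  - exact Ht.
  - apply cont_mult; [apply cont_minus; [apply cont_const|apply cont_id]|exact C].
  - intros s _. destruct (H s) as (a & b & _). auto_derive.
    + split; [exists (f2 s); exact b|split; [exists (f1 s); exact a|trivial]].
    + replace (Derive (fun x => f1 x) s) with (f2 s) by (symmetry; apply is_derive_unique; exact b).
      replace (Derive (fun x => f x) s) with (f1 s) by (symmetry; apply is_derive_unique; exact a).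
      ring.
Qed.

(** * The fixed point problem *)

(** A Lipschitz constant of [a - a ^ (p - 1)] for [a] up to [2 * peak p]; the 1 comes from the
    linear term. *)
Definition core_lip (p : R) : R := 1 + (p - 1) * pw (p - 2) (2 * peak p).
(** With this rate [core_lip p / core_rate p ^ 2] equals [1 / (4 * core_lip p)], which is at most
    1/4. *)
Definition core_rate (p : R) : R := 2 * core_lip p.
(** The weight of the core at the cut: the amplification granted to an error in the height when it
    crosses the core. *)
Definition core_gain (p rho : R) : R := 2 * exp (core_rate p * rho).
(** The derivative of [a ^ p / p - a ^ 2 / 2] at [peak p], computed with [peak p ^ (p - 2) = p / 2].
    It is positive, so the zero is simple. *)
Definition energy_slope (p : R) : R := peak p * (p / 2 - 1).

(* [sE] is the edge carrying the peak, [sL] the length of its part between the peak and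
   the vertex [sV], [srho] the radius of the core in rescaled units, [sdel] the size of the
   solution outside of the core, [seps] the tolerance on the height of the peak. *)
Record setup := Setup {
  sG : MGraph; sp : R; sE : nat; sV : nat; sL : R; srho : R; sdel : R; seps : R;
  s_wf : wf_graph sG;
  s_p : 6 < sp;
  s_lt : (sE < nE sG)%nat;
  s_bd : is_bounded sG sE = true;
  s_L : 0 < sL;
  s_rho : 1 <= srho;
  s_del : 0 < sdel <= 1;
  s_kap : 2 * (sp - 1) * pw (sp - 2) (2 * sdel) <= 1/64;
  s_sol : soliton sp srho = sdel / 2;
  s_eps : 0 < seps <= 1;
  s_eps1 : seps * core_gain sp srho <= sdel / 4;
  s_eps2 : seps * (2 * core_lip sp) <= energy_slope sp }.

(** All unknowns form one real function on this type, so that the system has a single norm with one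
    weight per index. [ICore] and [IEdge] take every real [t], the functions being extended by
    [fold_abs] and [clamp]. *)
Inductive idx :=
| IPeak
| ICore (t : R)
| IVert (v : nat)
| IEdge (e : nat) (t : R).

Section FixedPoint.
Variable X : setup.
Local Notation G := (sG X).
Local Notation p := (sp X).
Local Notation e0 := (sE X).
Local Notation v0 := (sV X).
Local Notation rho := (srho X).
Local Notation del := (sdel X).
Local Notation eps0 := (seps X).
Local Notation Lg := (core_lip p).
Local Notation K := (core_rate p).
Local Notation Q := (core_gain p rho).
Local Notation hp := (energy_slope p).

(** The value 1 on half-lines is a placeholder that keeps every [elen] positive. *)
Definition elen (e : nat) : R := match kind G e with Bounded l => l | HalfLine => 1 end.
(** On the edge of the peak this is the length of the tail alone, from the cut to the vertex. *)
Definition ell (k : R) (e : nat) : R := if Nat.eqb e e0 then k * sL X - rho else k * elen e.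
Definition bedge (e : nat) : bool := (e <? nE G)%nat && is_bounded G e.
Definition decay (k : R) : R := exp (- (1/2 * ell k e0)).

(** The edge of the peak is always run from the cut, where the value is [q], to the vertex [v0],
    whatever its orientation in the graph. *)
Definition end0 (q : R) (x : nat -> R) (e : nat) : R := if Nat.eqb e e0 then q else x (src G e).
Definition end1 (x : nat -> R) (e : nat) : R := if Nat.eqb e e0 then x v0 else x (tgt G e).

Definition flow1 (k q : R) (x : nat -> R) (g : nat -> R -> R) (e : nat) : R :=
  end0 q x e / sinh (ell k e) + green_flow1 (ell k e) (g e).
(** Both ends of the edge of the peak receive the flow of the tail at [v0]. On a loop this is the
    symmetry about the peak. On a pendant one of the ends is the tip; its vertex equation is then
    fictitious, and its unknown feeds no other equation. *)
Definition flow0 (k q : R) (x hf : nat -> R) (g : nat -> R -> R) (e : nat) : R :=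
  if Nat.eqb e e0 then flow1 k q x g e
  else if is_bounded G e then end1 x e / sinh (ell k e) + green_flow0 (ell k e) (g e)
  else hf (src G e).
Definition coth (l : R) : R := cosh l / sinh l.
Definition coef0 (k : R) (e : nat) : R := if is_bounded G e then coth (ell k e) else 1.

Definition at_vertex (f0 f1 : nat -> R) (v : nat) : R :=
  gsum (nE G) (fun e => (if Nat.eqb (src G e) v then f0 e else 0) +
     (if andb (is_bounded G e) (Nat.eqb (tgt G e) v) then f1 e else 0)).

(** The Kirchhoff condition at [v] reads [inflow = coefs * x v], all terms in the value at [v] that
    an edge sends back to itself being gathered in [coefs]. *)
Definition inflow (k q : R) (x hf : nat -> R) (g : nat -> R -> R) (v : nat) : R :=
  at_vertex (flow0 k q x hf g) (flow1 k q x g) v.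
Definition coefs (k : R) (v : nat) : R := at_vertex (coef0 k) (fun e => coth (ell k e)) v.

Definition energy0 (a : R) : R := pw p a / p - a ^ 2 / 2.

Definition qval (F : idx -> R) : R := F (ICore rho).
Definition xval (F : idx -> R) (v : nat) : R := F (IVert v).
Definition hval (F : idx -> R) (v : nat) : R := half_flow p (F (IVert v)).
Definition force (F : idx -> R) (e : nat) (t : R) : R := pw (p - 1) (F (IEdge e t)).
Definition cforce (F : idx -> R) (t : R) : R := F (ICore t) - pw (p - 1) (F (ICore t)).

(* The conserved energy of the tail of the peak, read off at the vertex. *)
Definition tail_energy (k : R) (F : idx -> R) : R :=
  (flow1 k (qval F) (xval F) (force F) e0 - coth (ell k e0) * F (IVert v0)) ^ 2 / 2
  - F (IVert v0) ^ 2 / 2 + pw p (F (IVert v0)) / p.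

(** The height is updated by a Newton step for the energy balance, with the slope frozen at
    [peak p]; the core by its Volterra equation; the vertices by the Kirchhoff conditions solved for
    the vertex value; the edges by the linear problem with the force of the previous iterate.
    [Rmax 1] guards the division: for large [k] a vertex with an incident edge has [coefs] at least
    1. *)
Definition Phi (k : R) (F : idx -> R) (i : idx) : R :=
  match i with
  | IPeak => F IPeak - (energy0 (F IPeak) - tail_energy k F) / hp
  | ICore t => F IPeak + primitive2 (cforce F) (fold_abs rho t)
  | IVert v => if (v <? nV G)%nat
      then inflow k (qval F) (xval F) (hval F) (force F) v / Rmax 1 (coefs k v) else 0
  | IEdge e t => if bedge e
      then edge_sol (ell k e) (end0 (qval F) (xval F) e) (end1 (xval F) e) (force F e) (clamp t)
      else 0
  end.

(* The weights decay along the tail like [exp (- s / 2)]: perturbations of the core reach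
   the vertex with a factor [decay], which makes [tail_energy] a small perturbation in the
   equation for the height of the peak. *)
Definition weight (k : R) (i : idx) : R :=
  match i with
  | IPeak => 1
  | ICore t => 2 * exp (K * fold_abs rho t)
  | IVert v => Q / 4 * decay k
  | IEdge e t => if Nat.eqb e e0 then 2 * Q * exp (- (1/2 * ell k e0 * clamp t)) else Q / 2 * decay k
  end.

(** The set of the contraction estimate. It does not depend on [k], so fixed points of different
    parameters can be compared in it. *)
Definition admissible (F : idx -> R) : Prop :=
  Rabs (F IPeak - peak p) <= eps0 /\
  cont (fun t => F (ICore t)) /\ (forall t, 0 <= F (ICore t) <= 2 * peak p) /\
  (forall v, 0 <= F (IVert v) <= 2 * del) /\
  (forall e, cont (fun t => F (IEdge e t))) /\ (forall e t, 0 <= F (IEdge e t) <= 2 * del).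

(** Bounds that reproduce themselves under [Phi]: the core stays near the soliton, and beyond it
    everything has size [del] and decays like the weights. The bound on the core later decides the
    sign of the slope at the cut. *)
Definition trapped (k : R) (F : idx -> R) : Prop :=
  admissible F /\
  (forall t, Rabs (F (ICore t) - soliton p (fold_abs rho t)) <= eps0 * (2 * exp (K * fold_abs rho t))) /\
  (forall v, F (IVert v) <= del / 4 * decay k) /\
  (forall t, F (IEdge e0 t) <= 2 * del * exp (- (1/2 * ell k e0 * clamp t))) /\
  (forall e t, e <> e0 -> F (IEdge e t) <= del / 2 * decay k).

(** The last two conditions control the tail energy in the equation for the height: one bounds its
    Lipschitz constant by [hp / 4] in the contraction, the other its size by [hp * eps0 / 4] in the
    invariance. *)
Definition big (k : R) : Prop :=
  0 < k /\ 200 <= ell k e0 /\ (forall e, bedge e = true -> 200 <= ell k e) /\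
  32 * peak p * Q * decay k <= hp /\ 4 * decay k <= hp * eps0.

(** * Consequences of the choice of the parameters *)

Lemma bedge_e0 : bedge e0 = true.
Proof.
  unfold bedge. rewrite (s_bd X), andb_true_r. apply Nat.ltb_lt, s_lt.
Qed.

Lemma bedge_spec (e : nat) : bedge e = true <-> (e < nE G)%nat /\ is_bounded G e = true.
Proof. unfold bedge. rewrite andb_true_iff, Nat.ltb_lt. reflexivity. Qed.

Lemma decay_bounds (k : R) : 200 <= ell k e0 -> 0 < decay k <= 1.
Proof.
  intros H. unfold decay. split; [apply exp_pos|]. apply exp_neg_le_1. lra.
Qed.

Lemma peak_facts : 1 < peak p /\ 1 <= Lg /\ 0 < K /\ 2 <= Q /\ 0 < hp /\ Lg / K ^ 2 <= 1/4.
Proof.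
  pose proof (s_p X) as Hp. pose proof (peak_gt_1 p Hp) as H1.
  assert (H2 : 1 <= Lg).
  { unfold core_lip. pose proof (pw_ge_0 (p - 2) (2 * peak p)). nra. }
  assert (H3 : 0 < K) by (unfold core_rate; lra).
  assert (H4 : 2 <= Q).
  { unfold core_gain. assert (0 <= K * rho) by (apply Rmult_le_pos; [lra|pose proof (s_rho X); lra]).
    pose proof (exp_ineq1_le (K * rho)). lra. }
  assert (H5 : 0 < hp) by (unfold energy_slope; apply Rmult_lt_0_compat; lra).
  repeat split; try assumption.
  unfold core_rate. replace (Lg / (2 * Lg) ^ 2) with (1/4 * / Lg) by (field; lra).
  assert (/ Lg <= 1) by (rewrite <- Rinv_1; apply Rinv_le_contravar; lra). lra.
Qed.

Lemma kap_facts : 0 <= pw (p - 2) (2 * del) <= 1/640 /\ (p - 1) * pw (p - 2) (2 * del) <= 1/128.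
Proof.
  pose proof (s_kap X). pose proof (s_p X). pose proof (pw_ge_0 (p - 2) (2 * del)).
  repeat split; nra.
Qed.

Lemma force_lipschitz (a b : R) : a <= 2 * del -> b <= 2 * del ->
  Rabs (pw (p - 1) a - pw (p - 1) b) <= 1/64 * Rabs (a - b).
Proof.
  intros Ha Hb. pose proof (s_p X) as Hp.
  eapply Rle_trans; [apply pw_lipschitz with (M := 2 * del); lra|].
  apply Rmult_le_compat_r; [apply Rabs_pos|].
  replace (p - 1 - 1) with (p - 2) by ring. pose proof kap_facts. lra.
Qed.

Lemma force_le (a : R) : 0 <= a <= 2 * del -> Rabs (pw (p - 1) a) <= 1/64 * a.
Proof.
  intros Ha. pose proof (s_del X).
  pose proof (force_lipschitz a 0 ltac:(lra) ltac:(lra)) as Hf.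
  rewrite (pw_nonpos _ 0), !Rminus_0_r, (Rabs_pos_eq a) in Hf by lra. exact Hf.
Qed.

Lemma hval_lipschitz (a b : R) : 0 <= a <= 2 * del -> 0 <= b <= 2 * del ->
  Rabs (half_flow p a - half_flow p b) <= 1/64 * Rabs (a - b).
Proof.
  intros Ha Hb. pose proof kap_facts. pose proof (s_kap X).
  eapply Rle_trans; [apply half_flow_lipschitz with (M := 2 * del); try assumption|].
  - apply s_p.
  - lra.
  - apply Rmult_le_compat_r; [apply Rabs_pos|]. lra.
Qed.

Lemma half_flow_0 : half_flow p 0 = 0.
Proof. unfold half_flow. ring. Qed.

Lemma hval_le (a : R) : 0 <= a <= 2 * del -> 0 <= half_flow p a /\ Rabs (half_flow p a) <= 1/64 * a.
Proof.
  intros Ha. pose proof (s_del X). split.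
  - apply half_flow_bounds; [apply s_p|lra|]. pose proof kap_facts.
    assert (pw (p - 2) a <= pw (p - 2) (2 * del)) by (apply pw_incr; [pose proof (s_p X); lra|lra]). lra.
  - pose proof (hval_lipschitz a 0 ltac:(lra) ltac:(lra)) as Hl.
    rewrite half_flow_0, !Rminus_0_r, (Rabs_pos_eq a) in Hl by lra. exact Hl.
Qed.

(** ** The linear part *)

Lemma at_vertex_bound (f0 f1 c0 c1 : nat -> R) (v : nat) :
  (forall e, (e < nE G)%nat -> Rabs (f0 e) <= c0 e) ->
  (forall e, (e < nE G)%nat -> is_bounded G e = true -> Rabs (f1 e) <= c1 e) ->
  Rabs (at_vertex f0 f1 v) <= at_vertex c0 c1 v.
Proof.
  intros H0 H1. apply gsum_abs_le. intros e He.
  specialize (H0 e He). specialize (H1 e He).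
  eapply Rle_trans; [apply Rabs_triang|]. apply Rplus_le_compat.
  - destruct (Nat.eqb _ _); [exact H0|rewrite Rabs_R0; lra].
  - destruct (is_bounded G e); simpl; [|rewrite Rabs_R0; lra].
    destruct (Nat.eqb _ _); [apply H1; reflexivity|rewrite Rabs_R0; lra].
Qed.

Lemma at_vertex_scal (c : R) (f0 f1 : nat -> R) (v : nat) :
  at_vertex (fun e => c * f0 e) (fun e => c * f1 e) v = c * at_vertex f0 f1 v.
Proof.
  unfold at_vertex. rewrite <- gsum_scal. apply gsum_ext. intros e _.
  destruct (Nat.eqb (src G e) v), (is_bounded G e && Nat.eqb (tgt G e) v); ring.
Qed.

Lemma at_vertex_minus (f0 f1 g0 g1 : nat -> R) (v : nat) :
  at_vertex (fun e => f0 e - g0 e) (fun e => f1 e - g1 e) v = at_vertex f0 f1 v - at_vertex g0 g1 v.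
Proof.
  unfold at_vertex. rewrite <- gsum_minus. apply gsum_ext. intros e _.
  destruct (Nat.eqb (src G e) v), (is_bounded G e && Nat.eqb (tgt G e) v); ring.
Qed.

Lemma at_vertex_ext (f0 f1 g0 g1 : nat -> R) (v : nat) :
  (forall e, (e < nE G)%nat -> f0 e = g0 e) ->
  (forall e, (e < nE G)%nat -> is_bounded G e = true -> f1 e = g1 e) ->
  at_vertex f0 f1 v = at_vertex g0 g1 v.
Proof.
  intros H0 H1. apply gsum_ext. intros e He. rewrite (H0 e He). f_equal.
  destruct (is_bounded G e) eqn:B; simpl; [|reflexivity]. rewrite (H1 e He B). reflexivity.
Qed.

Lemma coef_ge_1 (k : R) (e : nat) : big k -> (e < nE G)%nat ->
  1 <= coef0 k e /\ (is_bounded G e = true -> 1 <= coth (ell k e) <= 2).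
Proof.
  intros (_ & _ & Hb & _) He.
  assert (A : is_bounded G e = true -> 1 <= coth (ell k e) <= 2).
  { intros B. apply long_edge, Hb, bedge_spec. auto. }
  split; [|exact A]. unfold coef0. destruct (is_bounded G e); [apply A; reflexivity|lra].
Qed.

(** Serves twice: with [A = d * Q] for the difference of two iterates, with [A = del] for the size
    of one. The factor 1/64 in the hypotheses is the Lipschitz constant of the nonlinear terms. The
    constants 3/16, 3/2 and 3/8 of the conclusions are 3/4 of the 1/4, 2 and 1/2 in the hypotheses,
    which are those of the weights. *)
Lemma linear_bound (k q A : R) (x hf : nat -> R) (g : nat -> R -> R) :
  big k -> 0 <= A -> (forall e, cont (g e)) ->
  Rabs q <= A -> (forall v, Rabs (x v) <= A / 4 * decay k) ->
  (forall v, Rabs (hf v) <= 1/64 * (A / 4 * decay k)) ->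
  (forall s, 0 <= s <= 1 -> Rabs (g e0 s) <= 1/64 * (2 * A * exp (- (1/2 * ell k e0 * s)))) ->
  (forall e s, e <> e0 -> 0 <= s <= 1 -> Rabs (g e s) <= 1/64 * (A / 2 * decay k)) ->
  (Rabs (flow1 k q x g e0) <= 3/16 * A * decay k) /\
  (forall v, Rabs (inflow k q x hf g v / Rmax 1 (coefs k v)) <= 3/16 * A * decay k) /\
  (forall t, 0 <= t <= 1 -> Rabs (edge_sol (ell k e0) (end0 q x e0) (end1 x e0) (g e0) t)
     <= 3/2 * A * exp (- (1/2 * ell k e0 * t))) /\
  (forall e t, bedge e = true -> e <> e0 -> 0 <= t <= 1 ->
     Rabs (edge_sol (ell k e) (end0 q x e) (end1 x e) (g e) t) <= 3/8 * A * decay k).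
Proof.
  intros Hbig HA Cg Hq Hx Hh Hg0 Hg. pose proof Hbig as (Hk & H0 & Hb & _).
  destruct (decay_bounds k H0) as [E0 E1].
  assert (HAE : 0 <= A * decay k) by (apply Rmult_le_pos; lra).
  destruct (long_edge (ell k e0) H0) as (L1 & L2 & L3). fold (decay k) in L1.
  assert (F1 : Rabs (flow1 k q x g e0) <= 3/16 * A * decay k).
  { unfold flow1, end0. rewrite Nat.eqb_refl.
    destruct (green_le_exp (ell k e0) 0 (1/64 * (2 * A)) (g e0)) as [_ J].
    - lra.
    - apply L3.
    - lra.
    - apply Cg.
    - intros s Hs. specialize (Hg0 s Hs). lra.
    - fold (decay k) in J. eapply Rle_trans; [apply Rabs_triang|].
      unfold Rdiv at 1. rewrite Rabs_mult, (Rabs_pos_eq (/ _))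
        by (left; apply Rinv_0_lt_compat, sinh_gt_0; lra).
      assert (Rabs q * / sinh (ell k e0) <= A * (1/16 * decay k)).
      { apply Rmult_le_compat; [apply Rabs_pos| |assumption|assumption].
        left; apply Rinv_0_lt_compat, sinh_gt_0; lra. }
      lra. }
  assert (FF : forall e, (e < nE G)%nat -> Rabs (flow0 k q x hf g e) <= 3/16 * A * decay k /\
     (is_bounded G e = true -> Rabs (flow1 k q x g e) <= 3/16 * A * decay k)).
  { intros e He. destruct (Nat.eq_dec e e0) as [-> |N].
    - unfold flow0. rewrite Nat.eqb_refl. auto.
    - unfold flow0, flow1, end0, end1. rewrite (proj2 (Nat.eqb_neq e e0) N).
      destruct (is_bounded G e) eqn:B.
      + assert (Hl := Hb e (proj2 (bedge_spec e) (conj He B))).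
        destruct (long_edge (ell k e) Hl) as (l1 & l2 & l3).
        assert (Hi : 0 < / sinh (ell k e)) by (apply Rinv_0_lt_compat, sinh_gt_0; lra).
        destruct (green_le_const (ell k e) 0 (1/64 * (A / 2 * decay k)) (g e)) as (_ & J0 & J1).
        * lra.
        * lra.
        * apply Cg.
        * intros s Hs. apply Hg; assumption.
        * assert (KK : forall v J, Rabs J <= 1/64 * (A / 2 * decay k) ->
             Rabs (x v / sinh (ell k e) + J) <= 3/16 * A * decay k).
          { intros v J HJ. eapply Rle_trans; [apply Rabs_triang|].
            unfold Rdiv at 1. rewrite Rabs_mult, (Rabs_pos_eq (/ _)) by lra.
            assert (Rabs (x v) * / sinh (ell k e) <= A / 4 * decay k * (1/16)).
            { apply Rmult_le_compat; try assumption; [apply Rabs_pos|lra|apply Hx]. }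
            lra. }
          split; [|intros _]; apply KK; assumption.
      + split; [|discriminate]. specialize (Hh (src G e)). lra. }
  split; [exact F1|split; [|split]].
  - intros v. unfold Rdiv. rewrite Rabs_mult.
    assert (M1 : 1 <= Rmax 1 (coefs k v)) by apply Rmax_l.
    assert (M2 : coefs k v <= Rmax 1 (coefs k v)) by apply Rmax_r.
    rewrite (Rabs_pos_eq (/ _)) by (left; apply Rinv_0_lt_compat; lra).
    apply Rmult_le_reg_r with (Rmax 1 (coefs k v)); [lra|].
    rewrite Rmult_assoc, Rinv_l, Rmult_1_r by lra.
    (* Every incident flow is at most [3/16 * A * decay k] and every incident coefficient at least
       1, so the division by [coefs] compensates the number of terms, whatever the degree. *)
    apply Rle_trans with (3/16 * A * decay k * coefs k v); [|apply Rmult_le_compat_l; lra].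
    unfold coefs. rewrite <- at_vertex_scal. apply at_vertex_bound.
    + intros e He. destruct (FF e He) as [a _]. destruct (coef_ge_1 k e Hbig He) as [c _].
      eapply Rle_trans; [exact a|]. rewrite <- (Rmult_1_r (3/16 * A * decay k)) at 1.
      apply Rmult_le_compat_l; lra.
    + intros e He B. destruct (FF e He) as [_ a]. destruct (coef_ge_1 k e Hbig He) as [_ c].
      specialize (a B). specialize (c B).
      eapply Rle_trans; [exact a|]. rewrite <- (Rmult_1_r (3/16 * A * decay k)) at 1.
      apply Rmult_le_compat_l; lra.
  - intros t Ht. unfold edge_sol, end0, end1. rewrite Nat.eqb_refl.
    destruct (green_le_exp (ell k e0) t (1/64 * (2 * A)) (g e0)) as [J _].
    + lra.
    + apply L3.
    + lra.
    + apply Cg.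
    + intros s Hs. specialize (Hg0 s Hs). lra.
    + pose proof (hat0_le_exp (ell k e0) t ltac:(lra) ltac:(lra)) as Z0.
      pose proof (hat0_ge_0 (ell k e0) t ltac:(lra) Ht) as Z0'.
      pose proof (hat1_ge_0 (ell k e0) t ltac:(lra) Ht) as Z1.
      pose proof (hat_sum_le_1 (ell k e0) t ltac:(lra) Ht) as Z2.
      set (T := exp (- (1/2 * ell k e0 * t))) in *.
      (* [decay k] is the value of the profile [T] at the vertex, where it is smallest, so the
         boundary term of the vertex is absorbed by [T]. *)
      assert (T1 : decay k <= T).
      { unfold decay, T. apply exp_le. nra. }
      assert (T2 : exp (- (ell k e0 * t)) <= T).
      { unfold T. apply exp_le. assert (0 <= ell k e0 * t) by (apply Rmult_le_pos; lra). lra. }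
      eapply Rle_trans; [apply Rabs_triang|].
      eapply Rle_trans; [apply Rplus_le_compat_r, Rabs_triang|].
      rewrite !Rabs_mult, (Rabs_pos_eq (hat0 _ _)), (Rabs_pos_eq (hat1 _ _)) by assumption.
      assert (Rabs q * hat0 (ell k e0) t <= A * T).
      { apply Rmult_le_compat; try assumption; [apply Rabs_pos|lra]. }
      assert (Rabs (x v0) * hat1 (ell k e0) t <= A / 4 * T * 1).
      { apply Rmult_le_compat; [apply Rabs_pos|assumption| |lra].
        eapply Rle_trans; [apply Hx|]. apply Rmult_le_compat_l; lra. }
      assert (0 <= A * T) by (apply Rmult_le_pos; lra). lra.
  - intros e t Be N Ht. unfold edge_sol, end0, end1. rewrite (proj2 (Nat.eqb_neq e e0) N).
    assert (Hl := Hb e Be).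
    destruct (green_le_const (ell k e) t (1/64 * (A / 2 * decay k)) (g e)) as (J & _).
    + lra.
    + exact Ht.
    + apply Cg.
    + intros s Hs. apply Hg; assumption.
    + pose proof (hat0_ge_0 (ell k e) t ltac:(lra) Ht) as Z0.
      pose proof (hat1_ge_0 (ell k e) t ltac:(lra) Ht) as Z1.
      pose proof (hat_sum_le_1 (ell k e) t ltac:(lra) Ht) as Z2.
      eapply Rle_trans; [apply Rabs_triang|].
      eapply Rle_trans; [apply Rplus_le_compat_r, Rabs_triang|].
      rewrite !Rabs_mult, (Rabs_pos_eq (hat0 _ _)), (Rabs_pos_eq (hat1 _ _)) by assumption.
      assert (Rabs (x (src G e)) * hat0 (ell k e) t <= A / 4 * decay k * hat0 (ell k e) t)
        by (apply Rmult_le_compat_r; [assumption|apply Hx]).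
      assert (Rabs (x (tgt G e)) * hat1 (ell k e) t <= A / 4 * decay k * hat1 (ell k e) t)
        by (apply Rmult_le_compat_r; [assumption|apply Hx]).
      assert (A / 4 * decay k * (hat0 (ell k e) t + hat1 (ell k e) t) <= A / 4 * decay k * 1)
        by (apply Rmult_le_compat_l; lra).
      assert (1 / 64 * (A / 2 * decay k) * (1 - hat0 (ell k e) t - hat1 (ell k e) t)
         <= 1 / 64 * (A / 2 * decay k) * 1) by (apply Rmult_le_compat_l; lra).
      lra.
Qed.

(** ** Contraction and invariance *)

Lemma core_force_lipschitz (a b : R) : a <= 2 * peak p -> b <= 2 * peak p ->
  Rabs ((a - pw (p - 1) a) - (b - pw (p - 1) b)) <= Lg * Rabs (a - b).
Proof.
  intros Ha Hb. pose proof (s_p X) as Hp.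
  replace (a - pw (p - 1) a - (b - pw (p - 1) b)) with ((a - b) + - (pw (p - 1) a - pw (p - 1) b)) by ring.
  eapply Rle_trans; [apply Rabs_triang|]. rewrite Rabs_Ropp.
  assert (L := pw_lipschitz (p - 1) (2 * peak p) a b ltac:(lra) Ha Hb).
  replace (p - 1 - 1) with (p - 2) in L by ring. unfold core_lip. lra.
Qed.

Lemma peak_eq : pw (p - 1) (peak p) - peak p = hp.
Proof.
  pose proof (s_p X) as Hp. pose proof (peak_gt_1 p Hp).
  rewrite pw_p1, pw_peak by lra. unfold energy_slope. ring.
Qed.

(** The derivative of [a - energy0 a / hp] vanishes at [peak p], by the choice of [hp]. At distance
    at most [eps0] it is bounded by [Lg * eps0 / hp], that is by 1/2. *)
Lemma newton_half (a b : R) : Rabs (a - peak p) <= eps0 -> Rabs (b - peak p) <= eps0 ->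
  Rabs ((a - energy0 a / hp) - (b - energy0 b / hp)) <= 1/2 * Rabs (a - b).
Proof.
  intros Ha Hb. pose proof (s_p X) as Hp.
  destruct peak_facts as (P1 & P2 & _ & _ & P5 & _).
  pose proof (s_eps X). pose proof (s_eps2 X).
  set (df := fun z => 1 - (pw (p - 1) z - z) / hp).
  assert (near : forall z, Rmin b a <= z <= Rmax b a -> Rabs (z - peak p) <= eps0).
  { intros z Hz. apply Rabs_le_between in Ha. apply Rabs_le_between in Hb. apply Rabs_le_between.
    unfold Rmin, Rmax in Hz. destruct (Rle_dec b a); lra. }
  assert (pos : forall z, Rabs (z - peak p) <= eps0 -> 0 < z <= 2 * peak p).
  { intros z Hz. apply Rabs_le_between in Hz. lra. }
  assert (D : forall z, Rmin b a <= z <= Rmax b a -> is_derive (fun a => a - energy0 a / hp) z (df z)).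
  { intros z Hz. destruct (pos z (near z Hz)) as [z1 z2].
    assert (A := is_derive_pw p z z1). unfold df, energy0. auto_derive.
    - exists (p * pw (p - 1) z). exact A.
    - replace (Derive (fun x => pw p x) z) with (p * pw (p - 1) z)
        by (symmetry; apply is_derive_unique; exact A).
      field. lra. }
  destruct (MVT_gen (fun a => a - energy0 a / hp) b a df) as [c [Hc E]].
  - intros z Hz. apply D. lra.
  - intros z Hz. apply derivable_continuous_pt. exists (df z). apply is_derive_Reals, D, Hz.
  - cbv beta in E. rewrite E, Rabs_mult. apply Rmult_le_compat_r; [apply Rabs_pos|].
    specialize (near c Hc). destruct (pos c near) as [c1 c2].
    assert (M := core_force_lipschitz c (peak p) ltac:(lra) ltac:(lra)).
    unfold df. rewrite <- peak_eq at 1.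
    replace (1 - (pw (p - 1) c - c) / (pw (p - 1) (peak p) - peak p))
      with (((c - pw (p - 1) c) - (peak p - pw (p - 1) (peak p))) * / (pw (p - 1) (peak p) - peak p))
      by (field; rewrite peak_eq; lra).
    rewrite peak_eq, Rabs_mult, (Rabs_pos_eq (/ hp)) by (left; apply Rinv_0_lt_compat, P5).
    apply Rmult_le_reg_r with hp; [exact P5|]. rewrite Rmult_assoc, Rinv_l, Rmult_1_r by lra.
    eapply Rle_trans; [exact M|].
    assert (Lg * Rabs (c - peak p) <= Lg * eps0) by (apply Rmult_le_compat_l; lra). lra.
Qed.

Lemma flow1_minus (k q r : R) (x y : nat -> R) (g h : nat -> R -> R) (e : nat) :
  0 < ell k e -> cont (g e) -> cont (h e) ->
  flow1 k (q - r) (fun v => x v - y v) (fun e s => g e s - h e s) e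
   = flow1 k q x g e - flow1 k r y h e.
Proof.
  intros Hl Hg Hh. unfold flow1.
  destruct (green_minus (ell k e) 0 (g e) (h e) Hl Hg Hh) as (_ & _ & ->).
  unfold end0. destruct (Nat.eqb e e0); unfold Rdiv; ring.
Qed.

Lemma flow0_minus (k q r : R) (x y hx hy : nat -> R) (g h : nat -> R -> R) (e : nat) :
  (is_bounded G e = true -> 0 < ell k e) -> cont (g e) -> cont (h e) ->
  flow0 k (q - r) (fun v => x v - y v) (fun v => hx v - hy v) (fun e s => g e s - h e s) e
   = flow0 k q x hx g e - flow0 k r y hy h e.
Proof.
  intros Hl Hg Hh. unfold flow0.
  destruct (Nat.eqb e e0) eqn:N.
  - apply Nat.eqb_eq in N. apply flow1_minus; try assumption. apply Hl. subst e. apply s_bd.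
  - destruct (is_bounded G e) eqn:B; [|ring].
    destruct (green_minus (ell k e) 0 (g e) (h e) (Hl eq_refl) Hg Hh) as (_ & -> & _).
    unfold end1. rewrite N. unfold Rdiv; ring.
Qed.

Lemma big_ell (k : R) (e : nat) : big k -> (e < nE G)%nat -> is_bounded G e = true -> 0 < ell k e.
Proof.
  intros (_ & _ & Hb & _) He B. specialize (Hb e (proj2 (bedge_spec e) (conj He B))). lra.
Qed.

(** With the nonlinear terms [hx] and [g] treated as separate data the inflow is linear, so
    [linear_bound] applies to differences of iterates. *)
Lemma inflow_minus (k q r : R) (x y hx hy : nat -> R) (g h : nat -> R -> R) (v : nat) :
  big k -> (forall e, cont (g e)) -> (forall e, cont (h e)) ->
  inflow k (q - r) (fun v => x v - y v) (fun v => hx v - hy v) (fun e s => g e s - h e s) v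
   = inflow k q x hx g v - inflow k r y hy h v.
Proof.
  intros Hk Hg Hh. unfold inflow. rewrite <- at_vertex_minus. apply at_vertex_ext.
  - intros e He. apply flow0_minus; auto. intros B. apply big_ell; assumption.
  - intros e He B. apply flow1_minus; auto. apply big_ell; assumption.
Qed.

Lemma edge_sol_minus (l x1 y1 x2 y2 t : R) (g h : R -> R) : 0 < l -> cont g -> cont h ->
  edge_sol l x1 y1 g t - edge_sol l x2 y2 h t = edge_sol l (x1 - x2) (y1 - y2) (fun s => g s - h s) t.
Proof.
  intros Hl Hg Hh. unfold edge_sol. destruct (green_minus l t g h Hl Hg Hh) as (-> & _). ring.
Qed.

Lemma cont_force (F : idx -> R) (e : nat) : admissible F -> cont (force F e).
Proof.
  intros (_ & _ & _ & _ & C & _). apply (cont_pw (p - 1) (fun t => F (IEdge e t))); [|apply C].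
  pose proof (s_p X). lra.
Qed.

Lemma cont_cforce (F : idx -> R) : admissible F -> cont (cforce F).
Proof.
  intros (_ & C & _). apply cont_minus; [exact C|]. apply (cont_pw (p - 1) (fun t => F (ICore t))); [|exact C].
  pose proof (s_p X). lra.
Qed.

(** Turns unweighted bounds into weighted ones, at the price of a factor [2 / decay k]. *)
Lemma weight_lower (k : R) (i : idx) : big k -> 1/2 * decay k <= weight k i.
Proof.
  intros (_ & H0 & _). destruct (decay_bounds k H0). destruct peak_facts as (_ & _ & HK & HQ & _).
  destruct i; simpl.
  - lra.
  - pose proof (fold_abs_bounds rho t ltac:(pose proof (s_rho X); lra)).
    assert (0 <= K * fold_abs rho t) by (apply Rmult_le_pos; lra).
    pose proof (exp_ineq1_le (K * fold_abs rho t)). lra.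
  - apply Rmult_le_compat_r; lra.
  - destruct (Nat.eqb e e0).
    + pose proof (clamp_bounds t).
      assert (decay k <= exp (- (1/2 * ell k e0 * clamp t))) by (unfold decay; apply exp_le; nra).
      pose proof (exp_pos (- (1/2 * ell k e0 * clamp t))). nra.
    + apply Rmult_le_compat_r; lra.
Qed.

Lemma weight_pos (k : R) (i : idx) : big k -> 0 < weight k i.
Proof.
  intros Hk. pose proof (weight_lower k i Hk). destruct Hk as (_ & H0 & _).
  destruct (decay_bounds k H0). lra.
Qed.

(** The bound does not depend on [k]; it makes convergence in the weighted norm uniform. *)
Lemma weight_upper (k : R) (i : idx) : big k -> weight k i <= 2 * Q.
Proof.
  intros (_ & H0 & _). destruct (decay_bounds k H0). destruct peak_facts as (_ & _ & HK & HQ & _).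
  destruct i; simpl.
  - lra.
  - pose proof (fold_abs_bounds rho t ltac:(pose proof (s_rho X); lra)).
    assert (exp (K * fold_abs rho t) <= exp (K * rho)) by (apply exp_le; nra).
    unfold core_gain in *. lra.
  - nra.
  - destruct (Nat.eqb e e0).
    + pose proof (clamp_bounds t).
      assert (exp (- (1/2 * ell k e0 * clamp t)) <= 1) by (apply exp_neg_le_1; nra). nra.
    + nra.
Qed.

(** A crude bound without decay, which makes the square in [tail_energy] Lipschitz on the admissible
    set. The smallness comes from the difference of the flows. *)
Lemma flow1_abs_le (k : R) (F : idx -> R) : big k -> admissible F ->
  Rabs (flow1 k (qval F) (xval F) (force F) e0 - coth (ell k e0) * F (IVert v0)) <= 5 * peak p.
Proof.
  intros Hk HF. pose proof Hk as (_ & H0 & _). pose proof HF as (_ & _ & Fc & Fv & _ & Fe).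
  destruct (long_edge (ell k e0) H0) as (L1 & L2 & L3).
  pose proof (peak_gt_1 p (s_p X)). pose proof (s_del X).
  unfold flow1, end0. rewrite Nat.eqb_refl.
  destruct (green_le_const (ell k e0) 0 (1/64 * (2 * del)) (force F e0)) as (_ & _ & J).
  - lra.
  - lra.
  - apply cont_force, HF.
  - intros s _. unfold force. eapply Rle_trans; [apply force_le, Fe|]. specialize (Fe e0 s). lra.
  - specialize (Fc rho). specialize (Fv v0). unfold qval.
    assert (Hi : 0 < / sinh (ell k e0)) by (apply Rinv_0_lt_compat, sinh_gt_0; lra).
    eapply Rle_trans; [apply Rabs_triang|]. rewrite Rabs_Ropp.
    eapply Rle_trans; [apply Rplus_le_compat_r, Rabs_triang|].
    fold (coth (ell k e0)) in L3.
    assert (A1 : Rabs (F (ICore rho) / sinh (ell k e0)) <= 2 * peak p * (1/16)).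
    { unfold Rdiv. rewrite Rabs_mult, !Rabs_pos_eq by lra. apply Rmult_le_compat; lra. }
    assert (A2 : Rabs (coth (ell k e0) * F (IVert v0)) <= 2 * (2 * del)).
    { rewrite Rabs_mult, !Rabs_pos_eq by lra. apply Rmult_le_compat; lra. }
    lra.
Qed.

(** The ratio 3/4 is spent as follows. The height takes 1/2 from the Newton step and 1/4 from the
    tail energy. The core takes [d] from the height and half of [d * exp (K * s)] from the Volterra
    term, at most 3/4 of [2 * d * exp (K * s)]: hence the 2 in its weight. Vertices and edges fall
    under [linear_bound]. *)
Lemma Phi_contraction (k : R) : big k -> forall F H d, 0 <= d -> admissible F -> admissible H ->
  (forall i, Rabs (F i - H i) <= d * weight k i) ->
  forall i, Rabs (Phi k F i - Phi k H i) <= 3/4 * d * weight k i.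
Proof.
  intros Hk F H d Hd HF HH D.
  pose proof Hk as (k0 & Hl0 & Hb & B1 & B2).
  destruct (decay_bounds k Hl0) as [E0 E1].
  destruct peak_facts as (P1 & P2 & P3 & P4 & P5 & P6).
  pose proof (s_rho X) as Hrho. pose proof (s_p X) as Hp. pose proof (s_del X) as Hdel.
  pose proof HF as (Fp & Fcc & Fc & Fv & Fec & Fe). pose proof HH as (Gp & Gcc & Gc & Gv & Gec & Ge).
  assert (HdQ : 0 <= d * Q) by (apply Rmult_le_pos; lra).
  assert (HdQE : 0 <= d * Q * decay k) by (apply Rmult_le_pos; lra).
  assert (Dq : Rabs (qval F - qval H) <= d * Q).
  { pose proof (D (ICore rho)) as Dr. simpl in Dr. rewrite fold_abs_id_pos in Dr by lra. exact Dr. }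
  assert (Dx : forall v, Rabs (xval F v - xval H v) <= d * Q / 4 * decay k).
  { intros v. pose proof (D (IVert v)) as Dv. simpl in Dv. unfold xval. lra. }
  destruct (linear_bound k (qval F - qval H) (d * Q) (fun v => xval F v - xval H v)
     (fun v => hval F v - hval H v) (fun e s => force F e s - force H e s)) as (LF & LV & LT & LE).
  - exact Hk.
  - exact HdQ.
  - intros e. apply cont_minus; apply cont_force; assumption.
  - exact Dq.
  - exact Dx.
  - intros v. unfold hval. eapply Rle_trans; [apply hval_lipschitz; [apply Fv|apply Gv]|].
    apply Rmult_le_compat_l; [lra|]. apply (Dx v).
  - intros s Hs. unfold force. eapply Rle_trans; [apply force_lipschitz; [apply Fe|apply Ge]|].
    apply Rmult_le_compat_l; [lra|]. pose proof (D (IEdge e0 s)) as De. simpl in De.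
    rewrite Nat.eqb_refl, clamp_id in De by lra. lra.
  - intros e s N Hs. unfold force. eapply Rle_trans; [apply force_lipschitz; [apply Fe|apply Ge]|].
    apply Rmult_le_compat_l; [lra|]. pose proof (D (IEdge e s)) as De. simpl in De.
    rewrite (proj2 (Nat.eqb_neq e e0) N) in De. lra.
  - intros [|t|v|e t].
    + simpl. rewrite Rmult_1_r.
      assert (DN := newton_half (F IPeak) (H IPeak) Fp Gp).
      assert (DP := D IPeak). simpl in DP. rewrite Rmult_1_r in DP.
      replace (F IPeak - (energy0 (F IPeak) - tail_energy k F) / hp -
        (H IPeak - (energy0 (H IPeak) - tail_energy k H) / hp)) with
        ((F IPeak - energy0 (F IPeak) / hp - (H IPeak - energy0 (H IPeak) / hp)) +
          (tail_energy k F - tail_energy k H) / hp) by (field; lra).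
      eapply Rle_trans; [apply Rabs_triang|].
      assert (DT : Rabs (tail_energy k F - tail_energy k H) <= 8 * peak p * (d * Q * decay k)).
      { pose proof (flow1_abs_le k F Hk HF) as AF. pose proof (flow1_abs_le k H Hk HH) as AG.
        assert (FM := flow1_minus k (qval F) (qval H) (xval F) (xval H) (force F) (force H) e0
          ltac:(lra) (cont_force F e0 HF) (cont_force H e0 HH)).
        rewrite FM in LF.
        assert (DV := Dx v0). unfold xval in DV.
        destruct (long_edge (ell k e0) Hl0) as (_ & _ & LC). fold (coth (ell k e0)) in LC.
        assert (DC : Rabs (coth (ell k e0) * (F (IVert v0) - H (IVert v0))) <= 2 * (d * Q / 4 * decay k)).
        { rewrite Rabs_mult, Rabs_pos_eq by lra. apply Rmult_le_compat; try lra. apply Rabs_pos. }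
        unfold tail_energy.
        set (f := flow1 k (qval F) (xval F) (force F) e0) in *.
        set (h := flow1 k (qval H) (xval H) (force H) e0) in *.
        set (x := F (IVert v0)) in *. set (y := H (IVert v0)) in *. set (c := coth (ell k e0)) in *.
        assert (Bx : 0 <= x <= 2 * del) by apply Fv. assert (By : 0 <= y <= 2 * del) by apply Gv.
        assert (Bd : Rabs ((f - c * x) - (h - c * y)) <= d * Q * decay k).
        { replace (f - c * x - (h - c * y)) with ((f - h) + - (c * (x - y))) by ring.
          eapply Rle_trans; [apply Rabs_triang|]. rewrite Rabs_Ropp. lra. }
        assert (Bp : Rabs (pw p x / p - pw p y / p) <= d * Q * decay k).
        { replace (pw p x / p - pw p y / p) with ((pw p x - pw p y) * / p) by (unfold Rdiv; ring).
          rewrite Rabs_mult, (Rabs_pos_eq (/ p)) by (left; apply Rinv_0_lt_compat; lra).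
          apply Rmult_le_reg_r with p; [lra|]. rewrite Rmult_assoc, Rinv_l, Rmult_1_r by lra.
          eapply Rle_trans; [apply pw_lipschitz with (M := 2 * del); lra|].
          pose proof kap_facts as [KF _].
          assert (PW : pw (p - 1) (2 * del) <= 1) by (rewrite pw_p1 by lra; nra).
          pose proof (pw_ge_0 (p - 1) (2 * del)).
          assert (pw (p - 1) (2 * del) * Rabs (x - y) <= 1 * (d * Q / 4 * decay k)).
          { apply Rmult_le_compat; try lra. apply Rabs_pos. }
          assert (p * (pw (p - 1) (2 * del) * Rabs (x - y)) <= p * (1 * (d * Q / 4 * decay k)))
            by (apply Rmult_le_compat_l; lra).
          assert (0 <= p * (d * Q * decay k)) by (apply Rmult_le_pos; lra). lra. }
        set (u := f - c * x) in *. set (w := h - c * y) in *.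
        replace (u ^ 2 / 2 - x ^ 2 / 2 + pw p x / p - (w ^ 2 / 2 - y ^ 2 / 2 + pw p y / p)) with
          ((u + w) / 2 * (u - w) + (- ((x + y) / 2 * (x - y)) + (pw p x / p - pw p y / p))) by (field; lra).
        eapply Rle_trans; [apply Rabs_triang|].
        eapply Rle_trans; [apply Rplus_le_compat_l, Rabs_triang|].
        rewrite Rabs_Ropp, !Rabs_mult.
        assert (Rabs ((u + w) / 2) <= 5 * peak p).
        { apply Rabs_le_between in AF. apply Rabs_le_between in AG. apply Rabs_le_between. lra. }
        assert (Rabs ((x + y) / 2) <= 2) by (apply Rabs_le_between; lra).
        assert (Rabs ((u + w) / 2) * Rabs (u - w) <= 5 * peak p * (d * Q * decay k)).
        { apply Rmult_le_compat; try lra; apply Rabs_pos. }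
        assert (Rabs ((x + y) / 2) * Rabs (x - y) <= 2 * (d * Q / 4 * decay k)).
        { apply Rmult_le_compat; try lra; apply Rabs_pos. }
        assert (2 * (d * Q * decay k) <= 3 * peak p * (d * Q * decay k)) by (apply Rmult_le_compat_r; lra).
        lra. }
      unfold Rdiv. rewrite Rabs_mult, (Rabs_pos_eq (/ hp)) by (left; apply Rinv_0_lt_compat, P5).
      assert (Rabs (tail_energy k F - tail_energy k H) * / hp <= 1/4 * d).
      { apply Rmult_le_reg_r with hp; [exact P5|]. rewrite Rmult_assoc, Rinv_l, Rmult_1_r by lra.
        eapply Rle_trans; [exact DT|].
        apply Rmult_le_compat_l with (r := d) in B1; [|exact Hd]. lra. }
      lra.
    + simpl. pose proof (fold_abs_bounds rho t ltac:(lra)) as Ht. set (s := fold_abs rho t) in *.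
      assert (DP := D IPeak). simpl in DP. rewrite Rmult_1_r in DP.
      replace (F IPeak + primitive2 (cforce F) s - (H IPeak + primitive2 (cforce H) s)) with
        ((F IPeak - H IPeak) + (primitive2 (cforce F) s - primitive2 (cforce H) s)) by ring.
      rewrite primitive2_minus by (apply cont_cforce; assumption).
      eapply Rle_trans; [apply Rabs_triang|].
      assert (HLd : 0 <= Lg * (2 * d)) by (apply Rmult_le_pos; lra).
      assert (PB := primitive2_le_exp (fun r => cforce F r - cforce H r) K (Lg * (2 * d)) s
        (cont_minus _ _ (cont_cforce F HF) (cont_cforce H HH)) P3 HLd ltac:(lra)).
      assert (PB' : Rabs (primitive2 (fun r => cforce F r - cforce H r) s)
         <= Lg * (2 * d) * exp (K * s) / K ^ 2).
      { apply PB. intros r Hr. unfold cforce.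
        eapply Rle_trans; [apply core_force_lipschitz; [apply Fc|apply Gc]|].
        rewrite Rmult_assoc. apply Rmult_le_compat_l; [lra|].
        pose proof (D (ICore r)) as Dr. simpl in Dr. rewrite fold_abs_id_pos in Dr by lra. lra. }
      assert (X1 : 1 <= exp (K * s)).
      { assert (0 <= K * s) by (apply Rmult_le_pos; lra). pose proof (exp_ineq1_le (K * s)). lra. }
      assert (X2 : Lg * (2 * d) * exp (K * s) / K ^ 2 <= 1/2 * (d * exp (K * s))).
      { replace (Lg * (2 * d) * exp (K * s) / K ^ 2) with (Lg / K ^ 2 * (2 * (d * exp (K * s))))
          by (field; lra).
        assert (0 <= d * exp (K * s)) by (apply Rmult_le_pos; lra). nra. }
      assert (d <= d * exp (K * s)) by nra. lra.
    + simpl. destruct (v <? nV G)%nat.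
      * specialize (LV v).
        rewrite inflow_minus in LV by (try assumption; intros; apply cont_force; assumption).
        unfold Rdiv in *. rewrite Rmult_minus_distr_r in LV. lra.
      * rewrite Rminus_diag, Rabs_R0. assert (0 <= d * (Q / 4 * decay k)) by nra. lra.
    + simpl. destruct (bedge e) eqn:Be.
      * pose proof (clamp_bounds t) as Ht.
        rewrite edge_sol_minus by (try (apply cont_force; assumption); specialize (Hb e Be); lra).
        destruct (Nat.eqb e e0) eqn:N.
        -- apply Nat.eqb_eq in N. subst e. specialize (LT (clamp t) Ht).
           unfold end0, end1 in *. rewrite Nat.eqb_refl in *. lra.
        -- specialize (LE e (clamp t) Be (proj1 (Nat.eqb_neq e e0) N) Ht).
           unfold end0, end1 in *. rewrite N in *. lra.
      * rewrite Rminus_diag, Rabs_R0. pose proof (weight_pos k (IEdge e t) Hk) as Wp. simpl in Wp.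
        apply Rmult_le_pos; [lra|]. left; exact Wp.
Qed.

(** The weighted distance to the soliton is at most [del / 4] by the choice of [eps0], while the
    soliton stays between its value [del / 2] at the cut and [peak p]. *)
Lemma trapped_core_range (k : R) (F : idx -> R) (t : R) : trapped k F ->
  del / 4 <= F (ICore t) <= peak p + del / 4 /\ qval F <= 3/4 * del.
Proof.
  intros (_ & Fs & _). pose proof (s_rho X) as Hr. pose proof (s_p X) as Hp.
  destruct peak_facts as (_ & _ & HK & _). pose proof (s_eps1 X) as He. pose proof (s_eps X) as He'.
  assert (A : forall t, Rabs (F (ICore t) - soliton p (fold_abs rho t)) <= del / 4).
  { intros s. eapply Rle_trans; [apply Fs|]. eapply Rle_trans; [|exact He].
    apply Rmult_le_compat_l; [lra|]. unfold core_gain. apply Rmult_le_compat_l; [lra|].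
    apply exp_le. pose proof (fold_abs_bounds rho s ltac:(lra)). nra. }
  split.
  - specialize (A t). apply Rabs_le_between in A.
    pose proof (fold_abs_bounds rho t ltac:(lra)) as Ht.
    pose proof (soliton_decr p (fold_abs rho t) rho Hp ltac:(lra)) as S1.
    pose proof (soliton_decr p 0 (fold_abs rho t) Hp ltac:(lra)) as S2.
    rewrite soliton_0 in S2. rewrite (s_sol X) in S1. lra.
  - specialize (A rho). rewrite fold_abs_id_pos, (s_sol X) in A by lra.
    apply Rabs_le_between in A. unfold qval. lra.
Qed.

Lemma trapped_linear_bound (k : R) (F : idx -> R) : big k -> trapped k F ->
  (Rabs (flow1 k (qval F) (xval F) (force F) e0) <= 3/16 * del * decay k) /\
  (forall v, Rabs (inflow k (qval F) (xval F) (hval F) (force F) v / Rmax 1 (coefs k v))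
     <= 3/16 * del * decay k) /\
  (forall t, 0 <= t <= 1 ->
     Rabs (edge_sol (ell k e0) (end0 (qval F) (xval F) e0) (end1 (xval F) e0) (force F e0) t)
     <= 3/2 * del * exp (- (1/2 * ell k e0 * t))) /\
  (forall e t, bedge e = true -> e <> e0 -> 0 <= t <= 1 ->
     Rabs (edge_sol (ell k e) (end0 (qval F) (xval F) e) (end1 (xval F) e) (force F e) t)
     <= 3/8 * del * decay k).
Proof.
  intros Hk HF. pose proof HF as (HC & _ & Fv & F0 & Fe).
  pose proof HC as (_ & _ & Cc & Cv & _ & Ce). pose proof (s_del X).
  apply linear_bound.
  - exact Hk.
  - lra.
  - intros e. apply cont_force, HC.
  - destruct (trapped_core_range k F 0 HF) as [_ B]. rewrite Rabs_pos_eq; [lra|]. apply Cc.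
  - intros v. unfold xval. rewrite Rabs_pos_eq; [apply Fv|apply Cv].
  - intros v. unfold hval. eapply Rle_trans; [apply hval_le, Cv|].
    apply Rmult_le_compat_l; [lra|apply Fv].
  - intros s Hs. unfold force. eapply Rle_trans; [apply force_le, Ce|].
    apply Rmult_le_compat_l; [lra|]. specialize (F0 s). rewrite clamp_id in F0 by lra. exact F0.
  - intros e s N Hs. unfold force. eapply Rle_trans; [apply force_le, Ce|].
    apply Rmult_le_compat_l; [lra|]. apply Fe, N.
Qed.

Lemma admissible_flow_ge_0 (k : R) (F : idx -> R) (e : nat) : big k -> admissible F -> (e < nE G)%nat ->
  0 <= flow0 k (qval F) (xval F) (hval F) (force F) e /\
  (is_bounded G e = true -> 0 <= flow1 k (qval F) (xval F) (force F) e).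
Proof.
  intros Hk HC He. pose proof HC as (_ & _ & Cc & Cv & _ & Ce).
  assert (A : is_bounded G e = true -> 0 <= flow1 k (qval F) (xval F) (force F) e).
  { intros B. assert (Hl := big_ell k e Hk He B).
    assert (Hi : 0 < / sinh (ell k e)) by (apply Rinv_0_lt_compat, sinh_gt_0; lra).
    destruct (green_ge_0 (ell k e) 0 (force F e) Hl ltac:(lra) (cont_force F e HC)) as (_ & _ & J).
    { intros s _. apply pw_ge_0. }
    unfold flow1. apply Rplus_le_le_0_compat; [|exact J].
    apply Rmult_le_pos; [|lra]. unfold end0, qval, xval. destruct (Nat.eqb e e0); [apply Cc|apply Cv]. }
  split; [|exact A]. unfold flow0. destruct (Nat.eqb e e0) eqn:N.
  - apply A. apply Nat.eqb_eq in N. subst e. apply s_bd.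
  - destruct (is_bounded G e) eqn:B; [|apply hval_le, Cv].
    assert (Hl := big_ell k e Hk He B).
    assert (Hi : 0 < / sinh (ell k e)) by (apply Rinv_0_lt_compat, sinh_gt_0; lra).
    destruct (green_ge_0 (ell k e) 0 (force F e) Hl ltac:(lra) (cont_force F e HC)) as (_ & J & _).
    { intros s _. apply pw_ge_0. }
    apply Rplus_le_le_0_compat; [|exact J].
    apply Rmult_le_pos; [|lra]. unfold end1, xval. rewrite N. apply Cv.
Qed.

Lemma at_vertex_ge_0 (f0 f1 : nat -> R) (v : nat) :
  (forall e, (e < nE G)%nat -> 0 <= f0 e /\ (is_bounded G e = true -> 0 <= f1 e)) ->
  0 <= at_vertex f0 f1 v.
Proof.
  intros H. apply gsum_ge_0. intros e He. destruct (H e He) as [a b].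
  apply Rplus_le_le_0_compat.
  - destruct (Nat.eqb _ _); lra.
  - destruct (is_bounded G e); simpl; [|lra]. destruct (Nat.eqb _ _); [auto|lra].
Qed.

Lemma admissible_edge_ge_0 (k : R) (F : idx -> R) (e : nat) (t : R) : big k -> admissible F -> bedge e = true ->
  0 <= t <= 1 ->
  end0 (qval F) (xval F) e * hat0 (ell k e) t + end1 (xval F) e * hat1 (ell k e) t <=
  edge_sol (ell k e) (end0 (qval F) (xval F) e) (end1 (xval F) e) (force F e) t /\
  0 <= end0 (qval F) (xval F) e /\ 0 <= end1 (xval F) e.
Proof.
  intros Hk HC Be Ht. pose proof HC as (_ & _ & Cc & Cv & _ & Ce).
  assert (Hl : 0 < ell k e) by (apply bedge_spec in Be; apply big_ell; tauto).
  destruct (green_ge_0 (ell k e) t (force F e) Hl Ht (cont_force F e HC)) as (J & _).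
  { intros s _. apply pw_ge_0. }
  split; [unfold edge_sol; lra|].
  split; unfold end0, end1, qval, xval; destruct (Nat.eqb e e0); auto; (apply Cc || apply Cv).
Qed.

(** Every term is at least quadratic in quantities of size [decay k], which is at most 1; keeping
    one factor suffices. *)
Lemma trapped_tail_energy (k : R) (F : idx -> R) : big k -> trapped k F -> Rabs (tail_energy k F) <= decay k.
Proof.
  intros Hk HF. pose proof Hk as (_ & Hl0 & _). destruct (decay_bounds k Hl0) as [E0 E1].
  destruct (trapped_linear_bound k F Hk HF) as (LF & _).
  pose proof HF as (HC & _ & Fv & _). pose proof HC as (_ & _ & _ & Cv & _).
  pose proof (s_del X) as Hd. pose proof (s_p X) as Hp.
  destruct (long_edge (ell k e0) Hl0) as (_ & _ & LC). fold (coth (ell k e0)) in LC.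
  specialize (Fv v0). specialize (Cv v0). unfold tail_energy.
  set (f := flow1 k (qval F) (xval F) (force F) e0) in *. set (x := F (IVert v0)) in *.
  set (c := coth (ell k e0)) in *.
  assert (HdE : del * decay k <= decay k) by nra.
  assert (Hx : x <= 1/4 * decay k) by lra.
  assert (Hcx : 0 <= c * x <= 2 * (1/4 * decay k)).
  { split; [apply Rmult_le_pos; lra|]. apply Rmult_le_compat; lra. }
  assert (Hu : - decay k <= f - c * x <= decay k).
  { apply Rabs_le_between in LF. lra. }
  set (u := f - c * x) in *.
  assert (Hu2 : 0 <= u ^ 2 <= decay k) by (split; [apply pow2_ge_0|nra]).
  assert (Hx2 : 0 <= x ^ 2 <= 1/4 * decay k) by (split; [apply pow2_ge_0|nra]).
  assert (Hpx : 0 <= pw p x / p <= 1/4 * decay k).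
  { pose proof (pw_ge_0 p x). split; [apply Rmult_le_pos; [assumption|left; apply Rinv_0_lt_compat; lra]|].
    apply Rmult_le_reg_r with p; [lra|]. unfold Rdiv at 1. rewrite Rmult_assoc, Rinv_l, Rmult_1_r by lra.
    rewrite pw_p0 by lra.
    assert (pw (p - 2) x <= 1).
    { apply Rle_trans with (pw (p - 2) (2 * del)); [apply pw_incr; lra|]. pose proof kap_facts. lra. }
    pose proof (pw_ge_0 (p - 2) x). nra. }
  apply Rabs_le_between. lra.
Qed.

Lemma energy0_peak : energy0 (peak p) = 0.
Proof.
  pose proof (s_p X) as Hp. pose proof (peak_gt_1 p Hp). unfold energy0.
  rewrite pw_p0, pw_peak by lra. field. lra.
Qed.

Lemma cont_edge_clamp (l x y : R) (g : R -> R) : 0 < l -> cont g ->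
  cont (fun t => edge_sol l x y g (clamp t)).
Proof.
  intros Hl Hg. apply (cont_comp (edge_sol l x y g)); [|apply cont_clamp].
  exact (cont_derive _ _ (fun s => proj1 (edge_sol_C2 l x y g Hl Hg s))).
Qed.

(** The Newton step halves the distance to [peak p], where [energy0] vanishes, and the tail energy
    adds a quarter of [eps0]. The soliton solves the Volterra equation of the core with height
    [peak p], so the distance to it is estimated as in the contraction. The rest is [linear_bound]
    with [A = del], together with the positivity of the kernels. *)
Lemma Phi_invariant (k : R) (F : idx -> R) : big k -> trapped k F -> trapped k (Phi k F).
Proof.
  intros Hk HF. pose proof Hk as (k0 & Hl0 & Hb & B1 & B2).
  pose proof HF as (HC & Fs & Fv & F0 & Fe).
  pose proof HC as (Cp & Ccc & Cc & Cv & Cec & Ce).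
  destruct (decay_bounds k Hl0) as [E0 E1].
  destruct peak_facts as (P1 & P2 & P3 & P4 & P5 & P6).
  pose proof (s_rho X) as Hrho. pose proof (s_p X) as Hp. pose proof (s_del X) as Hdel.
  pose proof (s_eps X) as Heps. pose proof (s_eps1 X) as Heps1.
  destruct (trapped_linear_bound k F Hk HF) as (LF & LV & LT & LE).
  assert (HdE : 0 < del * decay k) by (apply Rmult_lt_0_compat; lra).
  assert (HdE' : del * decay k <= del) by nra.
  assert (SP : forall s, 0 <= s -> 0 < soliton p s <= peak p).
  { intros s Hs. split; [apply soliton_pos|]. rewrite <- soliton_0. apply soliton_decr; lra. }
  assert (NP : Rabs (Phi k F IPeak - peak p) <= eps0).
  { simpl. assert (DN := newton_half (F IPeak) (peak p) Cp).
    rewrite Rminus_diag, Rabs_R0 in DN. specialize (DN ltac:(lra)).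
    rewrite energy0_peak in DN. unfold Rdiv at 2 in DN. rewrite Rmult_0_l, Rminus_0_r in DN.
    replace (F IPeak - (energy0 (F IPeak) - tail_energy k F) / hp - peak p) with
      ((F IPeak - energy0 (F IPeak) / hp - peak p) + tail_energy k F / hp) by (field; lra).
    eapply Rle_trans; [apply Rabs_triang|].
    pose proof (trapped_tail_energy k F Hk HF).
    unfold Rdiv at 2. rewrite Rabs_mult, (Rabs_pos_eq (/ hp)) by (left; apply Rinv_0_lt_compat, P5).
    assert (Rabs (tail_energy k F) * / hp <= 1/4 * eps0).
    { apply Rmult_le_reg_r with hp; [exact P5|]. rewrite Rmult_assoc, Rinv_l, Rmult_1_r by lra. lra. }
    lra. }
  assert (NC : forall t, Rabs (Phi k F (ICore t) - soliton p (fold_abs rho t))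
     <= eps0 * (2 * exp (K * fold_abs rho t))).
  { intros t. simpl. pose proof (fold_abs_bounds rho t ltac:(lra)) as Ht.
    set (s := fold_abs rho t) in *.
    pose proof (soliton_C2 p Hp) as S2.
    set (g := fun t => soliton p t - pw (p - 1) (soliton p t)) in *.
    assert (Cg : cont g) by (intros r; apply S2).
    assert (T : soliton p s = peak p + primitive2 g s).
    { rewrite (primitive2_taylor (soliton p) (soliton1 p) g s S2 ltac:(lra)) at 1.
      rewrite soliton_0, soliton1_0. ring. }
    rewrite T.
    replace (F IPeak + primitive2 (cforce F) s - (peak p + primitive2 g s)) with
      ((F IPeak - peak p) + (primitive2 (cforce F) s - primitive2 g s)) by ring.
    rewrite primitive2_minus by (try apply cont_cforce; assumption).
    eapply Rle_trans; [apply Rabs_triang|].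
    assert (HLd : 0 <= Lg * (2 * eps0)) by (apply Rmult_le_pos; lra).
    assert (PB := primitive2_le_exp (fun r => cforce F r - g r) K (Lg * (2 * eps0)) s
      (cont_minus _ _ (cont_cforce F HC) Cg) P3 HLd ltac:(lra)).
    assert (PB' : Rabs (primitive2 (fun r => cforce F r - g r) s)
       <= Lg * (2 * eps0) * exp (K * s) / K ^ 2).
    { apply PB. intros r Hr. unfold cforce, g.
      eapply Rle_trans; [apply core_force_lipschitz; [apply Cc|specialize (SP r); lra]|].
      rewrite Rmult_assoc. apply Rmult_le_compat_l; [lra|].
      pose proof (Fs r) as Dr. rewrite fold_abs_id_pos in Dr by lra. lra. }
    assert (X1 : 1 <= exp (K * s)).
    { assert (0 <= K * s) by (apply Rmult_le_pos; lra). pose proof (exp_ineq1_le (K * s)). lra. }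
    assert (X2 : Lg * (2 * eps0) * exp (K * s) / K ^ 2 <= 1/2 * (eps0 * exp (K * s))).
    { replace (Lg * (2 * eps0) * exp (K * s) / K ^ 2) with (Lg / K ^ 2 * (2 * (eps0 * exp (K * s))))
        by (field; lra).
      assert (0 <= eps0 * exp (K * s)) by (apply Rmult_le_pos; lra). nra. }
    assert (eps0 <= eps0 * exp (K * s)) by nra. lra. }
  assert (NV : forall v, 0 <= Phi k F (IVert v) <= del / 4 * decay k).
  { intros v. simpl. destruct (v <? nV G)%nat; [|lra]. specialize (LV v).
    assert (0 <= inflow k (qval F) (xval F) (hval F) (force F) v / Rmax 1 (coefs k v)).
    { apply Rmult_le_pos.
      - apply at_vertex_ge_0. intros e He. apply admissible_flow_ge_0; assumption.
      - left. apply Rinv_0_lt_compat. pose proof (Rmax_l 1 (coefs k v)). lra. }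
    split; [assumption|]. rewrite Rabs_pos_eq in LV by assumption. lra. }
  assert (NE0 : forall t, 0 <= Phi k F (IEdge e0 t) <= 2 * del * exp (- (1/2 * ell k e0 * clamp t))).
  { intros t. simpl. rewrite bedge_e0. pose proof (clamp_bounds t) as Ht.
    specialize (LT (clamp t) Ht).
    destruct (admissible_edge_ge_0 k F e0 (clamp t) Hk HC bedge_e0 Ht) as (a & b & c).
    pose proof (hat0_ge_0 (ell k e0) (clamp t) ltac:(lra) Ht).
    pose proof (hat1_ge_0 (ell k e0) (clamp t) ltac:(lra) Ht).
    pose proof (exp_pos (- (1/2 * ell k e0 * clamp t))).
    assert (0 <= del * exp (- (1/2 * ell k e0 * clamp t))) by (apply Rmult_le_pos; lra).
    assert (P : 0 <= edge_sol (ell k e0) (end0 (qval F) (xval F) e0) (end1 (xval F) e0) (force F e0) (clamp t)).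
    { eapply Rle_trans; [|exact a]. apply Rplus_le_le_0_compat; apply Rmult_le_pos; assumption. }
    split; [exact P|]. rewrite Rabs_pos_eq in LT by exact P. lra. }
  assert (NE : forall e t, e <> e0 -> 0 <= Phi k F (IEdge e t) <= del / 2 * decay k).
  { intros e t N. simpl. destruct (bedge e) eqn:Be; [|lra]. pose proof (clamp_bounds t) as Ht.
    specialize (LE e (clamp t) Be N Ht). specialize (Hb e Be).
    destruct (admissible_edge_ge_0 k F e (clamp t) Hk HC Be Ht) as (a & b & c).
    pose proof (hat0_ge_0 (ell k e) (clamp t) ltac:(lra) Ht).
    pose proof (hat1_ge_0 (ell k e) (clamp t) ltac:(lra) Ht).
    assert (P : 0 <= edge_sol (ell k e) (end0 (qval F) (xval F) e) (end1 (xval F) e) (force F e) (clamp t)).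
    { eapply Rle_trans; [|exact a]. apply Rplus_le_le_0_compat; apply Rmult_le_pos; assumption. }
    split; [exact P|]. rewrite Rabs_pos_eq in LE by exact P. lra. }
  split; [|split; [exact NC|split; [apply NV|split; [apply NE0|intros; apply NE; assumption]]]].
  split; [exact NP|split; [|split; [|split; [|split]]]].
  - simpl. apply cont_plus; [apply cont_const|].
    apply (cont_comp (primitive2 (cforce F))); [|apply cont_fold_abs].
    exact (cont_derive _ _ (fun s => proj1 (primitive2_C2 (cforce F) (cont_cforce F HC) s))).
  - intros t. pose proof (fold_abs_bounds rho t ltac:(lra)) as Ht.
    assert (A : Rabs (Phi k F (ICore t) - soliton p (fold_abs rho t)) <= del / 4).
    { eapply Rle_trans; [apply NC|]. eapply Rle_trans; [|exact Heps1].
      apply Rmult_le_compat_l; [lra|]. unfold core_gain. apply Rmult_le_compat_l; [lra|].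
      apply exp_le. nra. }
    apply Rabs_le_between in A.
    pose proof (soliton_decr p (fold_abs rho t) rho Hp ltac:(lra)) as S1.
    rewrite (s_sol X) in S1. specialize (SP (fold_abs rho t)). lra.
  - intros v. specialize (NV v). lra.
  - intros e. simpl. destruct (bedge e) eqn:Be; [|apply cont_const].
    apply cont_edge_clamp; [|apply cont_force, HC]. specialize (Hb e Be). lra.
  - intros e t. destruct (Nat.eq_dec e e0) as [-> |N].
    + specialize (NE0 t). pose proof (clamp_bounds t).
      assert (exp (- (1/2 * ell k e0 * clamp t)) <= 1) by (apply exp_neg_le_1; nra). nra.
    + specialize (NE e t N). lra.
Qed.

(** * Closedness of the trapped set and existence of the fixed point *)

Lemma limit_le (Fn : nat -> R) (x c w : R) : 0 <= w -> (forall n, Fn n <= c) ->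
  (forall eps, 0 < eps -> exists N, forall n, (N <= n)%nat -> Rabs (Fn n - x) <= eps * w) -> x <= c.
Proof.
  intros Hw H Hl. apply Rle_plus_epsilon. intros eps He.
  destruct (Hl (eps / (w + 1)) ltac:(apply Rdiv_lt_0_compat; lra)) as [N HN].
  specialize (HN N (le_n _)). specialize (H N). apply Rabs_le_between in HN.
  assert (eps / (w + 1) * w <= eps); [|lra].
  apply Rmult_le_reg_r with (w + 1); [lra|].
  replace (eps / (w + 1) * w * (w + 1)) with (eps * w) by (field; lra). nra.
Qed.

Lemma limit_ge (Fn : nat -> R) (x c w : R) : 0 <= w -> (forall n, c <= Fn n) ->
  (forall eps, 0 < eps -> exists N, forall n, (N <= n)%nat -> Rabs (Fn n - x) <= eps * w) -> c <= x.
Proof.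
  intros Hw H Hl. assert (- x <= - c); [|lra].
  apply (limit_le (fun n => - Fn n) (- x) (- c) w Hw).
  - intros n. specialize (H n). lra.
  - intros eps He. destruct (Hl eps He) as [N HN]. exists N. intros n Hn.
    replace (- Fn n - - x) with (- (Fn n - x)) by ring. rewrite Rabs_Ropp. apply HN, Hn.
Qed.

Lemma cont_uniform_limit (Fn : nat -> R -> R) (f : R -> R) (w : R) : 0 <= w -> (forall n, cont (Fn n)) ->
  (forall eps, 0 < eps -> exists N, forall n, (N <= n)%nat -> forall t, Rabs (Fn n t - f t) <= eps * w) ->
  cont f.
Proof.
  intros Hw HC H x. apply eps_continuous. intros eps He.
  destruct (H (eps / (4 * (w + 1))) ltac:(apply Rdiv_lt_0_compat; lra)) as [N HN].
  specialize (HN N (le_n _)).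
  assert (B : eps / (4 * (w + 1)) * w <= eps / 4).
  { apply Rmult_le_reg_r with (4 * (w + 1)); [lra|].
    replace (eps / (4 * (w + 1)) * w * (4 * (w + 1))) with (eps * w) by (field; lra). nra. }
  generalize (continuous_eps (Fn N) x (eps / 4) ltac:(lra) (HC N x)). apply filter_imp. intros y Hy.
  replace (f y - f x) with (- (Fn N y - f y) + ((Fn N y - Fn N x) + (Fn N x - f x))) by ring.
  eapply Rle_lt_trans; [apply Rabs_triang|]. rewrite Rabs_Ropp.
  eapply Rle_lt_trans; [apply Rplus_le_compat_l, Rabs_triang|].
  pose proof (HN y). pose proof (HN x). lra.
Qed.

(** The inequalities pass to pointwise limits, and continuity survives because the weights are
    bounded. *)
Lemma trapped_closed (k : R) (Fn : nat -> idx -> R) (F : idx -> R) : big k -> (forall n, trapped k (Fn n)) ->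
  (forall eps, 0 < eps -> exists N, forall n, (N <= n)%nat ->
     forall i, Rabs (Fn n i - F i) <= eps * weight k i) -> trapped k F.
Proof.
  intros Hk HP H.
  assert (W : forall i, 0 <= weight k i) by (intros i; left; apply weight_pos, Hk).
  assert (Hi : forall i eps, 0 < eps -> exists N, forall n, (N <= n)%nat ->
     Rabs (Fn n i - F i) <= eps * weight k i).
  { intros i eps He. destruct (H eps He) as [N HN]. exists N. intros n Hn. apply HN, Hn. }
  assert (up : forall i c, (forall n, Fn n i <= c) -> F i <= c).
  { intros i c Hc. exact (limit_le (fun n => Fn n i) (F i) c (weight k i) (W i) Hc (Hi i)). }
  assert (low : forall i c, (forall n, c <= Fn n i) -> c <= F i).
  { intros i c Hc. exact (limit_ge (fun n => Fn n i) (F i) c (weight k i) (W i) Hc (Hi i)). }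
  assert (HQ : 0 <= 2 * Q) by (destruct peak_facts as (_ & _ & _ & HQ & _); lra).
  assert (cc : forall j : R -> idx, (forall n, cont (fun t => Fn n (j t))) -> cont (fun t => F (j t))).
  { intros j Hj. apply (cont_uniform_limit (fun n t => Fn n (j t)) _ (2 * Q) HQ Hj).
    intros eps He. destruct (H eps He) as [N HN]. exists N. intros n Hn t.
    eapply Rle_trans; [apply HN, Hn|]. apply Rmult_le_compat_l; [lra|]. apply weight_upper, Hk. }
  repeat split.
  - apply Rabs_le_between. split.
    + assert (peak p - eps0 <= F IPeak); [|lra]. apply low. intros n.
      destruct (HP n) as ((A & _) & _). apply Rabs_le_between in A. lra.
    + assert (F IPeak <= peak p + eps0); [|lra]. apply up. intros n.
      destruct (HP n) as ((A & _) & _). apply Rabs_le_between in A. lra.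
  - apply cc. intros n. apply (HP n).
  - apply low. intros n. apply (HP n).
  - apply up. intros n. apply (HP n).
  - apply low. intros n. apply (HP n).
  - apply up. intros n. apply (HP n).
  - intros e. apply (cc (IEdge e)). intros n. apply (HP n).
  - apply low. intros n. apply (HP n).
  - apply up. intros n. apply (HP n).
  - intros t. set (c := eps0 * (2 * exp (K * fold_abs rho t))). apply Rabs_le_between. split.
    + assert (soliton p (fold_abs rho t) - c <= F (ICore t)); [|lra]. apply low. intros n.
      destruct (HP n) as (_ & A & _). specialize (A t). apply Rabs_le_between in A. fold c in A. lra.
    + assert (F (ICore t) <= soliton p (fold_abs rho t) + c); [|lra]. apply up. intros n.
      destruct (HP n) as (_ & A & _). specialize (A t). apply Rabs_le_between in A. fold c in A. lra.
  - intros v. apply up. intros n. apply (HP n).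
  - intros t. apply up. intros n. apply (HP n).
  - intros e t N. apply up. intros n. apply (HP n). exact N.
Qed.

Lemma admissible_dist (F H : idx -> R) (i : idx) : admissible F -> admissible H -> Rabs (F i - H i) <= 2 * peak p.
Proof.
  intros (Fp & _ & Fc & Fv & _ & Fe) (Gp & _ & Gc & Gv & _ & Ge).
  pose proof (s_del X). pose proof (s_eps X). pose proof (peak_gt_1 p (s_p X)).
  apply Rabs_le_between in Fp. apply Rabs_le_between in Gp. apply Rabs_le_between.
  destruct i as [|t|v|e t].
  - lra.
  - specialize (Fc t). specialize (Gc t). lra.
  - specialize (Fv v). specialize (Gv v). lra.
  - specialize (Fe e t). specialize (Ge e t). lra.
Qed.

(** The finite a priori distance that starts both the iteration and the comparison of fixed points;
    that it blows up with [k] does no harm. *)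
Lemma admissible_weight_dist (k : R) (F H : idx -> R) (i : idx) : big k -> admissible F -> admissible H ->
  Rabs (F i - H i) <= 4 * peak p / decay k * weight k i.
Proof.
  intros Hk HF HH. eapply Rle_trans; [apply admissible_dist; assumption|].
  pose proof (weight_lower k i Hk) as W. pose proof Hk as (_ & H0 & _).
  destruct (decay_bounds k H0). pose proof (peak_gt_1 p (s_p X)).
  assert (0 < 4 * peak p / decay k) by (apply Rdiv_lt_0_compat; lra).
  apply Rle_trans with (4 * peak p / decay k * (1/2 * decay k)).
  - right. field. lra.
  - apply Rmult_le_compat_l; lra.
Qed.

Lemma fixed_point_exists (k : R) : big k -> exists F, trapped k F /\ forall i, Phi k F i = F i.
Proof.
  intros Hk. pose proof Hk as (_ & Hl0 & _). destruct (decay_bounds k Hl0) as [E0 E1].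
  pose proof (s_p X) as Hp. pose proof (s_del X) as Hd. pose proof (s_rho X) as Hr.
  pose proof (s_eps X) as He. pose proof (peak_gt_1 p Hp) as P1.
  set (F0 := fun i => match i with IPeak => peak p | ICore t => soliton p (fold_abs rho t) | _ => 0 end).
  assert (P0 : trapped k F0).
  { assert (HdE : 0 < del * decay k) by (apply Rmult_lt_0_compat; lra).
    split; [split; [|split; [|split; [|split; [|split]]]]|split; [|split; [|split]]]; simpl.
    - rewrite Rminus_diag, Rabs_R0. lra.
    - apply (cont_comp (soliton p)); [|apply cont_fold_abs].
      exact (cont_derive _ _ (fun s => proj1 (soliton_C2 p Hp s))).
    - intros t. pose proof (fold_abs_bounds rho t ltac:(lra)).
      pose proof (soliton_decr p 0 (fold_abs rho t) Hp ltac:(lra)) as S2.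
      rewrite soliton_0 in S2. pose proof (soliton_pos p (fold_abs rho t)). lra.
    - intros v. lra.
    - intros e. apply cont_const.
    - intros e t. lra.
    - intros t. rewrite Rminus_diag, Rabs_R0. pose proof (exp_pos (K * fold_abs rho t)).
      apply Rmult_le_pos; lra.
    - intros v. lra.
    - intros t. pose proof (exp_pos (- (1/2 * ell k e0 * clamp t))). apply Rmult_le_pos; lra.
    - intros e t _. lra. }
  apply (weighted_banach idx (weight k) admissible (trapped k) (Phi k)) with (F0 := F0) (D := 4 * peak p / decay k).
  - intros i. left. apply weight_pos, Hk.
  - apply Phi_contraction, Hk.
  - intros F HF. apply HF.
  - intros F HF. apply Phi_invariant; assumption.
  - exact P0.
  - intros i. apply admissible_weight_dist; [exact Hk|apply Phi_invariant; assumption|apply P0].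
  - intros Fn F HF HL. apply (trapped_closed k Fn F Hk HF HL).
Qed.

(** ** Continuous dependence on the parameter *)

Lemma cont_ell (e : nat) : cont (fun k => ell k e).
Proof.
  intros k. unfold ell. destruct (Nat.eqb e e0).
  - apply (cont_minus (fun k => k * sL X) (fun _ => rho)); [|apply cont_const].
    apply (cont_mult (fun k => k) (fun _ => sL X)); [apply cont_id|apply cont_const].
  - apply (cont_mult (fun k => k) (fun _ => elen e)); [apply cont_id|apply cont_const].
Qed.

(** Each flow is, up to sign, the end slope divided by [l] of an edge solution with value zero at
    that end, so continuity in [l] is inherited from [edge_sol1]. *)
Lemma continuous_flow (m x M : R) (g : R -> R) : 0 < m -> cont g ->
  (forall s, 0 <= s <= 1 -> Rabs (g s) <= M) ->
  continuous (fun l => x / sinh l + green_flow1 l g) m /\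
  continuous (fun l => x / sinh l + green_flow0 l g) m.
Proof.
  intros Hm Hg HM.
  assert (L : locally m (fun l => 0 < l)) by (exists (mkposreal m Hm); intros y Hy;
    change (Rabs (y - m) < m) in Hy; apply Rabs_def2 in Hy; lra).
  split.
  - apply continuous_ext_loc with (fun l => - 1 * edge_sol1 l x 0 g 1 / l).
    + revert L. apply filter_imp. intros l Hl. rewrite edge_sol1_at_1 by assumption.
      real_eq. field. split; [pose proof (sinh_gt_0 l Hl); lra|lra].
    + apply continuous_div_R; [|apply continuous_id|lra].
      apply continuous_mult_R; [apply continuous_const_R|].
      apply (edge_sol1_length_continuous m x 0 M g Hm Hg HM).
  - apply continuous_ext_loc with (fun l => edge_sol1 l 0 x g 0 / l).
    + revert L. apply filter_imp. intros l Hl. rewrite edge_sol1_at_0 by assumption.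
      real_eq. field. split; [pose proof (sinh_gt_0 l Hl); lra|lra].
    + apply continuous_div_R; [|apply continuous_id|lra].
      apply (edge_sol1_length_continuous m 0 x M g Hm Hg HM).
Qed.

Lemma continuous_coth (m : R) : 0 < m -> continuous coth m.
Proof.
  intros Hm. apply continuous_div_R; [apply cont_cosh|apply cont_sinh|].
  pose proof (sinh_gt_0 m Hm). lra.
Qed.

Lemma force_le_1 (F : idx -> R) (e : nat) (s : R) : admissible F -> Rabs (force F e s) <= 1.
Proof.
  intros (_ & _ & _ & _ & _ & Ce). unfold force. eapply Rle_trans; [apply force_le, Ce|].
  specialize (Ce e s). pose proof (s_del X). lra.
Qed.

Lemma continuous_flow_k (k : R) (F : idx -> R) (e : nat) : big k -> admissible F -> (e < nE G)%nat ->
  continuous (fun k => flow0 k (qval F) (xval F) (hval F) (force F) e) k /\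
  continuous (fun k => coef0 k e) k /\
  (is_bounded G e = true ->
   continuous (fun k => flow1 k (qval F) (xval F) (force F) e) k /\
   continuous (fun k => coth (ell k e)) k).
Proof.
  intros Hk HF He.
  assert (A : is_bounded G e = true ->
   continuous (fun k => flow1 k (qval F) (xval F) (force F) e) k /\
   continuous (fun k => coth (ell k e)) k).
  { intros B. assert (Hl := big_ell k e Hk He B). split.
    - apply (continuous_comp (fun k => ell k e)
        (fun l => end0 (qval F) (xval F) e / sinh l + green_flow1 l (force F e))); [apply cont_ell|].
      exact (proj1 (continuous_flow (ell k e) (end0 (qval F) (xval F) e) 1 (force F e) Hl (cont_force F e HF)
        (fun s _ => force_le_1 F e s HF))).
    - apply (continuous_comp (fun k => ell k e) coth); [apply cont_ell|]. apply continuous_coth, Hl. }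
  split; [|split; [|exact A]].
  - unfold flow0. destruct (Nat.eqb e e0) eqn:N.
    + apply A. apply Nat.eqb_eq in N. subst e. apply s_bd.
    + destruct (is_bounded G e) eqn:B; [|apply continuous_const_R].
      assert (Hl := big_ell k e Hk He B).
      apply (continuous_comp (fun k => ell k e)
        (fun l => end1 (xval F) e / sinh l + green_flow0 l (force F e))); [apply cont_ell|].
      exact (proj2 (continuous_flow (ell k e) (end1 (xval F) e) 1 (force F e) Hl (cont_force F e HF)
        (fun s _ => force_le_1 F e s HF))).
  - unfold coef0. destruct (is_bounded G e); [apply A; reflexivity|apply continuous_const_R].
Qed.

Lemma continuous_at_vertex (k : R) (f0 f1 : R -> nat -> R) (v : nat) :
  (forall e, (e < nE G)%nat -> continuous (fun k => f0 k e) k) ->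
  (forall e, (e < nE G)%nat -> is_bounded G e = true -> continuous (fun k => f1 k e) k) ->
  continuous (fun k => at_vertex (f0 k) (f1 k) v) k.
Proof.
  intros H0 H1. unfold at_vertex.
  apply (gsum_continuous (nE G) (fun e k => (if Nat.eqb (src G e) v then f0 k e else 0) +
     (if is_bounded G e && Nat.eqb (tgt G e) v then f1 k e else 0))).
  intros e He. apply continuous_plus_R.
  - destruct (Nat.eqb _ _); [apply H0, He|apply continuous_const_R].
  - destruct (is_bounded G e) eqn:B; simpl; [|apply continuous_const_R].
    destruct (Nat.eqb _ _); [apply H1; assumption|apply continuous_const_R].
Qed.

(** Uniform over an infinite index set: the core component does not involve [k], vertices and edges
    are finite in number, and on each edge the estimate is uniform in [t]. *)
Lemma Phi_continuous (k : R) (F : idx -> R) (eps : R) : big k -> admissible F -> 0 < eps ->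
  locally k (fun m => forall i, Rabs (Phi m F i - Phi k F i) < eps).
Proof.
  intros Hk HF He.
  pose proof Hk as (_ & Hl0 & Hb & _). destruct peak_facts as (_ & _ & _ & _ & P5 & _).
  assert (Z : forall x, Rabs (x - x) < eps) by (intros x; rewrite Rminus_diag, Rabs_R0; exact He).
  assert (LP : locally k (fun m => Rabs (Phi m F IPeak - Phi k F IPeak) < eps)).
  { apply (continuous_eps (fun m => Phi m F IPeak)); [exact He|]. simpl.
    destruct (continuous_flow_k k F e0 Hk HF (s_lt X)) as (_ & _ & C). destruct (C (s_bd X)) as [C1 C2'].
    apply continuous_minus_R; [apply continuous_const_R|].
    apply continuous_div_R; [|apply continuous_const_R|lra].
    apply continuous_minus_R; [apply continuous_const_R|].
    unfold tail_energy. apply continuous_plus_R; [|apply continuous_const_R].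
    apply continuous_minus_R; [|apply continuous_const_R].
    apply continuous_div_R; [|apply continuous_const_R|lra].
    apply (continuous_comp (fun m => flow1 m (qval F) (xval F) (force F) e0
       - coth (ell m e0) * F (IVert v0)) (fun z => z ^ 2)).
    - apply continuous_minus_R; [exact C1|]. apply continuous_mult_R; [exact C2'|apply continuous_const_R].
    - apply (cont_pow (fun z => z) 2 cont_id). }
  assert (LV : locally k (fun m => forall v, (v < nV G)%nat ->
     Rabs (Phi m F (IVert v) - Phi k F (IVert v)) < eps)).
  { apply locally_forall_lt. intros v Hv.
    apply (continuous_eps (fun m => Phi m F (IVert v))); [exact He|]. simpl.
    rewrite (proj2 (Nat.ltb_lt _ _) Hv).
    apply continuous_div_R.
    - apply continuous_at_vertex; intros e He'; destruct (continuous_flow_k k F e Hk HF He') as (c1 & _ & c2).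
      + exact c1.
      + intros B. exact (proj1 (c2 B)).
    - apply continuous_Rmax_const.
      apply continuous_at_vertex; intros e He'; destruct (continuous_flow_k k F e Hk HF He') as (_ & c1 & c2).
      + exact c1.
      + intros B. exact (proj2 (c2 B)).
    - pose proof (Rmax_l 1 (coefs k v)). lra. }
  assert (LE : locally k (fun m => forall e, (e < nE G)%nat -> forall t,
     Rabs (Phi m F (IEdge e t) - Phi k F (IEdge e t)) < eps)).
  { apply locally_forall_lt. intros e He'. simpl.
    destruct (bedge e) eqn:Be; [|apply filter_forall; intros m t; apply Z].
    specialize (Hb e Be).
    assert (A := edge_sol_length_continuous (ell k e) (end0 (qval F) (xval F) e) (end1 (xval F) e) 1 eps
      (force F e) ltac:(lra) He (cont_force F e HF) (fun s _ => force_le_1 F e s HF)).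
    assert (A' := cont_ell e k _ A). unfold filtermap in A'.
    revert A'. apply filter_imp. intros m Hm t. apply Hm, clamp_bounds. }
  generalize (filter_and _ _ LP (filter_and _ _ LV LE)). apply filter_imp.
  intros m (A & B & C) [|t|v|e t].
  - exact A.
  - apply Z.
  - destruct (Nat.ltb v (nV G)) eqn:Hv.
    + apply B. apply Nat.ltb_lt, Hv.
    + simpl. rewrite Hv. apply Z.
  - destruct (Nat.ltb e (nE G)) eqn:He'.
    + apply C. apply Nat.ltb_lt, He'.
    + simpl. unfold bedge. rewrite He'. apply Z.
Qed.

(** The fixed point at [k] is an approximate fixed point at a nearby [m], so [contraction_stability]
    at [m] compares it with every admissible fixed point [H]. Near [k] the weights stay above a
    positive constant, [decay m] being more than half of [decay k]. Taking [m = k] shows that fixed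
    points are unique. *)
Lemma fixed_point_continuous (k : R) (F : idx -> R) (eps : R) : big k -> admissible F ->
  (forall i, Phi k F i = F i) -> 0 < eps ->
  locally k (fun m => big m -> forall H, admissible H -> (forall i, Phi m H i = H i) ->
    forall i, Rabs (H i - F i) <= eps).
Proof.
  intros Hk HF fixF He.
  destruct peak_facts as (_ & _ & _ & HQ & _).
  pose proof Hk as (_ & Hl0 & _). destruct (decay_bounds k Hl0) as [E0 _].
  set (E := decay k / 2).
  assert (LE : locally k (fun m => E < decay m)).
  { assert (C : continuous decay k).
    { unfold decay. apply (continuous_comp (fun m => ell m e0) (fun l => exp (- (1/2 * l)))); [apply cont_ell|].
      apply cont_exp_lin. }
    generalize (continuous_eps decay k (decay k / 2) ltac:(lra) C). apply filter_imp.
    intros m Hm. apply Rabs_def2 in Hm. unfold E. lra. }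
  assert (HE : 0 < E) by (unfold E; lra).
  (* Chosen so that the final bound is [eps]: a factor 4 comes from the stability, [2 / E] from the
     lower bound of the weights, [2 * Q] from their upper bound. *)
  assert (Hd : 0 < eps * E / (16 * Q)).
  { apply Rdiv_lt_0_compat; [apply Rmult_lt_0_compat; lra|lra]. }
  generalize (filter_and _ _ LE (Phi_continuous k F (eps * E / (16 * Q)) Hk HF Hd)).
  apply filter_imp. intros m [Hm1 Hm2] Hm H HH fixH i.
  set (c := eps * E / (16 * Q)) in *.
  assert (S : Rabs (H i - F i) <= 4 * (2 * c / E) * weight m i).
  { apply (contraction_stability idx (weight m) admissible (Phi m)) with (D := 4 * peak p / decay m).
    - intros j. left. apply weight_pos, Hm.
    - apply Phi_contraction, Hm.
    - exact HH.
    - exact HF.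
    - exact fixH.
    - left. apply Rdiv_lt_0_compat; lra.
    - intros j. pose proof (weight_lower m j Hm) as W. specialize (Hm2 j). rewrite fixF in Hm2.
      apply Rle_trans with c; [lra|].
      apply Rle_trans with (2 * c / E * (1/2 * E)); [right; field; lra|].
      apply Rmult_le_compat_l; [left; apply Rdiv_lt_0_compat; lra|]. lra.
    - intros j. apply admissible_weight_dist; assumption. }
  eapply Rle_trans; [exact S|].
  apply Rle_trans with (4 * (2 * c / E) * (2 * Q)).
  - apply Rmult_le_compat_l; [|apply weight_upper, Hm].
    assert (0 < 2 * c / E) by (apply Rdiv_lt_0_compat; lra). lra.
  - right. unfold c. field. lra.
Qed.

End FixedPoint.

(** * The rescaled solution attached to a fixed point *)

Lemma constant_on (f : R -> R) (a b : R) : a <= b ->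
  (forall x, a <= x <= b -> is_derive f x 0) -> f b = f a.
Proof.
  intros Hab H. destruct (MVT_gen f a b (fun _ => 0)) as [c [_ E]].
  - intros x Hx. rewrite Rmin_left, Rmax_right in Hx by lra. apply H. lra.
  - intros x Hx. rewrite Rmin_left, Rmax_right in Hx by lra.
    apply derivable_continuous_pt. exists 0. apply is_derive_Reals, H, Hx.
  - lra.
Qed.

(** [c] is the length of an edge run in the unit coordinate; [c = 1] covers the core, which is run
    in arc length. Strict positivity allows [pw p] to be differentiated along the solution. *)
Lemma energy_conserved (p c a b : R) (w w1 w2 : R -> R) : p <> 0 -> 0 < c -> a <= b -> C2 w w1 w2 ->
  (forall x, a <= x <= b -> 0 < w x /\ w2 x = c ^ 2 * (w x - pw (p - 1) (w x))) ->
  w1 b ^ 2 / c ^ 2 / 2 - w b ^ 2 / 2 + pw p (w b) / p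
  = w1 a ^ 2 / c ^ 2 / 2 - w a ^ 2 / 2 + pw p (w a) / p.
Proof.
  intros Hp Hc Hab H HE.
  apply (constant_on (fun x => w1 x ^ 2 / c ^ 2 / 2 - w x ^ 2 / 2 + pw p (w x) / p)); [exact Hab|].
  intros x Hx. destruct (H x) as (D0 & D1 & _). destruct (HE x Hx) as [Hw E2].
  assert (DP := is_derive_comp (pw p) w x _ _ (is_derive_pw p (w x) Hw) D0).
  set (g := fun x => pw p (w x)). fold g in DP.
  apply is_derive_ext with (fun x => w1 x ^ 2 / c ^ 2 / 2 - w x ^ 2 / 2 + g x / p); [reflexivity|].
  auto_derive.
  - split; [exists (w2 x); exact D1|]. split; [exists (w1 x); exact D0|].
    split; [eexists; exact DP|trivial].
  - replace (Derive (fun x => w1 x) x) with (w2 x) by (symmetry; apply is_derive_unique; exact D1).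
    replace (Derive (fun x => w x) x) with (w1 x) by (symmetry; apply is_derive_unique; exact D0).
    replace (Derive (fun x => g x) x) with (w1 x * (p * pw (p - 1) (w x)))
      by (symmetry; apply is_derive_unique; exact DP).
    rewrite E2. field. split; lra.
Qed.

Section Solution.
Variables (X : setup) (k : R) (F : idx -> R).
Local Notation p := (sp X).
Local Notation e0 := (sE X).
Local Notation v0 := (sV X).
Local Notation rho := (srho X).
Local Notation del := (sdel X).
Local Notation l0 := (ell X k (sE X)).
Hypothesis Hk : big X k.
Hypothesis HF : trapped X k F.
Hypothesis fixF : forall i, Phi X k F i = F i.

Lemma ell0_ge : 200 <= l0.
Proof. destruct Hk as (_ & H & _). exact H. Qed.

Lemma ell0_eq : rho + l0 = k * sL X.
Proof. unfold ell. rewrite Nat.eqb_refl. ring. Qed.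

Lemma admissible_F : admissible X F.
Proof. apply HF. Qed.

Lemma edge_value (e : nat) (t : R) : bedge X e = true -> 0 <= t <= 1 ->
  edge_sol (ell X k e) (end0 X (qval X F) (xval F) e) (end1 X (xval F) e) (force X F e) t
  = F (IEdge e t).
Proof.
  intros Be Ht. rewrite <- (fixF (IEdge e t)). simpl. rewrite Be, clamp_id by assumption. reflexivity.
Qed.

Lemma core_value (t : R) : 0 <= t <= rho ->
  F IPeak + primitive2 (cforce X F) t = F (ICore t).
Proof.
  intros Ht. rewrite <- (fixF (ICore t)). simpl. rewrite fold_abs_id_pos by assumption. reflexivity.
Qed.

Lemma peak_energy : energy0 X (F IPeak) = tail_energy X k F.
Proof.
  pose proof (fixF IPeak) as E. simpl in E.
  destruct (peak_facts X) as (_ & _ & _ & _ & P5 & _).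
  assert (E' : (energy0 X (F IPeak) - tail_energy X k F) / energy_slope p = 0) by lra.
  apply Rmult_integral in E'. destruct E' as [E'|E']; [lra|].
  exfalso. pose proof (Rinv_0_lt_compat _ P5). lra.
Qed.

Definition core_fun (t : R) : R := F IPeak + primitive2 (cforce X F) t.
Definition core_fun1 (t : R) : R := RInt (cforce X F) 0 t.

Lemma core_fun_C2 : C2 core_fun core_fun1 (cforce X F).
Proof.
  intros t. destruct (primitive2_C2 (cforce X F) (cont_cforce X F admissible_F) t) as (a & b & c).
  split; [|split; assumption].
  replace (core_fun1 t) with (0 + RInt (cforce X F) 0 t) by (unfold core_fun1; ring).
  apply (is_derive_plus (fun _ => F IPeak) (primitive2 (cforce X F)) t 0 _); [|exact a].
  apply (is_derive_const (F IPeak) t).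
Qed.

Definition tail_sol (t : R) : R := edge_sol l0 (qval X F) (xval F v0) (force X F e0) t.
Definition tail_sol1 (t : R) : R := edge_sol1 l0 (qval X F) (xval F v0) (force X F e0) t.

Lemma tail_sol_C2 : C2 tail_sol tail_sol1 (fun t => l0 ^ 2 * (tail_sol t - force X F e0 t)).
Proof. apply edge_sol_C2; [pose proof ell0_ge; lra|apply cont_force, admissible_F]. Qed.

Lemma tail_value (t : R) : 0 <= t <= 1 -> tail_sol t = F (IEdge e0 t).
Proof.
  intros Ht. rewrite <- (edge_value e0 t (bedge_e0 X) Ht). unfold tail_sol, end0, end1.
  rewrite Nat.eqb_refl. reflexivity.
Qed.

Lemma core_pos (t : R) : 0 < F (ICore t).
Proof. destruct (trapped_core_range X k F t HF) as [A _]. pose proof (s_del X). lra. Qed.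

Lemma vert_bounds (v : nat) : 0 <= F (IVert v) <= del / 4 * decay X k.
Proof. destruct HF as ((_ & _ & _ & Cv & _) & _ & Fv & _). split; [apply Cv|apply Fv]. Qed.

Lemma tail_pos (t : R) : 0 <= t < 1 -> 0 < F (IEdge e0 t).
Proof.
  intros Ht. pose proof ell0_ge. rewrite <- (edge_value e0 t (bedge_e0 X)) by lra.
  destruct (admissible_edge_ge_0 X k F e0 t Hk admissible_F (bedge_e0 X) ltac:(lra)) as (A & _ & B).
  eapply Rlt_le_trans; [|exact A].
  assert (0 < end0 X (qval X F) (xval F) e0 * hat0 l0 t).
  { unfold end0, qval. rewrite Nat.eqb_refl. apply Rmult_lt_0_compat; [apply core_pos|].
    apply hat0_gt_0; lra. }
  assert (0 <= end1 X (xval F) e0 * hat1 l0 t).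
  { apply Rmult_le_pos; [exact B|]. apply hat1_ge_0; lra. }
  lra.
Qed.

(** Zero energy gives the soliton a slope of at most [- del / 4] at the cut. Integrating the
    Lipschitz bound of the force along the core changes it by at most [del / 8]. *)
Lemma core_slope_neg : core_fun1 rho < 0.
Proof.
  pose proof (s_rho X) as Hr. pose proof (s_p X) as Hp. pose proof (s_del X) as Hd.
  destruct (peak_facts X) as (P1 & P2 & P3 & P4 & P5 & P6).
  pose proof (soliton_C2 p Hp) as S2.
  set (g := fun t => soliton p t - pw (p - 1) (soliton p t)) in *.
  assert (Cg : cont g) by (intros r; apply S2).
  assert (E1 : soliton1 p rho = RInt g 0 rho).
  { rewrite (RInt_primitive (soliton1 p) g 0 rho); [rewrite soliton1_0; ring|lra|exact Cg|].
    intros x _. apply S2. }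
  pose proof HF as (_ & Fs & _). pose proof admissible_F as (_ & _ & Cc & _).
  set (K := core_rate p) in *. set (c := core_lip p * (seps X * 2)).
  assert (CE : cont (fun s => exp (K * s))).
  { apply cont_derive with (fun s => K * exp (K * s)). intros x. auto_derive; [trivial|ring]. }
  assert (D : Rabs (core_fun1 rho - soliton1 p rho) <= del / 8).
  { rewrite E1. unfold core_fun1. rewrite <- RInt_minus_cont by (try apply cont_cforce, admissible_F; assumption).
    eapply Rle_trans; [apply RInt_abs_le_cont with (g := fun s => c * exp (K * s))|].
    - lra.
    - apply cont_minus; [apply cont_cforce, admissible_F|exact Cg].
    - apply cont_mult; [apply cont_const|exact CE].
    - intros s Hs. unfold cforce, g.
      eapply Rle_trans; [apply core_force_lipschitz; [apply Cc|]|].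
      + pose proof (soliton_decr p 0 s Hp ltac:(lra)) as S. rewrite soliton_0 in S. lra.
      + specialize (Fs s). rewrite fold_abs_id_pos in Fs by lra. unfold c.
        rewrite Rmult_assoc. apply Rmult_le_compat_l; [lra|]. fold K in Fs. lra.
    - rewrite RInt_scal_cont by assumption.
      rewrite (RInt_primitive (fun s => exp (K * s) / K)); [| lra | assumption |].
      + rewrite Rmult_0_r, exp_0. pose proof (s_eps1 X) as E. unfold core_gain in E. fold K in E.
        pose proof (s_eps X).
        assert (EK : c * (exp (K * rho) / K - 1 / K) = seps X * exp (K * rho) - seps X).
        { unfold c, K, core_rate. field. lra. }
        rewrite EK. lra.
      + intros s _. auto_derive; [trivial|field; lra]. }
  assert (EN := sol_energy p (peak p) 0 rho Hp ltac:(lra) ltac:(lra) (peak_slope p Hp)).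
  fold (soliton p rho) in EN. fold (soliton1 p rho) in EN. rewrite (s_sol X) in EN.
  rewrite pw_p0 in EN by lra.
  assert (PW : 0 <= pw (p - 2) (del / 2) <= 1/640).
  { split; [apply pw_ge_0|]. apply Rle_trans with (pw (p - 2) (2 * del)); [apply pw_incr; lra|].
    apply kap_facts. }
  assert (0 < 2 / p <= 1).
  { split; [apply Rdiv_lt_0_compat; lra|]. apply Rmult_le_reg_r with p; [lra|].
    unfold Rdiv. rewrite Rmult_assoc, Rinv_l; lra. }
  assert (0 <= 2 / p * pw (p - 2) (del / 2) <= 1/640) by nra.
  assert (EN' : soliton1 p rho ^ 2 = (del / 2) ^ 2 * (1 - 2 / p * pw (p - 2) (del / 2))) by (rewrite EN; ring).
  assert (EN2 : (del / 4) ^ 2 <= soliton1 p rho ^ 2) by (rewrite EN'; nra).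
  pose proof (soliton1_le_0 p rho Hp ltac:(lra)).
  assert (soliton1 p rho <= - (del / 4)) by nra.
  apply Rabs_le_between in D. lra.
Qed.

Lemma tail_slope0 : tail_sol1 0 / l0
  = xval F v0 / sinh l0 + green_flow0 l0 (force X F e0) - coth l0 * qval X F.
Proof.
  pose proof ell0_ge. unfold tail_sol1. rewrite edge_sol1_at_0 by lra. unfold coth. field.
  pose proof (sinh_gt_0 l0). lra.
Qed.

(** The term [coth l0 * q], at least [del / 4], dominates what the vertex and the force contribute,
    together at most [3/64 * del]. The lower bound is used in the estimate of the energy. *)
Lemma tail_slope_bounds : -3 * del <= tail_sol1 0 / l0 < 0.
Proof.
  rewrite tail_slope0. pose proof ell0_ge as Hl. pose proof (s_del X) as Hd.
  destruct (long_edge l0 Hl) as (_ & L2 & L3). fold (coth l0) in L3.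
  pose proof (vert_bounds v0) as B. destruct (decay_bounds X k Hl) as [E0 E1].
  destruct (trapped_core_range X k F rho HF) as [Q1 Q2]. fold (qval X F) in Q1.
  pose proof admissible_F as (_ & _ & _ & _ & _ & Ce).
  destruct (green_le_const l0 0 (1/64 * (2 * del)) (force X F e0)) as (_ & J & _).
  - lra.
  - lra.
  - apply cont_force, admissible_F.
  - intros s _. unfold force. eapply Rle_trans; [apply force_le, Ce|]. specialize (Ce e0 s). lra.
  - apply Rabs_le_between in J.
    assert (Hi : 0 < / sinh l0) by (apply Rinv_0_lt_compat, sinh_gt_0; lra).
    unfold xval. assert (0 <= F (IVert v0) / sinh l0 <= del / 4 * (1/16)).
    { split; [apply Rmult_le_pos; lra|]. apply Rmult_le_compat; try lra. nra. }
    nra.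
Qed.

Lemma core_end : core_fun rho = qval X F.
Proof. apply core_value. pose proof (s_rho X). lra. Qed.

(** At the peak the slope vanishes, so the conserved energy is [energy0] of the height, which the
    fixed point equation identifies with the tail energy. *)
Lemma core_energy (t : R) : 0 <= t <= rho ->
  core_fun1 t ^ 2 / 2 - core_fun t ^ 2 / 2 + pw p (core_fun t) / p = tail_energy X k F.
Proof.
  intros Ht. pose proof (s_p X) as Hp.
  assert (E := energy_conserved p 1 0 t core_fun core_fun1 (cforce X F) ltac:(lra) ltac:(lra)
    ltac:(lra) core_fun_C2).
  assert (H : forall x, 0 <= x <= t -> 0 < core_fun x /\
     cforce X F x = 1 ^ 2 * (core_fun x - pw (p - 1) (core_fun x))).
  { intros x Hx. unfold core_fun. rewrite core_value by lra. split; [apply core_pos|].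
    unfold cforce. ring. }
  specialize (E H). rewrite pow1, !Rdiv_1_r in E. rewrite E, <- peak_energy. unfold energy0.
  replace (core_fun 0) with (F IPeak)
    by (unfold core_fun, primitive2; rewrite !RInt_point; unfold zero; simpl; ring).
  replace (core_fun1 0) with 0 by (unfold core_fun1; rewrite RInt_point; reflexivity).
  unfold Rdiv. ring.
Qed.

(** Conservation along the tail: at the vertex the slope is, up to sign, the flow minus [coth] times
    the value, which is how [tail_energy] is written. *)
Lemma tail_energy_start :
  (tail_sol1 0 / l0) ^ 2 / 2 - qval X F ^ 2 / 2 + pw p (qval X F) / p = tail_energy X k F.
Proof.
  pose proof (s_p X) as Hp. pose proof ell0_ge as Hl.
  assert (V0 : tail_sol 0 = qval X F) by (apply edge_sol_at_0; lra).
  assert (V1 : tail_sol 1 = F (IVert v0)) by (apply edge_sol_at_1; lra).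
  (* The value at the vertex is not known to be positive yet, hence the limit [b -> 1]. *)
  assert (E : forall b, 0 <= b < 1 ->
     tail_sol1 b ^ 2 / l0 ^ 2 / 2 - tail_sol b ^ 2 / 2 + pw p (tail_sol b) / p
      = tail_sol1 0 ^ 2 / l0 ^ 2 / 2 - tail_sol 0 ^ 2 / 2 + pw p (tail_sol 0) / p).
  { intros b Hb. apply (energy_conserved p l0 0 b tail_sol tail_sol1
      (fun t => l0 ^ 2 * (tail_sol t - force X F e0 t))); try lra.
    - apply tail_sol_C2.
    - intros x Hx. rewrite tail_value by lra. split; [apply tail_pos; lra|]. reflexivity. }
  set (en := fun b => tail_sol1 b ^ 2 / l0 ^ 2 / 2 - tail_sol b ^ 2 / 2 + pw p (tail_sol b) / p) in *.
  assert (Cen : cont en).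
  { pose proof (cont_derive _ _ (fun s => proj1 (tail_sol_C2 s))) as C0.
    pose proof (cont_derive _ _ (fun s => proj1 (proj2 (tail_sol_C2 s)))) as C1.
    unfold en. apply cont_plus.
    - apply cont_minus.
      + apply (cont_mult (fun b => tail_sol1 b ^ 2 / l0 ^ 2) (fun _ => / 2)); [|apply cont_const].
        apply (cont_mult (fun b => tail_sol1 b ^ 2) (fun _ => / l0 ^ 2)); [|apply cont_const].
        apply (cont_pow tail_sol1 2 C1).
      + apply (cont_mult (fun b => tail_sol b ^ 2) (fun _ => / 2)); [|apply cont_const].
        apply (cont_pow tail_sol 2 C0).
    - apply (cont_mult (fun b => pw p (tail_sol b)) (fun _ => / p)); [|apply cont_const].
      apply cont_pw; [lra|exact C0]. }
  assert (E1 : en 1 = en 0).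
  { apply Rminus_diag_uniq, Rabs_eq_0. apply Rle_antisym; [|apply Rabs_pos].
    apply Rle_plus_epsilon. intros eps He.
    destruct (continuous_eps en 1 eps He (Cen 1)) as [d Hd].
    set (b := 1 - Rmin (d / 2) 1).
    assert (0 < Rmin (d / 2) 1) by (apply Rmin_pos; [pose proof (cond_pos d); lra|lra]).
    assert (Rmin (d / 2) 1 <= 1) by apply Rmin_r.
    assert (Rmin (d / 2) 1 <= d / 2) by apply Rmin_l.
    assert (Hb : Rabs (en b - en 1) < eps).
    { apply Hd. change (Rabs (b - 1) < d). unfold b. pose proof (cond_pos d).
      apply Rabs_def1; lra. }
    assert (Eb : en b = en 0) by (apply E; unfold b; lra).
    rewrite Eb, Rabs_minus_sym in Hb. lra. }
  unfold en in E1. rewrite V0, V1 in E1.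
  replace ((tail_sol1 0 / l0) ^ 2) with (tail_sol1 0 ^ 2 / l0 ^ 2) by (field; lra).
  rewrite <- E1. unfold tail_energy, tail_sol1. rewrite edge_sol1_at_1 by lra.
  unfold flow1, end0, coth. rewrite Nat.eqb_refl. unfold xval. field.
  pose proof (sinh_gt_0 l0). lra.
Qed.

(* Both slopes are negative and belong to the same energy. *)
Lemma slopes_match : core_fun1 rho = tail_sol1 0 / l0.
Proof.
  pose proof (s_rho X) as Hr.
  assert (A := core_energy rho ltac:(lra)). rewrite core_end in A.
  assert (B := tail_energy_start). pose proof core_slope_neg. pose proof tail_slope_bounds.
  assert ((core_fun1 rho - tail_sol1 0 / l0) * (core_fun1 rho + tail_sol1 0 / l0) = 0) by lra.
  assert (core_fun1 rho + tail_sol1 0 / l0 < 0) by lra. nra.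
Qed.

(** A function of the rescaled distance [t] to the peak. The factors 1 and the affine arguments are
    left unreduced so that the three definitions match [C2_comp_lin]; the same holds for [arm] and
    [profile]. *)
Definition half_arm (t : R) : R :=
  if Rle_dec t rho then core_fun t else 1 * tail_sol (/ l0 * t + - (rho / l0)).
Definition half_arm1 (t : R) : R :=
  if Rle_dec t rho then core_fun1 t else 1 * / l0 * tail_sol1 (/ l0 * t + - (rho / l0)).
Definition half_arm2 (t : R) : R :=
  if Rle_dec t rho then cforce X F t else
    1 * (/ l0) ^ 2 * (l0 ^ 2 * (tail_sol (/ l0 * t + - (rho / l0)) - force X F e0 (/ l0 * t + - (rho / l0)))).

Lemma half_arm_C2 : C2 half_arm half_arm1 half_arm2.
Proof.
  pose proof ell0_ge as Hl.
  assert (Z : / l0 * rho + - (rho / l0) = 0) by (field; lra).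
  assert (V0 : tail_sol 0 = qval X F) by (apply edge_sol_at_0; lra).
  apply C2_glue.
  - apply core_fun_C2.
  - apply (C2_comp_lin _ _ _ 1 (/ l0) (- (rho / l0)) tail_sol_C2).
  - rewrite Z, core_end, V0. ring.
  - rewrite Z, slopes_match. field. lra.
  - rewrite Z. unfold force. rewrite <- tail_value, V0 by lra. unfold cforce, qval. field. lra.
Qed.

Definition arm (t : R) : R := if Rle_dec t 0 then 1 * half_arm (-1 * t + 0) else half_arm t.
Definition arm1 (t : R) : R := if Rle_dec t 0 then 1 * -1 * half_arm1 (-1 * t + 0) else half_arm1 t.
Definition arm2 (t : R) : R := if Rle_dec t 0 then 1 * (-1) ^ 2 * half_arm2 (-1 * t + 0) else half_arm2 t.

(** The even reflection is regular because the slope vanishes at the peak. *)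
Lemma arm_C2 : C2 arm arm1 arm2.
Proof.
  pose proof (s_rho X) as Hr.
  assert (Z : -1 * 0 + 0 = 0) by ring.
  apply C2_glue.
  - apply (C2_comp_lin _ _ _ 1 (-1) 0 half_arm_C2).
  - apply half_arm_C2.
  - rewrite Z. ring.
  - rewrite Z. unfold half_arm1. destruct (Rle_dec 0 rho); [|lra].
    unfold core_fun1. rewrite RInt_point. unfold zero; simpl. ring.
  - rewrite Z. ring.
Qed.

Lemma arm_even (t : R) : arm (- t) = arm t /\ arm1 (- t) = - arm1 t /\ arm2 (- t) = arm2 t.
Proof.
  assert (H0 : half_arm1 0 = 0).
  { unfold half_arm1. pose proof (s_rho X). destruct (Rle_dec 0 rho); [|lra].
    unfold core_fun1. rewrite RInt_point. reflexivity. }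
  unfold arm, arm1, arm2.
  destruct (Rle_dec (- t) 0), (Rle_dec t 0).
  - replace t with 0 by lra. replace (-1 * - 0 + 0) with 0 by ring.
    replace (-1 * 0 + 0) with 0 by ring. rewrite H0. repeat split; ring.
  - replace (-1 * - t + 0) with t by ring. repeat split; ring.
  - replace (-1 * t + 0) with (- t) by ring. repeat split; ring.
  - lra.
Qed.

Lemma arm_pos_side (t : R) : 0 <= t -> arm t = half_arm t /\ arm1 t = half_arm1 t /\ arm2 t = half_arm2 t.
Proof.
  intros Ht.
  assert (H0 : half_arm1 0 = 0).
  { unfold half_arm1. pose proof (s_rho X). destruct (Rle_dec 0 rho); [|lra].
    unfold core_fun1. rewrite RInt_point. reflexivity. }
  unfold arm, arm1, arm2. destruct (Rle_dec t 0); [|auto].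
  replace t with 0 by lra. replace (-1 * 0 + 0) with 0 by ring. rewrite H0. repeat split; ring.
Qed.

Lemma half_arm_core (t : R) : t <= rho -> half_arm t = core_fun t /\ half_arm1 t = core_fun1 t /\
  half_arm2 t = cforce X F t.
Proof.
  intros Ht. unfold half_arm, half_arm1, half_arm2. destruct (Rle_dec t rho); [auto|lra].
Qed.

Lemma half_arm_tail (t : R) : 0 <= t ->
  half_arm (l0 * t + rho) = tail_sol t /\ half_arm1 (l0 * t + rho) = tail_sol1 t / l0 /\
  half_arm2 (l0 * t + rho) = tail_sol t - force X F e0 t.
Proof.
  intros Ht. pose proof ell0_ge as Hl. pose proof (s_rho X) as Hr.
  unfold half_arm, half_arm1, half_arm2.
  replace (/ l0 * (l0 * t + rho) + - (rho / l0)) with t by (field; lra).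
  destruct (Rle_dec (l0 * t + rho) rho) as [L|L].
  - assert (t = 0) by nra. subst t.
    assert (V0 : tail_sol 0 = qval X F) by (apply edge_sol_at_0; lra).
    replace (l0 * 0 + rho) with rho by ring. rewrite core_end, V0, slopes_match.
    repeat split. unfold force. rewrite <- tail_value, V0 by lra. reflexivity.
  - repeat split; field; lra.
Qed.

Lemma anchor_pos : 0 < F (IVert v0) ->
  forall t, - (k * sL X) <= t <= k * sL X -> 0 < arm t /\ arm2 t = arm t - pw (p - 1) (arm t).
Proof.
  intros Hv. pose proof ell0_ge as Hl. pose proof (s_rho X) as Hr. pose proof ell0_eq as Ek.
  assert (A : forall t, 0 <= t <= k * sL X -> 0 < arm t /\ arm2 t = arm t - pw (p - 1) (arm t)).
  { intros t Ht. destruct (arm_pos_side t ltac:(lra)) as (-> & _ & ->).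
    destruct (Rle_dec t rho) as [L|L].
    - destruct (half_arm_core t L) as (-> & _ & ->). unfold core_fun. rewrite core_value by lra.
      split; [apply core_pos|reflexivity].
    - set (s := (t - rho) / l0).
      assert (Es : t = l0 * s + rho) by (unfold s; field; lra).
      assert (Hs : 0 <= s <= 1).
      { split.
        - apply Rmult_le_pos; [lra|]. left. apply Rinv_0_lt_compat. lra.
        - apply Rmult_le_reg_r with l0; [lra|]. unfold s, Rdiv. rewrite Rmult_assoc, Rinv_l by lra. lra. }
      rewrite Es. destruct (half_arm_tail s ltac:(lra)) as (-> & _ & ->).
      rewrite tail_value by lra. split; [|reflexivity].
      destruct (Req_dec s 1) as [-> |N]; [|apply tail_pos; lra].
      rewrite <- tail_value by lra. unfold tail_sol. rewrite edge_sol_at_1 by lra. exact Hv. }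
  intros t Ht. destruct (Rle_dec 0 t).
  - apply A. lra.
  - destruct (arm_even t) as (<- & _ & <-). apply A. lra.
Qed.

Lemma arm_at_0 : arm 0 = F IPeak /\ arm1 0 = 0.
Proof.
  pose proof (s_rho X) as Hr.
  destruct (arm_pos_side 0 ltac:(lra)) as (-> & -> & _).
  destruct (half_arm_core 0 ltac:(lra)) as (-> & -> & _).
  unfold core_fun, core_fun1, primitive2. rewrite !RInt_point. unfold zero; simpl. split; ring.
Qed.

Lemma arm_at_end : arm (k * sL X) = F (IVert v0) /\
  arm1 (k * sL X) = - (flow1 X k (qval X F) (xval F) (force X F) e0 - coth l0 * F (IVert v0)).
Proof.
  pose proof (s_rho X) as Hr. pose proof ell0_ge as Hl. pose proof ell0_eq as Ek.
  destruct (arm_pos_side (k * sL X) ltac:(lra)) as (-> & -> & _).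
  replace (k * sL X) with (l0 * 1 + rho) by lra.
  destruct (half_arm_tail 1 ltac:(lra)) as (-> & -> & _).
  split.
  - apply edge_sol_at_1. lra.
  - unfold tail_sol1. rewrite edge_sol1_at_1 by lra. unfold flow1, end0, coth, xval.
    rewrite Nat.eqb_refl. field. pose proof (sinh_gt_0 l0). lra.
Qed.

End Solution.

(* [c] is the position of the peak on its edge, [tip] the vertex at the peak, if any. *)
Record placement (X : setup) (c l : R) (tip : option nat) : Prop := Placement {
  pl_kind : kind (sG X) (sE X) = Bounded l;
  pl_case :
    (c = 0 /\ l = sL X /\ tip = Some (src (sG X) (sE X)) /\ sV X = tgt (sG X) (sE X)) \/
    (c = l /\ l = sL X /\ tip = Some (tgt (sG X) (sE X)) /\ sV X = src (sG X) (sE X)) \/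
    (c = sL X /\ l = 2 * sL X /\ tip = None /\
       sV X = src (sG X) (sE X) /\ sV X = tgt (sG X) (sE X));
  pl_tip : forall w, tip = Some w -> w <> sV X /\
    forall e, (e < nE (sG X))%nat -> e <> sE X ->
      src (sG X) e <> w /\ (is_bounded (sG X) e = true -> tgt (sG X) e <> w) }.

Section Profile.
Variables (X : setup) (k : R) (F : idx -> R) (c l : R) (tip : option nat).
Local Notation G := (sG X).
Local Notation p := (sp X).
Local Notation e0 := (sE X).
Local Notation v0 := (sV X).
Local Notation del := (sdel X).
Hypothesis Hk : big X k.
Hypothesis HF : trapped X k F.
Hypothesis fixF : forall i, Phi X k F i = F i.
Hypothesis HP : placement X c l tip.
Hypothesis conn : connected_graph (sG X).

(** * Positivity at the vertices *)

Lemma vert_lt (e : nat) : (e < nE G)%nat ->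
  (src G e < nV G)%nat /\ (is_bounded G e = true -> (tgt G e < nV G)%nat).
Proof.
  intros He. destruct (s_wf X e He) as [A B]. split; [exact A|]. unfold is_bounded.
  destruct (kind G e); [intros _; apply B|discriminate].
Qed.

Lemma anchor_lt : (v0 < nV G)%nat.
Proof.
  destruct (vert_lt e0 (s_lt X)) as [A B]. specialize (B (s_bd X)).
  destruct (pl_case _ _ _ _ HP) as [(_ & _ & _ & E)|[(_ & _ & _ & E)|(_ & _ & _ & E & _)]]; rewrite E; assumption.
Qed.

Lemma vert_value (v : nat) : (v < nV G)%nat ->
  F (IVert v) = inflow X k (qval X F) (xval F) (hval X F) (force X F) v / Rmax 1 (coefs X k v).
Proof.
  intros Hv. rewrite <- (fixF (IVert v)). simpl. rewrite (proj2 (Nat.ltb_lt _ _) Hv). reflexivity.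
Qed.

Lemma flow_terms_ge_0 (v e : nat) : (e < nE G)%nat ->
  0 <= (if Nat.eqb (src G e) v then flow0 X k (qval X F) (xval F) (hval X F) (force X F) e else 0) /\
  0 <= (if is_bounded G e && Nat.eqb (tgt G e) v then flow1 X k (qval X F) (xval F) (force X F) e else 0).
Proof.
  intros He. destruct (admissible_flow_ge_0 X k F e Hk (proj1 HF) He) as [A B]. split.
  - destruct (Nat.eqb _ _); lra.
  - destruct (is_bounded G e); simpl; [|lra]. destruct (Nat.eqb _ _); [auto|lra].
Qed.

Lemma vert_pos (v e : nat) : (v < nV G)%nat -> (e < nE G)%nat ->
  0 < (if Nat.eqb (src G e) v then flow0 X k (qval X F) (xval F) (hval X F) (force X F) e else 0) +
    (if is_bounded G e && Nat.eqb (tgt G e) v then flow1 X k (qval X F) (xval F) (force X F) e else 0) ->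
  0 < F (IVert v).
Proof.
  intros Hv He Hpos. rewrite vert_value by assumption. apply Rdiv_lt_0_compat.
  - eapply Rlt_le_trans; [exact Hpos|]. unfold inflow, at_vertex.
    apply (gsum_ge_term (nE G) e (fun e => (if Nat.eqb (src G e) v
      then flow0 X k (qval X F) (xval F) (hval X F) (force X F) e else 0) +
      (if is_bounded G e && Nat.eqb (tgt G e) v then flow1 X k (qval X F) (xval F) (force X F) e else 0)) He).
    intros i Hi. destruct (flow_terms_ge_0 v i Hi). lra.
  - pose proof (Rmax_l 1 (coefs X k v)). lra.
Qed.

Lemma flow1_pos (e : nat) : (e < nE G)%nat -> is_bounded G e = true ->
  0 < end0 X (qval X F) (xval F) e -> 0 < flow1 X k (qval X F) (xval F) (force X F) e.
Proof.
  intros He B Hx. assert (Hl := big_ell X k e Hk He B).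
  destruct (green_ge_0 (ell X k e) 0 (force X F e) Hl ltac:(lra) (cont_force X F e (proj1 HF))) as (_ & _ & J).
  { intros s _. apply pw_ge_0. }
  unfold flow1. apply Rplus_lt_le_0_compat; [|exact J].
  apply Rdiv_lt_0_compat; [exact Hx|apply sinh_gt_0, Hl].
Qed.

(** The positive value at the cut sends a strictly positive flow to the vertex, and no other
    incoming flow is negative. *)
Lemma anchor_positive : 0 < F (IVert v0).
Proof.
  apply (vert_pos v0 e0 anchor_lt (s_lt X)).
  assert (P : 0 < flow1 X k (qval X F) (xval F) (force X F) e0).
  { apply flow1_pos; [apply s_lt|apply s_bd|]. unfold end0. rewrite Nat.eqb_refl.
    apply (core_pos X k F HF). }
  destruct (flow_terms_ge_0 v0 e0 (s_lt X)) as [A B].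
  assert (H : src G e0 = v0 \/ tgt G e0 = v0).
  { destruct (pl_case _ _ _ _ HP) as [(_ & _ & _ & E)|[(_ & _ & _ & E)|(_ & _ & _ & E & _)]]; auto. }
  destruct H as [H|H].
  - rewrite H, Nat.eqb_refl in *. unfold flow0 at 1. rewrite Nat.eqb_refl. lra.
  - rewrite H, (s_bd X), Nat.eqb_refl in *. simpl in *. lra.
Qed.

Lemma positive_step (e v w : nat) : (e < nE G)%nat -> e <> e0 -> is_bounded G e = true ->
  (src G e = v /\ tgt G e = w) \/ (src G e = w /\ tgt G e = v) -> (w < nV G)%nat ->
  0 < F (IVert v) -> 0 < F (IVert w).
Proof.
  intros He N B H Hw Hv. apply (vert_pos w e Hw He).
  destruct (flow_terms_ge_0 w e He) as [P0 P1].
  apply Nat.eqb_neq in N.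
  destruct H as [[H1 H2]|[H1 H2]].
  - rewrite H2, B, Nat.eqb_refl in *. simpl in *.
    assert (0 < flow1 X k (qval X F) (xval F) (force X F) e); [|lra].
    apply flow1_pos; auto. unfold end0, xval. rewrite N, H1. exact Hv.
  - rewrite H1, Nat.eqb_refl in *.
    assert (0 < flow0 X k (qval X F) (xval F) (hval X F) (force X F) e); [|lra].
    unfold flow0. rewrite N, B. assert (Hl := big_ell X k e Hk He B).
    destruct (green_ge_0 (ell X k e) 0 (force X F e) Hl ltac:(lra) (cont_force X F e (proj1 HF))) as (_ & J & _).
    { intros s _. apply pw_ge_0. }
    apply Rplus_lt_le_0_compat; [|exact J].
    apply Rdiv_lt_0_compat; [|apply sinh_gt_0, Hl]. unfold end1, xval. rewrite N, H2. exact Hv.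
Qed.

(** Positivity spreads along paths from the anchor, since a positive vertex sends a positive flow
    through each bounded edge other than [e0]. The edge [e0] leads only to the anchor or to the tip,
    and no other edge leaves the tip. *)
Lemma vert_positive (w : nat) : (w < nV G)%nat -> tip <> Some w -> 0 < F (IVert w).
Proof.
  intros Hw Ht.
  assert (A : forall w, clos_refl_trans nat (adjacent G) v0 w -> tip = Some w \/ 0 < F (IVert w)).
  { intros u Hu. apply clos_rt_rtn1 in Hu. induction Hu as [|y z Hyz _ IH].
    - right. apply anchor_positive.
    - destruct Hyz as (e & He & B & Hyz).
      assert (Hz : (z < nV G)%nat).
      { destruct (vert_lt e He) as [S T]. destruct Hyz as [[_ <-]|[<- _]]; auto. }
      destruct (Nat.eq_dec e e0) as [-> |N].
      + assert (D : tip = Some z \/ z = v0).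
        { destruct (pl_case _ _ _ _ HP) as [(_ & _ & T & E)|[(_ & _ & T & E)|(_ & _ & T & E & E')]];
          destruct Hyz as [[E1 E2]|[E1 E2]]; subst z; rewrite T; auto; right; congruence. }
        destruct D as [D| ->]; [left; exact D|right; apply anchor_positive].
      + destruct IH as [T|Hy].
        * exfalso. destruct (pl_tip _ _ _ _ HP y T) as [_ Q]. destruct (Q e He N) as [Q1 Q2].
          specialize (Q2 B). destruct Hyz as [[E1 _]|[_ E2]]; contradiction.
        * right. apply (positive_step e y z); assumption. }
  destruct (A w (conn v0 w anchor_lt Hw)) as [B|B]; [contradiction|exact B].
Qed.

Definition profile (e : nat) (t : R) : R :=
  if Nat.eqb e e0 then 1 * arm X k F (1 * t + - (k * c))
  else match kind G e with
  | Bounded _ => 1 * edge_sol (ell X k e) (F (IVert (src G e))) (F (IVert (tgt G e))) (force X F e)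
                   (/ ell X k e * t + 0)
  | HalfLine => sol p (F (IVert (src G e))) (slope p (F (IVert (src G e)))) t
  end.

Definition profile1 (e : nat) (t : R) : R :=
  if Nat.eqb e e0 then 1 * 1 * arm1 X k F (1 * t + - (k * c))
  else match kind G e with
  | Bounded _ => 1 * / ell X k e * edge_sol1 (ell X k e) (F (IVert (src G e))) (F (IVert (tgt G e)))
                   (force X F e) (/ ell X k e * t + 0)
  | HalfLine => sol1 p (F (IVert (src G e))) (slope p (F (IVert (src G e)))) t
  end.

Definition profile2 (e : nat) (t : R) : R :=
  if Nat.eqb e e0 then 1 * 1 ^ 2 * arm2 X k F (1 * t + - (k * c))
  else match kind G e with
  | Bounded _ => 1 * (/ ell X k e) ^ 2 * (ell X k e ^ 2 * (
      edge_sol (ell X k e) (F (IVert (src G e))) (F (IVert (tgt G e))) (force X F e) (/ ell X k e * t + 0)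
      - force X F e (/ ell X k e * t + 0)))
  | HalfLine => sol p (F (IVert (src G e))) (slope p (F (IVert (src G e)))) t
      - pw (p - 1) (sol p (F (IVert (src G e))) (slope p (F (IVert (src G e)))) t)
  end.

Lemma vert_slope (v : nat) : 0 <= slope p (F (IVert v)) <= 1 /\
  slope p (F (IVert v)) ^ 2 = 1 - 2 / p * pw (p - 2) (F (IVert v)) /\ pw (p - 2) (F (IVert v)) <= 1/640.
Proof.
  destruct (proj1 HF) as (_ & _ & _ & Cv & _). specialize (Cv v). pose proof (s_p X).
  assert (P : pw (p - 2) (F (IVert v)) <= 1/640).
  { apply Rle_trans with (pw (p - 2) (2 * del)); [apply pw_incr; lra|]. apply kap_facts. }
  destruct (slope_bounds p (F (IVert v)) (s_p X) ltac:(lra)) as (A & B & _). auto.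
Qed.

Lemma profile_C2 (e : nat) : (e < nE G)%nat -> C2 (profile e) (profile1 e) (profile2 e).
Proof.
  intros He. unfold profile, profile1, profile2.
  destruct (Nat.eqb e e0) eqn:N.
  - apply (C2_comp_lin _ _ _ 1 1 (- (k * c)) (arm_C2 X k F Hk HF fixF)).
  - destruct (kind G e) as [le|] eqn:Ke.
    + assert (B : is_bounded G e = true) by (unfold is_bounded; rewrite Ke; reflexivity).
      apply (C2_comp_lin _ _ _ 1 (/ ell X k e) 0
        (edge_sol_C2 (ell X k e) (F (IVert (src G e))) (F (IVert (tgt G e))) (force X F e)
          (big_ell X k e Hk He B) (cont_force X F e (proj1 HF)))).
    + destruct (vert_slope (src G e)) as (A & B & _).
      destruct (proj1 HF) as (_ & _ & _ & Cv & _).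
      apply sol_C2; [apply s_p|apply Cv|exact A|exact B].
Qed.

Lemma arm_range (x : R) : 0 <= x <= l -> - (k * sL X) <= 1 * (k * x) + - (k * c) <= k * sL X.
Proof.
  intros Hx. pose proof (s_L X). destruct Hk as (k0 & _).
  replace (1 * (k * x) + - (k * c)) with (k * (x - c)) by ring.
  assert (- sL X <= x - c <= sL X).
  { destruct (pl_case _ _ _ _ HP) as [(C & D & _)|[(C & D & _)|(C & D & _)]]; lra. }
  nra.
Qed.

Lemma not_tip (e : nat) : (e < nE G)%nat -> e <> e0 ->
  tip <> Some (src G e) /\ (is_bounded G e = true -> tip <> Some (tgt G e)).
Proof.
  intros He N. split; [|intros B]; intros T; destruct (pl_tip _ _ _ _ HP _ T) as [_ Q];
  destruct (Q e He N) as [Q1 Q2]; [apply Q1|apply (Q2 B)]; reflexivity.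
Qed.

Lemma edge_value_other (e : nat) (t : R) : (e < nE G)%nat -> is_bounded G e = true -> e <> e0 -> 0 <= t <= 1 ->
  edge_sol (ell X k e) (F (IVert (src G e))) (F (IVert (tgt G e))) (force X F e) t = F (IEdge e t).
Proof.
  intros He B N Ht.
  rewrite <- (edge_value X k F fixF e t (proj2 (bedge_spec X e) (conj He B)) Ht).
  unfold end0, end1, xval. rewrite (proj2 (Nat.eqb_neq e e0) N). reflexivity.
Qed.

Lemma ell_other (e : nat) (le : R) : e <> e0 -> kind G e = Bounded le -> ell X k e = k * le.
Proof.
  intros N Ke. unfold ell, elen. rewrite (proj2 (Nat.eqb_neq e e0) N), Ke. reflexivity.
Qed.

Lemma unit_coordinate (e : nat) (le x : R) : (e < nE G)%nat -> e <> e0 -> kind G e = Bounded le ->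
  0 < le /\ / ell X k e * (k * x) + 0 = x / le /\ (0 <= x <= le -> 0 <= x / le <= 1).
Proof.
  intros He N Ke. destruct (s_wf X e He) as [_ W]. rewrite Ke in W. destruct W as [W _].
  destruct Hk as (k0 & _). split; [exact W|split].
  - rewrite (ell_other e le N Ke). field. lra.
  - intros Hx. split.
    + apply Rmult_le_pos; [lra|]. left. apply Rinv_0_lt_compat, W.
    + apply Rmult_le_reg_r with le; [exact W|]. unfold Rdiv. rewrite Rmult_assoc, Rinv_l; lra.
Qed.

Lemma profile_equation (e : nat) (x : R) : (e < nE G)%nat -> in_edge (kind G e) x ->
  0 < profile e (k * x) /\
  profile2 e (k * x) = profile e (k * x) - pw (p - 1) (profile e (k * x)).
Proof.
  intros He Hx. unfold profile, profile2.
  destruct (Nat.eq_dec e e0) as [-> |N].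
  - rewrite Nat.eqb_refl. rewrite (pl_kind _ _ _ _ HP) in Hx. simpl in Hx.
    destruct (anchor_pos X k F Hk HF fixF anchor_positive _ (arm_range x Hx)) as [A B].
    rewrite !Rmult_1_l. split; [rewrite Rmult_1_l in A; exact A|].
    rewrite Rmult_1_l in B. rewrite B. ring.
  - rewrite (proj2 (Nat.eqb_neq e e0) N).
    destruct (not_tip e He N) as [T1 T2]. destruct (vert_lt e He) as [V1 V2].
    assert (Ps := vert_positive (src G e) V1 T1).
    destruct (kind G e) as [le|] eqn:Ke.
    + assert (B : is_bounded G e = true) by (unfold is_bounded; rewrite Ke; reflexivity).
      assert (Pt := vert_positive (tgt G e) (V2 B) (T2 B)).
      assert (Hl := big_ell X k e Hk He B).
      destruct (unit_coordinate e le x He N Ke) as (W & -> & U). simpl in Hx. specialize (U Hx).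
      set (s := x / le) in *.
      assert (Pos : 0 < edge_sol (ell X k e) (F (IVert (src G e))) (F (IVert (tgt G e))) (force X F e) s).
      { destruct (green_ge_0 (ell X k e) s (force X F e) Hl U (cont_force X F e (proj1 HF))) as (J & _).
        { intros r _. apply pw_ge_0. }
        unfold edge_sol. apply Rplus_lt_le_0_compat; [|exact J].
        pose proof (hat0_ge_0 (ell X k e) s Hl U). pose proof (hat1_ge_0 (ell X k e) s Hl U).
        destruct (Rlt_dec s 1).
        - apply Rplus_lt_le_0_compat; [|apply Rmult_le_pos; lra].
          apply Rmult_lt_0_compat; [exact Ps|apply hat0_gt_0; assumption].
        - apply Rplus_le_lt_0_compat; [apply Rmult_le_pos; lra|].
          apply Rmult_lt_0_compat; [exact Pt|apply hat1_gt_0; lra]. }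
      split; [lra|]. rewrite !Rmult_1_l.
      change (force X F e s) with (pw (p - 1) (F (IEdge e s))).
      rewrite <- (edge_value_other e s He B N U). field. lra.
    + split; [apply sol_gt_0, Ps|reflexivity].
Qed.

(** At the tip the unknown [F (IVert v)] belongs to a fictitious equation and is discarded: the
    solution takes there the height of the peak. *)
Definition vertex_value (v : nat) : R :=
  match tip with
  | Some w => if Nat.eqb v w then F IPeak else F (IVert v)
  | None => F (IVert v)
  end.

Lemma vertex_value_not_tip (v : nat) : tip <> Some v -> vertex_value v = F (IVert v).
Proof.
  intros H. unfold vertex_value. destruct tip as [w|]; [|reflexivity].
  destruct (Nat.eqb v w) eqn:E; [|reflexivity]. apply Nat.eqb_eq in E. subst w. contradiction.
Qed.

Lemma vertex_value_tip (v : nat) : tip = Some v -> vertex_value v = F IPeak.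
Proof. intros H. unfold vertex_value. rewrite H, Nat.eqb_refl. reflexivity. Qed.

Lemma anchor_not_tip : tip <> Some v0.
Proof. intros T. destruct (pl_tip _ _ _ _ HP _ T) as [A _]. apply A. reflexivity. Qed.

Lemma profile_ends (e : nat) : (e < nE G)%nat ->
  profile e 0 = vertex_value (src G e) /\
  (forall le, kind G e = Bounded le -> profile e (k * le) = vertex_value (tgt G e)).
Proof.
  intros He. destruct (Nat.eq_dec e e0) as [-> |N].
  - pose proof (vertex_value_not_tip v0 anchor_not_tip) as A0.
    destruct (arm_at_0 X k F) as [B0 _].
    destruct (arm_at_end X k F Hk HF fixF) as [B1 _].
    destruct (arm_even X k F (k * sL X)) as [B2 _].
    unfold profile. rewrite Nat.eqb_refl, (pl_kind _ _ _ _ HP).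
    destruct (pl_case _ _ _ _ HP) as [(C & D & T & E)|[(C & D & T & E)|(C & D & T & E & E')]].
    + split; [|intros le Hle; injection Hle as <-].
      * rewrite (vertex_value_tip _ T). subst c. replace (1 * 0 + - (k * 0)) with 0 by ring.
        rewrite B0. ring.
      * rewrite <- E, A0. subst c. rewrite D. replace (1 * (k * sL X) + - (k * 0)) with (k * sL X) by ring.
        rewrite B1. ring.
    + split; [|intros le Hle; injection Hle as <-].
      * rewrite <- E, A0. rewrite C, D. replace (1 * 0 + - (k * sL X)) with (- (k * sL X)) by ring.
        rewrite B2, B1. ring.
      * rewrite (vertex_value_tip _ T). rewrite C. replace (1 * (k * l) + - (k * l)) with 0 by ring.
        rewrite B0. ring.
    + split; [|intros le Hle; injection Hle as <-].
      * rewrite <- E, A0. rewrite C. replace (1 * 0 + - (k * sL X)) with (- (k * sL X)) by ring.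
        rewrite B2, B1. ring.
      * rewrite <- E', A0. rewrite C, D.
        replace (1 * (k * (2 * sL X)) + - (k * sL X)) with (k * sL X) by ring.
        rewrite B1. ring.
  - destruct (not_tip e He N) as [T1 T2]. rewrite (vertex_value_not_tip _ T1).
    unfold profile. rewrite (proj2 (Nat.eqb_neq e e0) N).
    destruct (kind G e) as [le|] eqn:Ke.
    + assert (B : is_bounded G e = true) by (unfold is_bounded; rewrite Ke; reflexivity).
      assert (Hl := big_ell X k e Hk He B).
      split; [|intros le' Hle; injection Hle as <-].
      * rewrite Rmult_0_r, Rplus_0_l, edge_sol_at_0 by assumption. ring.
      * rewrite (vertex_value_not_tip _ (T2 B)).
        destruct (unit_coordinate e le le He N Ke) as (W & -> & _).
        replace (le / le) with 1 by (field; lra). rewrite edge_sol_at_1 by assumption. ring.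
    + split; [apply sol_at_0|discriminate].
Qed.

(** Away from the tip an outgoing slope is the incoming flow minus a coefficient times the vertex
    value, so that the sum over the edges is the vertex equation. At the tip the slope vanishes,
    which is the Kirchhoff condition at a vertex of degree 1. *)
Lemma profile_slopes (e : nat) : (e < nE G)%nat ->
  (tip <> Some (src G e) -> profile1 e 0 = flow0 X k (qval X F) (xval F) (hval X F) (force X F) e
     - coef0 X k e * F (IVert (src G e))) /\
  (tip = Some (src G e) -> profile1 e 0 = 0) /\
  (forall le, kind G e = Bounded le -> tip <> Some (tgt G e) ->
     - profile1 e (k * le) = flow1 X k (qval X F) (xval F) (force X F) e
       - coth (ell X k e) * F (IVert (tgt G e))) /\
  (forall le, kind G e = Bounded le -> tip = Some (tgt G e) -> profile1 e (k * le) = 0).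
Proof.
  intros He. destruct (Nat.eq_dec e e0) as [-> |N].
  - destruct (arm_at_0 X k F) as [_ B0].
    destruct (arm_at_end X k F Hk HF fixF) as [_ B1].
    destruct (arm_even X k F (k * sL X)) as [_ [B2 _]].
    pose proof anchor_not_tip as AT.
    unfold profile1, flow0, coef0. rewrite Nat.eqb_refl, (pl_kind _ _ _ _ HP), (s_bd X).
    destruct (pl_case _ _ _ _ HP) as [(C & D & T & E)|[(C & D & T & E)|(C & D & T & E & E')]].
    + rewrite T. split; [|split; [|split]].
      * intros A. exfalso. apply A. reflexivity.
      * intros _. subst c. replace (1 * 0 + - (k * 0)) with 0 by ring. rewrite B0. ring.
      * intros le Hle _. injection Hle as <-. subst c. rewrite D.
        replace (1 * (k * sL X) + - (k * 0)) with (k * sL X) by ring. rewrite B1, <- E. ring.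
      * intros le _ A. exfalso. apply AT. rewrite T, A, E. reflexivity.
    + rewrite T. split; [|split; [|split]].
      * intros _. rewrite C, D. replace (1 * 0 + - (k * sL X)) with (- (k * sL X)) by ring.
        rewrite B2, B1, <- E. ring.
      * intros A. exfalso. apply AT. rewrite T, A, E. reflexivity.
      * intros le _ A. exfalso. apply A. reflexivity.
      * intros le Hle _. injection Hle as <-. rewrite C.
        replace (1 * (k * l) + - (k * l)) with 0 by ring. rewrite B0. ring.
    + rewrite T. split; [|split; [|split]].
      * intros _. rewrite C. replace (1 * 0 + - (k * sL X)) with (- (k * sL X)) by ring.
        rewrite B2, B1, <- E. ring.
      * discriminate.
      * intros le Hle _. injection Hle as <-. rewrite C, D.
        replace (1 * (k * (2 * sL X)) + - (k * sL X)) with (k * sL X) by ring. rewrite B1, <- E'. ring.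
      * discriminate.
  - destruct (not_tip e He N) as [T1 T2].
    unfold profile1, flow0, flow1, coef0, end0, end1. rewrite (proj2 (Nat.eqb_neq e e0) N).
    unfold is_bounded in *. destruct (kind G e) as [le|] eqn:Ke.
    + assert (B : is_bounded G e = true) by (unfold is_bounded; rewrite Ke; reflexivity).
      assert (Hl := big_ell X k e Hk He B).
      pose proof (sinh_gt_0 _ Hl) as Hs.
      split; [|split; [intros A; contradiction|split]].
      * intros _. rewrite Rmult_0_r, Rplus_0_l, edge_sol1_at_0 by assumption. unfold coth, xval. field. lra.
      * intros le' Hle _. injection Hle as <-.
        destruct (unit_coordinate e le le He N Ke) as (W & -> & _).
        replace (le / le) with 1 by (field; lra). rewrite edge_sol1_at_1 by assumption.
        unfold coth, xval. field. lra.
      * intros le' Hle A. exfalso. apply T2; auto.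
    + split; [|split; [intros A; contradiction|split; discriminate]].
      intros _. rewrite sol1_at_0. unfold hval, half_flow. ring.
Qed.

Definition slope_src (e : nat) : R := profile1 e 0.
Definition slope_tgt (e : nat) : R :=
  match kind G e with Bounded le => - profile1 e (k * le) | HalfLine => 0 end.

Lemma profile_kirchhoff (v : nat) : (v < nV G)%nat ->
  gsum (nE G) (fun e => (if Nat.eqb (src G e) v then slope_src e else 0) +
     (if andb (is_bounded G e) (Nat.eqb (tgt G e) v) then slope_tgt e else 0)) = 0.
Proof.
  intros Hv.
  assert (Dec : tip = Some v \/ tip <> Some v).
  { destruct tip as [w|]; [|right; discriminate]. destruct (Nat.eq_dec w v) as [-> |N]; [left; reflexivity|].
    right. congruence. }
  destruct Dec as [T|T].
  - apply gsum_0. intros e He. destruct (profile_slopes e He) as (_ & S1 & _ & S2).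
    destruct (Nat.eqb (src G e) v) eqn:E1.
    + apply Nat.eqb_eq in E1. unfold slope_src. rewrite S1 by congruence.
      destruct (is_bounded G e && Nat.eqb (tgt G e) v) eqn:E2; [|ring].
      apply andb_true_iff in E2. destruct E2 as [_ E2]. apply Nat.eqb_eq in E2.
      unfold slope_tgt. destruct (kind G e) as [le|]; [|ring].
      rewrite (S2 le eq_refl) by congruence. ring.
    + destruct (is_bounded G e && Nat.eqb (tgt G e) v) eqn:E2; [|ring].
      apply andb_true_iff in E2. destruct E2 as [_ E2]. apply Nat.eqb_eq in E2.
      unfold slope_tgt. destruct (kind G e) as [le|]; [|ring].
      rewrite (S2 le eq_refl) by congruence. ring.
  - rewrite (gsum_ext _ _ (fun e =>
      ((if Nat.eqb (src G e) v then flow0 X k (qval X F) (xval F) (hval X F) (force X F) e else 0) +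
       (if is_bounded G e && Nat.eqb (tgt G e) v then flow1 X k (qval X F) (xval F) (force X F) e else 0))
      - F (IVert v) * ((if Nat.eqb (src G e) v then coef0 X k e else 0) +
       (if is_bounded G e && Nat.eqb (tgt G e) v then coth (ell X k e) else 0)))).
    + rewrite gsum_minus, gsum_scal.
      change (inflow X k (qval X F) (xval F) (hval X F) (force X F) v - F (IVert v) * coefs X k v = 0).
      assert (Pv := vert_positive v Hv T).
      assert (Hc : 1 <= coefs X k v).
      { assert (Hc0 : forall e, (e < nE G)%nat ->
          0 <= (if Nat.eqb (src G e) v then coef0 X k e else 0) /\
          0 <= (if is_bounded G e && Nat.eqb (tgt G e) v then coth (ell X k e) else 0)).
        { intros e He. destruct (coef_ge_1 X k e Hk He) as [c1 c2]. split.
          - destruct (Nat.eqb _ _); lra.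
          - destruct (is_bounded G e); simpl; [|lra]. specialize (c2 eq_refl).
            destruct (Nat.eqb _ _); lra. }
        destruct (Classical_Prop.classic (exists e, (e < nE G)%nat /\ (Nat.eqb (src G e) v = true \/
          is_bounded G e && Nat.eqb (tgt G e) v = true))) as [(e & He & I)|I].
        - unfold coefs, at_vertex.
          eapply Rle_trans; [|apply (gsum_ge_term (nE G) e _ He); intros i Hi; specialize (Hc0 i Hi); lra].
          cbv beta. destruct (coef_ge_1 X k e Hk He) as [c1 c2]. specialize (Hc0 e He).
          destruct I as [I|I]; rewrite I in *; [lra|].
          apply andb_true_iff in I. destruct I as [I _]. specialize (c2 I). lra.
        (* Without an incident edge the inflow would be zero, and so would the vertex value, which
           is positive. *)
        - exfalso. rewrite vert_value in Pv by assumption.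
          unfold inflow, at_vertex in Pv. rewrite gsum_0 in Pv.
          + unfold Rdiv in Pv. lra.
          + intros e He.
            destruct (Nat.eqb (src G e) v) eqn:E1; [exfalso; apply I; exists e; auto|].
            destruct (is_bounded G e && Nat.eqb (tgt G e) v) eqn:E2; [exfalso; apply I; exists e; auto|].
            ring. }
      assert (VV := vert_value v Hv). rewrite Rmax_right in VV by lra. rewrite VV. field. lra.
    + intros e He. destruct (profile_slopes e He) as (S1 & _ & S2 & _).
      destruct (Nat.eqb (src G e) v) eqn:E1; destruct (is_bounded G e) eqn:B; simpl;
      try destruct (Nat.eqb (tgt G e) v) eqn:E2;
      repeat match goal with H : Nat.eqb _ _ = true |- _ => apply Nat.eqb_eq in H end;
      unfold slope_src, slope_tgt; unfold is_bounded in B; destruct (kind G e) as [le|]; try discriminate;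
      rewrite ?(S2 le eq_refl) by congruence; rewrite ?S1 by congruence;
      try (rewrite E1); try (rewrite E2); try ring.
Qed.

End Profile.

(** * Mass and energy *)

(** A total function, so that masses can be defined without carrying a proof of convergence. *)
Definition half_integral_value (f : R -> R) : R := real (Lim (fun T => RInt f 0 T) p_infty).

Lemma half_integral_value_eq (f : R -> R) (I : R) : half_integral f I -> half_integral_value f = I.
Proof.
  intros H. unfold half_integral_value. rewrite (is_lim_unique (fun T => RInt f 0 T) p_infty (Finite I)); [reflexivity|].
  exact H.
Qed.

Lemma edge_integral_ext (K : edge_kind) (f g : R -> R) (I : R) :
  match K with Bounded l => 0 < l | HalfLine => True end ->
  (forall x, in_edge K x -> f x = g x) -> edge_integral K f I -> edge_integral K g I.
Proof.
  intros HK H. destruct K as [l|]; simpl in *; intros HI.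
  - apply (is_RInt_gen_ext f g); [|exact HI].
    apply (Filter_prod _ _ _ (fun a => 0 < a < l) (fun b => 0 < b < l)).
    + exists (mkposreal l HK). intros y Hy Hy'. change (Rabs (y - 0) < l) in Hy.
      apply Rabs_def2 in Hy. lra.
    + exists (mkposreal l HK). intros y Hy Hy'. change (Rabs (y - l) < l) in Hy.
      apply Rabs_def2 in Hy. lra.
    + intros a b Ha Hb x Hx. simpl in Hx. apply H. unfold Rmin, Rmax in Hx.
      destruct (Rle_dec a b); lra.
  - apply (is_RInt_gen_ext f g); [|exact HI].
    apply (Filter_prod _ _ _ (fun a => 0 < a) (fun b => 0 < b)).
    + exists (mkposreal 1 Rlt_0_1). intros y Hy Hy'. exact Hy'.
    + exists 0. intros y Hy. exact Hy.
    + intros a b Ha Hb x Hx. simpl in Hx. apply H. unfold Rmin, Rmax in Hx.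
      destruct (Rle_dec a b); lra.
Qed.

Lemma RInt_even (h : R -> R) (a : R) : cont h -> (forall t, h (- t) = h t) ->
  RInt h (- a) 0 = RInt h 0 a.
Proof.
  intros Hh He.
  assert (E := RInt_comp_lin_cont h (-1) 0 0 a Hh).
  replace (-1 * a + 0) with (- a) in E by ring. replace (-1 * 0 + 0) with 0 in E by ring.
  rewrite (RInt_ext (fun x => h (-1 * x + 0)) h) in E.
  - assert (Z : RInt h (- a) 0 + RInt h 0 (- a) = RInt h (- a) (- a)) by (apply RInt_Chasles_cont; assumption).
    rewrite RInt_point in Z. change (zero : R) with 0 in Z. lra.
  - intros x _. replace (-1 * x + 0) with (- x) by ring. apply He.
Qed.

Section Mass.
Variables (X : setup) (k : R) (F : idx -> R) (c l : R) (tip : option nat).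
Local Notation G := (sG X).
Local Notation p := (sp X).
Local Notation e0 := (sE X).
Local Notation rho := (srho X).
Local Notation del := (sdel X).
Local Notation l0 := (ell X k (sE X)).
Hypothesis Hk : big X k.
Hypothesis HF : trapped X k F.
Hypothesis fixF : forall i, Phi X k F i = F i.
Hypothesis HP : placement X c l tip.
Local Notation w := (profile X k F c).
Local Notation w1 := (profile1 X k F c).

Definition scaled_integral (e : nat) (h : R -> R) : R :=
  match kind G e with Bounded le => RInt h 0 (k * le) | HalfLine => half_integral_value h end.

Lemma scaled_integral_spec (e : nat) (A : R) (h : R -> R) : (e < nE G)%nat -> cont h ->
  (kind G e = HalfLine -> exists I, half_integral h I) ->
  edge_integral (kind G e) (fun x => A * h (k * x)) (A / k * scaled_integral e h).
Proof.
  intros He Hh HI. destruct Hk as (k0 & _). unfold scaled_integral.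
  assert (C : cont (fun x => A * h (k * x))).
  { apply cont_mult; [apply cont_const|]. apply (cont_comp h); [exact Hh|].
    apply cont_mult; [apply cont_const|apply cont_id]. }
  destruct (s_wf X e He) as [_ W].
  destruct (kind G e) as [le|] eqn:Ke.
  - replace (A / k * RInt h 0 (k * le)) with (RInt (fun x => A * h (k * x)) 0 le).
    + apply bounded_edge_integral; [exact C|apply W].
    + assert (E := RInt_comp_lin_cont h k 0 0 le Hh).
      rewrite Rmult_0_r, Rplus_0_r, Rplus_0_r in E. rewrite <- E.
      replace (A / k * (k * RInt (fun x => h (k * x + 0)) 0 le)) with (A * RInt (fun x => h (k * x + 0)) 0 le)
        by (field; lra).
      rewrite RInt_scal_cont.
      * f_equal. apply RInt_ext. intros x _. rewrite Rplus_0_r. reflexivity.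
      * apply (cont_comp h); [exact Hh|]. apply cont_mult; [apply cont_const|apply cont_id].
  - destruct (HI eq_refl) as [I HI']. rewrite (half_integral_value_eq h I HI').
    apply half_edge_integral; [exact C|].
    apply (half_integral_scale h _ A k I Hh k0); [reflexivity|exact HI'].
Qed.

Lemma cont_profile (e : nat) : (e < nE G)%nat -> cont (w e) /\ cont (w1 e).
Proof.
  intros He. pose proof (profile_C2 X k F c Hk HF fixF e He) as H. split.
  - exact (cont_derive _ _ (fun s => proj1 (H s))).
  - exact (cont_derive _ _ (fun s => proj1 (proj2 (H s)))).
Qed.

Lemma sol_bounds (e : nat) (t : R) : e <> e0 -> kind G e = HalfLine -> 0 <= t ->
  0 <= w e t <= 2 * F (IVert (src G e)) * exp (- t) /\ w1 e t ^ 2 <= w e t ^ 2 /\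
  pw p (w e t) <= 1/640 * w e t ^ 2.
Proof.
  intros N Ke Ht. unfold profile, profile1. rewrite (proj2 (Nat.eqb_neq e e0) N), Ke.
  set (x := F (IVert (src G e))). pose proof (s_p X) as Hp. pose proof (s_del X) as Hd.
  destruct (vert_slope X k F HF (src G e)) as (S1 & S2 & S3). fold x in S1, S2, S3.
  destruct (proj1 HF) as (_ & _ & _ & Cv & _). specialize (Cv (src G e)). fold x in Cv.
  assert (W0 := sol_ge_0 p x (slope p x) t ltac:(lra)).
  assert (W1 := sol_decay p x (slope p x) t Hp ltac:(lra) S1 Ht).
  split; [lra|split].
  - unfold sol1. pose proof (sol_dbase_ratio p (slope p x) t S1) as R1.
    set (r := sol_dbase p (slope p x) t / sol_base p (slope p x) t) in *.
    replace ((- (sol p x (slope p x) t * r)) ^ 2) with (sol p x (slope p x) t ^ 2 * r ^ 2) by ring.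
    assert (r ^ 2 <= 1) by (apply Rabs_le_between in R1; nra).
    pose proof (pow2_ge_0 (sol p x (slope p x) t)). nra.
  - rewrite pw_p0 by assumption. rewrite pw_sol by lra.
    assert (B1 : 1 <= sol_base p (slope p x) t).
    { unfold sol_base. pose proof (cosh_ge_1 ((p - 2) / 2 * t)).
      assert (0 <= sinh ((p - 2) / 2 * t)) by (apply sinh_ge_0, Rmult_le_pos; lra).
      assert (0 <= slope p x * sinh ((p - 2) / 2 * t)) by (apply Rmult_le_pos; lra). lra. }
    assert (pw (p - 2) x / sol_base p (slope p x) t ^ 2 <= 1/640).
    { apply Rmult_le_reg_r with (sol_base p (slope p x) t ^ 2); [nra|].
      unfold Rdiv at 1. rewrite Rmult_assoc, Rinv_l, Rmult_1_r by nra. nra. }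
    pose proof (pow2_ge_0 (sol p x (slope p x) t)). nra.
Qed.

(** The coefficients let one statement serve the mass, the kinetic term, the nonlinear term and the
    [H^1] norm. All are dominated by [w ^ 2], hence by a multiple of [exp (- 2 * t)]. *)
Lemma half_line_integrals (e : nat) (a b d : R) : (e < nE G)%nat -> e <> e0 -> kind G e = HalfLine ->
  0 <= a -> 0 <= b -> 0 <= d ->
  exists I, half_integral (fun t => a * w e t ^ 2 + b * w1 e t ^ 2 + d * pw p (w e t)) I /\
    0 <= I <= 2 * (a + b + d * (1/640)) * F (IVert (src G e)) ^ 2.
Proof.
  intros He N Ke Ha Hb Hd. destruct (cont_profile e He) as [C0 C1]. pose proof (s_p X) as Hp.
  set (x := F (IVert (src G e))).
  destruct (half_integral_exists (fun t => a * w e t ^ 2 + b * w1 e t ^ 2 + d * pw p (w e t))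
    (4 * (a + b + d * (1/640)) * x ^ 2) 2) as (I & HI & BI).
  - apply cont_plus.
    + apply cont_plus.
      * apply cont_mult; [apply cont_const|apply cont_pow, C0].
      * apply cont_mult; [apply cont_const|apply cont_pow, C1].
    + apply cont_mult; [apply cont_const|apply cont_pw; [lra|exact C0]].
  - lra.
  - intros t Ht. destruct (sol_bounds e t N Ke Ht) as (B0 & B1 & B2). fold x in B0.
    pose proof (pow2_ge_0 (w e t)). pose proof (pow2_ge_0 (w1 e t)). pose proof (pw_ge_0 p (w e t)).
    assert (E2 : exp (- (2 * t)) = exp (- t) ^ 2).
    { replace (- (2 * t)) with (- t + - t) by ring. rewrite exp_plus. ring. }
    assert (S : w e t ^ 2 <= 4 * x ^ 2 * exp (- (2 * t))).
    { rewrite E2. replace (4 * x ^ 2 * exp (- t) ^ 2) with ((2 * x * exp (- t)) ^ 2) by ring. nra. }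
    assert (0 <= a * w e t ^ 2) by (apply Rmult_le_pos; lra).
    assert (0 <= b * w1 e t ^ 2) by (apply Rmult_le_pos; lra).
    assert (0 <= d * pw p (w e t)) by (apply Rmult_le_pos; lra).
    split; [lra|].
    assert (a * w e t ^ 2 <= a * (4 * x ^ 2 * exp (- (2 * t)))) by (apply Rmult_le_compat_l; lra).
    assert (b * w1 e t ^ 2 <= b * (4 * x ^ 2 * exp (- (2 * t)))) by (apply Rmult_le_compat_l; lra).
    assert (d * pw p (w e t) <= d * (1/640 * (4 * x ^ 2 * exp (- (2 * t))))) by (apply Rmult_le_compat_l; lra).
    lra.
  - exists I. split; [exact HI|]. lra.
Qed.

(* The peak at an end of the edge is seen once, a peak in the middle of a loop twice. *)
Definition multiplicity : R := match tip with Some _ => 1 | None => 2 end.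

Lemma arm_integral (h : R -> R) : cont h -> (forall t, h (- t) = h t) ->
  RInt (fun t => h (1 * t + - (k * c))) 0 (k * l) = multiplicity * RInt h 0 (k * sL X).
Proof.
  intros Hh He. assert (E := RInt_comp_lin_cont h 1 (- (k * c)) 0 (k * l) Hh).
  rewrite Rmult_1_l in E. rewrite E. unfold multiplicity.
  destruct (pl_case _ _ _ _ HP) as [(C & D & T & _)|[(C & D & T & _)|(C & D & T & _)]]; rewrite T, C, D.
  - replace (1 * 0 + - (k * 0)) with 0 by ring.
    replace (1 * (k * sL X) + - (k * 0)) with (k * sL X) by ring. real_eq. ring.
  - replace (1 * 0 + - (k * sL X)) with (- (k * sL X)) by ring.
    replace (1 * (k * sL X) + - (k * sL X)) with 0 by ring. rewrite RInt_even by assumption. real_eq. ring.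
  - replace (1 * 0 + - (k * sL X)) with (- (k * sL X)) by ring.
    replace (1 * (k * (2 * sL X)) + - (k * sL X)) with (k * sL X) by ring.
    rewrite <- (RInt_Chasles_cont h _ 0) by assumption. rewrite RInt_even by assumption. real_eq. ring.
Qed.

Lemma arm_split (h : R -> R) : cont h ->
  RInt h 0 (k * sL X) = RInt h 0 rho + l0 * RInt (fun t => h (l0 * t + rho)) 0 1.
Proof.
  intros Hh. rewrite RInt_comp_lin_cont by assumption.
  rewrite <- (RInt_Chasles_cont h 0 rho) by assumption. f_equal. f_equal.
  - ring.
  - rewrite <- (ell0_eq X k). ring.
Qed.

Lemma cont_arm : cont (arm X k F) /\ cont (arm1 X k F).
Proof.
  pose proof (arm_C2 X k F Hk HF fixF) as H. split.
  - exact (cont_derive _ _ (fun s => proj1 (H s))).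
  - exact (cont_derive _ _ (fun s => proj1 (proj2 (H s)))).
Qed.

(** * Rescaled mass of each edge *)

Definition core_mass : R := RInt (fun t => F (ICore t) ^ 2) 0 rho.
Definition tail_mass (e : nat) : R := ell X k e * RInt (fun t => F (IEdge e t) ^ 2) 0 1.

(** Written through the unknowns [F] on intervals that do not move with [k], so that continuity in
    [k] follows from that of the fixed point; [edge_mass_eq] relates it to the profile. *)
Definition edge_mass (e : nat) : R :=
  if Nat.eqb e e0 then multiplicity * (core_mass + tail_mass e0)
  else match kind G e with
  | Bounded _ => tail_mass e
  | HalfLine => half_integral_value (fun t => sol p (F (IVert (src G e))) (slope p (F (IVert (src G e)))) t ^ 2)
  end.

Lemma arm_core (t : R) : 0 <= t <= rho -> arm X k F t = F (ICore t) /\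
  arm1 X k F t = core_fun1 X F t.
Proof.
  intros Ht. destruct (arm_pos_side X k F t ltac:(lra)) as (-> & -> & _).
  destruct (half_arm_core X k F t ltac:(lra)) as (-> & -> & _).
  split; [|reflexivity]. apply (core_value X k F fixF t Ht).
Qed.

Lemma arm_tail (t : R) : 0 <= t <= 1 -> arm X k F (l0 * t + rho) = F (IEdge e0 t).
Proof.
  intros Ht. pose proof (s_rho X). pose proof (ell0_ge X k Hk).
  assert (0 <= l0 * t) by (apply Rmult_le_pos; lra).
  destruct (arm_pos_side X k F (l0 * t + rho) ltac:(lra)) as (-> & _).
  destruct (half_arm_tail X k F Hk HF fixF t ltac:(lra)) as (-> & _).
  apply (tail_value X k F fixF t Ht).
Qed.

Lemma edge_mass_eq (e : nat) : (e < nE G)%nat ->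
  scaled_integral e (fun t => w e t ^ 2) = edge_mass e.
Proof.
  intros He. unfold scaled_integral, edge_mass, profile.
  destruct (Nat.eq_dec e e0) as [-> |N].
  - rewrite Nat.eqb_refl, (pl_kind _ _ _ _ HP).
    destruct cont_arm as [C0 _].
    rewrite (RInt_ext _ (fun t => (fun s => arm X k F s ^ 2) (1 * t + - (k * c))))
      by (intros t _; cbv beta; real_eq; ring).
    rewrite (arm_integral (fun s => arm X k F s ^ 2)).
    + f_equal. rewrite arm_split by (apply cont_pow, C0). unfold core_mass, tail_mass.
      pose proof (s_rho X) as Hr. f_equal; [|f_equal].
      * apply RInt_ext_le; [lra|]. intros t Ht. destruct (arm_core t Ht) as [-> _]. reflexivity.
      * apply RInt_ext_le; [lra|]. intros t Ht. rewrite arm_tail by assumption. reflexivity.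
    + apply cont_pow, C0.
    + intros t. destruct (arm_even X k F t) as [-> _]. reflexivity.
  - rewrite (proj2 (Nat.eqb_neq e e0) N).
    destruct (kind G e) as [le|] eqn:Ke; [|reflexivity].
    assert (B : is_bounded G e = true) by (unfold is_bounded; rewrite Ke; reflexivity).
    pose proof (big_ell X k e Hk He B) as Hl. pose proof (ell_other X k e le N Ke) as El.
    unfold tail_mass.
    set (u := edge_sol (ell X k e) (F (IVert (src G e))) (F (IVert (tgt G e))) (force X F e)).
    assert (Cu : cont u).
    { exact (cont_derive _ _ (fun s => proj1 (edge_sol_C2 (ell X k e) (F (IVert (src G e)))
        (F (IVert (tgt G e))) (force X F e) Hl (cont_force X F e (proj1 HF)) s))). }
    assert (Cu2 : cont (fun t => u t ^ 2)) by (apply cont_pow, Cu).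
    assert (E := RInt_comp_lin_cont (fun t => u t ^ 2) (/ ell X k e) 0 0 (k * le) Cu2).
    replace (/ ell X k e * 0 + 0) with 0 in E by ring.
    replace (/ ell X k e * (k * le) + 0) with 1 in E by (rewrite El; rewrite El in Hl; field; nra).
    transitivity (ell X k e * RInt (fun t => u t ^ 2) 0 1).
    + rewrite <- E. rewrite <- Rmult_assoc, Rinv_r, Rmult_1_l by lra.
      apply RInt_ext. intros t _. fold u. real_eq. ring.
    + f_equal. apply RInt_ext_le; [lra|]. intros t Ht. unfold u.
      rewrite (edge_value_other X k F fixF e t He B N Ht). reflexivity.
Qed.

Lemma cont_edge_fun (e : nat) : cont (fun t => F (IEdge e t) ^ 2).
Proof. destruct (proj1 HF) as (_ & _ & _ & _ & Ce & _). apply (cont_pow (fun t => F (IEdge e t))), Ce. Qed.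

(** The squared profile [exp (- (l0 * t))] has integral at most [1 / l0], which cancels the length:
    the bound does not depend on [k]. *)
Lemma tail_mass_bounds : 0 <= tail_mass e0 <= 4 * del ^ 2.
Proof.
  pose proof (ell0_ge X k Hk) as Hl. pose proof (s_del X) as Hd.
  destruct HF as ((_ & _ & _ & _ & _ & Ce) & _ & _ & F0 & _).
  unfold tail_mass. split.
  - apply Rmult_le_pos; [lra|]. apply RInt_ge_0_cont; [lra|apply cont_edge_fun|].
    intros; apply pow2_ge_0.
  - assert (B : RInt (fun t => F (IEdge e0 t) ^ 2) 0 1 <= 4 * del ^ 2 * RInt (fun t => exp (- (l0 * t))) 0 1).
    { rewrite <- RInt_scal_cont by apply cont_exp_lin.
      apply RInt_le_cont; [lra|apply cont_edge_fun|apply cont_mult; [apply cont_const|apply cont_exp_lin]|].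
      intros t Ht. specialize (F0 t). specialize (Ce e0 t). rewrite clamp_id in F0 by assumption.
      assert (E2 : exp (- (l0 * t)) = exp (- (1/2 * l0 * t)) ^ 2).
      { replace (- (l0 * t)) with (- (1/2 * l0 * t) + - (1/2 * l0 * t)) by field. rewrite exp_plus. ring. }
      rewrite E2. replace (4 * del ^ 2 * exp (- (1/2 * l0 * t)) ^ 2)
        with ((2 * del * exp (- (1/2 * l0 * t))) ^ 2) by ring. nra. }
    assert (I := RInt_exp_le l0 1 ltac:(lra) ltac:(lra)).
    assert (0 <= 4 * del ^ 2) by nra.
    apply Rle_trans with (l0 * (4 * del ^ 2 * / l0)); [|right; field; lra].
    apply Rmult_le_compat_l; [lra|]. eapply Rle_trans; [exact B|]. apply Rmult_le_compat_l; assumption.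
Qed.

Lemma other_mass_bounds (e : nat) : (e < nE G)%nat -> e <> e0 ->
  0 <= edge_mass e <= del ^ 2 * ((if is_bounded G e then ell X k e else 1) * decay X k ^ 2).
Proof.
  intros He N. unfold edge_mass. rewrite (proj2 (Nat.eqb_neq e e0) N).
  pose proof (s_del X) as Hd.
  destruct (decay_bounds X k (ell0_ge X k Hk)) as [E0 E1].
  assert (DE : 0 <= del ^ 2 * decay X k ^ 2) by (apply Rmult_le_pos; apply pow2_ge_0).
  unfold is_bounded. destruct (kind G e) as [le|] eqn:Ke.
  - assert (B : is_bounded G e = true) by (unfold is_bounded; rewrite Ke; reflexivity).
    pose proof (big_ell X k e Hk He B) as Hl.
    destruct HF as ((_ & _ & _ & _ & _ & Ce) & _ & _ & _ & Fe). unfold tail_mass. split.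
    + apply Rmult_le_pos; [lra|]. apply RInt_ge_0_cont; [lra|apply cont_edge_fun|].
      intros; apply pow2_ge_0.
    + replace (del ^ 2 * (ell X k e * decay X k ^ 2)) with (ell X k e * (del ^ 2 * decay X k ^ 2)) by ring.
      apply Rmult_le_compat_l; [lra|].
      apply Rle_trans with (RInt (fun _ => del ^ 2 * decay X k ^ 2) 0 1); [|rewrite RInt_const_R; lra].
      apply RInt_le_cont; [lra|apply cont_edge_fun|apply cont_const|].
      intros t _. specialize (Fe e t N). specialize (Ce e t).
      replace (del ^ 2 * decay X k ^ 2) with ((del * decay X k) ^ 2) by ring. nra.
  - destruct (half_line_integrals e 1 0 0 He N Ke) as (I & HI & BI); try lra.
    assert (HI' : half_integral (fun t => sol p (F (IVert (src G e))) (slope p (F (IVert (src G e)))) t ^ 2) I).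
    { revert HI. unfold half_integral. apply filterlim_ext. intros T. apply RInt_ext. intros t _.
      unfold profile. rewrite (proj2 (Nat.eqb_neq e e0) N), Ke. real_eq. ring. }
    rewrite (half_integral_value_eq _ I HI'). pose proof (vert_bounds X k F HF (src G e)) as V.
    replace (del ^ 2 * (1 * decay X k ^ 2)) with ((del * decay X k) ^ 2) by ring. nra.
Qed.

Lemma cont_core_fun : cont (fun t => F (ICore t) ^ 2).
Proof. destruct (proj1 HF) as (_ & Cc & _). apply (cont_pow (fun t => F (ICore t))), Cc. Qed.

(** The lower bound uses only [[0, 1]] and so depends on [p] alone. There the distance to the
    soliton is at most [del / 4], which is half of its value at the cut and hence at most half of
    [soliton p 1]. *)
Lemma core_mass_bounds : soliton p 1 ^ 2 / 4 <= core_mass <= rho * (2 * peak p) ^ 2.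
Proof.
  pose proof (s_rho X) as Hr. pose proof (s_p X) as Hp. pose proof (s_del X) as Hd.
  pose proof (peak_gt_1 p Hp) as P1.
  destruct (proj1 HF) as (_ & _ & Cc & _). unfold core_mass. split.
  - rewrite <- (RInt_Chasles_cont _ 0 1 rho) by apply cont_core_fun.
    assert (0 <= RInt (fun t => F (ICore t) ^ 2) 1 rho)
      by (apply RInt_ge_0_cont; [lra|apply cont_core_fun|intros; apply pow2_ge_0]).
    assert (soliton p 1 ^ 2 / 4 <= RInt (fun t => F (ICore t) ^ 2) 0 1); [|lra].
    apply Rle_trans with (RInt (fun _ => soliton p 1 ^ 2 / 4) 0 1); [rewrite RInt_const_R; lra|].
    apply RInt_le_cont; [lra|apply cont_const|apply cont_core_fun|]. intros t Ht.
    pose proof HF as (_ & Fs & _). specialize (Fs t). rewrite fold_abs_id_pos in Fs by lra.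
    assert (B : seps X * (2 * exp (core_rate p * t)) <= del / 4).
    { eapply Rle_trans; [|apply s_eps1]. pose proof (s_eps X).
      apply Rmult_le_compat_l; [lra|]. unfold core_gain. apply Rmult_le_compat_l; [lra|].
      apply exp_le. destruct (peak_facts X) as (_ & _ & HK & _). nra. }
    apply Rabs_le_between in Fs.
    pose proof (soliton_decr p t 1 Hp ltac:(lra)) as S1.
    pose proof (soliton_decr p 1 rho Hp ltac:(lra)) as S2. rewrite (s_sol X) in S2.
    pose proof (soliton_pos p 1). nra.
  - apply Rle_trans with (RInt (fun _ => (2 * peak p) ^ 2) 0 rho); [|rewrite RInt_const_R; lra].
    apply RInt_le_cont; [lra|apply cont_core_fun|apply cont_const|]. intros t Ht.
    specialize (Cc t). nra.
Qed.

Lemma multiplicity_bounds : 1 <= multiplicity <= 2.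
Proof. clear HP. unfold multiplicity. destruct tip; lra. Qed.

(** ** Energy *)

Definition edge_energy (e : nat) : R :=
  scaled_integral e (fun t => w1 e t ^ 2) / 2 - scaled_integral e (fun t => pw p (w e t)) / p.

(* [w1^2/2 - w^p/p] is a combination of [w^2], of the conserved energy and of [(w w1)']. *)
Lemma core_energy_lower :
  (p - 6) / (2 * (p + 2)) * core_mass - rho * decay X k - 3 * del ^ 2
  <= RInt (fun t => arm1 X k F t ^ 2 / 2 - pw p (arm X k F t) / p) 0 rho.
Proof.
  pose proof (s_rho X) as Hr. pose proof (s_p X) as Hp. pose proof (s_del X) as Hd.
  set (h := tail_energy X k F).
  set (f := core_fun X F). set (f1 := core_fun1 X F). set (f2 := cforce X F).
  pose proof (core_fun_C2 X k F HF) as CC. fold f f1 f2 in CC.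
  assert (C0 : cont f) by exact (cont_derive _ _ (fun s => proj1 (CC s))).
  assert (C1 : cont f1) by exact (cont_derive _ _ (fun s => proj1 (proj2 (CC s)))).
  assert (C2' : cont f2) by exact (fun s => proj2 (proj2 (CC s))).
  (* The coefficients come from matching [f1 ^ 2], [f ^ 2] and [f ^ p] in the combination
     [a * f ^ 2 + b * h + g * (f * f1)']; the condition [p > 6] is the positivity of [a]. *)
  set (a := (p - 6) / (2 * (p + 2))). set (b := (p - 2) / (p + 2)). set (g := 2 / (p + 2)).
  assert (Cd : cont (fun t => f1 t ^ 2 + f t * f2 t)).
  { apply cont_plus; [apply cont_pow, C1|apply cont_mult; assumption]. }
  assert (E : RInt (fun t => arm1 X k F t ^ 2 / 2 - pw p (arm X k F t) / p) 0 rho =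
    RInt (fun t => (a * f t ^ 2 + b * h) + g * (f1 t ^ 2 + f t * f2 t)) 0 rho).
  { apply RInt_ext_le; [lra|]. intros t Ht. destruct (arm_core t Ht) as [-> ->].
    pose proof (core_energy X k F HF fixF t Ht) as EN. fold f f1 h in EN.
    pose proof (core_value X k F fixF t Ht) as V. change (f t = F (ICore t)) in V.
    pose proof (core_pos X k F HF t) as P.
    unfold f2, cforce. rewrite <- V in *. fold f1.
    assert (PP : pw p (f t) = f t * pw (p - 1) (f t)) by (rewrite <- pw_S by lra; f_equal; ring).
    replace (f t * (f t - pw (p - 1) (f t))) with (f t ^ 2 - pw p (f t)) by (rewrite PP; ring).
    rewrite <- EN. unfold a, b, g. field. lra. }
  rewrite E.
  rewrite RInt_plus_cont; [|apply cont_plus; [apply cont_mult; [apply cont_const|apply cont_pow, C0]|apply cont_const]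
    |apply cont_mult; [apply cont_const|exact Cd]].
  rewrite RInt_plus_cont; [|apply cont_mult; [apply cont_const|apply cont_pow, C0]|apply cont_const].
  rewrite (RInt_scal_cont (fun t => f t ^ 2) a) by (apply cont_pow, C0).
  rewrite (RInt_scal_cont (fun t => f1 t ^ 2 + f t * f2 t) g) by exact Cd.
  rewrite RInt_const_R.
  assert (M : RInt (fun t => f t ^ 2) 0 rho = core_mass).
  { apply RInt_ext_le; [lra|]. intros t Ht. pose proof (core_value X k F fixF t Ht) as V.
    change (f t = F (ICore t)) in V. rewrite V. reflexivity. }
  rewrite M.
  (* The total derivative leaves the boundary term [f * f1], zero at the peak; at the cut the value
     is below [del] and the slope at least [-3 * del]. *)
  rewrite (RInt_primitive (fun t => f t * f1 t)); [|lra|exact Cd|].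
  - assert (B := trapped_tail_energy X k F Hk HF). fold h in B. apply Rabs_le_between in B.
    assert (S := slopes_match X k F Hk HF fixF). fold f1 in S.
    pose proof (tail_slope_bounds X k F Hk HF) as TB. rewrite <- S in TB.
    assert (Q : f rho = qval X F) by (apply (core_end X k F fixF)).
    destruct (trapped_core_range X k F rho HF) as [Q1 Q2]. fold (qval X F) in Q1.
    replace (f1 0) with 0 by (unfold f1, core_fun1; rewrite RInt_point; reflexivity).
    rewrite Q.
    destruct (decay_bounds X k (ell0_ge X k Hk)) as [E0 E1].
    assert (Bb : 0 < b <= 1).
    { unfold b. split; [apply Rdiv_lt_0_compat; lra|]. apply Rmult_le_reg_r with (p + 2); [lra|].
      unfold Rdiv. rewrite Rmult_assoc, Rinv_l; lra. }
    assert (Bg : 0 < g <= 1).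
    { unfold g. split; [apply Rdiv_lt_0_compat; lra|]. apply Rmult_le_reg_r with (p + 2); [lra|].
      unfold Rdiv. rewrite Rmult_assoc, Rinv_l; lra. }
    assert (- (decay X k * rho) <= b * h * (rho - 0)).
    { assert (- decay X k <= b * h) by nra. nra. }
    assert (- (3 * del ^ 2) <= qval X F * f1 rho).
    { assert (0 <= qval X F * (f1 rho + 3 * del)) by (apply Rmult_le_pos; lra). nra. }
    assert (qval X F * f1 rho <= 0) by nra.
    assert (- (3 * del ^ 2) <= g * (qval X F * f1 rho - f 0 * 0)) by nra.
    lra.
  - intros t _. destruct (CC t) as (a1 & a2 & _). auto_derive.
    + split; [exists (f1 t); exact a1|split; [exists (f2 t); exact a2|trivial]].
    + replace (Derive (fun x => f x) t) with (f1 t) by (symmetry; apply is_derive_unique; exact a1).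
      replace (Derive (fun x => f1 x) t) with (f2 t) by (symmetry; apply is_derive_unique; exact a2).
      ring.
Qed.

Lemma pw_p_small (z : R) : 0 <= z <= 2 * del -> 0 <= pw p z / p <= 1/640 * z ^ 2.
Proof.
  intros Hz. pose proof (s_p X) as Hp. pose proof (s_del X) as Hd. destruct (kap_facts X) as [KF _].
  assert (pw (p - 2) z <= 1/640).
  { apply Rle_trans with (pw (p - 2) (2 * del)); [apply pw_incr; lra|lra]. }
  pose proof (pw_ge_0 p z). split.
  - apply Rmult_le_pos; [assumption|]. left. apply Rinv_0_lt_compat. lra.
  - apply Rmult_le_reg_r with p; [lra|]. unfold Rdiv at 1. rewrite Rmult_assoc, Rinv_l, Rmult_1_r by lra.
    rewrite pw_p0 by lra. pose proof (pow2_ge_0 z).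
    assert (z ^ 2 * pw (p - 2) z <= z ^ 2 * (1/640)) by (apply Rmult_le_compat_l; lra). nra.
Qed.

(** On the tail the nonlinear term is at most [1/640] of the squared value, so dropping the kinetic
    term there costs less than [del ^ 2]. Added to the loss [3 * del ^ 2] in the core, this makes
    [4 * del ^ 2]. *)
Lemma peak_edge_energy :
  multiplicity * ((p - 6) / (2 * (p + 2)) * core_mass - rho * decay X k - 4 * del ^ 2) <= edge_energy e0.
Proof.
  pose proof (s_rho X) as Hr. pose proof (s_p X) as Hp. pose proof (s_del X) as Hd.
  destruct cont_arm as [C0 C1]. pose proof multiplicity_bounds as Mb.
  pose proof (ell0_ge X k Hk) as Hl.
  assert (Cp : cont (fun s => pw p (arm X k F s))) by (apply cont_pw; [lra|exact C0]).
  set (en := fun s => arm1 X k F s ^ 2 / 2 - pw p (arm X k F s) / p).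
  assert (Cen : cont en).
  { apply cont_minus.
    - apply (cont_mult (fun s => arm1 X k F s ^ 2) (fun _ => / 2)); [apply cont_pow, C1|apply cont_const].
    - apply (cont_mult (fun s => pw p (arm X k F s)) (fun _ => / p)); [exact Cp|apply cont_const]. }
  assert (E : edge_energy e0 = multiplicity * RInt en 0 (k * sL X)).
  { unfold edge_energy, scaled_integral, profile, profile1. rewrite (pl_kind _ _ _ _ HP), Nat.eqb_refl.
    rewrite (RInt_ext _ (fun t => (fun s => arm1 X k F s ^ 2) (1 * t + - (k * c))))
      by (intros t _; cbv beta; real_eq; ring).
    rewrite (RInt_ext (fun t => pw p (1 * arm X k F (1 * t + - (k * c))))
      (fun t => (fun s => pw p (arm X k F s)) (1 * t + - (k * c))))
      by (intros t _; cbv beta; f_equal; ring).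
    rewrite (arm_integral (fun s => arm1 X k F s ^ 2)), (arm_integral (fun s => pw p (arm X k F s))).
    - unfold en. rewrite RInt_minus_cont.
      + rewrite (RInt_ext (fun s => arm1 X k F s ^ 2 / 2) (fun s => / 2 * arm1 X k F s ^ 2))
          by (intros t _; real_eq; field).
        rewrite (RInt_ext (fun s => pw p (arm X k F s) / p) (fun s => / p * pw p (arm X k F s)))
          by (intros t _; real_eq; field; lra).
        rewrite !RInt_scal_cont by (try exact Cp; apply cont_pow, C1). field. lra.
      + apply (cont_mult (fun s => arm1 X k F s ^ 2) (fun _ => / 2)); [apply cont_pow, C1|apply cont_const].
      + apply (cont_mult (fun s => pw p (arm X k F s)) (fun _ => / p)); [exact Cp|apply cont_const].
    - exact Cp.
    - intros t. destruct (arm_even X k F t) as [-> _]. reflexivity.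
    - apply cont_pow, C1.
    - intros t. destruct (arm_even X k F t) as [_ [-> _]]. ring. }
  rewrite E. apply Rmult_le_compat_l; [lra|].
  rewrite arm_split by exact Cen.
  pose proof core_energy_lower as CL. fold en in CL.
  assert (T : - del ^ 2 <= l0 * RInt (fun t => en (l0 * t + rho)) 0 1).
  { pose proof tail_mass_bounds as TM. unfold tail_mass in TM.
    assert (L : - (1/640) * RInt (fun t => F (IEdge e0 t) ^ 2) 0 1 <= RInt (fun t => en (l0 * t + rho)) 0 1).
    { rewrite <- RInt_scal_cont by apply cont_edge_fun.
      apply RInt_le_cont; [lra|apply cont_mult; [apply cont_const|apply cont_edge_fun]| |].
      - apply (cont_comp en); [exact Cen|]. apply cont_plus; [|apply cont_const].
        apply cont_mult; [apply cont_const|apply cont_id].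
      - intros t Ht. unfold en. rewrite arm_tail by assumption.
        destruct (proj1 HF) as (_ & _ & _ & _ & _ & Ce).
        pose proof (pw_p_small (F (IEdge e0 t)) (Ce e0 t)).
        pose proof (pow2_ge_0 (arm1 X k F (l0 * t + rho))). lra. }
    assert (l0 * (- (1/640) * RInt (fun t => F (IEdge e0 t) ^ 2) 0 1)
       <= l0 * RInt (fun t => en (l0 * t + rho)) 0 1) by (apply Rmult_le_compat_l; lra).
    nra. }
  lra.
Qed.

Lemma profile_other_range (e : nat) (x : R) : (e < nE G)%nat -> e <> e0 -> in_edge (kind G e) x ->
  0 <= w e (k * x) <= 2 * del.
Proof.
  intros He N Hx. destruct (proj1 HF) as (_ & _ & _ & Cv & _ & Ce). pose proof (s_p X) as Hp.
  pose proof Hk as (k0 & _).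
  destruct (kind G e) as [le|] eqn:Ke.
  - assert (B : is_bounded G e = true) by (unfold is_bounded; rewrite Ke; reflexivity).
    unfold profile. rewrite (proj2 (Nat.eqb_neq e e0) N), Ke.
    destruct (unit_coordinate X k Hk e le x He N Ke) as (W & -> & U).
    rewrite (edge_value_other X k F fixF e _ He B N (U Hx)). rewrite Rmult_1_l. apply Ce.
  - simpl in Hx. assert (0 <= k * x) by (apply Rmult_le_pos; lra).
    destruct (sol_bounds e (k * x) N Ke ltac:(assumption)) as (B & _).
    split; [apply B|]. eapply Rle_trans; [apply B|].
    pose proof (vert_bounds X k F HF (src G e)) as V. pose proof (s_del X).
    destruct (decay_bounds X k (ell0_ge X k Hk)) as [E0 E1].
    assert (exp (- (k * x)) <= 1) by (apply exp_neg_le_1; assumption).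
    pose proof (exp_pos (- (k * x))).
    assert (F (IVert (src G e)) <= del) by nra. nra.
Qed.

(** The kinetic term is dropped and the nonlinear one bounded by the mass, which is itself
    negligible on these edges for large [k]. *)
Lemma other_edge_energy (e : nat) : (e < nE G)%nat -> e <> e0 -> - edge_mass e <= edge_energy e.
Proof.
  intros He N. pose proof (s_p X) as Hp. pose proof Hk as (k0 & _).
  rewrite <- edge_mass_eq by assumption. unfold edge_energy, scaled_integral.
  destruct (cont_profile e He) as [C0 C1].
  assert (Cp : cont (fun t => pw p (w e t))) by (apply cont_pw; [lra|exact C0]).
  destruct (s_wf X e He) as [_ W].
  assert (Q : forall P M, 0 <= M -> P <= 1/640 * p * M -> P / p <= M).
  { intros P M HM H. apply Rmult_le_reg_r with p; [lra|]. unfold Rdiv at 1.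
    rewrite Rmult_assoc, Rinv_l, Rmult_1_r by lra. nra. }
  destruct (kind G e) as [le|] eqn:Ke.
  - assert (0 <= k * le) by (apply Rmult_le_pos; lra).
    assert (A : 0 <= RInt (fun t => w1 e t ^ 2) 0 (k * le)).
    { apply RInt_ge_0_cont; [assumption|apply cont_pow, C1|intros; apply pow2_ge_0]. }
    assert (M : 0 <= RInt (fun t => w e t ^ 2) 0 (k * le)).
    { apply RInt_ge_0_cont; [assumption|apply cont_pow, C0|intros; apply pow2_ge_0]. }
    assert (RInt (fun t => pw p (w e t)) 0 (k * le) / p <= RInt (fun t => w e t ^ 2) 0 (k * le)); [|lra].
    apply Q; [exact M|]. rewrite <- RInt_scal_cont by (apply cont_pow, C0).
    apply RInt_le_cont; [assumption|exact Cp|apply cont_mult; [apply cont_const|apply cont_pow, C0]|].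
    intros t Ht. assert (R : 0 <= w e t <= 2 * del).
    { replace t with (k * (t / k)) by (field; lra). apply profile_other_range; [assumption|assumption|].
      rewrite Ke. simpl. split.
      - apply Rmult_le_pos; [lra|]. left. apply Rinv_0_lt_compat, k0.
      - apply Rmult_le_reg_r with k; [exact k0|]. unfold Rdiv. rewrite Rmult_assoc, Rinv_l; lra. }
    pose proof (pw_p_small (w e t) R) as S.
    assert (pw p (w e t) = p * (pw p (w e t) / p)) by (field; lra). nra.
  - destruct (half_line_integrals e 0 1 0 He N Ke) as (I1 & HI1 & BI1); try lra.
    destruct (half_line_integrals e 1 0 0 He N Ke) as (I0 & HI0 & BI0); try lra.
    destruct (half_line_integrals e 0 0 1 He N Ke) as (Ip & HIp & BIp); try lra.
    destruct (half_line_integrals e 1 0 1 He N Ke) as (Is & HIs & BIs); try lra.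
    assert (X1 : half_integral_value (fun t => w1 e t ^ 2) = I1).
    { apply half_integral_value_eq. revert HI1. unfold half_integral. apply filterlim_ext. intros T.
      apply RInt_ext. intros; real_eq; ring. }
    assert (X0 : half_integral_value (fun t => w e t ^ 2) = I0).
    { apply half_integral_value_eq. revert HI0. unfold half_integral. apply filterlim_ext. intros T.
      apply RInt_ext. intros; real_eq; ring. }
    assert (HIp' : half_integral (fun t => pw p (w e t)) Ip).
    { revert HIp. unfold half_integral. apply filterlim_ext. intros T.
      apply RInt_ext. intros; real_eq; ring. }
    rewrite X1, X0, (half_integral_value_eq _ _ HIp').
    assert (Ip / p <= I0); [|lra].
    apply Q; [lra|].
    (* The improper integrals are compared through truncations at a common [T]; the error in [I0] is
       divided by [p] because the truncated inequality carries that factor. *)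
    apply Rle_plus_epsilon. intros eps He'.
    destruct (proj1 (half_integral_spec _ _) HIp' (eps / 4) ltac:(lra)) as (M1 & HM1 & L1).
    destruct (proj1 (half_integral_spec _ _) HI0 (eps / (4 * p)) ltac:(apply Rdiv_lt_0_compat; lra))
      as (M2 & HM2 & L2).
    specialize (L1 (M1 + M2 + 1) ltac:(lra)). specialize (L2 (M1 + M2 + 1) ltac:(lra)).
    set (T := M1 + M2 + 1) in *.
    assert (LL : RInt (fun t => pw p (w e t)) 0 T <= 1/640 * p *
       RInt (fun t => 1 * w e t ^ 2 + 0 * w1 e t ^ 2 + 0 * pw p (w e t)) 0 T).
    { rewrite (RInt_ext (fun t => 1 * w e t ^ 2 + 0 * w1 e t ^ 2 + 0 * pw p (w e t)) (fun t => w e t ^ 2))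
        by (intros; real_eq; ring).
      rewrite <- RInt_scal_cont by (apply cont_pow, C0).
      apply RInt_le_cont; [unfold T; lra|exact Cp|apply cont_mult; [apply cont_const|apply cont_pow, C0]|].
      intros t Ht. destruct (sol_bounds e t N Ke ltac:(lra)) as (_ & _ & B).
      pose proof (pow2_ge_0 (w e t)). nra. }
    apply Rabs_def2 in L1. apply Rabs_def2 in L2.
    assert (p * (eps / (4 * p)) = eps / 4) by (field; lra).
    set (J := RInt (fun t => 1 * w e t ^ 2 + 0 * w1 e t ^ 2 + 0 * pw p (w e t)) 0 T) in *.
    assert (p * J <= p * (I0 + eps / (4 * p))) by (apply Rmult_le_compat_l; lra).
    lra.
Qed.

End Mass.

(** * Back to the graph *)

Lemma right_difference_quotient (g : R -> R) (d : R) : is_derive g 0 d ->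
  filterlim (fun h => (g h - g 0) / h) (at_right 0) (locally d).
Proof.
  intros H. apply filterlim_locally. intros eps.
  apply is_derive_Reals in H. destruct (H eps (cond_pos eps)) as [dl Hd].
  exists dl. intros y Hy Hy0. change (Rabs (y - 0) < dl) in Hy. rewrite Rminus_0_r in Hy.
  specialize (Hd y ltac:(lra) Hy). rewrite Rplus_0_l in Hd. exact Hd.
Qed.

Lemma C2_dilate (a u : R) (f f1 f2 : R -> R) : C2 f f1 f2 ->
  C2 (fun x => a * f (u * x)) (fun x => a * u * f1 (u * x)) (fun x => a * u ^ 2 * f2 (u * x)).
Proof.
  intros H x. destruct (C2_comp_lin f f1 f2 a u 0 H x) as (A & B & C).
  rewrite !Rplus_0_r in *. split; [|split].
  - revert A. apply is_derive_ext. intros t. rewrite Rplus_0_r. reflexivity.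
  - revert B. apply is_derive_ext. intros t. rewrite Rplus_0_r. reflexivity.
  - assert (C' : continuous (fun x => a * u ^ 2 * f2 (u * x)) x).
    { apply continuous_ext with (fun x => a * u ^ 2 * f2 (u * x + 0)); [|].
      - intros t. rewrite Rplus_0_r. reflexivity.
      - exact C. }
    exact C'.
Qed.

Definition amplitude (p k : R) : R := Rpower k (2 / (p - 2)).

Lemma amplitude_pos (p k : R) : 0 < amplitude p k.
Proof. apply Rpower_gt_0. Qed.

Lemma amplitude_pow (p k : R) : 2 < p -> 0 < k ->
  pw (p - 2) (amplitude p k) = k ^ 2 /\ pw (p - 1) (amplitude p k) = amplitude p k * k ^ 2 /\
  pw p (amplitude p k) = amplitude p k ^ 2 * k ^ 2.
Proof.
  intros Hp Hk. pose proof (amplitude_pos p k) as A.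
  assert (E : pw (p - 2) (amplitude p k) = k ^ 2).
  { rewrite pw_pos by assumption. unfold amplitude. rewrite Rpower_mult.
    replace (2 / (p - 2) * (p - 2)) with (INR 2) by (simpl; field; lra).
    apply Rpower_pow, Hk. }
  rewrite (pw_p1 p), (pw_p0 p), E by lra. auto.
Qed.

Lemma amplitude_mass (p k : R) : 2 < p -> 0 < k ->
  amplitude p k ^ 2 / k = Rpower k (4 / (p - 2) - 1).
Proof.
  intros Hp Hk. unfold Rminus. rewrite Rpower_plus, Rpower_Ropp, Rpower_1 by assumption.
  unfold Rdiv at 1. f_equal. unfold amplitude. simpl. rewrite Rmult_1_r, <- Rpower_plus. f_equal. field. lra.
Qed.

Section Graph.
Variables (X : setup) (k : R) (F : idx -> R) (c l : R) (tip : option nat).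
Local Notation G := (sG X).
Local Notation p := (sp X).
Local Notation e0 := (sE X).
Local Notation rho := (srho X).
Local Notation del := (sdel X).
Hypothesis Hk : big X k.
Hypothesis HF : trapped X k F.
Hypothesis fixF : forall i, Phi X k F i = F i.
Hypothesis HP : placement X c l tip.
Hypothesis conn : connected_graph (sG X).
Local Notation w := (profile X k F c).
Local Notation w1 := (profile1 X k F c).
Local Notation w2 := (profile2 X k F c).
Local Notation am := (amplitude (sp X) k).

Definition wave (e : nat) (x : R) : R := am * w e (k * x).

Lemma wave_C2 (e : nat) : (e < nE G)%nat ->
  C2 (wave e) (fun x => am * k * w1 e (k * x)) (fun x => am * k ^ 2 * w2 e (k * x)).
Proof. intros He. apply C2_dilate. apply (profile_C2 X k F c Hk HF fixF e He). Qed.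

Lemma wave_derive (e : nat) (x : R) : (e < nE G)%nat -> Derive (wave e) x = am * k * w1 e (k * x).
Proof. intros He. apply is_derive_unique. apply (wave_C2 e He). Qed.

Lemma wave_pos (e : nat) (x : R) : (e < nE G)%nat -> in_edge (kind G e) x -> 0 < w e (k * x).
Proof. intros He Hx. apply (profile_equation X k F c l tip Hk HF fixF HP conn e x He Hx). Qed.

Lemma half_line_not_peak (e : nat) : kind G e = HalfLine -> e <> e0.
Proof. intros Ke ->. rewrite (pl_kind _ _ _ _ HP) in Ke. discriminate. Qed.

Lemma kind_pos (e : nat) : (e < nE G)%nat -> match kind G e with Bounded l => 0 < l | HalfLine => True end.
Proof. intros He. destruct (s_wf X e He) as [_ W]. destruct (kind G e); [apply W|trivial]. Qed.

Lemma wave_mass : graph_mass G wave (Rpower k (4 / (p - 2) - 1) * gsum (nE G) (edge_mass X k F tip)).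
Proof.
  pose proof Hk as (k0 & _). pose proof (s_p X) as Hp.
  exists (fun e => am ^ 2 / k * scaled_integral X k e (fun t => w e t ^ 2)). split.
  - intros e He. destruct (cont_profile X k F c Hk HF fixF e He) as [C0 C1].
    apply (edge_integral_ext _ (fun x => am ^ 2 * w e (k * x) ^ 2)); [apply kind_pos, He| |].
    { intros x _. unfold wave. ring. }
    apply (scaled_integral_spec X k Hk e (am ^ 2) (fun t => w e t ^ 2) He (cont_pow _ 2 C0)).
    intros Ke. destruct (half_line_integrals X k F c Hk HF fixF e 1 0 0 He (half_line_not_peak e Ke) Ke)
      as (I & HI & _); try lra. exists I.
    revert HI. unfold half_integral. apply filterlim_ext. intros T. apply RInt_ext. intros; real_eq; ring.
  - change (graph_sum G) with (gsum (nE G)). rewrite gsum_scal, amplitude_mass by lra. f_equal.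
    apply gsum_ext. intros e He. symmetry. apply (edge_mass_eq X k F c l tip Hk HF fixF HP e He).
Qed.

Lemma wave_energy : graph_energy G p wave (am ^ 2 * k * gsum (nE G) (edge_energy X k F c)).
Proof.
  pose proof Hk as (k0 & _). pose proof (s_p X) as Hp.
  destruct (amplitude_pow p k ltac:(lra) k0) as (_ & _ & EP).
  exists (gsum (nE G) (fun e => am ^ 2 * k ^ 2 / k * scaled_integral X k e (fun t => w1 e t ^ 2))),
         (gsum (nE G) (fun e => am ^ 2 * k ^ 2 / k * scaled_integral X k e (fun t => pw p (w e t)))).
  split; [|split].
  - eexists. split; [|reflexivity]. intros e He. cbv beta.
    destruct (cont_profile X k F c Hk HF fixF e He) as [C0 C1].
    apply (edge_integral_ext _ (fun x => am ^ 2 * k ^ 2 * w1 e (k * x) ^ 2)); [apply kind_pos, He| |].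
    { intros x _. rewrite wave_derive by assumption. ring. }
    apply (scaled_integral_spec X k Hk e (am ^ 2 * k ^ 2) (fun t => w1 e t ^ 2) He (cont_pow _ 2 C1)).
    intros Ke. destruct (half_line_integrals X k F c Hk HF fixF e 0 1 0 He (half_line_not_peak e Ke) Ke)
      as (I & HI & _); try lra. exists I.
    revert HI. unfold half_integral. apply filterlim_ext. intros T. apply RInt_ext. intros; real_eq; ring.
  - eexists. split; [|reflexivity]. intros e He. cbv beta.
    destruct (cont_profile X k F c Hk HF fixF e He) as [C0 C1].
    assert (Cp : cont (fun t => pw p (w e t))) by (apply cont_pw; [lra|exact C0]).
    apply (edge_integral_ext _ (fun x => am ^ 2 * k ^ 2 * pw p (w e (k * x)))); [apply kind_pos, He| |].
    { intros x Hx. pose proof (wave_pos e x He Hx) as W. pose proof (amplitude_pos p k) as A.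
      unfold rpow_abs, wave. assert (0 < am * w e (k * x)) by (apply Rmult_lt_0_compat; assumption).
      destruct (Req_EM_T _ 0); [lra|]. rewrite Rabs_pos_eq by lra.
      rewrite <- pw_pos by assumption. rewrite pw_mult, EP by lra. ring. }
    apply (scaled_integral_spec X k Hk e (am ^ 2 * k ^ 2) (fun t => pw p (w e t)) He Cp).
    intros Ke. destruct (half_line_integrals X k F c Hk HF fixF e 0 0 1 He (half_line_not_peak e Ke) Ke)
      as (I & HI & _); try lra. exists I.
    revert HI. unfold half_integral. apply filterlim_ext. intros T. apply RInt_ext. intros; real_eq; ring.
  - rewrite !gsum_scal. unfold edge_energy.
    rewrite (gsum_ext (nE G) (fun e => scaled_integral X k e (fun t => w1 e t ^ 2) / 2 -
        scaled_integral X k e (fun t => pw p (w e t)) / p)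
      (fun e => / 2 * scaled_integral X k e (fun t => w1 e t ^ 2) -
        / p * scaled_integral X k e (fun t => pw p (w e t)))) by (intros; field; lra).
    rewrite gsum_minus, !gsum_scal. field. lra.
Qed.

Lemma wave_in_H1 : in_H1 G wave.
Proof.
  pose proof Hk as (k0 & _). pose proof (s_p X) as Hp.
  split; [|split].
  - exists (fun v => am * vertex_value F tip v). intros e He.
    destruct (profile_ends X k F c l tip Hk HF fixF HP e He) as [A B].
    unfold wave. split.
    + rewrite Rmult_0_r, A. reflexivity.
    + intros le Ke. rewrite (B le Ke). reflexivity.
  - intros e He. pose proof (wave_C2 e He) as W. split.
    + intros x _. apply (filterlim_filter_le_1 _ (F := locally x)).
      * intros S HS. unfold within. revert HS. apply filter_imp. intros; assumption.
      * exact (is_derive_continuous _ _ _ (proj1 (W x))).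
    + intros x _. exists (am * k * w1 e (k * x)). exact (proj1 (W x)).
  - eexists. eexists. split; [|reflexivity]. intros e He.
    destruct (cont_profile X k F c Hk HF fixF e He) as [C0 C1].
    apply (edge_integral_ext _ (fun x => am ^ 2 * (k ^ 2 * w1 e (k * x) ^ 2 + w e (k * x) ^ 2)));
      [apply kind_pos, He| |].
    { intros x _. rewrite wave_derive by assumption. unfold wave. ring. }
    apply (scaled_integral_spec X k Hk e (am ^ 2) (fun t => k ^ 2 * w1 e t ^ 2 + w e t ^ 2) He).
    + apply cont_plus; [apply cont_mult; [apply cont_const|]|]; apply cont_pow; assumption.
    + intros Ke. destruct (half_line_integrals X k F c Hk HF fixF e 1 (k ^ 2) 0 He (half_line_not_peak e Ke) Ke)
        as (I & HI & _); try lra; [apply pow2_ge_0|]. exists I.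
      revert HI. unfold half_integral. apply filterlim_ext. intros T. apply RInt_ext. intros; real_eq; ring.
Qed.

Lemma wave_kirchhoff : kirchhoff G wave.
Proof.
  exists (fun e => am * k * slope_src X k F c e), (fun e => am * k * slope_tgt X k F c e). split.
  - intros e He. pose proof (wave_C2 e He) as W. split.
    + apply right_difference_quotient. destruct (W 0) as (A & _). rewrite Rmult_0_r in A. exact A.
    + intros le Ke.
      apply filterlim_ext with (fun h => (wave e (le - h) - wave e (le - 0)) / h).
      { intros h. rewrite Rminus_0_r. reflexivity. }
      apply (right_difference_quotient (fun h => wave e (le - h))).
      unfold slope_tgt. rewrite Ke.
      replace (am * k * - w1 e (k * le)) with (-1 * (am * k * w1 e (k * (le - 0))))
        by (rewrite Rminus_0_r; ring).
      apply (is_derive_comp (wave e) (fun h => le - h)); [apply W|].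
      auto_derive; [trivial|ring].
  - intros v Hv.
    change (gsum (nE G) (fun e => (if Nat.eqb (src G e) v then am * k * slope_src X k F c e else 0) +
      (if is_bounded G e && Nat.eqb (tgt G e) v then am * k * slope_tgt X k F c e else 0)) = 0).
    rewrite (gsum_ext _ _ (fun e => am * k * ((if Nat.eqb (src G e) v then slope_src X k F c e else 0) +
      (if is_bounded G e && Nat.eqb (tgt G e) v then slope_tgt X k F c e else 0)))).
    + rewrite gsum_scal, (profile_kirchhoff X k F c l tip Hk HF fixF HP conn v Hv). ring.
    + intros e _. destruct (Nat.eqb (src G e) v), (is_bounded G e && Nat.eqb (tgt G e) v); ring.
Qed.

Lemma in_edge_interior (K : edge_kind) (x : R) : in_edge_int K x -> in_edge K x.
Proof. destruct K; simpl; lra. Qed.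

Lemma wave_solution : NLS_solution G p (k ^ 2) wave.
Proof.
  pose proof Hk as (k0 & _). pose proof (s_p X) as Hp. pose proof (amplitude_pos p k) as A.
  destruct (amplitude_pow p k ltac:(lra) k0) as (_ & EP & _).
  split; [exact wave_in_H1|split; [|split; [|exact wave_kirchhoff]]].
  - intros e He x Hx. apply Rmult_lt_0_compat; [exact A|]. apply wave_pos; assumption.
  - intros e He x Hx. apply in_edge_interior in Hx.
    destruct (wave_C2 e He x) as (D0 & D1 & _).
    assert (D1' : is_derive (Derive (wave e)) x (am * k ^ 2 * w2 e (k * x))).
    { revert D1. apply is_derive_ext. intros t. symmetry. apply wave_derive, He. }
    split; [eexists; exact D0|split; [eexists; exact D1'|]].
    replace (Derive (Derive (wave e)) x) with (am * k ^ 2 * w2 e (k * x))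
      by (symmetry; apply is_derive_unique; exact D1').
    destruct (profile_equation X k F c l tip Hk HF fixF HP conn e x He Hx) as [W E].
    unfold wave. rewrite <- pw_pos by (apply Rmult_lt_0_compat; assumption).
    rewrite pw_mult, EP, E by lra. ring.
Qed.

(** * Total mass and total energy *)

Lemma total_other_mass :
  (forall e, (e < nE G)%nat -> INR (nE G) * ((if is_bounded G e then ell X k e else 1) * decay X k ^ 2) <= 1) ->
  0 <= gsum (nE G) (fun e => if Nat.eqb e e0 then 0 else edge_mass X k F tip e) <= del ^ 2.
Proof.
  intros H.
  assert (N1 : 1 <= INR (nE G)).
  { pose proof (s_lt X). apply (le_INR 1). lia. }
  assert (D2 : 0 <= del ^ 2) by apply pow2_ge_0. split.
  - apply gsum_ge_0. intros e He. destruct (Nat.eqb e e0) eqn:N; [lra|].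
    apply Nat.eqb_neq in N.
    apply (other_mass_bounds X k F c tip Hk HF fixF e He N).
  - apply Rle_trans with (gsum (nE G) (fun _ => del ^ 2 * / INR (nE G))).
    + apply gsum_le. intros e He. destruct (Nat.eqb e e0) eqn:N.
      * apply Rmult_le_pos; [exact D2|]. left. apply Rinv_0_lt_compat. lra.
      * apply Nat.eqb_neq in N.
        eapply Rle_trans; [apply (other_mass_bounds X k F c tip Hk HF fixF e He N)|].
        apply Rmult_le_compat_l; [exact D2|]. specialize (H e He).
        apply Rmult_le_reg_r with (INR (nE G)); [lra|]. rewrite Rinv_l by lra. lra.
    + rewrite gsum_const. right. field. lra.
Qed.

Lemma total_mass_bounds :
  (forall e, (e < nE G)%nat -> INR (nE G) * ((if is_bounded G e then ell X k e else 1) * decay X k ^ 2) <= 1) ->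
  soliton p 1 ^ 2 / 4 <= gsum (nE G) (edge_mass X k F tip) <= 2 * (rho * (2 * peak p) ^ 2 + 4 * del ^ 2) + del ^ 2.
Proof.
  intros H. pose proof (total_other_mass H) as O.
  rewrite (gsum_remove (nE G) e0 (edge_mass X k F tip) (s_lt X)).
  unfold edge_mass at 1 3. rewrite Nat.eqb_refl.
  pose proof (core_mass_bounds X k F HF) as C. pose proof (tail_mass_bounds X k F Hk HF) as T.
  pose proof (multiplicity_bounds tip) as M. pose proof (pow2_ge_0 (soliton p 1)).
  split; nra.
Qed.

(** The core yields at least [8 * del ^ 2]. The losses are [del ^ 2] from the term [rho * decay] and
    [4 * del ^ 2] on the edge of the peak, counted with the same multiplicity as the gain, and
    [del ^ 2] on all other edges together. *)
Lemma total_energy_pos :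
  (forall e, (e < nE G)%nat -> INR (nE G) * ((if is_bounded G e then ell X k e else 1) * decay X k ^ 2) <= 1) ->
  rho * decay X k <= del ^ 2 ->
  8 * del ^ 2 <= (p - 6) / (2 * (p + 2)) * (soliton p 1 ^ 2 / 4) ->
  0 < gsum (nE G) (edge_energy X k F c).
Proof.
  intros H HE HD. pose proof (total_other_mass H) as O.
  rewrite (gsum_remove (nE G) e0 (edge_energy X k F c) (s_lt X)).
  pose proof (peak_edge_energy X k F c l tip Hk HF fixF HP) as PE.
  pose proof (core_mass_bounds X k F HF) as C.
  pose proof (multiplicity_bounds tip) as M. pose proof (s_p X) as Hp. pose proof (s_del X) as Hd.
  assert (A : 0 < (p - 6) / (2 * (p + 2))) by (apply Rdiv_lt_0_compat; lra).
  assert (OE : - gsum (nE G) (fun e => if Nat.eqb e e0 then 0 else edge_mass X k F tip e)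
     <= gsum (nE G) (fun e => if Nat.eqb e e0 then 0 else edge_energy X k F c e)).
  { replace (- gsum (nE G) (fun e => if Nat.eqb e e0 then 0 else edge_mass X k F tip e))
      with (gsum (nE G) (fun e => -1 * (if Nat.eqb e e0 then 0 else edge_mass X k F tip e)))
      by (rewrite gsum_scal; ring).
    apply gsum_le. intros e He. destruct (Nat.eqb e e0) eqn:N; [lra|]. apply Nat.eqb_neq in N.
    pose proof (other_edge_energy X k F c l tip Hk HF fixF HP e He N). lra. }
  assert ((p - 6) / (2 * (p + 2)) * (soliton p 1 ^ 2 / 4) <= (p - 6) / (2 * (p + 2)) * core_mass X F)
    by (apply Rmult_le_compat_l; lra).
  assert (0 < del ^ 2) by nra.
  nra.
Qed.

End Graph.

(** * Choice of the parameters *)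

(** [d] is an upper bound for [del] that makes the nonlinearity and, through [A], the energy losses
    small. Then [rho] brings the soliton below [d / 2]. The tolerance on the height comes last,
    since it has to beat the amplification across a core of radius [rho]. *)
Lemma setup_exists (G : MGraph) (p : R) (e v : nat) (L A : R) : wf_graph G -> 6 < p ->
  (e < nE G)%nat -> is_bounded G e = true -> 0 < L -> 0 < A ->
  exists X : setup, sG X = G /\ sp X = p /\ sE X = e /\ sV X = v /\ sL X = L /\ 8 * sdel X ^ 2 <= A.
Proof.
  intros Hwf Hp He Hb HL HA.
  assert (Hk : 0 < / (128 * (p - 1))) by (apply Rinv_0_lt_compat; lra).
  destruct (pw_small (p - 2) (/ (128 * (p - 1))) ltac:(lra) Hk) as (d0 & Hd0 & Hd0').
  (* Since [d] is at most 1, [8 * d ^ 2 <= 8 * d <= A]; the half of [d0] appears because the power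
     is evaluated at [2 * del]. *)
  set (d := Rmin (Rmin (d0 / 2) 1) (A / 8)).
  assert (Hd : 0 < d) by (repeat apply Rmin_pos; lra).
  assert (d <= d0 / 2) by (eapply Rle_trans; apply Rmin_l).
  assert (d <= 1) by (eapply Rle_trans; [apply Rmin_l|apply Rmin_r]).
  assert (d <= A / 8) by apply Rmin_r.
  destruct (soliton_small p (d / 2) 1 Hp ltac:(lra)) as (rho & Hr & _ & Hs).
  (* Read off from [rho], so that the soliton at the cut is exactly [del / 2] without inverting
     it. *)
  set (del := 2 * soliton p rho). pose proof (soliton_pos p rho) as Sp.
  assert (Hdel : 0 < del <= 1) by (unfold del; lra).
  assert (HLg : 1 <= core_lip p).
  { unfold core_lip. pose proof (pw_ge_0 (p - 2) (2 * peak p)). nra. }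
  assert (HQ : 0 < core_gain p rho) by (unfold core_gain; pose proof (exp_pos (core_rate p * rho)); lra).
  assert (Hhp : 0 < energy_slope p).
  { unfold energy_slope. pose proof (peak_gt_1 p Hp). apply Rmult_lt_0_compat; lra. }
  set (eps := Rmin (Rmin 1 (del / 4 / core_gain p rho)) (energy_slope p / (2 * core_lip p))).
  assert (E0 : 0 < eps).
  { repeat apply Rmin_pos; [lra| |]; apply Rdiv_lt_0_compat; lra. }
  assert (E1 : eps <= 1) by (eapply Rle_trans; apply Rmin_l).
  assert (E2 : eps <= del / 4 / core_gain p rho) by (eapply Rle_trans; [apply Rmin_l|apply Rmin_r]).
  assert (E3 : eps <= energy_slope p / (2 * core_lip p)) by apply Rmin_r.
  assert (P1 : 2 * (p - 1) * pw (p - 2) (2 * del) <= 1/64).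
  { assert (B := Hd0' (2 * del) ltac:(unfold del; lra)).
    apply Rle_trans with (2 * (p - 1) * / (128 * (p - 1))); [apply Rmult_le_compat_l; lra|].
    right. field. lra. }
  assert (P2 : soliton p rho = del / 2) by (unfold del; field).
  assert (P3 : eps * core_gain p rho <= del / 4).
  { apply Rmult_le_compat_r with (r := core_gain p rho) in E2; [|lra].
    unfold Rdiv in E2 at 1. rewrite Rmult_assoc, Rinv_l, Rmult_1_r in E2; lra. }
  assert (P4 : eps * (2 * core_lip p) <= energy_slope p).
  { apply Rmult_le_compat_r with (r := 2 * core_lip p) in E3; [|lra].
    unfold Rdiv in E3. rewrite Rmult_assoc, Rinv_l, Rmult_1_r in E3; lra. }
  exists (Setup G p e v L rho del eps Hwf Hp He Hb HL Hr Hdel P1 P2 (conj E0 E1) P3 P4).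
  simpl. repeat split. assert (del <= d) by (unfold del; lra). nra.
Qed.

(** * Large parameters *)

Definition eventually_ge (P : R -> Prop) : Prop := exists M, forall k, M <= k -> P k.

Lemma ev_and (P Q : R -> Prop) : eventually_ge P -> eventually_ge Q -> eventually_ge (fun k => P k /\ Q k).
Proof.
  intros [M HM] [N HN]. exists (Rmax M N). intros k Hk.
  split; [apply HM|apply HN]; eapply Rle_trans; try exact Hk; [apply Rmax_l|apply Rmax_r].
Qed.

Lemma ev_imp (P Q : R -> Prop) : (forall k, P k -> Q k) -> eventually_ge P -> eventually_ge Q.
Proof. intros H [M HM]. exists M. intros k Hk. apply H, HM, Hk. Qed.

Lemma ev_forall_lt (n : nat) (P : nat -> R -> Prop) : (forall i, (i < n)%nat -> eventually_ge (P i)) ->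
  eventually_ge (fun k => forall i, (i < n)%nat -> P i k).
Proof.
  induction n; intros H.
  - exists 0. intros k _ i Hi. lia.
  - generalize (ev_and _ _ (IHn (fun i Hi => H i (Nat.lt_lt_succ_r _ _ Hi))) (H n (Nat.lt_succ_diag_r n))).
    apply ev_imp. intros k [A B] i Hi. destruct (Nat.eq_dec i n) as [-> |N]; [exact B|]. apply A. lia.
Qed.

Lemma ev_affine (a b M : R) : 0 < a -> eventually_ge (fun k => M <= k * a - b).
Proof.
  intros Ha. exists ((M + b) / a). intros k Hk.
  apply Rmult_le_compat_r with (r := a) in Hk; [|lra].
  unfold Rdiv in Hk. rewrite Rmult_assoc, Rinv_l in Hk; lra.
Qed.

Lemma ev_Rpower_small (a eps : R) : 0 < a -> 0 < eps -> eventually_ge (fun k => Rpower k (- a) <= eps).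
Proof.
  intros Ha He. exists (Rpower (/ eps) (/ a)). intros k Hk.
  assert (A : / eps <= Rpower k a).
  { replace (/ eps) with (Rpower (Rpower (/ eps) (/ a)) a).
    - apply Rle_Rpower_l; [lra|]. split; [apply Rpower_gt_0|exact Hk].
    - rewrite Rpower_mult, Rinv_l, Rpower_1; [reflexivity|apply Rinv_0_lt_compat, He|lra]. }
  rewrite Rpower_Ropp. rewrite <- (Rinv_inv eps). apply Rinv_le_contravar; [|exact A].
  apply Rinv_0_lt_compat, He.
Qed.

Lemma ev_exp_small (X : setup) (eps : R) : 0 < eps -> eventually_ge (fun k => decay X k <= eps).
Proof.
  intros He. destruct (ev_affine (sL X) (srho X) (2 * - ln eps) (s_L X)) as [M HM].
  exists M. intros k Hk. specialize (HM k Hk). unfold decay, ell. rewrite Nat.eqb_refl.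
  rewrite <- (exp_ln eps He). apply exp_le. lra.
Qed.

(** Once [k * sL X] exceeds twice the core radius, the tail is at least [k * sL X / 2] long, and
    [exp (z / 2)] is at least [z / 2]. *)
Lemma ev_linear_exp_bounded (X : setup) : eventually_ge (fun k => 0 < k /\ k * decay X k <= 4 / sL X).
Proof.
  pose proof (s_L X) as HL. pose proof (s_rho X) as Hr.
  destruct (ev_affine (sL X) 0 (2 * srho X) HL) as [M HM].
  exists M. intros k Hk. specialize (HM k Hk). rewrite Rminus_0_r in HM.
  assert (Hk0 : 0 < k) by nra. split; [exact Hk0|].
  unfold decay, ell. rewrite Nat.eqb_refl. set (z := k * sL X - srho X).
  assert (Hz : k * sL X / 2 <= z) by (unfold z; lra).
  rewrite exp_Ropp. pose proof (exp_ineq1_le (1/2 * z)) as E.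
  apply Rle_trans with (k * / (k * sL X / 4)).
  - apply Rmult_le_compat_l; [lra|]. apply Rinv_le_contravar; [|lra].
    assert (0 < k * sL X) by (apply Rmult_lt_0_compat; lra). lra.
  - right. field. lra.
Qed.

(** Besides [big], what mass and energy require: the edges without the peak carry together at most
    [del ^ 2] of mass, and the contribution of the tail energy over the core is of that order
    too. *)
Definition very_big (X : setup) (k : R) : Prop :=
  big X k /\
  (forall e, (e < nE (sG X))%nat ->
     INR (nE (sG X)) * ((if is_bounded (sG X) e then ell X k e else 1) * decay X k ^ 2) <= 1) /\
  srho X * decay X k <= sdel X ^ 2.

Lemma elen_pos (X : setup) (e : nat) : (e < nE (sG X))%nat -> 0 < elen X e.
Proof.
  intros He. unfold elen. destruct (s_wf X e He) as [_ W]. destruct (kind (sG X) e); [apply W|lra].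
Qed.

Lemma ev_very_big (X : setup) : eventually_ge (very_big X).
Proof.
  pose proof (s_L X) as HL. pose proof (s_rho X) as Hr. pose proof (s_del X) as Hd. pose proof (s_eps X) as Heps.
  destruct (peak_facts X) as (P1 & _ & _ & P4 & P5 & _).
  assert (HN : 1 <= INR (nE (sG X))).
  { pose proof (s_lt X). apply (le_INR 1). lia. }
  assert (PQ : 0 < 32 * peak (sp X) * core_gain (sp X) (srho X)).
  { apply Rmult_lt_0_compat; lra. }
  assert (A1 := ev_linear_exp_bounded X).
  assert (A2 := ev_affine (sL X) (srho X) 200 HL).
  assert (A3 : eventually_ge (fun k => forall e, (e < nE (sG X))%nat -> 200 <= ell X k e)).
  { apply ev_forall_lt. intros e He. unfold ell. destruct (Nat.eqb e (sE X)); [exact A2|].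
    generalize (ev_affine (elen X e) 0 200 (elen_pos X e He)). apply ev_imp. intros k. lra. }
  assert (A4 := ev_exp_small X (energy_slope (sp X) / (32 * peak (sp X) * core_gain (sp X) (srho X)))
    ltac:(apply Rdiv_lt_0_compat; lra)).
  assert (Hhe : 0 < energy_slope (sp X) * seps X) by (apply Rmult_lt_0_compat; lra).
  assert (A5 := ev_exp_small X (energy_slope (sp X) * seps X / 4) ltac:(lra)).
  assert (A6 : eventually_ge (fun k => forall e, (e < nE (sG X))%nat ->
    INR (nE (sG X)) * ((if is_bounded (sG X) e then ell X k e else 1) * decay X k ^ 2) <= 1)).
  { apply ev_forall_lt. intros e He. pose proof (elen_pos X e He) as El.
    set (len := Rmax (sL X) (elen X e)).
    assert (L1 : sL X <= len) by apply Rmax_l. assert (L2 : elen X e <= len) by apply Rmax_r.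
    (* Of the two factors [decay X k], one absorbs the length and leaves the constant in [a], the
       other is made smaller than [/ a]. *)
    set (a := INR (nE (sG X)) * (len * (4 / sL X) + 1)).
    assert (B4 : 0 < 4 / sL X) by (apply Rdiv_lt_0_compat; lra).
    assert (B5 : 0 < len * (4 / sL X)) by (apply Rmult_lt_0_compat; lra).
    assert (Ha : 0 < a) by (apply Rmult_lt_0_compat; lra).
    generalize (ev_and _ _ A1 (ev_and _ _ (ev_exp_small X 1 ltac:(lra))
      (ev_exp_small X (/ a) ltac:(apply Rinv_0_lt_compat, Ha)))).
    apply ev_imp. intros k ((Hk & KE) & E1 & Ea).
    assert (E0 : 0 < decay X k) by apply exp_pos.
    assert (LL : (if is_bounded (sG X) e then ell X k e else 1) <= k * len + 1).
    { assert (k * sL X <= k * len) by (apply Rmult_le_compat_l; lra).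
      assert (k * elen X e <= k * len) by (apply Rmult_le_compat_l; lra).
      assert (0 <= k * len) by (apply Rmult_le_pos; lra).
      destruct (is_bounded (sG X) e); [|lra]. unfold ell. destruct (Nat.eqb e (sE X)); lra. }
    assert (S1 : (if is_bounded (sG X) e then ell X k e else 1) * decay X k <= len * (4 / sL X) + 1).
    { apply Rle_trans with ((k * len + 1) * decay X k); [apply Rmult_le_compat_r; lra|].
      assert (len * (k * decay X k) <= len * (4 / sL X)) by (apply Rmult_le_compat_l; lra). lra. }
    apply Rle_trans with (a * decay X k).
    - unfold a. rewrite Rmult_assoc. apply Rmult_le_compat_l; [lra|].
      replace ((if is_bounded (sG X) e then ell X k e else 1) * decay X k ^ 2)
        with ((if is_bounded (sG X) e then ell X k e else 1) * decay X k * decay X k) by ring.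
      apply Rmult_le_compat_r; lra.
    - apply Rmult_le_compat_l with (r := a) in Ea; [|lra]. rewrite Rinv_r in Ea; lra. }
  assert (A7 := ev_exp_small X (sdel X ^ 2 / srho X)
    ltac:(apply Rdiv_lt_0_compat; [apply pow_lt; lra|lra])).
  generalize (ev_and _ _ A1 (ev_and _ _ A2 (ev_and _ _ A3 (ev_and _ _ A4 (ev_and _ _ A5 (ev_and _ _ A6 A7)))))).
  apply ev_imp. intros k ((B1 & _) & B2 & B3 & B4 & B5 & B6 & B7).
  split; [|split; [exact B6|]].
  - split; [exact B1|split; [|split; [|split]]].
    + unfold ell. rewrite Nat.eqb_refl. exact B2.
    + intros e He. apply B3. apply bedge_spec in He. apply He.
    + apply Rmult_le_compat_l with (r := 32 * peak (sp X) * core_gain (sp X) (srho X)) in B4; [|lra].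
      eapply Rle_trans; [exact B4|]. right. field. lra.
    + lra.
  - apply Rmult_le_compat_l with (r := srho X) in B7; [|lra].
    eapply Rle_trans; [exact B7|]. right. field. lra.
Qed.

(** * Continuity of the mass *)

Section MassContinuity.
Variables (X : setup) (tip : option nat) (k0 : R).
Local Notation G := (sG X).
Local Notation p := (sp X).
Local Notation del := (sdel X).
Hypothesis Hbig : forall k, k0 <= k -> very_big X k.

(** The choice carries no regularity of its own: [fixed_point_continuous] holds for all admissible
    fixed points, so every selection is continuous in [k]. *)
Definition select (k : R) : idx -> R :=
  epsilon (inhabits (fun _ => 0)) (fun F => trapped X k F /\ forall i, Phi X k F i = F i).

Lemma select_spec (k : R) : k0 <= k -> trapped X k (select k) /\ forall i, Phi X k (select k) i = select k i.
Proof.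
  intros Hk. unfold select. apply epsilon_spec. apply fixed_point_exists. apply (Hbig k Hk).
Qed.

Lemma locally_ge (k : R) : k0 < k -> locally k (fun m => k0 <= m).
Proof.
  intros Hk. assert (Hd : 0 < k - k0) by lra. exists (mkposreal _ Hd). intros y Hy.
  change (Rabs (y - k) < k - k0) in Hy. apply Rabs_def2 in Hy. lra.
Qed.

Lemma select_continuous (k eps : R) : k0 < k -> 0 < eps ->
  locally k (fun m => k0 <= m /\ forall i, Rabs (select m i - select k i) <= eps).
Proof.
  intros Hk He. destruct (select_spec k ltac:(lra)) as [A B].
  generalize (filter_and _ _ (locally_ge k Hk)
    (fixed_point_continuous X k (select k) eps (proj1 (Hbig k ltac:(lra))) (proj1 A) B He)).
  apply filter_imp. intros m [Hm H]. split; [exact Hm|].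
  destruct (select_spec m Hm) as [A' B']. apply H; [apply (Hbig m Hm)|apply A'|exact B'].
Qed.

Lemma select_abs_le (k : R) (i : idx) : k0 <= k -> Rabs (select k i) <= 2 * peak p + 2.
Proof.
  intros Hk. destruct (select_spec k Hk) as [((Cp & _ & Cc & Cv & _ & Ce) & _) _].
  pose proof (s_del X). pose proof (s_eps X). pose proof (peak_gt_1 p (s_p X)).
  apply Rabs_le_between in Cp. apply Rabs_le_between. destruct i as [|t|v|e t].
  - lra.
  - specialize (Cc t). lra.
  - specialize (Cv v). lra.
  - specialize (Ce e t). lra.
Qed.

Lemma square_integral_continuous (j : R -> idx) (T k : R) : 0 <= T -> k0 < k ->
  (forall F, admissible X F -> cont (fun t => F (j t))) ->
  continuous (fun m => RInt (fun t => select m (j t) ^ 2) 0 T) k.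
Proof.
  intros HT Hk Cj. apply eps_continuous. intros eps He.
  pose proof (peak_gt_1 p (s_p X)) as P1.
  set (b := 2 * (2 * peak p + 2) * (T + 1)).
  assert (Hb : 0 < b) by (unfold b; repeat apply Rmult_lt_0_compat; lra).
  generalize (select_continuous k (eps / 2 / b) Hk ltac:(apply Rdiv_lt_0_compat; lra)).
  apply filter_imp. intros m [Hm D].
  assert (C : forall n, k0 <= n -> cont (fun t => select n (j t) ^ 2)).
  { intros n Hn. apply (cont_pow (fun t => select n (j t))). apply Cj. apply (select_spec n Hn). }
  eapply Rle_lt_trans; [apply RInt_close with (e := eps / 2 / b * (2 * (2 * peak p + 2)))|].
  - exact HT.
  - apply C, Hm.
  - apply C. lra.
  - intros t _. replace (select m (j t) ^ 2 - select k (j t) ^ 2) with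
      ((select m (j t) - select k (j t)) * (select m (j t) + select k (j t))) by ring.
    rewrite Rabs_mult. apply Rmult_le_compat; [apply Rabs_pos|apply Rabs_pos|apply D|].
    eapply Rle_trans; [apply Rabs_triang|].
    pose proof (select_abs_le m (j t) Hm). pose proof (select_abs_le k (j t) ltac:(lra)). lra.
  - rewrite Rminus_0_r.
    apply Rle_lt_trans with (eps / 2 / b * b).
    + rewrite Rmult_assoc. apply Rmult_le_compat_l; [left; apply Rdiv_lt_0_compat; lra|].
      unfold b. apply Rmult_le_compat_l; lra.
    + replace (eps / 2 / b * b) with (eps / 2) by (field; lra). lra.
Qed.

Lemma half_line_mass_exists (x s : R) : 0 <= x -> 0 <= s <= 1 ->
  exists I, half_integral (fun t => sol p x s t ^ 2) I.
Proof.
  intros Hx Hs. pose proof (s_p X) as Hp.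
  destruct (half_integral_exists (fun t => sol p x s t ^ 2) ((2 * x) ^ 2) 1) as (I & HI & _).
  - apply (cont_pow (sol p x s)). apply cont_derive with (sol1 p x s). intros t.
    apply is_derive_sol; lra.
  - lra.
  - intros t Ht. pose proof (sol_ge_0 p x s t Hx). pose proof (sol_decay p x s t Hp Hx Hs Ht).
    split; [apply pow2_ge_0|]. rewrite Rmult_1_l.
    assert (exp (- t) <= 1) by (apply exp_neg_le_1; lra). pose proof (exp_pos (- t)).
    apply Rle_trans with ((2 * x * exp (- t)) ^ 2); [nra|].
    replace ((2 * x * exp (- t)) ^ 2) with ((2 * x) ^ 2 * (exp (- t) * exp (- t))) by ring.
    apply Rmult_le_compat_l; [apply pow2_ge_0|]. nra.
  - exists I. exact HI.
Qed.

(** The vertex value acts directly and through [slope]. Both dependences are Lipschitz with the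
    factor [exp (- t)], which can be integrated along the half-line. *)
Lemma half_line_mass_lipschitz : exists C, 0 < C /\ forall x y, 0 <= x <= 2 * del -> 0 <= y <= 2 * del ->
  Rabs (half_integral_value (fun t => sol p x (slope p x) t ^ 2) - half_integral_value (fun t => sol p y (slope p y) t ^ 2))
  <= C * Rabs (x - y).
Proof.
  pose proof (s_p X) as Hp. pose proof (s_del X) as Hd. destruct (kap_facts X) as [KF _].
  set (c := (p - 2) * pw (p - 3) (2 * del)).
  assert (Hc : 0 <= c) by (apply Rmult_le_pos; [lra|apply pw_ge_0]).
  (* A factor 2 comes from [sol_lipschitz], 8 from the sum of the two solutions, and [2 * c] from
     the slope, which is multiplied by a value of at most 2. *)
  exists (16 * (1 + 2 * c)). split; [lra|].
  intros x y Hx Hy.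
  assert (Px : pw (p - 2) x <= 1) by (apply Rle_trans with (pw (p - 2) (2 * del)); [apply pw_incr|]; lra).
  assert (Py : pw (p - 2) y <= 1) by (apply Rle_trans with (pw (p - 2) (2 * del)); [apply pw_incr|]; lra).
  destruct (slope_bounds p x Hp Px) as (Sx & _). destruct (slope_bounds p y Hp Py) as (Sy & _).
  destruct (half_line_mass_exists x (slope p x) ltac:(lra) Sx) as [I HI].
  destruct (half_line_mass_exists y (slope p y) ltac:(lra) Sy) as [J HJ].
  rewrite (half_integral_value_eq _ _ HI), (half_integral_value_eq _ _ HJ).
  assert (SL : Rabs (slope p x - slope p y) <= c * Rabs (x - y)).
  { eapply Rle_trans; [apply slope_lipschitz; assumption|]. unfold c.
    replace (p - 3) with (p - 2 - 1) by ring. apply pw_lipschitz; lra. }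
  assert (Cs : forall z s, 0 <= s <= 1 -> cont (fun t => sol p z s t ^ 2)).
  { intros z s Hs. apply (cont_pow (sol p z s)). apply cont_derive with (sol1 p z s). intros t.
    apply is_derive_sol; lra. }
  pose proof (Rabs_pos (x - y)) as Pxy.
  assert (Hcx : 0 <= c * Rabs (x - y)) by (apply Rmult_le_pos; lra).
  rewrite <- (Rdiv_1_r (16 * (1 + 2 * c) * Rabs (x - y))).
  apply (half_integral_close _ _ I J (16 * (1 + 2 * c) * Rabs (x - y)) 1
    (Cs x _ Sx) (Cs y _ Sy) ltac:(lra) ltac:(apply Rmult_le_pos; lra) HI HJ).
  intros t Ht. rewrite Rmult_1_l.
  set (u := sol p x (slope p x) t). set (v := sol p y (slope p y) t).
  assert (D : Rabs (u - v) <= 2 * ((1 + 2 * c) * Rabs (x - y)) * exp (- t)).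
  { eapply Rle_trans; [apply sol_lipschitz; try assumption; lra|].
    apply Rmult_le_compat_r; [left; apply exp_pos|]. apply Rmult_le_compat_l; [lra|].
    assert (y * Rabs (slope p x - slope p y) <= 2 * (c * Rabs (x - y))).
    { apply Rmult_le_compat; try lra. apply Rabs_pos. }
    lra. }
  assert (E1 : exp (- t) <= 1) by (apply exp_neg_le_1; lra).
  pose proof (exp_pos (- t)) as E0.
  assert (U : 0 <= u <= 4).
  { split; [apply sol_ge_0; lra|]. unfold u.
    eapply Rle_trans; [apply sol_decay; try assumption; lra|]. nra. }
  assert (V : 0 <= v <= 4).
  { split; [apply sol_ge_0; lra|]. unfold v.
    eapply Rle_trans; [apply sol_decay; try assumption; lra|]. nra. }
  replace (u ^ 2 - v ^ 2) with ((u - v) * (u + v)) by ring.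
  rewrite Rabs_mult, (Rabs_pos_eq (u + v)) by lra.
  apply Rle_trans with (2 * ((1 + 2 * c) * Rabs (x - y)) * exp (- t) * 8).
  - apply Rmult_le_compat; try lra. apply Rabs_pos.
  - right. ring.
Qed.

Lemma edge_mass_continuous (e : nat) (k : R) : k0 < k ->
  continuous (fun m => edge_mass X m (select m) tip e) k.
Proof.
  intros Hk. pose proof (s_rho X) as Hr.
  assert (T : forall i, continuous (fun m => tail_mass X m (select m) i) k).
  { intros i. apply continuous_mult_R; [apply (cont_ell X i k)|].
    apply (square_integral_continuous (fun t => IEdge i t) 1 k); [lra|exact Hk|].
    intros F HF. apply HF. }
  unfold edge_mass. destruct (Nat.eqb e (sE X)).
  - apply continuous_mult_R; [apply continuous_const_R|]. apply continuous_plus_R; [|apply T].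
    apply (square_integral_continuous (fun t => ICore t) (srho X) k); [lra|exact Hk|].
    intros F HF. apply HF.
  - destruct (kind G e) as [le|]; [apply T|].
    destruct half_line_mass_lipschitz as (C & HC & L).
    apply eps_continuous. intros eps He.
    generalize (select_continuous k (eps / 2 / C) Hk ltac:(apply Rdiv_lt_0_compat; lra)).
    apply filter_imp. intros m [Hm D].
    destruct (select_spec m Hm) as [((_ & _ & _ & Cv & _) & _) _].
    destruct (select_spec k ltac:(lra)) as [((_ & _ & _ & Cv' & _) & _) _].
    eapply Rle_lt_trans; [apply L; [apply Cv|apply Cv']|].
    apply Rle_lt_trans with (C * (eps / 2 / C)); [apply Rmult_le_compat_l; [lra|apply D]|].
    replace (C * (eps / 2 / C)) with (eps / 2) by (field; lra). lra.
Qed.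

Definition total_mass (k : R) : R :=
  Rpower k (4 / (p - 2) - 1) * gsum (nE G) (edge_mass X k (select k) tip).

Lemma total_mass_continuous (k : R) : 0 < k -> k0 < k -> continuous total_mass k.
Proof.
  intros Hk Hk0. apply continuous_mult_R.
  - apply (is_derive_continuous _ _ ((4 / (p - 2) - 1) * Rpower k (4 / (p - 2) - 1 - 1))).
    apply is_derive_Reals, derivable_pt_lim_power, Hk.
  - apply (gsum_continuous (nE G) (fun e m => edge_mass X m (select m) tip e)).
    intros e _. apply edge_mass_continuous, Hk0.
Qed.

Lemma select_mass_bounds (k : R) : k0 <= k ->
  0 < gsum (nE G) (edge_mass X k (select k) tip)
    <= 2 * (srho X * (2 * peak p) ^ 2 + 4 * del ^ 2) + del ^ 2.
Proof.
  intros Hk. destruct (Hbig k Hk) as (B & S & _). destruct (select_spec k Hk) as [A A'].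
  destruct (total_mass_bounds X k (select k) 0 tip B A A' S) as [M1 M2].
  split; [|exact M2]. pose proof (pow_lt (soliton p 1) 2 (soliton_pos p 1)). lra.
Qed.

Lemma total_mass_small (mu : R) : 0 < mu -> exists M, forall k, M < k -> total_mass k < mu.
Proof.
  intros Hmu. pose proof (s_p X) as Hp. pose proof (s_rho X) as Hr.
  set (C := 2 * (srho X * (2 * peak p) ^ 2 + 4 * del ^ 2) + del ^ 2).
  assert (HC : 0 < C).
  { destruct (select_mass_bounds k0 (Rle_refl _)) as [A B]. fold C in B. lra. }
  set (a := (p - 6) / (p - 2)).
  assert (Ha : 0 < a) by (apply Rdiv_lt_0_compat; lra).
  destruct (ev_Rpower_small a (mu / 2 / C) Ha ltac:(apply Rdiv_lt_0_compat; lra)) as [M HM].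
  exists (Rmax M k0). intros k Hk. pose proof (Rmax_l M k0). pose proof (Rmax_r M k0).
  specialize (HM k ltac:(lra)).
  destruct (select_mass_bounds k ltac:(lra)) as [A B]. fold C in B.
  unfold total_mass. replace (4 / (p - 2) - 1) with (- a) by (unfold a; field; lra).
  apply Rle_lt_trans with (mu / 2 / C * C).
  - apply Rmult_le_compat; try lra. left. apply Rpower_gt_0.
  - replace (mu / 2 / C * C) with (mu / 2) by (field; lra). lra.
Qed.

(** Intermediate values between [k1] and a parameter of mass below [mu]. Monotonicity of the mass is
    not claimed, so [k] need not be unique. *)
Lemma total_mass_surjective (k1 mu : R) : k0 < k1 -> 0 < k1 -> 0 < mu <= total_mass k1 ->
  exists k, k1 <= k /\ total_mass k = mu.
Proof.
  intros Hk1 Hk1' [Hmu Hle]. destruct (Rle_lt_or_eq_dec _ _ Hle) as [Hlt| ->].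
  - destruct (total_mass_small mu Hmu) as (M & HM).
    set (k2 := Rmax M k1 + 1). pose proof (Rmax_l M k1). pose proof (Rmax_r M k1).
    specialize (HM k2 ltac:(unfold k2; lra)).
    destruct (Ranalysis5.IVT_interv (fun z => mu - total_mass z) k1 k2) as (k & Hk & Ek).
    + intros z Hz. apply continuity_pt_filterlim.
      apply (continuous_minus_R (fun _ => mu) total_mass); [apply continuous_const_R|].
      apply total_mass_continuous; lra.
    + unfold k2; lra.
    + lra.
    + lra.
    + exists k. split; lra.
  - exists k1. split; [lra|reflexivity].
Qed.

End MassContinuity.

Lemma placement_solutions (X : setup) (c l : R) (tip : option nat) :
  placement X c l tip -> connected_graph (sG X) ->
  8 * sdel X ^ 2 <= (sp X - 6) / (2 * (sp X + 2)) * (soliton (sp X) 1 ^ 2 / 4) ->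
  exists mu0, 0 < mu0 /\ forall mu, 0 < mu <= mu0 ->
    exists u lam En, NLS_solution (sG X) (sp X) lam u /\ graph_mass (sG X) u mu /\
      graph_energy (sG X) (sp X) u En /\ 0 < En /\ 0 < lam.
Proof.
  intros HP conn HD. destruct (ev_very_big X) as [k0 Hbig].
  (* Strictly beyond [k0], since continuity is established only where a whole neighbourhood consists
     of very big parameters. The mass at [k1] is the threshold of the theorem. *)
  set (k1 := Rmax k0 0 + 1).
  assert (K1 : k0 < k1 /\ 0 < k1).
  { pose proof (Rmax_l k0 0). pose proof (Rmax_r k0 0). unfold k1. lra. }
  exists (total_mass X tip k1). split.
  - apply Rmult_lt_0_compat; [apply Rpower_gt_0|].
    apply (select_mass_bounds X tip k0 Hbig k1). lra.
  - intros mu Hmu.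
    destruct (total_mass_surjective X tip k0 Hbig k1 mu) as (k & Hk & Ek); try tauto.
    destruct (Hbig k ltac:(lra)) as (B & S & E).
    destruct (select_spec X k0 Hbig k ltac:(lra)) as [A A'].
    exists (wave X k (select X k) c), (k ^ 2),
      (amplitude (sp X) k ^ 2 * k * gsum (nE (sG X)) (edge_energy X k (select X k) c)).
    split; [|split; [|split; [|split]]].
    + apply (wave_solution X k (select X k) c l tip B A A' HP conn).
    + rewrite <- Ek. apply (wave_mass X k (select X k) c l tip B A A' HP).
    + apply (wave_energy X k (select X k) c l tip B A A' HP conn).
    + apply Rmult_lt_0_compat.
      * apply Rmult_lt_0_compat; [apply pow_lt, amplitude_pos|lra].
      * apply (total_energy_pos X k (select X k) c l tip B A A' HP S E HD).
    + apply pow_lt. lra.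
Qed.

(** * Pendants and loops *)

Lemma filter_length_1 (f : nat -> bool) (s : list nat) (e : nat) : In e s -> f e = true ->
  length (filter f s) = 1%nat -> forall i, In i s -> f i = true -> i = e.
Proof.
  intros He Fe Hl i Hi Fi.
  assert (A : In e (filter f s)) by (apply filter_In; auto).
  assert (B : In i (filter f s)) by (apply filter_In; auto).
  destruct (filter f s) as [|a [|b t]]; simpl in *; try discriminate; try contradiction.
  destruct A as [A|[]], B as [B|[]]. congruence.
Qed.

Lemma filter_length_0 (f : nat -> bool) (s : list nat) :
  length (filter f s) = 0%nat -> forall i, In i s -> f i = false.
Proof.
  intros Hl i Hi. destruct (f i) eqn:Fi; [|reflexivity].
  assert (B : In i (filter f s)) by (apply filter_In; auto).
  destruct (filter f s); [contradiction|discriminate].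
Qed.

Lemma filter_length_pos (f : nat -> bool) (s : list nat) (e : nat) : In e s -> f e = true ->
  (1 <= length (filter f s))%nat.
Proof.
  intros He Fe. assert (A : In e (filter f s)) by (apply filter_In; auto).
  destruct (filter f s); [contradiction|simpl; lia].
Qed.

(** A loop enters both counts of [degree], so degree 1 excludes it together with every further
    incidence at the vertex. *)
Lemma degree_1_src (G : MGraph) (e : nat) : (e < nE G)%nat -> degree G (src G e) = 1%nat ->
  (is_bounded G e = true -> tgt G e <> src G e) /\
  forall i, (i < nE G)%nat -> i <> e ->
    src G i <> src G e /\ (is_bounded G i = true -> tgt G i <> src G e).
Proof.
  intros He Hd. unfold degree in Hd.
  set (f := fun i => Nat.eqb (src G i) (src G e)) in *.
  set (g := fun i => andb (is_bounded G i) (Nat.eqb (tgt G i) (src G e))) in *.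
  assert (Ie : forall i, (i < nE G)%nat -> In i (seq 0 (nE G))) by (intros; apply in_seq; lia).
  assert (Fe : f e = true) by apply Nat.eqb_refl.
  pose proof (filter_length_pos f _ e (Ie e He) Fe) as P.
  assert (L1 : length (filter f (seq 0 (nE G))) = 1%nat) by lia.
  assert (L0 : length (filter g (seq 0 (nE G))) = 0%nat) by lia.
  assert (T : forall i, (i < nE G)%nat -> is_bounded G i = true -> tgt G i <> src G e).
  { intros i Hi B E. pose proof (filter_length_0 g _ L0 i (Ie i Hi)) as N. unfold g in N.
    rewrite B, E, Nat.eqb_refl in N. discriminate. }
  split; [apply T, He|]. intros i Hi N. split; [|apply T, Hi].
  intros E. apply N. apply (filter_length_1 f (seq 0 (nE G)) e (Ie e He) Fe L1 i (Ie i Hi)).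
  unfold f. rewrite E. apply Nat.eqb_refl.
Qed.

Lemma degree_1_tgt (G : MGraph) (e : nat) : (e < nE G)%nat -> is_bounded G e = true ->
  degree G (tgt G e) = 1%nat ->
  src G e <> tgt G e /\
  forall i, (i < nE G)%nat -> i <> e ->
    src G i <> tgt G e /\ (is_bounded G i = true -> tgt G i <> tgt G e).
Proof.
  intros He Be Hd. unfold degree in Hd.
  set (f := fun i => Nat.eqb (src G i) (tgt G e)) in *.
  set (g := fun i => andb (is_bounded G i) (Nat.eqb (tgt G i) (tgt G e))) in *.
  assert (Ie : forall i, (i < nE G)%nat -> In i (seq 0 (nE G))) by (intros; apply in_seq; lia).
  assert (Ge : g e = true) by (unfold g; rewrite Be, Nat.eqb_refl; reflexivity).
  pose proof (filter_length_pos g _ e (Ie e He) Ge) as P.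
  assert (L1 : length (filter g (seq 0 (nE G))) = 1%nat) by lia.
  assert (L0 : length (filter f (seq 0 (nE G))) = 0%nat) by lia.
  assert (T : forall i, (i < nE G)%nat -> src G i <> tgt G e).
  { intros i Hi E. pose proof (filter_length_0 f _ L0 i (Ie i Hi)) as N. unfold f in N.
    rewrite E, Nat.eqb_refl in N. discriminate. }
  split; [apply T, He|]. intros i Hi N. split; [apply T, Hi|].
  intros B E. apply N. apply (filter_length_1 g (seq 0 (nE G)) e (Ie e He) Ge L1 i (Ie i Hi)).
  unfold g. rewrite B, E. apply Nat.eqb_refl.
Qed.

Lemma placement_exists (G : MGraph) (p A : R) : wf_graph G -> (has_pendant G \/ has_signpost G) ->
  6 < p -> 0 < A ->
  exists (X : setup) (c l : R) (tip : option nat), sG X = G /\ sp X = p /\ placement X c l tip /\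
    8 * sdel X ^ 2 <= A.
Proof.
  intros Hwf HG Hp HA.
  assert (Hlen : forall e, (e < nE G)%nat -> is_bounded G e = true ->
    exists l, kind G e = Bounded l /\ 0 < l).
  { intros e He B. destruct (Hwf e He) as [_ W]. unfold is_bounded in B.
    destruct (kind G e) as [l|]; [exists l; split; [reflexivity|apply W]|discriminate]. }
  destruct HG as [(e & He & B & [D|D])|(_ & e & _ & He & _ & _ & B & Hloop & _)];
  destruct (Hlen e He B) as (l & Kl & Hl).
  - destruct (degree_1_src G e He D) as [T1 T2].
    destruct (setup_exists G p e (tgt G e) l A Hwf Hp He B Hl HA) as (X & E1 & E2 & E3 & E4 & E5 & E6).
    exists X, 0, l, (Some (src G e)). split; [exact E1|split; [exact E2|split; [|exact E6]]].
    split; rewrite ?E1, ?E3, ?E4, ?E5.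
    + exact Kl.
    + left. auto.
    + intros w Hw. injection Hw as <-. split; [intros E; apply (T1 B); auto|exact T2].
  - destruct (degree_1_tgt G e He B D) as [T1 T2].
    destruct (setup_exists G p e (src G e) l A Hwf Hp He B Hl HA) as (X & E1 & E2 & E3 & E4 & E5 & E6).
    exists X, l, l, (Some (tgt G e)). split; [exact E1|split; [exact E2|split; [|exact E6]]].
    split; rewrite ?E1, ?E3, ?E4, ?E5.
    + exact Kl.
    + right. left. auto.
    + intros w Hw. injection Hw as <-. split; [intros E; apply T1; auto|exact T2].
  (* The peak sits at the midpoint of the loop: each half is an arm of length [l / 2] ending at the
     same vertex, and no vertex lies at the peak. *)
  - destruct (setup_exists G p e (src G e) (l / 2) A Hwf Hp He B ltac:(lra) HA)
      as (X & E1 & E2 & E3 & E4 & E5 & E6).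
    exists X, (l / 2), l, None. split; [exact E1|split; [exact E2|split; [|exact E6]]].
    split; rewrite ?E1, ?E3, ?E4, ?E5.
    + exact Kl.
    + right. right. repeat split; auto. field.
    + discriminate.
Qed.

Theorem theorem1p1 (G : MGraph) :
  wf_graph G -> connected_graph G -> noncompact G ->
  (has_pendant G \/ has_signpost G) ->
  forall p : R, 6 < p ->
  exists mu0 : R, 0 < mu0 /\
    forall mu : R, 0 < mu <= mu0 ->
      exists (u : nat -> R -> R) (lam En : R),
        NLS_solution G p lam u /\ graph_mass G u mu /\
        graph_energy G p u En /\ 0 < En /\ 0 < lam.
Proof.
  intros Hwf conn _ HG p Hp.
  (* This threshold depends on [p] only, so it is available before the setup that has to respect
     it. *)
  assert (HA : 0 < (p - 6) / (2 * (p + 2)) * (soliton p 1 ^ 2 / 4)).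
  { apply Rmult_lt_0_compat; [apply Rdiv_lt_0_compat; lra|].
    pose proof (pow_lt _ 2 (soliton_pos p 1)). lra. }
  destruct (placement_exists G p _ Hwf HG Hp HA) as (X & c & l & tip & <- & <- & HP & HD).
  exact (placement_solutions X c l tip HP conn HD).
Qed.
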